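(* Let $\varphi,\eta\in \mathrm{Diff}_{p1}(\mathbb{C}^2,0)$ with $\mathrm{Fix}(\varphi)=\mathrm{Fix}(\eta)$. Suppose there exist $s\in\mathbb{R}^{+}$ and a sequence $x_n\to 0$ contained in $B(0,\delta)\setminus\{0\}$ such that for any $n\in\mathbb{N}$ the restrictions $\varphi_{|x=x_n}$ and $\eta_{|x=x_n}$ are conjugated by an injective holomorphic mapping $\kappa_n$ defined in $B(0,s)$ and fixing the points in $\mathrm{Fix}(\varphi)\cap\{x=x_n\}$. Then $\varphi\sim\eta$.
   Context: $B(0,r)$ is the open disc of radius $r$ in $\mathbb{C}$. $\mathrm{Diff}(\mathbb{C}^n,0)$ is the group of germs of biholomorphisms of $\mathbb{C}^n$ fixing $0$. $\mathrm{Diff}_p(\mathbb{C}^2,0)$ is the set of $\varphi\in\mathrm{Diff}(\mathbb{C}^2,0)$ of the form $\varphi(x,y)=(x,f(x,y))$. $\mathrm{Diff}_{p1}(\mathbb{C}^2,0)$ is the set of $\varphi\in \mathrm{Diff}_p(\mathbb{C}^2,0)$ such that the germ $\varphi_{|x=0}\in\mathrm{Diff}(\mathbb{C},0)$ has linear part equal to the identity and $\varphi_{|x=0}\neq Id$. $\mathrm{Fix}(\varphi)$ is the (germ of the) fixed point set of $\varphi$. Representatives of the germs are defined on $B(0,\delta)\times B(0,\epsilon)$ for some small $\delta,\epsilon>0$. ''Conjugated by $\kappa_n$'' means $\kappa_n\circ\varphi_{|x=x_n}=\eta_{|x=x_n}\circ\kappa_n$ wherever both sides make sense; $\kappa_n$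 is a map in the variable $y$ on the line $x=x_n$, and no dependence of $\kappa_n$ on $x_n$ is assumed. We write $\varphi\sim\eta$ if there exists $\sigma\in\mathrm{Diff}(\mathbb{C}^2,0)$ conjugating $\varphi$ and $\eta$ (i.e. $\sigma\circ\varphi=\eta\circ\sigma$) such that $\sigma_{|\mathrm{Fix}(\varphi)}\equiv Id$. *)

(* Defs.v *)
From Stdlib Require Import Reals.
From Coquelicot Require Import Coquelicot.

(* Coquelicot also makes C a normed module over R, so the scalar ring of every
   derivative and of the product below is fixed explicitly to C. *)
Definition C2 : NormedModule C_AbsRing :=
  prod_NormedModule C_AbsRing C_NormedModule C_NormedModule.

Definition O2 : C2 := (RtoC 0, RtoC 0).

Definition Cdisc (r : R) (z : C) : Prop := (Cmod z < r)%R.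

Definition polydisc (delta epsilon : R) (p : C2) : Prop :=
  Cdisc delta (fst p) /\ Cdisc epsilon (snd p).

(* The domains D used here are open, so holomorphy on D is complex
   differentiability at every point of D. *)
Definition holomorphic1 (D : C -> Prop) (f : C -> C) : Prop :=
  forall z, D z -> ex_derive (K := C_AbsRing) (V := C_NormedModule) f z.

Definition holomorphic2 (D : C2 -> Prop) (f : C2 -> C2) : Prop :=
  forall p, D p -> ex_filterdiff (K := C_AbsRing) (U := C2) (V := C2) f (locally p).

(* A germ at the origin is represented by a total function (or a predicate)
   that is only ever constrained near the origin. *)
Definition near0 (P : C2 -> Prop) : Prop := locally (T := C2) O2 P.

Definition holomorphic_germ (f : C2 -> C2) : Prop :=
  exists r : R, (0 < r)%R /\ holomorphic2 (polydisc r r) f.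

Definition Diff (phi : C2 -> C2) : Prop :=
  holomorphic_germ phi /\ phi O2 = O2 /\
  exists psi : C2 -> C2,
    holomorphic_germ psi /\ psi O2 = O2 /\
    near0 (fun p => psi (phi p) = p) /\ near0 (fun p => phi (psi p) = p).

Definition Diff_p (phi : C2 -> C2) : Prop :=
  Diff phi /\ near0 (fun p => fst (phi p) = fst p).

(* The restriction of (x,y) |-> (x,f(x,y)) to a vertical line, read in the
   coordinate y: the map y |-> f(x,y). *)
Definition line_restr (phi : C2 -> C2) (x : C) : C -> C :=
  fun y => snd (phi (x, y)).

Definition Diff_p1 (phi : C2 -> C2) : Prop :=
  Diff_p phi /\
  is_derive (K := C_AbsRing) (V := C_NormedModule)
    (line_restr phi (RtoC 0)) (RtoC 0) (RtoC 1) /\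
  ~ locally (T := C_UniformSpace) (RtoC 0)
      (fun y : C => line_restr phi (RtoC 0) y = y).

Definition Fixset (phi : C2 -> C2) (p : C2) : Prop := phi p = p.

Definition germ_set_eq (A B : C2 -> Prop) : Prop := near0 (fun p => A p <-> B p).

(* kappa o f = g o kappa wherever both sides make sense, when kappa is defined
   on B(0,s), and f and g on B(0,epsilon). *)
Definition conjugates_on (s epsilon : R) (kappa f g : C -> C) : Prop :=
  forall y : C,
    Cdisc epsilon y -> Cdisc s (f y) -> Cdisc s y -> Cdisc epsilon (kappa y) ->
    kappa (f y) = g (kappa y).

Definition injective_on (D : C -> Prop) (f : C -> C) : Prop :=
  forall y z : C, D y -> D z -> f y = f z -> y = z.

(* phi ~ eta *)
Definition equiv_rel_Fix (phi eta : C2 -> C2) : Prop :=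
  exists sigma : C2 -> C2,
    Diff sigma /\
    near0 (fun p => sigma (phi p) = eta (sigma p)) /\
    near0 (fun p => Fixset phi p -> sigma p = p).

(* Main.v *)
(* Write both maps on the line [x] as [f x] and [g x]; on [x = 0] they are [y + a y^d + ..]. A conjugacy [id + V] close to the
   identity solves [(id + V) o f = g o (id + V)]. On a small circle every point is moved inside the disc by [f] or by its inverse, so
   the equation recovers the boundary values of [V] from its interior values, while the linearised equation recovers all Taylor
   coefficients of low order but the [d]-th one. This is a contraction, and it yields a holomorphic family [V x c] of approximate
   solutions, [c] being the [d]-th coefficient, such that every exact solution belongs to the family.
   The [kappa_n] are injective on a fixed disc and fix the zeros of [f x_n - id]; a distortion estimate shows that a subsequence
   converges to some [S0], and replacing [g] by its conjugate by [S0] we may assume that the limit is [id]. Then [kappa_n] is a member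
   of the family on [x = x_n], with a parameter [c_n -> 0]. If the error [E (x, c)] of the family vanishes identically, any
   member will do. Otherwise divide its expansion by the largest power of [x]: the leading term has a simple zero in [c], for else an
   Euler flow along the family would produce a whole disc of solutions on [x = x_n]. The implicit function theorem gives a
   holomorphic [c (x)] with [c (x_n) = c_n], hence an exact conjugacy for all [x].
   It is the identity on the fixed points: if [U = f - id] and [D] is its displacement then [D^d = U Q] on the lines [x = x_n], and so
   everywhere. *)

From Stdlib Require Import Reals Lra Lia Psatz Classical ClassicalEpsilon.
From Coquelicot Require Import Coquelicot.
Require Import Defs.
Open Scope list_scope. Open Scope R_scope.

(** * Holomorphic functions of one variable and path integrals *)

(* The maps [kappa_n] live on isolated lines and are unrelated to one another, so there is nothing
   to interpolate, and a limit only sees [x = 0]. Hence the detour through a family that is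
   holomorphic in [x] by construction and complete, in that the [kappa_n] can only be members of it:
   membership turns them into a sequence of numbers [c_n], and the identity theorem in [x] becomes
   available. The Euler flow serves as follows: a multiple zero in [c] makes the velocity of the
   family an approximate symmetry of [f x_n], and moving along it produces approximate solutions
   with any prescribed small parameter, too many for a nonzero leading term. All this costs domain,
   because composition with [f] does not preserve discs, and each family lives on a slightly smaller
   disc than the data. Orders in [x] are therefore compared between families, through their
   stability, and maximised over all families that reach beyond a fixed radius. The absolute
   constants in the distortion estimate come from comparing a rescaled function with the
   exponential, which is not injective on large discs. *)
Tactic Notation "have" ident(x) ":=" lconstr(t) := assert (x := t).
Tactic Notation "have" ident(x) ":" lconstr(t) := assert (x : t).
Tactic Notation "have" ident(x) ":" lconstr(t) "by" tactic3(k) := assert (x : t) by k.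
Tactic Notation "via" uconstr(t) := eapply Rle_trans; [apply t|].

Lemma pow_le_1 (x : R) n : 0 <= x <= 1 -> x ^ n <= 1.
Proof. intros h. rewrite <- (pow1 n). apply pow_incr, h. Qed.
Lemma pow_le_self (x : R) n : 0 <= x <= 1 -> (1 <= n)%nat -> x ^ n <= x.
Proof.
  intros h hn. destruct n as [|n]; [inversion hn|]. assert (x * x ^ n <= x * 1) by (apply Rmult_le_compat_l; [apply h|apply pow_le_1, h]). simpl. lra.
Qed.

(** The smallness conditions met below are mostly finite lists of upper bounds, linear in the
    constant to be chosen; listing them as pairs (coefficient, bound) replaces nested minima. *)
Fixpoint small_for (e : R) (l : list (R * R)) : Prop := match l with nil => True | (k, a) :: m => k * e <= a /\ small_for e m end.
Fixpoint all_pos (l : list (R * R)) : Prop := match l with nil => True | (k, a) :: m => 0 < k /\ 0 < a /\ all_pos m end.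
Lemma small_exists l : all_pos l -> exists e, 0 < e /\ small_for e l.
Proof.
  have mono : forall m e e', all_pos m -> e' <= e -> small_for e m -> small_for e' m.
  { induction m as [|[k a] m IH]; simpl; [auto|]. intros e e' [p [_ q]] h [h1 h2]. split; [|apply (IH e); auto].
    apply Rle_trans with (k * e); [apply Rmult_le_compat_l; lra|auto]. }
  induction l as [|[k a] l IH]; [exists 1; split; [lra|exact I]|]. intros [hk [ha hl]]. destruct (IH hl) as [e [he H]].
  have p : 0 < a / k by (apply Rdiv_lt_0_compat; auto). exists (Rmin e (a / k)). split; [apply Rmin_pos; auto|]. split.
  - apply Rle_trans with (k * (a / k)); [apply Rmult_le_compat_l; [lra|apply Rmin_r]|apply Req_le; field; lra].
  - apply (mono l e); auto. apply Rmin_l.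
Qed.

Lemma C0r (z : C) : (z - 0)%C = z. Proof. ring. Qed.
Lemma Cmod_self (c : C) : Cmod (c - c) = 0.
Proof. replace (c - c)%C with (RtoC 0) by ring. apply Cmod_0. Qed.

(* From here on [lra] also sees through [z - 0], [z - z] and the moduli of simple complex numbers. *)
Ltac norm := rewrite ?C0r, ?Cmod_0, ?Cmod_self in *.
Ltac lra := first [Lra.lra | norm; rewrite ?Cmod_R, ?Rabs_pos_eq by Lra.lra; Lra.lra].
Notation _lra := ltac:(lra) (only parsing).
Ltac pos := first [Lra.lra | assumption | apply Rdiv_lt_0_compat; pos | apply Rmult_lt_0_compat; pos | apply Rinv_0_lt_compat; pos | apply Rplus_lt_0_compat; pos|apply pow_lt; pos].

Ltac mono := first [Lra.lra | assumption | apply Cmod_ge_0 | lazymatch goal with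
  | |- 0 <= _ * _ => apply Rmult_le_pos; mono
  | |- 0 <= _ ^ _ => apply pow_le; mono
  | |- 0 <= _ + _ => apply Rplus_le_le_0_compat; mono
  | |- 0 <= _ / _ => apply Rdiv_le_0_compat; [mono|pos]
  | |- ?a * _ <= ?a * _ => apply Rmult_le_compat_l; mono
  | |- _ * ?a <= _ * ?a => apply Rmult_le_compat_r; mono
  | |- _ * _ <= _ * _ => apply Rmult_le_compat; mono
  | |- _ ^ ?n <= _ ^ ?n => apply pow_incr; split; mono
  | |- _ + _ <= _ + _ => apply Rplus_le_compat; mono
  end | pos | apply Rlt_le; pos | apply Cmod_triangle | solve [auto]].
(* [small e ((k1, a1) :: .. :: nil) as p] provides [e > 0] with [k1 * e <= a1], and so on. *)
Tactic Notation "small" ident(e) constr(l) "as" simple_intropattern(p) :=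
  let H := fresh in destruct (small_exists l) as [e H]; [cbn [all_pos]; repeat split; pos|cbn [small_for] in H; rewrite ?Rmult_1_l in H; destruct H as p].

(** * Moduli of complex numbers *)

Lemma Cmod_sym (a b : C) : Cmod (a - b) = Cmod (b - a).
Proof. rewrite <- Cmod_opp. f_equal. ring. Qed.

Lemma Cmod_tri (a b c : C) : Cmod (a - c) <= Cmod (a - b) + Cmod (b - c).
Proof. replace (a - c)%C with ((a - b) + (b - c))%C by ring. mono. Qed.

Lemma Cmod_minus_le (a b : C) : Cmod (a - b) <= Cmod a + Cmod b.
Proof. unfold Cminus. rewrite <- (Cmod_opp b). mono. Qed.

Lemma Cmod_rev (a b : C) : Cmod a - Cmod b <= Cmod (a - b).
Proof.
  have H := Cmod_triangle (a - b) b.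
  replace (a - b + b)%C with a in H by ring. lra.
Qed.

Lemma Cmod_rev_plus (a b : C) : Cmod a - Cmod b <= Cmod (a + b).
Proof.
  rewrite <- (Cmod_opp b). replace (a + b)%C with (a - (- b))%C by ring.
  apply Cmod_rev.
Qed.

Lemma Cmod_small_eq (a b : C) : (forall e, 0 < e -> Cmod (a - b) <= e) -> a = b.
Proof.
  intros H. apply Ceq_minus. apply Cmod_eq_0.
  destruct (Rle_lt_or_eq_dec 0 (Cmod (a - b)) (Cmod_ge_0 _)) as [h|h]; [|auto].
  specialize (H (Cmod (a - b) / 2)). lra.
Qed.

Lemma Cmod_le_0 (a : C) : Cmod a <= 0 -> a = RtoC 0.
Proof. intros H. apply Cmod_eq_0. have h := Cmod_ge_0 a. lra. Qed.

Lemma Cmod_pos (z : C) : z <> 0 -> 0 < Cmod z.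
Proof. intros H. apply Cmod_gt_0. mono. Qed.

Lemma Cmod_neq0 (z : C) : 0 < Cmod z -> z <> 0.
Proof. intros H. apply Cmod_gt_0. lra. Qed.

(** The working notion of derivative: explicit bounds instead of filters, with [<=] and without
    excluding [w = z], so that estimates can be substituted directly. [is_derive] is translated into
    it by [is_derive_Cd]. *)
Definition Cd (f : C -> C) (z l : C) : Prop :=
  forall e, 0 < e -> exists d, 0 < d /\
    forall w, Cmod (w - z) < d -> Cmod (f w - f z - l * (w - z)) <= e * Cmod (w - z).

Definition hol (f : C -> C) (z : C) : Prop := exists l, Cd f z l.

Definition Ccont (f : C -> C) (z : C) : Prop :=
  forall e, 0 < e -> exists d, 0 < d /\ forall w, Cmod (w - z) < d -> Cmod (f w - f z) < e.

Lemma Cd_lip f z l : Cd f z l ->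
  exists d, 0 < d /\ forall w, Cmod (w - z) < d -> Cmod (f w - f z) <= (Cmod l + 1) * Cmod (w - z).
Proof.
  intros H. destruct (H 1 Rlt_0_1) as [d [hd h]]. exists d; split; auto.
  intros w hw. specialize (h w hw).
  replace (f w - f z)%C with ((f w - f z - l * (w - z)) + l * (w - z))%C by ring.
  via Cmod_triangle. rewrite Cmod_mult. lra.
Qed.

Lemma Cd_cont f z l : Cd f z l -> Ccont f z.
Proof.
  intros H e he. destruct (Cd_lip _ _ _ H) as [d [hd h]].
  have hl := Cmod_ge_0 l.
  assert (0 < e / (Cmod l + 2)) by pos.
  exists (Rmin d (e / (Cmod l + 2))). split; [apply Rmin_pos; lra|].
  intros w hw.
  have hw1 := Rlt_le_trans _ _ _ hw (Rmin_l _ _).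
  have hw2 := Rlt_le_trans _ _ _ hw (Rmin_r _ _).
  specialize (h w hw1). assert (0 <= Cmod (w - z)) by apply Cmod_ge_0.
  assert ((Cmod l + 2) * Cmod (w - z) < e).
  { apply Rmult_lt_reg_r with (/ (Cmod l + 2)); [pos|].
    replace ((Cmod l + 2) * Cmod (w - z) * / (Cmod l + 2)) with (Cmod (w - z)) by (field; lra).
    lra. }
  nra.
Qed.

Lemma hol_cont f z : hol f z -> Ccont f z.
Proof. intros [l H]. eapply Cd_cont; eauto. Qed.

(** The usual source of derivatives below is a second-order remainder. [K] may have any sign, hence
    the [Rabs K + 1] in the proof. *)
Lemma Cd_quad f z l K r : 0 < r ->
  (forall w, Cmod (w - z) < r -> Cmod (f w - f z - l * (w - z)) <= K * Cmod (w - z) ^ 2) -> Cd f z l.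
Proof.
  intros hr H e he. set (K' := Rabs K + 1).
  have hK : K <= K' by (unfold K'; have h := Rle_abs K; lra).
  have hK' : 0 < K' by (unfold K'; have h := Rabs_pos K; lra).
  assert (0 < e / K') by pos.
  exists (Rmin r (e / K')). split; [apply Rmin_pos; lra|].
  intros w hw.
  have hw1 := Rlt_le_trans _ _ _ hw (Rmin_l _ _).
  have hw2 := Rlt_le_trans _ _ _ hw (Rmin_r _ _).
  specialize (H w hw1). have h0 : 0 <= Cmod (w - z) by apply Cmod_ge_0.
  assert (K' * Cmod (w - z) < e).
  { apply Rmult_lt_reg_r with (/ K'); [pos|].
    replace (K' * Cmod (w - z) * / K') with (Cmod (w - z)) by (field; lra). lra. }
  nra.
Qed.

Lemma Cd_const (c z : C) : Cd (fun _ => c) z 0.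
Proof.
  apply Cd_quad with (K := 0) (r := 1); [lra|]. intros w _.
  replace (c - c - 0 * (w - z))%C with (RtoC 0) by ring. lra.
Qed.

Lemma Cd_id (z : C) : Cd (fun w => w) z 1.
Proof.
  apply Cd_quad with (K := 0) (r := 1); [lra|]. intros w _.
  replace (w - z - 1 * (w - z))%C with (RtoC 0) by ring. lra.
Qed.

Lemma Cd_plus f g z l m : Cd f z l -> Cd g z m -> Cd (fun w => f w + g w)%C z (l + m).
Proof.
  intros Hf Hg e he.
  destruct (Hf (e / 2)) as [d1 [h1 H1]]; [lra|].
  destruct (Hg (e / 2)) as [d2 [h2 H2]]; [lra|].
  exists (Rmin d1 d2). split; [apply Rmin_pos; auto|]. intros w hw.
  specialize (H1 w (Rlt_le_trans _ _ _ hw (Rmin_l _ _))).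
  specialize (H2 w (Rlt_le_trans _ _ _ hw (Rmin_r _ _))).
  replace (f w + g w - (f z + g z) - (l + m) * (w - z))%C with
    ((f w - f z - l * (w - z)) + (g w - g z - m * (w - z)))%C by ring.
  via Cmod_triangle. lra.
Qed.

Lemma Cd_comp f g z l m : Cd f z l -> Cd g (f z) m -> Cd (fun w => g (f w)) z (m * l).
Proof.
  intros Hf Hg e he.
  destruct (Cd_lip _ _ _ Hf) as [d0 [h0 H0]].
  have hl := Cmod_ge_0 l. have hm := Cmod_ge_0 m.
  set (e1 := e / (2 * (Cmod l + 1))).
  set (e2 := e / (2 * (Cmod m + 1))).
  have he1 : 0 < e1 by pos.
  have he2 : 0 < e2 by pos.
  destruct (Hg e1 he1) as [d1 [h1 H1]].
  destruct (Hf e2 he2) as [d2 [h2 H2]].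
  destruct (Cd_cont _ _ _ Hf d1 h1) as [d3 [h3 H3]].
  exists (Rmin d0 (Rmin d2 d3)). split; [repeat apply Rmin_pos; auto|]. intros w hw.
  have hw0 := Rlt_le_trans _ _ _ hw (Rmin_l _ _).
  have hw' := Rlt_le_trans _ _ _ hw (Rmin_r _ _).
  have hw2 := Rlt_le_trans _ _ _ hw' (Rmin_l _ _).
  have hw3 := Rlt_le_trans _ _ _ hw' (Rmin_r _ _).
  specialize (H0 w hw0). specialize (H2 w hw2). specialize (H1 _ (H3 w hw3)).
  replace (g (f w) - g (f z) - m * l * (w - z))%C with
    ((g (f w) - g (f z) - m * (f w - f z)) + m * (f w - f z - l * (w - z)))%C by ring.
  via Cmod_triangle. rewrite Cmod_mult.
  have hp := Cmod_ge_0 (w - z).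
  assert (e1 * Cmod (f w - f z) <= e1 * ((Cmod l + 1) * Cmod (w - z))) by mono.
  assert (Cmod m * Cmod (f w - f z - l * (w - z)) <= Cmod m * (e2 * Cmod (w - z))) by mono.
  assert (e1 * (Cmod l + 1) = e / 2) by (unfold e1; field; lra).
  assert (e2 * (Cmod m + 1) = e / 2) by (unfold e2; field; lra).
  assert (Cmod m * e2 <= e / 2) by nra.
  nra.
Qed.

Lemma Cd_sq z : Cd (fun w => w * w)%C z (2 * z).
Proof.
  apply Cd_quad with (K := 1) (r := 1); [lra|]. intros w _.
  replace (w * w - z * z - 2 * z * (w - z))%C with ((w - z) * (w - z))%C by ring.
  rewrite Cmod_mult. lra.
Qed.

Lemma Cd_scal c f z l : Cd f z l -> Cd (fun w => c * f w)%C z (c * l).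
Proof.
  intros H. apply (Cd_comp f (fun w => c * w)%C); [mono|].
  apply Cd_quad with (K := 0) (r := 1); [lra|]. intros w _.
  replace (c * w - c * f z - c * (w - f z))%C with (RtoC 0) by ring. lra.
Qed.

Lemma Cd_ext f g z l r : 0 < r -> (forall w, Cmod (w - z) < r -> f w = g w) -> Cd f z l -> Cd g z l.
Proof.
  intros hr E H e he. destruct (H e he) as [d [hd h]].
  exists (Rmin d r). split; [apply Rmin_pos; auto|]. intros w hw.
  rewrite <- (E w (Rlt_le_trans _ _ _ hw (Rmin_r _ _))), <- (E z).
  - apply h. exact (Rlt_le_trans _ _ _ hw (Rmin_l _ _)).
  - lra.
Qed.

Lemma Cd_eq f z l m : l = m -> Cd f z l -> Cd f z m.
Proof. intros ->; auto. Qed.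

(** Polarisation: [4 f g = (f + g)^2 - (f - g)^2] reduces the product rule to sums, the chain rule
    and the derivative of a square. Products of continuous paths are treated in the same way. *)
Lemma Cd_mult f g z l m : Cd f z l -> Cd g z m -> Cd (fun w => f w * g w)%C z (l * g z + f z * m).
Proof.
  intros Hf Hg.
  have H1 := Cd_comp _ _ _ _ _ (Cd_plus _ _ _ _ _ Hf Hg) (Cd_sq _).
  have H2 := Cd_comp _ _ _ _ _ (Cd_plus _ _ _ _ _ Hf (Cd_scal (-1) _ _ _ Hg)) (Cd_sq _).
  have H := Cd_scal (/ 4) _ _ _ (Cd_plus _ _ _ _ _ H1 (Cd_scal (-1) _ _ _ H2)).
  simpl in H.
  have h4 : RtoC 4 <> 0 by (intro h; apply RtoC_inj in h; lra).
  apply (Cd_ext _ (fun w => f w * g w)%C _ _ 1) in H; [|lra|intros w _; field; auto].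
  refine (Cd_eq _ _ _ _ _ H). field; auto.
Qed.

Lemma Cd_inv (z : C) : z <> 0 -> Cd (fun w => / w)%C z (- / (z * z)).
Proof.
  intros hz. have h : 0 < Cmod z by (apply Cmod_pos; auto).
  apply Cd_quad with (K := 2 / Cmod z ^ 3) (r := Cmod z / 2); [lra|]. intros w hw.
  have h2 : Cmod z / 2 <= Cmod w.
  { have h3 := Cmod_rev z w. rewrite Cmod_sym in h3. lra. }
  have hw0 : w <> 0 by (apply Cmod_neq0; lra).
  replace (/ w - / z - - / (z * z) * (w - z))%C with ((w - z) * (w - z) * (/ w * (/ z * / z)))%C
    by (field; auto).
  rewrite !Cmod_mult, !Cmod_inv by auto.
  assert (/ Cmod w <= 2 / Cmod z).
  { replace (2 / Cmod z) with (/ (Cmod z / 2)) by (field; lra). apply Rinv_le_contravar; lra. }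
  have hz2 : 0 < / Cmod z by pos.
  replace (2 / Cmod z ^ 3 * Cmod (w - z) ^ 2) with
    (Cmod (w - z) * Cmod (w - z) * (2 / Cmod z * (/ Cmod z * / Cmod z))) by (field; lra).
  mono.
Qed.

Lemma Cd_unique f z l m : Cd f z l -> Cd f z m -> l = m.
Proof.
  intros H1 H2. apply Cmod_small_eq. intros e he.
  destruct (H1 (e / 2)) as [d1 [h1 K1]]; [lra|].
  destruct (H2 (e / 2)) as [d2 [h2 K2]]; [lra|].
  set (d := Rmin d1 d2 / 2).
  have hd : 0 < Rmin d1 d2 by (apply Rmin_pos; auto).
  have hd0 : 0 < d by mono.
  have hw : Cmod (z + d - z) = d.
  { replace (z + d - z)%C with (RtoC d) by ring. lra. }
  specialize (K1 (z + d)%C). specialize (K2 (z + d)%C). rewrite hw in K1, K2.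
  have a1 := Rmin_l d1 d2. have a2 := Rmin_r d1 d2. unfold d in *.
  specialize (K1 _lra). specialize (K2 _lra).
  fold d in hw. fold d in K1, K2, hd0.
  apply Rmult_le_reg_r with d; [lra|].
  rewrite <- hw at 1. rewrite <- Cmod_mult.
  replace ((l - m) * (z + d - z))%C with
   ((f (z + d) - f z - m * (z + d - z)) - (f (z + d) - f z - l * (z + d - z)))%C by ring.
  via Cmod_minus_le. lra.
Qed.

Lemma hol_const c z : hol (fun _ => c) z. Proof. eexists; apply Cd_const. Qed.
Lemma hol_id z : hol (fun w => w) z. Proof. eexists; apply Cd_id. Qed.
Lemma hol_plus f g z : hol f z -> hol g z -> hol (fun w => f w + g w)%C z.
Proof. intros [l H] [m K]. eexists; eapply Cd_plus; eauto. Qed.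
Lemma hol_mult f g z : hol f z -> hol g z -> hol (fun w => f w * g w)%C z.
Proof. intros [l H] [m K]. eexists; eapply Cd_mult; eauto. Qed.
Lemma hol_comp f g z : hol f z -> hol g (f z) -> hol (fun w => g (f w)) z.
Proof. intros [l H] [m K]. eexists; eapply Cd_comp; eauto. Qed.
Lemma hol_inv f z : hol f z -> f z <> 0 -> hol (fun w => / f w)%C z.
Proof. intros H h. apply (hol_comp f (fun w => / w)%C); auto. eexists; apply Cd_inv; auto. Qed.
Lemma hol_opp f z : hol f z -> hol (fun w => - f w)%C z.
Proof.
  intros [l H]. exists ((-1) * l)%C. apply Cd_ext with (f := (fun w => (-1) * f w)%C) (r := 1); [lra|intros; ring|].
  apply Cd_scal; auto.
Qed.
Lemma hol_minus f g z : hol f z -> hol g z -> hol (fun w => f w - g w)%C z.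
Proof. intros H K. apply (hol_plus f (fun w => - g w)%C); auto. apply hol_opp; auto. Qed.
Lemma hol_div f g z : hol f z -> hol g z -> g z <> 0 -> hol (fun w => f w / g w)%C z.
Proof. intros H K h. apply (hol_mult f (fun w => / g w)%C); auto. apply hol_inv; auto. Qed.
Lemma hol_pow f z n : hol f z -> hol (fun w => f w ^ n)%C z.
Proof. intros H. induction n; simpl. apply hol_const. apply hol_mult; auto. Qed.
Lemma hol_ext f g z r : 0 < r -> (forall w, Cmod (w - z) < r -> f w = g w) -> hol f z -> hol g z.
Proof. intros hr E [l H]. exists l. eapply Cd_ext; eauto. Qed.
Lemma hol_ext_all f g z : (forall w, f w = g w) -> hol f z -> hol g z.
Proof. intros E. apply hol_ext with 1; [lra|auto]. Qed.

(** The derivative as a total function, chosen by [epsilon]; where [f] is not differentiable the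
    value is arbitrary, and [cD_spec] asks for [hol]. *)
Definition cD (f : C -> C) (z : C) : C := epsilon (inhabits (RtoC 0)) (fun l => Cd f z l).
Lemma cD_spec f z : hol f z -> Cd f z (cD f z).
Proof. intros H. apply (epsilon_spec (inhabits (RtoC 0)) (fun l => Cd f z l) H). Qed.
Lemma cD_eq f z l : Cd f z l -> cD f z = l.
Proof. intros H. eapply Cd_unique; [apply cD_spec; eexists|]; eauto. Qed.

(** * Continuous paths and their means over the unit interval *)

Definition ccont (h : R -> C) (t : R) : Prop :=
  forall e, 0 < e -> exists d, 0 < d /\ forall u, Rabs (u - t) < d -> Cmod (h u - h t) < e.

Lemma ccont_const c t : ccont (fun _ => c) t.
Proof.
  intros e he. exists 1; split; [lra|]. intros.
  lra.
Qed.
Lemma ccont_id t : ccont (fun u => RtoC u) t.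
Proof. intros e he. exists e; split; auto. intros u hu. rewrite <- RtoC_minus, Cmod_R. auto. Qed.
Lemma ccont_Ccont f h t : ccont h t -> Ccont f (h t) -> ccont (fun u => f (h u)) t.
Proof.
  intros H K e he. destruct (K e he) as [d [hd h1]]. destruct (H d hd) as [d' [hd' h2]].
  exists d'; split; auto.
Qed.
Lemma ccont_hol f h t : ccont h t -> hol f (h t) -> ccont (fun u => f (h u)) t.
Proof. intros H K. apply ccont_Ccont; auto. apply hol_cont; auto. Qed.
Lemma ccont_plus g h t : ccont g t -> ccont h t -> ccont (fun u => g u + h u)%C t.
Proof.
  intros H K e he.
  destruct (H (e / 2)) as [d [hd h1]]; [lra|]. destruct (K (e / 2)) as [d' [hd' h2]]; [lra|].
  exists (Rmin d d'); split; [apply Rmin_pos; auto|]. intros u hu.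
  specialize (h1 u (Rlt_le_trans _ _ _ hu (Rmin_l _ _))).
  specialize (h2 u (Rlt_le_trans _ _ _ hu (Rmin_r _ _))).
  replace (g u + h u - (g t + h t))%C with ((g u - g t) + (h u - h t))%C by ring.
  eapply Rle_lt_trans; [mono|]. lra.
Qed.
Lemma ccont_ext g h t : (forall u, g u = h u) -> ccont g t -> ccont h t.
Proof.
  intros E H e he. destruct (H e he) as [d [hd h1]]. exists d; split; auto.
  intros u hu. rewrite <- !E. auto.
Qed.
Lemma ccont_scal c h t : ccont h t -> ccont (fun u => c * h u)%C t.
Proof.
  intros H. apply (ccont_hol (fun w => c * w)%C); auto.
  apply hol_mult; [apply hol_const|apply hol_id].
Qed.
Lemma ccont_mult g h t : ccont g t -> ccont h t -> ccont (fun u => g u * h u)%C t.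
Proof.
  intros H K.
  have sq : forall k, ccont k t -> ccont (fun u => k u * k u)%C t.
  { intros k hk. apply (ccont_hol (fun w => w * w)%C); auto. eexists; apply Cd_sq. }
  have h4 : RtoC 4 <> 0 by (intro h4; apply RtoC_inj in h4; lra).
  apply ccont_ext with (g := (fun u => / 4 * ((g u + h u) * (g u + h u) + (-1) * ((g u + (-1) * h u) * (g u + (-1) * h u))))%C).
  { intros u. field; auto. }
  apply ccont_scal. apply ccont_plus; [|apply ccont_scal]; apply sq; apply ccont_plus; auto.
  apply ccont_scal; auto.
Qed.
Lemma ccont_opp h t : ccont h t -> ccont (fun u => - h u)%C t.
Proof. intros H. apply ccont_ext with (g := fun u => ((-1) * h u)%C); [intros; ring|]. apply ccont_scal; auto. Qed.
Lemma ccont_minus g h t : ccont g t -> ccont h t -> ccont (fun u => g u - h u)%C t.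
Proof. intros H K. apply (ccont_plus g (fun u => - h u)%C); auto. apply ccont_opp; auto. Qed.
Lemma ccont_inv h t : ccont h t -> h t <> 0 -> ccont (fun u => / h u)%C t.
Proof. intros H K. apply (ccont_hol (fun w => / w)%C); auto. eexists; apply Cd_inv; auto. Qed.
Lemma ccont_div g h t : ccont g t -> ccont h t -> h t <> 0 -> ccont (fun u => g u / h u)%C t.
Proof. intros. apply ccont_mult; auto. apply ccont_inv; auto. Qed.
Lemma ccont_pow h t n : ccont h t -> ccont (fun u => h u ^ n)%C t.
Proof. intros H. induction n; simpl. apply ccont_const. apply ccont_mult; auto. Qed.

Lemma re_le (a : C) : Rabs (Re a) <= Cmod a.
Proof. apply re_le_Cmod. Qed.
Lemma im_le (a : C) : Rabs (Im a) <= Cmod a.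
Proof. eapply Rle_trans; [apply Rmax_r|apply (Rmax_Cmod a)]. Qed.

Lemma ccont_re h t : ccont h t -> continuous (fun u => Re (h u)) t.
Proof.
  intros H. apply continuity_pt_filterlim. intros e he. destruct (H e he) as [d [hd h1]].
  exists d; split; auto. intros u [_ hu]. simpl in *. unfold R_dist in *.
  specialize (h1 u hu). eapply Rle_lt_trans; [|exact h1].
  replace (Re (h u) - Re (h t)) with (Re (h u - h t)); [apply re_le|].
  mono.
Qed.
Lemma ccont_im h t : ccont h t -> continuous (fun u => Im (h u)) t.
Proof.
  intros H. apply continuity_pt_filterlim. intros e he. destruct (H e he) as [d [hd h1]].
  exists d; split; auto. intros u [_ hu]. simpl in *. unfold R_dist in *.
  specialize (h1 u hu). eapply Rle_lt_trans; [|exact h1].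
  replace (Im (h u) - Im (h t)) with (Im (h u - h t)); [apply im_le|].
  mono.
Qed.

Definition conth (h : R -> C) : Prop := forall t, 0 <= t <= 1 -> ccont h t.
(** Integrals are averages over the parameter: on a circle, [dz = tpi * z dt], so a contour integral
    of [f] becomes [tpi] times the mean of [f z * z]. *)
Definition mean (h : R -> C) : C := (RInt (fun t => Re (h t)) 0 1, RInt (fun t => Im (h t)) 0 1).

Lemma conth_re h a b : 0 <= a <= b -> b <= 1 -> conth h -> ex_RInt (fun t => Re (h t)) a b.
Proof.
  intros H1 H2 H. apply (ex_RInt_continuous (V := R_CompleteNormedModule)).
  rewrite Rmin_left, Rmax_right by lra. intros z hz. apply ccont_re. apply H. lra.
Qed.
Lemma conth_im h a b : 0 <= a <= b -> b <= 1 -> conth h -> ex_RInt (fun t => Im (h t)) a b.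
Proof.
  intros H1 H2 H. apply (ex_RInt_continuous (V := R_CompleteNormedModule)).
  rewrite Rmin_left, Rmax_right by lra. intros z hz. apply ccont_im. apply H. lra.
Qed.

Lemma mean_ext g h : (forall t, 0 < t < 1 -> g t = h t) -> mean g = mean h.
Proof.
  intros E. unfold mean. f_equal; apply RInt_ext; rewrite Rmin_left, Rmax_right by lra;
  intros; rewrite E; auto.
Qed.

Lemma mean_plus g h : conth g -> conth h -> mean (fun t => g t + h t)%C = (mean g + mean h)%C.
Proof.
  intros H K. unfold mean, Cplus; simpl. f_equal.
  - rewrite <- (RInt_plus (V := R_CompleteNormedModule)); [|apply conth_re; auto; lra|apply conth_re; auto; lra].
    mono.
  - rewrite <- (RInt_plus (V := R_CompleteNormedModule)); [|apply conth_im; auto; lra|apply conth_im; auto; lra].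
    mono.
Qed.

Lemma mean_scal c h : conth h -> mean (fun t => c * h t)%C = (c * mean h)%C.
Proof.
  intros H.
  have h1 := conth_re h 0 1 _lra _lra H.
  have h2 := conth_im h 0 1 _lra _lra H.
  unfold mean, Cmult; simpl. f_equal.
  - rewrite (RInt_ext _ (fun t => minus (scal (fst c) (Re (h t))) (scal (snd c) (Im (h t)))))
      by mono.
    rewrite (RInt_minus (V := R_CompleteNormedModule)) by
      (apply (ex_RInt_scal (V := R_CompleteNormedModule)); auto).
    rewrite !(RInt_scal (V := R_CompleteNormedModule)) by auto. mono.
  - rewrite (RInt_ext _ (fun t => plus (scal (fst c) (Im (h t))) (scal (snd c) (Re (h t)))))
      by mono.
    rewrite (RInt_plus (V := R_CompleteNormedModule)) by
      (apply (ex_RInt_scal (V := R_CompleteNormedModule)); auto).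
    rewrite !(RInt_scal (V := R_CompleteNormedModule)) by auto. mono.
Qed.

Lemma mean_minus g h : conth g -> conth h -> mean (fun t => g t - h t)%C = (mean g - mean h)%C.
Proof.
  intros H K. rewrite (mean_ext _ (fun t => g t + (-1) * h t)%C) by (intros; ring).
  rewrite mean_plus, mean_scal; auto. ring.
  intros t ht. apply ccont_scal; auto.
Qed.

Lemma mean_const c : mean (fun _ => c) = c.
Proof.
  unfold mean. rewrite !RInt_const. unfold scal; simpl. unfold mult; simpl.
  destruct c; simpl. f_equal; ring.
Qed.

(** Rotation by the unit [u], the conjugate of the mean divided by its modulus, makes the mean real
    and positive; then only the real part of [u * h] has to be bounded. *)
Lemma mean_bound h M : conth h -> (forall t, 0 < t < 1 -> Cmod (h t) <= M) -> Cmod (mean h) <= M.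
Proof.
  intros H HM.
  destruct (Ceq_dec (mean h) 0) as [h0|h0].
  { rewrite h0, Cmod_0. eapply Rle_trans; [mono|apply (HM (1/2)); lra]. }
  set (m := mean h) in *. have hm : 0 < Cmod m by (apply Cmod_pos; auto).
  set (u := (Cconj m / Cmod m)%C).
  have hu : Cmod u = 1.
  { unfold u. rewrite Cmod_div, Cmod_conj, Cmod_R, Rabs_pos_eq; [field; lra|lra|].
    intro h1; apply RtoC_inj in h1; lra. }
  have hum : (u * m)%C = Cmod m.
  { unfold u. replace (Cconj m / Cmod m * m)%C with ((m * Cconj m) / Cmod m)%C.
    rewrite <- Cmod2_conj. rewrite <- RtoC_div by lra. f_equal. field; lra.
    field. intro h1; apply RtoC_inj in h1; lra. }
  have hmu : mean (fun t => u * h t)%C = Cmod m by (rewrite mean_scal; auto).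
  have hre : Re (mean (fun t => u * h t)%C) = Cmod m by (rewrite hmu; apply re_RtoC).
  rewrite <- hre. change (RInt (fun t => Re (u * h t)) 0 1 <= M).
  replace M with (RInt (fun _ => M) 0 1) by (rewrite RInt_const; unfold scal; simpl; unfold mult; simpl; ring).
  apply RInt_le; [lra| | |].
  - apply (conth_re (fun t => u * h t)%C); try lra. intros t ht. apply ccont_scal; auto.
  - apply ex_RInt_const.
  - intros t ht. via Rle_abs. via re_le.
    rewrite Cmod_mult, hu. specialize (HM t ht). lra.
Qed.

(** Splitting the interval at [1/2] is what cuts a segment at its midpoint in the bisection of
    triangles. *)
Lemma mean_split h : conth h ->
  mean h = (/ 2 * (mean (fun t => h (t / 2)%R) + mean (fun t => h ((1 + t) / 2)%R)))%C.
Proof.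
  intros H.
  have aux : forall k : R -> R, (forall t, 0 <= t <= 1 -> continuous k t) ->
    RInt k 0 1 = / 2 * (RInt (fun t => k (t / 2)) 0 1 + RInt (fun t => k ((1 + t) / 2)) 0 1).
  { intros k hk.
    have ex : forall a b, 0 <= a <= b -> b <= 1 -> ex_RInt k a b.
    { intros a b h1 h2. apply (ex_RInt_continuous (V := R_CompleteNormedModule)).
      rewrite Rmin_left, Rmax_right by lra. intros; apply hk; lra. }
    rewrite <- (RInt_Chasles (V := R_CompleteNormedModule) k 0 (1/2) 1) by (apply ex; lra).
    have e1 := RInt_comp_lin (V := R_CompleteNormedModule) k (1/2) 0 0 1.
    have e2 := RInt_comp_lin (V := R_CompleteNormedModule) k (1/2) (1/2) 0 1.
    replace (1 / 2 * 0 + 0) with 0 in e1 by ring. replace (1 / 2 * 1 + 0) with (1/2) in e1 by ring.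
    replace (1 / 2 * 0 + 1/2) with (1/2) in e2 by field. replace (1 / 2 * 1 + 1/2) with 1 in e2 by field.
    rewrite <- e1 by (apply ex; lra). rewrite <- e2 by (apply ex; lra).
    have c1 : forall t, 0 <= t <= 1 -> continuous (fun t => k (t / 2)) t.
    { intros t ht. apply (continuous_comp (fun t => t / 2) k).
      - apply (continuous_mult (K := R_AbsRing) (fun t => t) (fun _ => / 2)); [apply continuous_id|apply continuous_const].
      - apply hk; lra. }
    have c2 : forall t, 0 <= t <= 1 -> continuous (fun t => k ((1 + t) / 2)) t.
    { intros t ht. apply (continuous_comp (fun t => (1 + t) / 2) k).
      - apply (continuous_mult (K := R_AbsRing) (fun t => 1 + t) (fun _ => / 2)); [|apply continuous_const].
        apply (continuous_plus (V := R_NormedModule)); [apply continuous_const|apply continuous_id].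
      - apply hk; lra. }
    rewrite (RInt_ext _ (fun t => scal (/2) (k (t / 2)))).
    2:{ intros x _. unfold scal; simpl; unfold mult; simpl. replace (1/2*x+0) with (x/2) by field. lra. }
    rewrite (RInt_ext (fun y => scal (1/2) (k (1/2*y+1/2))) (fun t => scal (/2) (k ((1+t) / 2)))).
    2:{ intros x _. unfold scal; simpl; unfold mult; simpl. replace (1/2*x+1/2) with ((1+x)/2) by field. lra. }
    rewrite !(RInt_scal (V := R_CompleteNormedModule)).
    - unfold plus, scal; simpl; unfold mult; simpl. ring.
    - apply (ex_RInt_continuous (V := R_CompleteNormedModule)). rewrite Rmin_left, Rmax_right by lra. auto.
    - apply (ex_RInt_continuous (V := R_CompleteNormedModule)). rewrite Rmin_left, Rmax_right by lra. auto. }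
  unfold mean. rewrite (aux (fun t => Re (h t))), (aux (fun t => Im (h t))).
  - replace (/ RtoC 2)%C with (RtoC (/ 2)) by (apply RtoC_inv; lra).
    unfold Cmult, Cplus, RtoC; simpl. f_equal; ring.
  - intros; apply ccont_im; auto.
  - intros; apply ccont_re; auto.
Qed.

(** * Derivatives of paths and mean value inequalities *)

Definition rd (h : R -> C) (t : R) (l : C) : Prop :=
  forall e, 0 < e -> exists d, 0 < d /\
    forall u, Rabs (u - t) < d -> Cmod (h u - h t - l * (u - t)%R) <= e * Rabs (u - t).

Lemma rd_Cd f h t l m : rd h t l -> Cd f (h t) m -> rd (fun u => f (h u)) t (m * l).
Proof.
  intros Hh Hf e he.
  destruct (Hh 1 Rlt_0_1) as [d0 [h0 H0]].
  have hl := Cmod_ge_0 l. have hm := Cmod_ge_0 m.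
  set (e1 := e / (2 * (Cmod l + 1))).
  set (e2 := e / (2 * (Cmod m + 1))).
  have he1 : 0 < e1 by pos.
  have he2 : 0 < e2 by pos.
  destruct (Hf e1 he1) as [d1 [h1 H1]].
  destruct (Hh e2 he2) as [d2 [h2 H2]].
  set (d3 := d1 / (Cmod l + 1)).
  have h3 : 0 < d3 by pos.
  exists (Rmin d0 (Rmin d2 d3)). split; [repeat apply Rmin_pos; auto|]. intros w hw.
  have hw0 := Rlt_le_trans _ _ _ hw (Rmin_l _ _).
  have hw' := Rlt_le_trans _ _ _ hw (Rmin_r _ _).
  have hw2 := Rlt_le_trans _ _ _ hw' (Rmin_l _ _).
  have hw3 := Rlt_le_trans _ _ _ hw' (Rmin_r _ _).
  specialize (H0 w hw0). specialize (H2 w hw2).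
  have hp := Rabs_pos (w - t).
  have L : Cmod (h w - h t) <= (Cmod l + 1) * Rabs (w - t).
  { replace (h w - h t)%C with ((h w - h t - l * (w - t)%R) + l * (w - t)%R)%C by ring.
    via Cmod_triangle. rewrite Cmod_mult, Cmod_R. lra. }
  have hd3 : (Cmod l + 1) * d3 = d1 by (unfold d3; field; lra).
  specialize (H1 (h w)). 
  assert (Cmod (h w - h t) < d1) by nra. specialize (H1 H).
  replace (f (h w) - f (h t) - m * l * (w - t)%R)%C with
    ((f (h w) - f (h t) - m * (h w - h t)) + m * (h w - h t - l * (w - t)%R))%C by ring.
  via Cmod_triangle. rewrite Cmod_mult.
  assert (e1 * Cmod (h w - h t) <= e1 * ((Cmod l + 1) * Rabs (w - t))) by mono.
  assert (Cmod m * Cmod (h w - h t - l * (w - t)%R) <= Cmod m * (e2 * Rabs (w - t))) by mono.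
  assert (e1 * (Cmod l + 1) = e / 2) by (unfold e1; field; lra).
  assert (e2 * (Cmod m + 1) = e / 2) by (unfold e2; field; lra).
  assert (Cmod m * e2 <= e / 2) by nra.
  nra.
Qed.

Lemma rd_line a b t : rd (fun u => a + u * b)%C t b.
Proof.
  intros e he. exists 1; split; [lra|]. intros u _. rewrite RtoC_minus.
  replace (a + u * b - (a + t * b) - b * (u - t))%C with (RtoC 0) by ring.
  rewrite Cmod_0. have h := Rabs_pos (u - t). nra.
Qed.

Lemma rd_re h t l : rd h t l -> is_derive (fun u => Re (h u)) t (Re l).
Proof.
  intros H. split; [apply is_linear_scal_l|]. intros x hx.
  have hx' : t = x by exact (is_filter_lim_locally_unique t x hx). subst x. intros eps.
  destruct (H eps (cond_pos eps)) as [d [hd h1]]. exists (mkposreal d hd). intros u hu.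
  specialize (h1 u hu). eapply Rle_trans; [|exact h1].
  eapply Rle_trans; [|apply re_le]. unfold Cminus. rewrite !re_plus, !re_opp, re_scal_r.
  change (Rabs ((Re (h u) + - Re (h t)) + - ((u + - t) * Re l)) <= Rabs (Re (h u) + - Re (h t) + - (Re l * (u - t)))).
  apply Req_le. f_equal. ring.
Qed.
Lemma rd_im h t l : rd h t l -> is_derive (fun u => Im (h u)) t (Im l).
Proof.
  intros H. split; [apply is_linear_scal_l|]. intros x hx.
  have hx' : t = x by exact (is_filter_lim_locally_unique t x hx). subst x. intros eps.
  destruct (H eps (cond_pos eps)) as [d [hd h1]]. exists (mkposreal d hd). intros u hu.
  specialize (h1 u hu). eapply Rle_trans; [|exact h1].
  eapply Rle_trans; [|apply im_le]. unfold Cminus. rewrite !im_plus, !im_opp, im_scal_r.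
  change (Rabs ((Im (h u) + - Im (h t)) + - ((u + - t) * Im l)) <= Rabs (Im (h u) + - Im (h t) + - (Im l * (u - t)))).
  apply Req_le. f_equal. ring.
Qed.

Lemma mean_FTC h h' : (forall t, 0 <= t <= 1 -> rd h t (h' t)) -> conth h' -> mean h' = (h 1 - h 0)%C.
Proof.
  intros H K. unfold mean.
  have e1 : is_RInt (fun t => Re (h' t)) 0 1 (minus (Re (h 1)) (Re (h 0))).
  { apply (is_RInt_derive (V := R_CompleteNormedModule) (fun t => Re (h t))).
    - rewrite Rmin_left, Rmax_right by lra. intros; apply rd_re; auto.
    - rewrite Rmin_left, Rmax_right by lra. intros; apply ccont_re; auto. }
  have e2 : is_RInt (fun t => Im (h' t)) 0 1 (minus (Im (h 1)) (Im (h 0))).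
  { apply (is_RInt_derive (V := R_CompleteNormedModule) (fun t => Im (h t))).
    - rewrite Rmin_left, Rmax_right by lra. intros; apply rd_im; auto.
    - rewrite Rmin_left, Rmax_right by lra. intros; apply ccont_im; auto. }
  rewrite (is_RInt_unique _ _ _ _ e1), (is_RInt_unique _ _ _ _ e2). mono.
Qed.

(** The real mean value theorem is applied to the real part of the conjugate of [F b - F a] times
    [F], along the segment: between the end points this function varies by [|F b - F a|^2]. *)
Lemma MVT_C F f a b L :
  (forall t, 0 <= t <= 1 -> Cd F (a + RtoC t * (b - a)) (f (a + RtoC t * (b - a))%C)) ->
  (forall t, 0 <= t <= 1 -> Cmod (f (a + RtoC t * (b - a))%C) <= L) ->
  Cmod (F b - F a) <= L * Cmod (b - a).
Proof.
  intros HF HL.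
  destruct (Ceq_dec (F b - F a) 0) as [h0|h0].
  { rewrite h0, Cmod_0. apply Rmult_le_pos; [|mono].
    eapply Rle_trans; [mono|apply (HL 0); lra]. }
  set (m := (F b - F a)%C) in *. have hm : 0 < Cmod m by (apply Cmod_pos; auto).
  set (u := Cconj m).
  have D : forall t, 0 <= t <= 1 ->
     rd (fun t : R => (u * F (a + t * (b - a)))%C) t ((u * f (a + t * (b - a)) * (b - a))%C).
  { intros t ht. apply (rd_Cd (fun w => u * F w)%C (fun t : R => a + t * (b - a))%C).
    apply rd_line. apply Cd_scal. auto. }
  destruct (MVT_gen (fun t => Re (u * F (a + RtoC t * (b - a)))%C) 0 1 (fun t => Re (u * f (a + RtoC t * (b - a)) * (b - a))%C)) as [c [hc E]].
  - rewrite Rmin_left, Rmax_right by lra. intros; apply rd_re. apply D. lra.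
  - rewrite Rmin_left, Rmax_right by lra. intros.
    apply derivable_continuous_pt. exists (Re (u * f (a + RtoC x * (b - a)) * (b - a))%C).
    apply is_derive_Reals. apply rd_re. mono.
  - rewrite Rmin_left, Rmax_right in hc by lra.
    replace (a + 1 * (b - a))%C with b in E by ring. replace (a + 0 * (b - a))%C with a in E by ring.
    replace (Re (u * F b)%C - Re (u * F a)%C) with (Re (m * Cconj m)) in E.
    2:{ unfold Rminus. rewrite <- re_opp, <- re_plus. f_equal. unfold u, m. ring. }
    rewrite <- Cmod2_conj, re_RtoC in E.
    specialize (HL c hc).
    assert (Re (u * f (a + RtoC c * (b - a)) * (b - a))%C <= Cmod m * L * Cmod (b - a)).
    { via Rle_abs. via re_le.
      rewrite !Cmod_mult. unfold u. rewrite Cmod_conj.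
      mono. }
    apply Rmult_le_reg_l with (Cmod m); [auto|]. lra.
Qed.

Create HintDb hd.
#[global] Hint Resolve hol_const hol_id hol_plus hol_mult hol_opp hol_minus hol_pow hol_div ccont_const ccont_id ccont_plus ccont_mult ccont_opp ccont_minus ccont_div ccont_pow Cmod_neq0 Cmod_pos : hd.
#[global] Hint Extern 3 (_ < _)%R => lra : hd.
#[global] Hint Extern 3 (_ <= _)%R => solve [lra | mono] : hd.
#[global] Hint Extern 3 (_ <= _)%nat => lia : hd.
#[global] Hint Extern 3 (_ < _)%nat => lia : hd.
Ltac au := solve [auto 7 with hd].

(** * Goursat's theorem *)
Lemma C_cauchy (u : nat -> C) :
  (forall e, 0 < e -> exists N, forall n m, (N <= n)%nat -> (N <= m)%nat -> Cmod (u n - u m) <= e) ->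
  exists l, forall e, 0 < e -> exists N, forall n, (N <= n)%nat -> Cmod (u n - l) <= e.
Proof.
  intros H.
  have X : forall p : C -> R, (forall a b, Rabs (p a - p b) <= Cmod (a - b)) ->
     exists l : R, Un_cv (fun n => p (u n)) l.
  { intros p hp. destruct (Rcomplete.R_complete (fun n => p (u n))) as [l hl]; [|exists l; auto].
    intros e he. destruct (H (e / 2)) as [N hN]; [lra|]. exists N. intros n m hn hm.
    unfold R_dist. eapply Rle_lt_trans; [mono|]. specialize (hN n m hn hm). lra. }
  destruct (X Re) as [x hx].
  { intros a b. replace (Re a - Re b) with (Re (a - b)); [apply re_le|].
    au. }
  destruct (X Im) as [y hy].
  { intros a b. replace (Im a - Im b) with (Im (a - b)); [apply im_le|].
    au. }
  exists (x, y). intros e he.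
  destruct (hx (e / 2)) as [N1 h1]; [lra|]. destruct (hy (e / 2)) as [N2 h2]; [lra|].
  exists (max N1 N2). intros n hn.
  specialize (h1 n ltac:(lia)). specialize (h2 n ltac:(lia)). unfold R_dist in *.
  via Cmod_2Rmax. simpl.
  have s2 : sqrt 2 <= 2.
  { rewrite <- (sqrt_Rsqr 2) at 2 by lra. apply sqrt_le_1; unfold Rsqr; lra. }
  have h : Rmax (Rabs (fst (u n) + - x)) (Rabs (snd (u n) + - y)) <= e / 2.
  { apply Rmax_lub; mono. }
  assert (0 <= Rmax (Rabs (fst (u n) + - x)) (Rabs (snd (u n) + - y))).
  { eapply Rle_trans; [apply Rabs_pos|apply Rmax_l]. }
  assert (0 <= sqrt 2) by apply sqrt_pos. nra.
Qed.

Lemma pow_small (q e : R) : 0 <= q < 1 -> 0 < e -> exists N, forall n, (N <= n)%nat -> q ^ n <= e.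
Proof.
  intros hq he. destruct (pow_lt_1_zero q) with (y := e) as [N hN]; [lra|lra|].
  exists N. intros n hn. specialize (hN n hn). rewrite Rabs_pos_eq in hN; [lra|]. au.
Qed.

Lemma geom_dist (u : nat -> C) A q : 0 <= q < 1 -> 0 <= A ->
  (forall n, Cmod (u (S n) - u n) <= A * q ^ n) ->
  forall n k, Cmod (u (n + k)%nat - u n) <= A * q ^ n / (1 - q) * (1 - q ^ k).
Proof.
  intros hq hA H n k. induction k.
  - replace (n + 0)%nat with n by lia. lra.
  - replace (n + S k)%nat with (S (n + k)) by lia.
    via (Cmod_tri _ (u (n + k)%nat)).
    eapply Rle_trans; [apply Rplus_le_compat; [au|exact IHk]|].
    rewrite pow_add. simpl. apply Req_le. field. lra.
Qed.

(** The rate is kept, because the iterations depending on parameters converge uniformly and this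
    makes their limits holomorphic. *)
Lemma geom_lim (u : nat -> C) A q : 0 <= q < 1 -> 0 <= A ->
  (forall n, Cmod (u (S n) - u n) <= A * q ^ n) ->
  exists l, forall n, Cmod (u n - l) <= A * q ^ n / (1 - q).
Proof.
  intros hq hA H.
  have G : forall n k, Cmod (u (n + k)%nat - u n) <= A * q ^ n / (1 - q).
  { intros n k. eapply Rle_trans; [apply (geom_dist u A q); auto|].
    assert (0 <= q ^ k) by mono. assert (0 <= q ^ n) by mono.
    assert (0 <= A * q ^ n / (1 - q)).
    { apply Rmult_le_pos; [nra|]. apply Rlt_le, Rinv_0_lt_compat; lra. }
    nra. }
  destruct (C_cauchy u) as [l hl].
  { intros e he.
    destruct (pow_small q (e * (1 - q) / (2 * (A + 1)))) as [N hN]; auto.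
    { mono. }
    exists N. intros n m hn hm.
    via (Cmod_tri _ (u N)). rewrite (Cmod_sym (u N)).
    have g1 := G N (n - N)%nat. replace (N + (n - N))%nat with n in g1 by lia.
    have g2 := G N (m - N)%nat. replace (N + (m - N))%nat with m in g2 by lia.
    specialize (hN N (le_n _)).
    assert (A * q ^ N / (1 - q) <= e / 2).
    { apply Rmult_le_reg_r with (1 - q); [lra|]. replace (A * q ^ N / (1 - q) * (1 - q)) with (A * q ^ N) by (field; lra).
      apply Rle_trans with ((A + 1) * (e * (1 - q) / (2 * (A + 1)))).
      - au.
      - apply Req_le. field. lra. }
    lra. }
  exists l. intros n. apply le_epsilon. intros e he.
  destruct (hl e he) as [N hN]. specialize (hN (n + N)%nat ltac:(lia)).
  via (Cmod_tri _ (u (n + N)%nat)).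
  rewrite Cmod_sym. au.
Qed.

Definition seg (f : C -> C) (a b : C) : C := ((b - a) * mean (fun t => f (a + RtoC t * (b - a))))%C.

Lemma seg_in (a b : C) r t : 0 <= t <= 1 -> Cmod a <= r -> Cmod b <= r -> Cmod (a + RtoC t * (b - a)) <= r.
Proof.
  intros ht ha hb. replace (a + t * (b - a))%C with ((1 - t)%R * a + t * b)%C by (rewrite RtoC_minus; ring).
  via Cmod_triangle. rewrite !Cmod_mult, !Cmod_R, !Rabs_pos_eq by lra. nra.
Qed.

Lemma seg_conth f a b r R0 : r < R0 -> (forall z, Cmod z < R0 -> Ccont f z) -> Cmod a <= r -> Cmod b <= r ->
  conth (fun t => f (a + RtoC t * (b - a))%C).
Proof.
  intros hr H ha hb t ht. apply (ccont_Ccont f (fun u => a + RtoC u * (b - a))%C); [au|].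
  apply H. have h := seg_in a b r t ht ha hb. lra.
Qed.

Lemma seg_FTC F f a b r R0 : r < R0 -> (forall z, Cmod z < R0 -> Cd F z (f z)) ->
  (forall z, Cmod z < R0 -> Ccont f z) -> Cmod a <= r -> Cmod b <= r -> seg f a b = (F b - F a)%C.
Proof.
  intros hr HF Hf ha hb. unfold seg. rewrite <- mean_scal by (eapply seg_conth; eauto).
  rewrite (mean_FTC (fun t => F (a + RtoC t * (b - a))%C)).
  - f_equal; [|f_equal]; f_equal; ring.
  - intros t ht. replace ((b - a) * f (a + t * (b - a)))%C with (f (a + t * (b - a)) * (b - a))%C by ring.
    apply (rd_Cd F (fun u => a + RtoC u * (b - a))%C).
    + apply rd_line.
    + apply HF. have h := seg_in a b r t ht ha hb. lra.
  - intros t ht. apply ccont_scal. eapply seg_conth; eauto.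
Qed.

Lemma seg_rev f a b r R0 : r < R0 -> (forall z, Cmod z < R0 -> Ccont f z) -> Cmod a <= r -> Cmod b <= r ->
  seg f b a = (- seg f a b)%C.
Proof.
  intros hr H ha hb. unfold seg.
  have E : mean (fun t => f (b + RtoC t * (a - b))%C) = mean (fun t => f (a + RtoC t * (b - a))%C).
  { have K := seg_conth f a b r R0 hr H ha hb.
    have aux : forall k : R -> R, (forall t, 0 <= t <= 1 -> continuous k t) ->
       RInt (fun t => k (1 - t)) 0 1 = RInt k 0 1.
    { intros k hk. have e1 := RInt_comp_lin (V := R_CompleteNormedModule) k (-1) 1 0 1.
      replace (-1 * 0 + 1) with 1 in e1 by ring. replace (-1 * 1 + 1) with 0 in e1 by ring.
      have ex : ex_RInt k 0 1.
      { apply (ex_RInt_continuous (V := R_CompleteNormedModule)). rewrite Rmin_left, Rmax_right by lra. au. }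
      specialize (e1 (ex_RInt_swap _ _ _ ex)). have e2 := opp_RInt_swap (V := R_CompleteNormedModule) k 0 1 ex. rewrite <- e2 in e1.
      rewrite <- (opp_opp (RInt k 0 1)). rewrite <- e1.
      rewrite <- (RInt_opp (V := R_CompleteNormedModule)).
      - apply RInt_ext. intros x _. unfold opp, scal; simpl; unfold mult; simpl.
        replace (-1 * x + 1) with (1 - x) by ring. ring.
      - apply (ex_RInt_continuous (V := R_CompleteNormedModule)). rewrite Rmin_left, Rmax_right by lra.
        intros z hz. apply (continuous_scal_r (V := R_NormedModule)). apply (continuous_comp (fun y => -1 * y + 1) k).
        + apply (continuous_plus (V := R_NormedModule)); [|apply continuous_const].
          apply (continuous_scal_r (V := R_NormedModule) (-1) (fun y => y)). apply continuous_id.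
        + au. }
    unfold mean. f_equal.
    - rewrite <- (aux (fun t => Re (f (a + RtoC t * (b - a))%C))).
      + apply RInt_ext. intros t _. do 2 f_equal. rewrite RtoC_minus. ring.
      + intros; apply ccont_re; apply K; auto.
    - rewrite <- (aux (fun t => Im (f (a + RtoC t * (b - a))%C))).
      + apply RInt_ext. intros t _. do 2 f_equal. rewrite RtoC_minus. ring.
      + intros; apply ccont_im; apply K; auto. }
  rewrite E. ring.
Qed.

Lemma two_nz : RtoC 2 <> 0.
Proof. au. Qed.

Lemma seg_mid f a b r R0 : r < R0 -> (forall z, Cmod z < R0 -> Ccont f z) -> Cmod a <= r -> Cmod b <= r ->
  seg f a b = (seg f a ((a + b) / 2) + seg f ((a + b) / 2) b)%C.
Proof.
  intros hr H ha hb. unfold seg. have h2 := two_nz.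
  rewrite mean_split by (eapply seg_conth; eauto).
  replace (mean (fun t => f (a + RtoC t * ((a + b) / 2 - a))%C)) with (mean (fun t => f (a + RtoC (t / 2) * (b - a))%C)).
  replace (mean (fun t => f ((a + b) / 2 + RtoC t * (b - (a + b) / 2))%C)) with (mean (fun t => f (a + RtoC ((1 + t) / 2) * (b - a))%C)).
  - field; auto.
  - apply mean_ext. intros t _. f_equal. rewrite RtoC_div, RtoC_plus by lra. field; auto.
  - apply mean_ext. intros t _. f_equal. rewrite RtoC_div by lra. field; auto.
Qed.

Lemma seg_minus f g a b r R0 : r < R0 -> (forall z, Cmod z < R0 -> Ccont f z) ->
  (forall z, Cmod z < R0 -> Ccont g z) -> Cmod a <= r -> Cmod b <= r ->
  seg (fun z => f z - g z)%C a b = (seg f a b - seg g a b)%C.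
Proof.
  intros hr Hf Hg ha hb. unfold seg.
  rewrite (mean_minus (fun t => f (a + RtoC t * (b - a))%C) (fun t => g (a + RtoC t * (b - a))%C)) by (eapply seg_conth; eauto).
  ring.
Qed.

Lemma seg_bound f a b M : conth (fun t => f (a + RtoC t * (b - a))%C) ->
  (forall t, 0 <= t <= 1 -> Cmod (f (a + RtoC t * (b - a))%C) <= M) -> Cmod (seg f a b) <= M * Cmod (b - a).
Proof.
  intros H HM. unfold seg. rewrite Cmod_mult, Rmult_comm. apply Rmult_le_compat_r; [mono|].
  apply mean_bound; auto. au.
Qed.

Definition tri f a b c := (seg f a b + seg f b c + seg f c a)%C.

Definition mid (a b : C) : C := ((a + b) / 2)%C.

Lemma mid_in (a b : C) r : Cmod a <= r -> Cmod b <= r -> Cmod (mid a b) <= r.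
Proof.
  intros ha hb. replace (mid a b) with (a + RtoC (/ 2) * (b - a))%C.
  - apply seg_in; auto; lra.
  - unfold mid. rewrite RtoC_inv by lra. field.
Qed.

Lemma tri_split f a b c r R0 : r < R0 -> (forall z, Cmod z < R0 -> Ccont f z) ->
  Cmod a <= r -> Cmod b <= r -> Cmod c <= r ->
  tri f a b c = (tri f a (mid a b) (mid c a) + tri f (mid a b) b (mid b c)
     + tri f (mid c a) (mid b c) c + tri f (mid a b) (mid b c) (mid c a))%C.
Proof.
  intros hr H ha hb hc. unfold tri.
  have m1 := mid_in a b r ha hb. have m2 := mid_in b c r hb hc. have m3 := mid_in c a r hc ha.
  rewrite (seg_mid f a b r R0), (seg_mid f b c r R0), (seg_mid f c a r R0) by auto. fold (mid a b) (mid b c) (mid c a).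
  rewrite (seg_rev f (mid a b) (mid b c) r R0 hr H m1 m2), (seg_rev f (mid b c) (mid c a) r R0 hr H m2 m3),
    (seg_rev f (mid c a) (mid a b) r R0 hr H m3 m1). ring.
Qed.

Section Goursat.
Variable f : C -> C.

(** One bisection: the first of the three corner triangles whose integral is at least a quarter of
    the total, and otherwise the middle one, which then qualifies by the triangle inequality. *)
Definition gstep (T : C * C * C) : C * C * C :=
  let '(a, b, c) := T in
  let I := Cmod (tri f a b c) in
  if Rle_dec (I / 4) (Cmod (tri f a (mid a b) (mid c a))) then (a, mid a b, mid c a) else
  if Rle_dec (I / 4) (Cmod (tri f (mid a b) b (mid b c))) then (mid a b, b, mid b c) else
  if Rle_dec (I / 4) (Cmod (tri f (mid c a) (mid b c) c)) then (mid c a, mid b c, c) else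
  (mid a b, mid b c, mid c a).

Definition per (T : C * C * C) := let '(a, b, c) := T in Cmod (b - a) + Cmod (c - b) + Cmod (a - c).
Definition tin r (T : C * C * C) := let '(a, b, c) := T in Cmod a <= r /\ Cmod b <= r /\ Cmod c <= r.
Definition trT (T : C * C * C) := let '(a, b, c) := T in tri f a b c.
(** A step moves the first vertex by at most the perimeter, which is halved each time; the first
    vertices therefore converge, and this replaces a compactness argument for nested triangles. *)
Definition v1 (T : C * C * C) := fst (fst T).

Lemma half_mod (a b : C) : Cmod ((a - b) / 2) = Cmod (a - b) / 2.
Proof. rewrite Cmod_div by apply two_nz. lra. Qed.

Lemma gstep_spec T r R0 : r < R0 -> (forall z, Cmod z < R0 -> Ccont f z) -> tin r T ->
  tin r (gstep T) /\ per (gstep T) = per T / 2 /\ Cmod (trT T) / 4 <= Cmod (trT (gstep T)) /\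
  Cmod (v1 (gstep T) - v1 T) <= per T.
Proof.
  intros hr H. destruct T as [[a b] c]. intros [ha [hb hc]].
  have m1 := mid_in a b r ha hb. have m2 := mid_in b c r hb hc. have m3 := mid_in c a r hc ha.
  have S := tri_split f a b c r R0 hr H ha hb hc.
  have h2 := two_nz.
  have p1 := Cmod_ge_0 (b - a). have p2 := Cmod_ge_0 (c - b). have p3 := Cmod_ge_0 (a - c).
  unfold gstep.
  have P : forall x y z, x = ((b - a) / 2)%C -> y = ((c - b) / 2)%C -> z = ((a - c) / 2)%C ->
     Cmod x + Cmod y + Cmod z = (Cmod (b - a) + Cmod (c - b) + Cmod (a - c)) / 2.
  { intros x y z -> -> ->. rewrite !half_mod. lra. }
  have Q : Cmod (mid a b - a) = Cmod (b - a) / 2.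
  { rewrite <- half_mod. f_equal. unfold mid. field; auto. }
  have Q' : Cmod (mid c a - a) = Cmod (a - c) / 2.
  { rewrite (Cmod_sym a c). rewrite <- half_mod. f_equal. unfold mid. field; auto. }
  have Q0 : Cmod (a - a) = 0 by lra.
  repeat destruct Rle_dec; simpl; unfold v1; simpl; (split; [repeat split; auto|split; [|split]]);
   try (apply P; unfold mid; field; auto); try lra.
  - assert (Cmod (mid a b - mid b c) = Cmod (a - c) / 2).
    { rewrite <- half_mod. f_equal. unfold mid. field; auto. }
    rewrite (Cmod_sym (mid b c)), H0, (Cmod_sym (mid a b) (mid c a)).
    assert (Cmod (mid c a - mid a b) = Cmod (c - b) / 2).
    { rewrite <- half_mod. f_equal. unfold mid. field; auto. }
    assert (Cmod (mid c a - mid b c) = Cmod (b - a) / 2).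
    { rewrite Cmod_sym. rewrite <- (half_mod b a). f_equal. unfold mid. field; auto. }
    lra.
  - rewrite S.
    have t1 := Cmod_triangle (tri f a (mid a b) (mid c a) + tri f (mid a b) b (mid b c)
     + tri f (mid c a) (mid b c) c) (tri f (mid a b) (mid b c) (mid c a)).
    have t2 := Cmod_triangle (tri f a (mid a b) (mid c a) + tri f (mid a b) b (mid b c)) (tri f (mid c a) (mid b c) c).
    have t3 := Cmod_triangle (tri f a (mid a b) (mid c a)) (tri f (mid a b) b (mid b c)).
    rewrite <- S in *. lra.
Qed.

(** At the limit point [zs] of the triangles, [f] differs from its affine part [A] by at most [ee]
    times the distance. [A] has the primitive [PA] and contributes nothing, so the integral over the
    [N]-th triangle is at most a multiple of [ee * 4^(-N)], whereas the choice of the triangles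
    keeps at least the fraction [4^(-N)] of the original integral. *)
Lemma goursat R0 a b c : (forall z, Cmod z < R0 -> hol f z) -> Cmod a < R0 -> Cmod b < R0 -> Cmod c < R0 ->
  tri f a b c = 0.
Proof.
  intros Hf ha hb hc. set (r := Rmax (Cmod a) (Rmax (Cmod b) (Cmod c))).
  have hr : r < R0 by (unfold r; repeat apply Rmax_lub_lt; auto).
  have hr1 := Rmax_l (Cmod a) (Rmax (Cmod b) (Cmod c)).
  have hr2 := Rmax_r (Cmod a) (Rmax (Cmod b) (Cmod c)).
  have hr3 := Rmax_l (Cmod b) (Cmod c). have hr4 := Rmax_r (Cmod b) (Cmod c).
  fold r in hr1, hr2.
  have Hc : forall z, Cmod z < R0 -> Ccont f z by (intros; apply hol_cont; auto).
  set (T0 := (a, b, c)). set (T := fun n => Nat.iter n gstep T0). set (L := per T0).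
  have hL : 0 <= L.
  { unfold L, T0; simpl. au. }
  have I : forall n, tin r (T n) /\ per (T n) = L * (/2) ^ n /\ Cmod (trT T0) * (/4) ^ n <= Cmod (trT (T n)).
  { induction n.
    - simpl. repeat split; try lra. unfold L. simpl. lra.
    - destruct IHn as [i1 [i2 i3]]. destruct (gstep_spec (T n) r R0 hr Hc i1) as [j1 [j2 [j3 _]]].
      change (T (S n)) with (gstep (T n)). split; [auto|split].
      + rewrite j2, i2. simpl. lra.
      + change ((/4) ^ S n) with (/4 * (/4) ^ n). lra. }
  destruct (geom_lim (fun n => v1 (T n)) L (/2)) as [zs hz]; [lra|auto| |].
  { intros n. destruct (I n) as [i1 [i2 _]]. destruct (gstep_spec (T n) r R0 hr Hc i1) as [_ [_ [_ j]]].
    rewrite i2 in j. au. }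
  have hzs : Cmod zs <= r.
  { apply le_epsilon. intros e he.
    destruct (pow_small (/2) (e / (2 * (L + 1)))) as [N hN]; [lra|pos|].
    specialize (hN N (le_n _)). specialize (hz N).
    assert (L * (/ 2) ^ N / (1 - / 2) <= e).
    { assert (0 < (/2)^N) by pos.
      apply Rle_trans with (2 * (L + 1) * (/2)^N). { lra. }
      apply Rle_trans with (2 * (L + 1) * (e / (2 * (L + 1)))); [mono|]. apply Req_le; field; lra. }
    destruct (I N) as [i1 _]. destruct (T N) as [[x y] w]. destruct i1 as [i1 _]. unfold v1 in hz; simpl in hz.
    have t := Cmod_rev zs x. rewrite Cmod_sym in t. lra. }
  destruct (Hf zs _lra) as [l hl].
  apply Cmod_small_eq. intros e he. replace (tri f a b c - 0)%C with (tri f a b c) by ring.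
  destruct (hl (e / (3 * (L + 1) ^ 2))) as [d [hd hd']]; [mono|].
  destruct (pow_small (/2) (d / (4 * (L + 1)))) as [N hN]; [lra|pos|].
  specialize (hN N (le_n _)). specialize (hz N). destruct (I N) as [i1 [i2 i3]].
  have q0 : 0 < (/2)^N by pos.
  have hd3 : 3 * L * (/2) ^ N < d.
  { apply Rle_lt_trans with (3 * L * (d / (4 * (L + 1)))); [mono|].
    apply Rmult_lt_reg_r with (4 * (L + 1)); [lra|].
    replace (3 * L * (d / (4 * (L + 1))) * (4 * (L + 1))) with (3 * L * d) by (field; lra). nra. }
  destruct (T N) as [[x y] w]. destruct i1 as [k1 [k2 k3]]. unfold v1 in hz; simpl in *.
  set (ee := e / (3 * ((L + 1) * ((L + 1) * 1)))) in *.
  have hee : 0 < ee by mono.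
  set (A := fun z => (f zs + l * (z - zs))%C).
  set (g := fun z => (f z - A z)%C).
  have HA : forall z, Cmod z < R0 -> Ccont A z.
  { intros z _. apply hol_cont. unfold A. au. }
  set (PA := fun z => (f zs * z + l / 2 * ((z - zs) * (z - zs)))%C).
  have HPA : forall z, Cmod z < R0 -> Cd PA z (A z).
  { intros z _. unfold PA, A.
    have h2 := two_nz.
    refine (Cd_eq _ _ _ _ _ (Cd_plus _ _ _ _ _ (Cd_scal (f zs) _ _ _ (Cd_id z)) (Cd_scal (l/2) _ _ _ (Cd_comp (fun z => z - zs)%C _ z _ _ (Cd_plus _ _ _ _ _ (Cd_id z) (Cd_const (- zs) z)) (Cd_sq _))))).
    field; auto. }
  have EA : forall u v, Cmod u <= r -> Cmod v <= r -> seg g u v = (seg f u v - (PA v - PA u))%C.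
  { intros u v hu hv. unfold g. rewrite (seg_minus f A u v r R0); auto. rewrite (seg_FTC PA A u v r R0); auto. }
  have Et : tri f x y w = (seg g x y + seg g y w + seg g w x)%C.
  { unfold tri. rewrite !EA by auto. ring. }
  have px := Cmod_ge_0 (y - x). have py := Cmod_ge_0 (w - y). have pw := Cmod_ge_0 (x - w).
  have hz2 : Cmod (x - zs) <= 2 * L * (/2) ^ N.
  { lra. }
  have B : forall u v, Cmod u <= r -> Cmod v <= r -> Cmod (u - x) <= L * (/2) ^ N -> Cmod (v - x) <= L * (/2) ^ N ->
     Cmod (seg g u v) <= ee * (3 * L * (/2) ^ N) * Cmod (v - u).
  { intros u v hu hv du dv. apply seg_bound.
    - apply (seg_conth g u v r R0); auto. intros z hz'. unfold g.
      intros e' he'. destruct (Hc z hz' (e'/2)) as [d1 [hd1 h1]]; [lra|]. destruct (HA z hz' (e'/2)) as [d2 [hd2 h2]]; [lra|].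
      exists (Rmin d1 d2); split; [apply Rmin_pos; auto|]. intros z' hz''.
      specialize (h1 z' (Rlt_le_trans _ _ _ hz'' (Rmin_l _ _))). specialize (h2 z' (Rlt_le_trans _ _ _ hz'' (Rmin_r _ _))).
      replace (f z' - A z' - (f z - A z))%C with ((f z' - f z) - (A z' - A z))%C by ring.
      eapply Rle_lt_trans; [apply Cmod_minus_le|]. lra.
    - intros t ht. set (p := (u + t * (v - u))%C).
      have hp : Cmod (p - zs) <= 3 * L * (/2) ^ N.
      { via (Cmod_tri _ x).
        assert (Cmod (p - x) <= L * (/2) ^ N).
        { unfold p. replace (u + t * (v - u) - x)%C with ((u - x) + t * ((v - x) - (u - x)))%C by ring. apply seg_in; auto. }
        lra. }
      unfold g, A. replace (f p - (f zs + l * (p - zs)))%C with (f p - f zs - l * (p - zs))%C by ring.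
      eapply Rle_trans; [au|]. au. }
  have Bt : Cmod (tri f x y w) <= ee * (3 * L * (/2) ^ N) * (L * (/2) ^ N).
  { rewrite Et. rewrite <- i2.
    via Cmod_triangle.
    assert (Cmod (x - x) <= L * (/2) ^ N) by lra.
    assert (Cmod (y - x) <= L * (/2) ^ N) by lra.
    assert (Cmod (w - x) <= L * (/2) ^ N) by (rewrite Cmod_sym; lra).
    have b1 := B x y k1 k2 H H0. have b2 := B y w k2 k3 H0 H1. have b3 := B w x k3 k1 H1 H.
    assert (Cmod (seg g x y + seg g y w) <= ee * (3 * L * (/ 2) ^ N) * Cmod (y - x) + ee * (3 * L * (/ 2) ^ N) * Cmod (w - y)).
    { via Cmod_triangle. lra. }
    lra. }
  have Q : (/4)^N = (/2)^N * (/2)^N.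
  { rewrite <- Rpow_mult_distr. f_equal. lra. }
  have F : Cmod (tri f a b c) * ((/2)^N * (/2)^N) <= 3 * ee * L * L * ((/2)^N * (/2)^N).
  { rewrite <- Q at 1. lra. }
  apply Rmult_le_reg_r in F; [|nra].
  eapply Rle_trans; [exact F|].
  apply Rle_trans with (3 * ee * (L + 1) * (L + 1)); [nra|]. unfold ee. apply Req_le. field. lra.
Qed.
End Goursat.

(** The integral from [0] is a primitive: the vanishing integral over the triangle [0, z, w] turns
    its increment into the integral over the segment from [z] to [w]. *)
Lemma hol_primitive f R0 : (forall z, Cmod z < R0 -> hol f z) -> exists F, forall z, Cmod z < R0 -> Cd F z (f z).
Proof.
  intros Hf. exists (fun z => seg f 0 z). intros z hz e he.
  have Hc : forall z, Cmod z < R0 -> Ccont f z by (intros; apply hol_cont; auto).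
  destruct (Hc z hz e he) as [d [hd h]].
  have h0 : 0 <= Cmod z by apply Cmod_ge_0.
  exists (Rmin d ((R0 - Cmod z) / 2)). split; [apply Rmin_pos; lra|]. intros w hw.
  have hw1 := Rlt_le_trans _ _ _ hw (Rmin_l _ _). have hw2 := Rlt_le_trans _ _ _ hw (Rmin_r _ _).
  set (r := (R0 + Cmod z) / 2).
  have hwr : Cmod w <= r. { have t := Cmod_rev w z. unfold r. lra. }
  have hzr : Cmod z <= r by (unfold r; lra). have hr : r < R0 by (unfold r; lra).
  have h0r : Cmod 0 <= r by lra.
  have G := goursat f R0 0 z w Hf _lra _lra _lra. unfold tri in G.
  rewrite (seg_rev f 0 w r R0) in G by auto.
  have E : (seg f 0 w - seg f 0 z)%C = seg f z w.
  { replace (seg f z w) with ((seg f 0 z + seg f z w + - seg f 0 w) + seg f 0 w - seg f 0 z)%C by ring. rewrite G. ring. }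
  rewrite E.
  have E2 : seg (fun _ => f z) z w = (f z * (w - z))%C.
  { unfold seg. rewrite mean_const. ring. }
  rewrite <- E2. rewrite <- (seg_minus f (fun _ => f z) z w r R0); auto.
  2:{ intros; apply hol_cont; apply hol_const. }
  apply seg_bound.
  - intros t ht. apply (ccont_minus (fun t => f (z + t * (w - z))%C)); [|au].
    eapply seg_conth; eauto.
  - intros t ht. apply Rlt_le, h. replace (z + t * (w - z) - z)%C with (t * (w - z))%C by ring.
    rewrite Cmod_mult, Cmod_R, Rabs_pos_eq by lra. have p := Cmod_ge_0 (w - z). nra.
Qed.

(** * The complex exponential and circles *)
Definition cexp (z : C) : C := (exp (Re z) * cos (Im z), exp (Re z) * sin (Im z)).

Lemma cexp_plus a b : cexp (a + b) = (cexp a * cexp b)%C.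
Proof.
  unfold cexp. rewrite re_plus, im_plus, exp_plus, cos_plus, sin_plus.
  unfold Cmult; simpl. f_equal; ring.
Qed.
Lemma cexp_0 : cexp 0 = 1.
Proof. unfold cexp. rewrite re_RtoC, im_RtoC, exp_0, cos_0, sin_0. unfold RtoC. f_equal; ring. Qed.
Lemma Cmod_cexp z : Cmod (cexp z) = exp (Re z).
Proof.
  unfold Cmod, cexp; simpl.
  replace (exp (Re z) * cos (Im z) * (exp (Re z) * cos (Im z) * 1) +
   exp (Re z) * sin (Im z) * (exp (Re z) * sin (Im z) * 1)) with (Rsqr (exp (Re z))).
  - apply sqrt_Rsqr. apply Rlt_le, exp_pos.
  - have h := sin2_cos2 (Im z). unfold Rsqr in *. nra.
Qed.

Lemma sin_le_abs u : Rabs (sin u) <= Rabs u.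
Proof.
  destruct (MVT_gen sin 0 u cos) as [c [_ E]].
  - intros; apply is_derive_Reals, derivable_pt_lim_sin.
  - intros; apply continuity_sin.
  - rewrite sin_0, !Rminus_0_r in E. rewrite E, Rabs_mult.
    have h : Rabs (cos c) <= 1 by (apply Rabs_le; destruct (COS_bound c); lra).
    have h2 := Rabs_pos u. nra.
Qed.

Lemma cos_quad u : Rabs (cos u - 1) <= u ^ 2 / 2.
Proof.
  replace u with (2 * (u / 2)) at 1 by field. rewrite cos_2a_sin.
  replace (1 - 2 * sin (u / 2) * sin (u / 2) - 1) with (- (2 * (sin (u/2) * sin (u/2)))) by ring.
  rewrite Rabs_Ropp, Rabs_pos_eq by nra.
  have h := sin_le_abs (u / 2).
  have h2 : Rabs (sin (u/2)) * Rabs (sin (u/2)) <= Rabs (u/2) * Rabs (u/2) by (apply Rmult_le_compat; auto; apply Rabs_pos).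
  rewrite <- !Rabs_mult in h2. rewrite !Rabs_pos_eq in h2 by nra. nra.
Qed.

Lemma sin_quad u : Rabs u <= 1 -> Rabs (sin u - u) <= u ^ 2.
Proof.
  intros hu.
  destruct (MVT_gen (fun x => sin x - x) 0 u (fun x => cos x - 1)) as [c [hc E]].
  - intros; auto_derive; auto; ring.
  - intros; apply continuity_minus; [apply continuity_sin|apply derivable_continuous, derivable_id].
  - rewrite sin_0, !Rminus_0_r in E. rewrite E, Rabs_mult.
    have h := cos_quad c.
    have hc2 : Rabs c <= Rabs u.
    { unfold Rmin, Rmax in hc. unfold Rabs in *. destruct Rle_dec; repeat destruct Rcase_abs; lra. }
    assert (c ^ 2 <= Rabs u * Rabs u).
    { rewrite <- (Rabs_pos_eq (c ^ 2)) by nra. simpl. rewrite Rmult_1_r, Rabs_mult. apply Rmult_le_compat; auto; apply Rabs_pos. }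
    assert (u ^ 2 = Rabs u * Rabs u) by (rewrite <- Rabs_mult, Rabs_pos_eq; nra).
    have p := Rabs_pos u. have p' := Rabs_pos (cos c - 1). nra.
Qed.

Lemma exp_quad x : Rabs x <= 1 / 2 -> Rabs (exp x - 1 - x) <= 2 * x ^ 2 /\ exp x <= 2.
Proof.
  intros hx. have h1 := exp_ineq1_le x. have h2 := exp_ineq1_le (- x).
  rewrite exp_Ropp in h2. apply Rabs_le_between in hx.
  have hp := exp_pos x.
  have h3 : exp x * (1 - x) <= 1.
  { apply Rle_trans with (exp x * / exp x); [mono|]. rewrite Rinv_r; lra. }
  split; [|nra]. rewrite Rabs_pos_eq; [|lra].
  assert (exp x <= 2) by nra. nra.
Qed.

(** With the addition formula, this bound at [0] gives the derivative everywhere. *)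
Lemma cexp_quad w : Cmod w <= 1 / 2 -> Cmod (cexp w - 1 - w) <= 10 * Cmod w ^ 2.
Proof.
  intros hw. have hr := re_le w. have hi := im_le w.
  set (x := Re w) in *. set (y := Im w) in *. set (m := Cmod w) in *.
  have hx := exp_quad x _lra. destruct hx as [e1 e2].
  have c1 := cos_quad y. have s1 := sin_quad y _lra.
  have s0 := sin_le_abs y. have hp := exp_pos x.
  have q1 : x ^ 2 <= m ^ 2 by (rewrite <- (pow2_abs x); apply pow_incr; split; auto; apply Rabs_pos).
  have q2 : y ^ 2 <= m ^ 2 by (rewrite <- (pow2_abs y); apply pow_incr; split; auto; apply Rabs_pos).
  have q3 : 0 <= x^2 by nra. have q4 : 0 <= y^2 by nra.
  via Cmod_2Rmax.
  have s2 : sqrt 2 <= 2.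
  { rewrite <- (sqrt_Rsqr 2) at 2 by lra. apply sqrt_le_1; unfold Rsqr; lra. }
  have s3 := sqrt_pos 2.
  have hM : Rmax (Rabs (fst (cexp w - 1 - w)%C)) (Rabs (snd (cexp w - 1 - w)%C)) <= 5 * m ^ 2.
  { apply Rmax_lub.
    - change (Rabs (exp x * cos y + - (1) + - x) <= 5 * m ^ 2).
      replace (exp x * cos y + - (1) + - x) with ((exp x - 1 - x) + exp x * (cos y - 1)) by ring.
      via Rabs_triang. rewrite Rabs_mult, (Rabs_pos_eq (exp x)) by lra.
      have p := Rabs_pos (cos y - 1). nra.
    - change (Rabs (exp x * sin y + - 0 + - y) <= 5 * m ^ 2).
      replace (exp x * sin y + - 0 + - y) with ((sin y - y) + (exp x - 1) * sin y) by ring.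
      via Rabs_triang. rewrite Rabs_mult.
      assert (Rabs (exp x - 1) <= 2 * Rabs x).
      { replace (exp x - 1) with ((exp x - 1 - x) + x) by ring. via Rabs_triang.
        assert (x ^ 2 = Rabs x * Rabs x) by (rewrite <- Rabs_mult, Rabs_pos_eq; nra).
        have p := Rabs_pos x. nra. }
      have p := Rabs_pos x. have p' := Rabs_pos (sin y). have p'' := Rabs_pos y.
      assert (Rabs (exp x - 1) * Rabs (sin y) <= 2 * m * m).
      { apply Rmult_le_compat; try lra. apply Rabs_pos. }
      nra. }
  assert (0 <= Rmax (Rabs (fst (cexp w - 1 - w)%C)) (Rabs (snd (cexp w - 1 - w)%C))).
  { eapply Rle_trans; [apply Rabs_pos|apply Rmax_l]. }
  nra.
Qed.

Lemma Cd_cexp z : Cd cexp z (cexp z).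
Proof.
  apply Cd_quad with (K := 10 * Cmod (cexp z)) (r := 1 / 2); [lra|]. intros w hw.
  replace (cexp w - cexp z - cexp z * (w - z))%C with (cexp z * (cexp (w - z) - 1 - (w - z)))%C.
  - rewrite Cmod_mult. have h := cexp_quad (w - z) _lra. have p := Cmod_ge_0 (cexp z). nra.
  - have E : cexp w = (cexp z * cexp (w - z))%C by (rewrite <- cexp_plus; f_equal; ring).
    rewrite E. ring.
Qed.

Definition tpi : C := (0, 2 * PI).
Lemma tpi_nz : tpi <> 0.
Proof. intro h. injection h. have p := PI_RGT_0. lra. Qed.

Definition cir (r : R) (t : R) : C := (RtoC r * cexp (RtoC t * tpi))%C.

Lemma re_tpi t : Re (RtoC t * tpi) = 0.
Proof. rewrite re_scal_l. simpl. ring. Qed.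

Lemma Cmod_cir r t : 0 <= r -> Cmod (cir r t) = r.
Proof. intros. unfold cir. rewrite Cmod_mult, Cmod_cexp, re_tpi, exp_0, Cmod_R, Rabs_pos_eq; lra. Qed.

Lemma in0 r t : 0 <= r -> Cmod (0 + cir r t) = r.
Proof. intros h. replace (0 + cir r t)%C with (cir r t) by ring. apply Cmod_cir; auto. Qed.
Ltac norm ::= rewrite ?C0r, ?Cmod_0, ?Cmod_self in *; rewrite ?Cmod_cir, ?in0 by Lra.lra.

Lemma cir_nz r t : 0 < r -> cir r t <> 0.
Proof. au. Qed.

Lemma cexp_tpi : cexp tpi = 1.
Proof. unfold cexp, tpi, Re, Im; simpl. rewrite exp_0, cos_2PI, sin_2PI. unfold RtoC. f_equal; ring. Qed.

Lemma cir_1 r : cir r 1 = cir r 0.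
Proof.
  unfold cir. replace (1 * tpi)%C with tpi by ring. replace (0 * tpi)%C with (RtoC 0) by ring.
  rewrite cexp_tpi, cexp_0. au.
Qed.

Lemma rd_cir r t : rd (cir r) t (tpi * cir r t).
Proof.
  unfold cir. replace (tpi * (r * cexp (t * tpi)))%C with (r * cexp (t * tpi) * tpi)%C by ring.
  have H := rd_Cd (fun w => r * cexp w)%C (fun u : R => 0 + u * tpi)%C t tpi (r * cexp (0 + t * tpi))%C.
  replace (0 + t * tpi)%C with (t * tpi)%C in H by ring.
  have K : rd (fun u : R => (r * cexp (0 + u * tpi))%C) t (r * cexp (t * tpi) * tpi)%C.
  { apply H; [apply rd_line|]. apply Cd_scal. replace (0 + t * tpi)%C with (t * tpi)%C by ring. apply Cd_cexp. }
  intros e he. destruct (K e he) as [d [hd k]]. exists d; split; auto. intros u hu. specialize (k u hu).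
  replace (0 + u * tpi)%C with (u * tpi)%C in k by ring. replace (0 + t * tpi)%C with (t * tpi)%C in k by ring. lra.
Qed.

Lemma rd_cont h t l : rd h t l -> ccont h t.
Proof.
  intros H e he. destruct (H 1 Rlt_0_1) as [d [hd h1]].
  have hl := Cmod_ge_0 l.
  assert (0 < e / (Cmod l + 2)) by pos.
  exists (Rmin d (e / (Cmod l + 2))). split; [apply Rmin_pos; lra|]. intros u hu.
  have hu1 := Rlt_le_trans _ _ _ hu (Rmin_l _ _). have hu2 := Rlt_le_trans _ _ _ hu (Rmin_r _ _).
  specialize (h1 u hu1). 
  replace (h u - h t)%C with ((h u - h t - l * (u - t)%R) + l * (u - t)%R)%C by ring.
  eapply Rle_lt_trans; [mono|]. rewrite Cmod_mult, Cmod_R.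
  assert ((Cmod l + 2) * Rabs (u - t) < e).
  { apply Rmult_lt_reg_r with (/ (Cmod l + 2)); [pos|].
    replace ((Cmod l + 2) * Rabs (u - t) * / (Cmod l + 2)) with (Rabs (u - t)) by (field; lra). lra. }
  have p := Rabs_pos (u - t). nra.
Qed.

Lemma ccont_cir r t : ccont (cir r) t.
Proof. eapply rd_cont, rd_cir. Qed.
#[global] Hint Resolve ccont_cir cir_nz : hd.

Lemma mean_cir_FTC F f r : 0 <= r -> (forall t, 0 <= t <= 1 -> Cd F (cir r t) (f (cir r t))) ->
  conth (fun t => f (cir r t)) -> mean (fun t => f (cir r t) * cir r t)%C = 0.
Proof.
  intros hr HF Hf.
  have E : mean (fun t => f (cir r t) * (tpi * cir r t))%C = 0.
  { rewrite (mean_FTC (fun t => F (cir r t))).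
    - rewrite cir_1. ring.
    - intros t ht. apply rd_Cd; [apply rd_cir|auto].
    - intros t ht. au. }
  rewrite (mean_ext _ (fun t => tpi * (f (cir r t) * cir r t))%C) in E by (intros; ring).
  rewrite mean_scal in E by (intros t ht; apply ccont_mult; auto; apply ccont_cir).
  have h := tpi_nz.
  transitivity (/ tpi * (tpi * mean (fun t => f (cir r t) * cir r t)))%C; [field; auto|rewrite E; ring].
Qed.

(** Written as [z^(-k-1) * z], the integrand falls under [mean_cir_FTC], since [z^(-k-1)] with
    [k + 1 >= 2] has a primitive away from [0]. *)
Lemma mean_cir_pow_inv r k : 0 < r -> (1 <= k)%nat -> mean (fun t => / cir r t ^ k)%C = 0.
Proof.
  intros hr hk. destruct k as [|k]; [lia|]. clear hk.
  induction k as [|k _] using nat_ind.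
  - rewrite (mean_ext _ (fun t => (/ (cir r t * cir r t)) * cir r t)%C).
    2:{ intros t _. have h := cir_nz r t hr. simpl. field. au. }
    apply (mean_cir_FTC (fun w => - / w)%C (fun w => / (w * w))%C); [lra| |].
    + intros t _. have h := cir_nz r t hr.
      refine (Cd_eq _ _ _ _ _ (Cd_ext (fun w => (-1) * / w)%C _ _ _ 1 _ _ (Cd_scal (-1) _ _ _ (Cd_inv _ h)))); [|lra|intros; ring].
      field; auto.
    + intros t _. have h := cir_nz r t hr. apply ccont_inv; [au|]. apply Cmult_neq_0; auto.
  - have P : forall n, exists F : C -> C, forall z : C, z <> 0 -> Cd F z (/ z ^ (S (S n))).
    { induction n as [|n [F HF]].
      - exists (fun w => (-1) * / w)%C. intros z hz. refine (Cd_eq _ _ _ _ _ (Cd_scal (-1) _ _ _ (Cd_inv _ hz))). field; auto.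
      - exists (fun w => - / INR (S (S n)) * ((/ w) ^ (S (S n))))%C. intros z hz.
        have Q : forall m, Cd (fun w => (/ w) ^ m)%C z (- INR m * (/ z) ^ (S m)).
        { induction m.
          - refine (Cd_eq _ _ _ _ _ (Cd_const _ _)). simpl. ring.
          - refine (Cd_eq _ _ _ _ _ (Cd_mult _ _ _ _ _ (Cd_inv z hz) IHm)). rewrite S_INR, RtoC_plus, !Cpow_S. field; auto. }
        refine (Cd_eq _ _ _ _ _ (Cd_scal _ _ _ _ (Q (S (S n))))).
        rewrite Cpow_inv by auto.
        have hn : RtoC (INR (S (S n))) <> 0. { intro h; apply RtoC_inj in h. have p := pos_INR (S n). rewrite S_INR in h. lra. }
        field. split; auto. apply Cpow_nz; auto. }
    destruct (P (S k)) as [F HF].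
    rewrite (mean_ext _ (fun t => (/ (cir r t ^ (S (S (S k))))) * cir r t)%C).
    2:{ intros t _. have h := cir_nz r t hr. rewrite (Cpow_S _ (S (S k))). field. split; auto. apply Cpow_nz; auto. }
    apply (mean_cir_FTC F (fun w => / w ^ (S (S (S k))))%C); [lra| |].
    + au.
    + intros t _. apply ccont_inv; [au|]. apply Cpow_nz, cir_nz; auto.
Qed.

Fixpoint csum (n : nat) (f : nat -> C) : C := match n with O => 0 | S n => (csum n f + f n)%C end.

Lemma csum_ext n f g : (forall k, (k < n)%nat -> f k = g k) -> csum n f = csum n g.
Proof. induction n; simpl; intros H; auto. rewrite IHn, H; auto. Qed.
Lemma csum_minus n f g : csum n (fun k => f k - g k)%C = (csum n f - csum n g)%C.
Proof. induction n; simpl; [ring|]. rewrite IHn. ring. Qed.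
Lemma csum_scal n c f : csum n (fun k => c * f k)%C = (c * csum n f)%C.
Proof. induction n; simpl; [ring|]. rewrite IHn. ring. Qed.
Lemma csum_bound n f B : (forall k, (k < n)%nat -> Cmod (f k) <= B) -> Cmod (csum n f) <= INR n * B.
Proof.
  induction n; intros H. simpl. rewrite Cmod_0. lra.
  rewrite S_INR. simpl csum. via Cmod_triangle. specialize (IHn ltac:(mono)).
  specialize (H n ltac:(lia)). lra.
Qed.
Lemma csum_0 n (f : nat -> C) : (forall k, (k < n)%nat -> f k = 0) -> csum n f = 0.
Proof. induction n; simpl; intros H; auto. rewrite IHn, H by auto. ring. Qed.
Lemma mean_csum n (f : nat -> R -> C) : (forall k, (k < n)%nat -> conth (f k)) ->
  mean (fun t => csum n (fun k => f k t)) = csum n (fun k => mean (f k)).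
Proof.
  have C0 : forall n, (forall k, (k < n)%nat -> conth (f k)) -> conth (fun t => csum n (fun k => f k t)).
  { induction n0; simpl; intros H t ht; [au|].
    apply ccont_plus; [apply IHn0; auto|apply H; auto]. }
  induction n; simpl; intros H. apply mean_const.
  rewrite mean_plus; auto. rewrite IHn; auto.
Qed.
Lemma hol_csum n (f : nat -> C -> C) z : (forall k, (k < n)%nat -> hol (f k) z) -> hol (fun w => csum n (fun k => f k w)) z.
Proof. induction n; simpl; intros H. apply hol_const. au. Qed.

Lemma geom_identity (z w : C) n : z <> 0 -> (z - w)%C <> 0 ->
  (z / (z - w))%C = (csum n (fun k => w ^ k / z ^ k) + w ^ n / z ^ n * (z / (z - w)))%C.
Proof.
  intros hz hzw. induction n.
  - simpl. field. au.
  - rewrite IHn at 1. simpl csum. rewrite <- Cplus_assoc. f_equal.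
    rewrite !Cpow_S. field. repeat split; auto. apply Cpow_nz; auto.
Qed.

Lemma cir_minus_nz r t w : Cmod w < r -> (cir r t - w)%C <> 0.
Proof.
  intros h. have p := Cmod_ge_0 w. apply Cmod_neq0. have q := Cmod_rev (cir r t) w. rewrite Cmod_cir in q; lra.
Qed.

Lemma cir_minus_inv r t w : Cmod w < r -> Cmod (/ (cir r t - w)) <= / (r - Cmod w).
Proof.
  intros h. rewrite Cmod_inv by (apply cir_minus_nz; auto). have p := Cmod_ge_0 w.
  apply Rinv_le_contravar; [lra|]. have q := Cmod_rev (cir r t) w. rewrite Cmod_cir in q; lra.
Qed.

Lemma ccont_kernel r w t : Cmod w < r -> ccont (fun t => cir r t / (cir r t - w))%C t.
Proof.
  intros h. apply ccont_div; [au| |apply cir_minus_nz; auto].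
  au.
Qed.

Lemma Cmod_kernel r w t : Cmod w < r -> Cmod (cir r t / (cir r t - w)) <= r / (r - Cmod w).
Proof.
  intros h. have p := Cmod_ge_0 w. unfold Cdiv. rewrite Cmod_mult, Cmod_cir by lra.
  apply Rmult_le_compat_l; [lra|]. apply cir_minus_inv; auto.
Qed.

Lemma mean_kernel r w : Cmod w < r -> mean (fun t => cir r t / (cir r t - w))%C = 1.
Proof.
  intros hw. have p := Cmod_ge_0 w. have hr : 0 < r by lra.
  have kk : 0 < r / (r - Cmod w) by pos.
  have q0 : 0 <= Cmod w / r < 1.
  { split; [mono|].
    apply Rmult_lt_reg_r with r; auto. field_simplify; lra. }
  apply Cmod_small_eq. intros e he.
  destruct (pow_small (Cmod w / r) (e / (r / (r - Cmod w)))) as [N hN]; auto.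
  { pos. }
  specialize (hN (S N) ltac:(lia)).
  have cz : forall k t, ccont (fun t => w ^ k / cir r t ^ k)%C t.
  { intros k t. apply ccont_div; [au|au|]. apply Cpow_nz, cir_nz; auto. }
  have ck : conth (fun t => w ^ S N / cir r t ^ S N * (cir r t / (cir r t - w)))%C.
  { intros t _. apply ccont_mult; [mono|apply ccont_kernel; auto]. }
  rewrite (mean_ext _ (fun t => csum (S N) (fun k => w ^ k / cir r t ^ k) + w ^ S N / cir r t ^ S N * (cir r t / (cir r t - w)))%C).
  2:{ intros t _. apply geom_identity; [au|apply cir_minus_nz]; auto. }
  rewrite mean_plus; auto.
  2:{ have C1 : forall n, conth (fun t => csum n (fun k => (w ^ k / cir r t ^ k)%C)).
      { induction n; intros t ht; simpl; [au|]. au. }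
      au. }
  rewrite (mean_csum (S N) (fun k t => w ^ k / cir r t ^ k)%C) by (intros k _ t _; apply cz).
  have E : csum (S N) (fun k => mean (fun t => w ^ k / cir r t ^ k)%C) = 1.
  { generalize N. induction N0; simpl csum.
    - rewrite (mean_ext _ (fun _ => RtoC 1)) by (intros; simpl; field). rewrite mean_const. ring.
    - simpl csum in IHN0. rewrite IHN0. rewrite (mean_ext _ (fun t => w ^ S N0 * (/ cir r t ^ S N0))%C) by mono. rewrite (mean_scal (w ^ S N0)).
      + rewrite mean_cir_pow_inv by (auto; lia). ring.
      + intros t _. apply ccont_inv; [au|apply Cpow_nz, cir_nz; auto]. }
  rewrite E. replace (1 + mean (fun t => w ^ S N / cir r t ^ S N * (cir r t / (cir r t - w))) - 1)%C
   with (mean (fun t => w ^ S N / cir r t ^ S N * (cir r t / (cir r t - w))))%C by ring.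
  apply mean_bound; auto. intros t _. rewrite Cmod_mult, Cmod_div, !Cmod_pow, Cmod_cir by (try lra; apply Cpow_nz, cir_nz; auto).
  replace (Cmod w ^ S N / r ^ S N) with ((Cmod w / r) ^ S N) by (unfold Rdiv; rewrite Rpow_mult_distr, pow_inv; auto).
  apply Rle_trans with (e / (r / (r - Cmod w)) * (r / (r - Cmod w))); [|apply Req_le; set (a := r / (r - Cmod w)) in *; field; lra].
  apply Rmult_le_compat; auto; [mono|mono|apply Cmod_kernel; auto].
Qed.
Global Opaque cir cexp.

(** * Cauchy's formula and Taylor expansions *)
Ltac ccs := lazymatch goal with
  | |- ccont (fun _ => ?c) _ => apply (ccont_const c)
  | |- ccont (cir _) _ => apply ccont_cir
  | |- ccont (fun t => cir _ t) _ => apply ccont_cir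
  | |- ccont (fun t => (@?a t * @?b t)%C) _ => apply (ccont_mult a b); ccs
  | |- ccont (fun t => (@?a t + @?b t)%C) _ => apply (ccont_plus a b); ccs
  | |- ccont (fun t => (@?a t - @?b t)%C) _ => apply (ccont_minus a b); ccs
  | |- ccont (fun t => (- @?a t)%C) _ => apply (ccont_opp a); ccs
  | |- ccont (fun t => (@?a t / @?b t)%C) _ => apply (ccont_div a b); ccs
  | |- ccont (fun t => (/ @?a t)%C) _ => apply (ccont_inv a); ccs
  | |- ccont (fun t => (@?a t ^ ?n)%C) _ => apply (ccont_pow a); ccs
  | |- (_ ^ _)%C <> _ => apply Cpow_nz; ccs
  | |- cir _ _ <> _ => apply cir_nz; try lra
  | |- (cir _ _ - _)%C <> _ => apply cir_minus_nz; solve [auto | lra]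
  | |- _ => solve [auto | lra]
  end.

Lemma ccont_Cmod h t : ccont h t -> continuity_pt (fun u => Cmod (h u)) t.
Proof.
  intros H e he. destruct (H e he) as [d [hd h1]]. exists d; split; auto. intros u [_ hu]. simpl in *. unfold R_dist in *.
  eapply Rle_lt_trans; [|apply (h1 u hu)]. apply Rabs_le. have a := Cmod_rev (h u) (h t). have b := Cmod_rev (h t) (h u).
  rewrite Cmod_sym in b. lra.
Qed.

Lemma conth_bounded h : conth h -> exists M, 0 <= M /\ forall t, 0 <= t <= 1 -> Cmod (h t) <= M.
Proof.
  intros H. destruct (continuity_ab_maj (fun t => Cmod (h t)) 0 1) as [x [hx _]]; [lra| |].
  - intros; apply ccont_Cmod; auto.
  - exists (Cmod (h x)). au.
Qed.

(** Shrinking homotopy: the mean of [F (w + u (z - w))] against the kernel has derivative zero in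
    [u]; at [u = 1] it is the Cauchy integral, at [u = 0] it is [F w]. Differentiation under the
    integral uses the continuity of the derivative [f], which at this stage is known for a primitive
    of a holomorphic function but not for the function itself. *)
Lemma cauchy_C1 F f R0 rho w : (forall z, Cmod z < R0 -> Cd F z (f z)) -> (forall z, Cmod z < R0 -> Ccont f z) ->
  Cmod w < rho -> rho < R0 -> mean (fun t => F (cir rho t) * (cir rho t / (cir rho t - w)))%C = F w.
Proof.
  intros HF Hf hw hr. have pw := Cmod_ge_0 w. have hrho : 0 < rho by lra.
  set (p := fun u t : R => (w + RtoC u * (cir rho t - w))%C).
  set (K := fun t : R => (cir rho t / (cir rho t - w))%C).
  set (Fn := fun u t : R => (F (p u t) * K t)%C).
  set (dF := fun u t : R => (f (p u t) * cir rho t)%C).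
  (* The parameter [u] runs over a neighbourhood of [[0, 1]], to have two-sided derivatives at the
     end points. *)
  small d ((1, 1) :: (4 * rho, R0 - rho) :: nil) as [hd [hd1 [hd2 _]]].
  have hp : forall u t, - d < u < 1 + d -> Cmod (p u t) < R0.
  { intros u t hu. unfold p. replace (w + u * (cir rho t - w))%C with ((1 - u)%R * w + u * cir rho t)%C by (rewrite RtoC_minus; ring).
    eapply Rle_lt_trans; [mono|]. rewrite !Cmod_mult, !Cmod_R, Cmod_cir by lra.
    assert (Rabs (1 - u) + Rabs u <= 1 + 2 * d).
    { unfold Rabs; repeat destruct Rcase_abs; lra. }
    have q := Rabs_pos (1 - u). have q' := Rabs_pos u. nra. }
  have hK : forall t, (K t * (cir rho t - w))%C = cir rho t.
  { intros t. unfold K. field. apply cir_minus_nz; auto. }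
  have D : forall u t, - d < u < 1 + d -> rd (fun u => Fn u t) u (dF u t).
  { intros u t hu. unfold Fn, dF. rewrite <- (hK t).
    replace (f (p u t) * (K t * (cir rho t - w)))%C with ((K t * f (p u t)) * (cir rho t - w))%C by ring.
    have X := rd_Cd (fun z => K t * F z)%C (fun u => p u t) u (cir rho t - w) (K t * f (p u t)) (rd_line _ _ _) (Cd_scal _ _ _ _ (HF _ (hp u t hu))).
    intros e he. destruct (X e he) as [d' [hd' x]]. exists d'; split; auto. intros v hv. specialize (x v hv).
    rewrite (Cmult_comm (F (p v t))), (Cmult_comm (F (p u t))). lra. }
  have C2 : forall u t, - d < u < 1 + d -> forall e, 0 < e -> exists d', 0 < d' /\ forall u' t', Rabs (u' - u) < d' -> Rabs (t' - t) < d' -> Cmod (dF u' t' - dF u t) < e.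
  { intros u t hu e he.
    destruct (Hf (p u t) (hp u t hu) (e / (2 * rho))) as [d1 [h1 k1]]; [pos|].
    set (B := Cmod (f (p u t)) + 1). have hB : 0 < B by (unfold B; have q := Cmod_ge_0 (f (p u t)); lra).
    small e2 ((1, d1 / 4) :: (1, e / (2 * B)) :: nil) as [he2 [l1 [l2 _]]].
    destruct (ccont_cir rho t e2 he2) as [d2 [h2 k2]].
    small m ((1, d2) :: (1, d1 / (8 * rho)) :: nil) as [hm [m1 [m2 _]]]. exists m. split; [auto|].
    intros u' t' hu' ht'. specialize (k2 t' _lra).
    assert (Cmod (p u' t' - p u t) < d1).
    { unfold p. replace (w + u' * (cir rho t' - w) - (w + u * (cir rho t - w)))%C with
       (RtoC (u' - u) * (cir rho t' - w) + u * (cir rho t' - cir rho t))%C by (rewrite RtoC_minus; ring).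
      eapply Rle_lt_trans; [mono|]. rewrite !Cmod_mult, !Cmod_R.
      assert (Cmod (cir rho t' - w) <= 2 * rho) by (via Cmod_minus_le; rewrite Cmod_cir; lra).
      assert (Rabs u <= 2) by (apply Rabs_le; lra).
      assert (Rabs (u' - u) * Cmod (cir rho t' - w) <= d1 / (8 * rho) * (2 * rho)).
      { apply Rmult_le_compat; try lra. apply Rabs_pos. au. }
      replace (d1 / (8 * rho) * (2 * rho)) with (d1 / 4) in H1 by (field; lra).
      assert (Rabs u * Cmod (cir rho t' - cir rho t) <= 2 * (d1 / 4)).
      { apply Rmult_le_compat; try lra. apply Rabs_pos. au. }
      lra. }
    specialize (k1 _ H). unfold dF.
    replace (f (p u' t') * cir rho t' - f (p u t) * cir rho t)%C with
      ((f (p u' t') - f (p u t)) * cir rho t' + f (p u t) * (cir rho t' - cir rho t))%C by ring.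
    eapply Rle_lt_trans; [mono|]. rewrite !Cmod_mult, Cmod_cir by lra.
    assert (Cmod (f (p u' t') - f (p u t)) * rho < e / 2).
    { apply Rlt_le_trans with (e / (2 * rho) * rho); [mono|]. apply Req_le; field; lra. }
    assert (Cmod (f (p u t)) * Cmod (cir rho t' - cir rho t) <= B * (e / (2 * B))).
    { apply Rmult_le_compat; try apply Cmod_ge_0. unfold B; lra. lra. }
    replace (B * (e / (2 * B))) with (e / 2) in H1 by (field; lra). lra. }
  have cp : forall u, - d < u < 1 + d -> conth (Fn u).
  { intros u hu t _. unfold Fn. apply ccont_mult; [|apply ccont_kernel; auto].
    apply (ccont_hol F (p u)); [|eexists; apply HF, hp; auto].
    unfold p. au. }
  have cd : forall u, - d < u < 1 + d -> conth (dF u).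
  { intros u hu t _ e he. destruct (C2 u t hu e he) as [d' [h1 k1]]. exists d'; split; auto.
    au. }
  (* For [u <> 0] the integrand comes from the derivative along the circle of
     [F (w + u (z - w)) / u]. *)
  have Z : forall u, - d < u < 1 + d -> mean (dF u) = 0.
  { intros u hu. destruct (Req_dec u 0) as [->|hu0].
    - unfold dF, p. rewrite (mean_ext _ (fun t => f w * cir rho t)%C) by (intros; f_equal; f_equal; ring).
      rewrite mean_scal by (intros t _; apply ccont_cir).
      have E := mean_cir_FTC (fun z => z) (fun _ => 1) rho _lra.
      rewrite (mean_ext _ (fun t => 1 * cir rho t)%C) by (intros; ring).
      rewrite E. ring. intros; apply Cd_id. intros t _; apply ccont_const.
    - have uz : RtoC u <> 0 by (intro h; apply RtoC_inj in h; auto).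
      apply (mean_cir_FTC (fun z => / u * F (w + u * (z - w)))%C (fun z => f (w + u * (z - w))%C)); [lra| |].
      + intros t _. have X := Cd_comp (fun z => w + u * (z - w))%C F (cir rho t) (RtoC u) (f (p u t)).
        refine (Cd_eq _ _ _ _ _ (Cd_scal (/ u) _ _ _ (X _ (HF _ (hp u t hu))))).
        * unfold p. field. au.
        * refine (Cd_eq _ _ _ _ _ (Cd_plus _ _ _ _ _ (Cd_const w _) (Cd_scal u _ _ _ (Cd_plus _ _ _ _ _ (Cd_id _) (Cd_const (- w) _))))). ring.
      + intros t _. apply (ccont_Ccont f (p u)); [|mono].
        unfold p. au. }
  (* Real and imaginary parts are treated at once: [q] stands for either projection. *)
  have P : forall q : C -> R, (forall a b, Rabs (q a - q b) <= Cmod (a - b)) -> (q 0 = 0) ->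
     (forall h t l, rd h t l -> is_derive (fun u => q (h u)) t (q l)) ->
     (forall h, conth h -> ex_RInt (fun t => q (h t)) 0 1) ->
     (forall h, RInt (fun t => q (h t)) 0 1 = q (mean h)) ->
     q (mean (Fn 1)) = q (mean (Fn 0)).
  { intros q q1 q0 q2 q3 q4.
    have dd : forall u, - d < u < 1 + d -> is_derive (fun u => RInt (fun t => q (Fn u t)) 0 1) u 0.
    { intros u hu.
      have L : locally u (fun y => - d < y < 1 + d).
      { small m ((1, u + d) :: (1, 1 + d - u) :: nil) as [hm [m1 [m2 _]]]. exists (mkposreal m hm). intros y hy.
        have hy' : Rabs (y - u) < m by exact hy. apply Rabs_lt_between in hy'. lra. }
      have DD : forall y t, - d < y < 1 + d -> Derive (fun u => q (Fn u t)) y = q (dF y t).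
      { intros y t hy. apply is_derive_unique. au. }
      have V : RInt (fun t => Derive (fun u => q (Fn u t)) u) 0 1 = 0.
      { rewrite (RInt_ext _ (fun t => q (dF u t))) by mono. rewrite q4, Z; auto. }
      refine (eq_ind _ (fun v => is_derive (fun u => RInt (fun t => q (Fn u t)) 0 1) u v) _ _ V).
      apply (is_derive_RInt_param (fun u t => q (Fn u t))).
      - revert L. apply filter_imp. intros y hy t _. exists (q (dF y t)). au.
      - intros t _. apply (continuity_2d_pt_ext_loc (fun u v => q (dF u v))).
        + destruct L as [r hr']. exists r. intros a b ha hb. symmetry. au.
        + intros e. destruct (C2 u t hu e (cond_pos e)) as [d' [h1 k1]]. exists (mkposreal d' h1). intros a b ha hb.
          eapply Rle_lt_trans; [mono|]. au.
      - revert L. apply filter_imp. au. }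
    rewrite <- !q4.
    destruct (MVT_gen (fun u => RInt (fun t => q (Fn u t)) 0 1) 0 1 (fun _ => 0)) as [c [_ E]].
    - rewrite Rmin_left, Rmax_right by lra. au.
    - rewrite Rmin_left, Rmax_right by lra. intros. apply derivable_continuous_pt. exists 0. apply is_derive_Reals. au.
    - lra. }
  have E : mean (Fn 1) = mean (Fn 0).
  { have E1 : Re (mean (Fn 1)) = Re (mean (Fn 0)).
    { apply (P Re); auto.
      - intros a b. replace (Re a - Re b) with (Re (a - b)); [apply re_le|]. au.
      - apply rd_re.
      - intros; apply conth_re; auto; lra. }
    have E2 : Im (mean (Fn 1)) = Im (mean (Fn 0)).
    { apply (P Im); auto.
      - intros a b. replace (Im a - Im b) with (Im (a - b)); [apply im_le|]. au.
      - apply rd_im.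
      - intros; apply conth_im; auto; lra. }
    destruct (mean (Fn 1)), (mean (Fn 0)). simpl in *. congruence. }
  transitivity (mean (Fn 1)).
  { apply mean_ext. intros t _. unfold Fn, p, K. do 2 f_equal. ring. }
  rewrite E. unfold Fn, p. rewrite (mean_ext _ (fun t => F w * K t)%C).
  2:{ intros t _. do 2 f_equal. ring. }
  rewrite mean_scal by (intros t _; apply ccont_kernel; auto).
  unfold K. rewrite mean_kernel by auto. ring.
Qed.

Definition holball (c : C) (r : R) (f : C -> C) : Prop := forall z, Cmod (z - c) < r -> hol f z.
#[global] Hint Extern 2 (hol _ _) => match goal with H : holball _ _ ?f |- hol ?f _ => apply H; lra | H : forall x, _ -> holball _ _ _ |- _ => apply H; solve [lra | auto] | H : forall x, holball _ _ _ |- _ => apply H; solve [lra | auto] end : hd.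
#[global] Hint Unfold holball : hd.

(** A primitive [F] of [f] has the continuous derivative [f], so Cauchy's formula holds for [F].
    Differentiating it expresses [f w] by the integral of [F / (z - w)^2], and integration by parts
    on the circle moves the derivative back onto [F]. *)
Lemma cauchy_0 f R0 rho w : (forall z, Cmod z < R0 -> hol f z) -> Cmod w < rho -> rho < R0 ->
  mean (fun t => f (cir rho t) * (cir rho t / (cir rho t - w)))%C = f w.
Proof.
  intros Hf hw hr. have pw := Cmod_ge_0 w. have hrho : 0 < rho by lra.
  destruct (hol_primitive f R0 Hf) as [F HF].
  have hin : forall t, Cmod (cir rho t) < R0 by au.
  have CF : forall t, ccont (fun t => F (cir rho t)) t.
  { intros t. apply (ccont_hol F (cir rho)); [au|]. eexists. au. }
  have Cf : forall t, ccont (fun t => f (cir rho t)) t.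
  { intros t. apply (ccont_hol f (cir rho)); [au|]. au. }
  have Cz : forall v t, Cmod v < rho -> ccont (fun t => / (cir rho t - v))%C t.
  { intros v t hv. apply ccont_inv; [au|apply cir_minus_nz; auto]. }
  set (l := mean (fun t => F (cir rho t) * cir rho t * (/ (cir rho t - w) * / (cir rho t - w)))%C).
  have D : Cd F w l.
  { destruct (conth_bounded (fun t => F (cir rho t))) as [M [hM0 hM]]; [intros t _; apply CF|].
    set (g := rho - Cmod w). have hg : 0 < g by (unfold g; lra).
    apply Cd_quad with (K := M * rho * (/ g * / g * / (g / 2))) (r := g / 2); [lra|]. intros v hv.
    have hv2 : Cmod v <= Cmod w + Cmod (v - w) by (have q := Cmod_rev v w; lra).
    have hvr : Cmod v < rho by (unfold g in *; lra).
    rewrite <- (cauchy_C1 F f R0 rho v), <- (cauchy_C1 F f R0 rho w); auto; try (intros; apply hol_cont; auto).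
    set (k := (v - w)%C) in *.
    have E : (mean (fun t => F (cir rho t) * (cir rho t / (cir rho t - v))) -
       mean (fun t => F (cir rho t) * (cir rho t / (cir rho t - w))) - l * k)%C =
       (k * k * mean (fun t => F (cir rho t) * cir rho t * (/ (cir rho t - w) * / (cir rho t - w) * / (cir rho t - v))))%C.
    { unfold l. rewrite (Cmult_comm _ k).
      rewrite <- !mean_scal.
      - rewrite <- mean_minus, <- mean_minus.
        + apply mean_ext. intros t _. unfold k.
          have a1 := cir_minus_nz rho t w hw. have a2 := cir_minus_nz rho t v hvr. field. au.
        + intros t _. ccs.
        + intros t _. ccs.
        + intros t _; ccs.
        + intros t _; ccs.
      - intros t _. ccs.
      - intros t _. ccs. }
    rewrite E, !Cmod_mult.
    replace (M * rho * (/ g * / g * / (g / 2)) * Cmod k ^ 2) with (Cmod k * Cmod k * (M * rho * (/ g * / g * / (g / 2)))) by ring.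
    apply Rmult_le_compat_l; [mono|].
    apply mean_bound.
    - intros t _. ccs.
    - intros t ht. rewrite !Cmod_mult, Cmod_cir by lra.
      have b1 := cir_minus_inv rho t w hw. fold g in b1. have b2 := cir_minus_inv rho t v hvr.
      have b3 : / (rho - Cmod v) <= / (g / 2) by (apply Rinv_le_contravar; unfold g in *; lra).
      have p1 := Cmod_ge_0 (F (cir rho t)). have p2 := Cmod_ge_0 (/ (cir rho t - w)). have p3 := Cmod_ge_0 (/ (cir rho t - v)).
      repeat apply Rmult_le_compat; auto; try lra; repeat apply Rmult_le_pos; try lra. au. }
  rewrite <- (Cd_unique _ _ _ _ D (HF w _lra)).
  have G : mean (fun t => (f (cir rho t) * / (cir rho t - w) - F (cir rho t) * (/ (cir rho t - w) * / (cir rho t - w))) * cir rho t)%C = 0.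
  { apply (mean_cir_FTC (fun z => F z * / (z - w))%C (fun z => f z * / (z - w) - F z * (/ (z - w) * / (z - w)))%C); [lra| |].
    - intros t _. have a1 := cir_minus_nz rho t w hw.
      refine (Cd_eq _ _ _ _ _ (Cd_mult _ _ _ _ _ (HF _ (hin t)) (Cd_comp (fun z => z - w)%C _ (cir rho t) _ _ (Cd_plus _ _ _ _ _ (Cd_id _) (Cd_const (- w) _)) (Cd_inv _ a1)))).
      unfold Cminus in *. field. au.
    - intros t _. ccs. }
  rewrite (mean_ext _ (fun t => f (cir rho t) * (cir rho t / (cir rho t - w)) - F (cir rho t) * cir rho t * (/ (cir rho t - w) * / (cir rho t - w)))%C) in G
    by (intros t _; unfold Cdiv; ring).
  rewrite mean_minus in G.
  - apply Ceq_minus. au.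
  - intros t _. ccs.
  - intros t _. ccs.
Qed.

Lemma holball_shift c r f : holball c r f -> forall z, Cmod z < r -> hol (fun w => f (c + w)%C) z.
Proof.
  intros H z hz. apply (hol_comp (fun w => c + w)%C f).
  - au.
  - apply H. replace (c + z - c)%C with z by ring. auto.
Qed.

Lemma cauchy_formula c r f rho w : holball c r f -> Cmod w < rho -> rho < r ->
  mean (fun t => f (c + cir rho t)%C * (cir rho t / (cir rho t - w)))%C = f (c + w)%C.
Proof. intros H. apply (cauchy_0 (fun w => f (c + w)%C) r). apply holball_shift; auto. Qed.

Lemma ccont_circ c r f rho t : holball c r f -> 0 <= rho < r -> ccont (fun t => f (c + cir rho t)%C) t.
Proof.
  intros H h. apply (ccont_hol f (fun t => c + cir rho t)%C).
  - au.
  - apply H. replace (c + cir rho t - c)%C with (cir rho t) by ring. lra.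
Qed.

Definition coef c rho k (f : C -> C) : C := mean (fun t => f (c + cir rho t)%C / cir rho t ^ k)%C.
(** The data [h] on the circle is arbitrary, not necessarily the trace of a holomorphic function: in
    the contraction it is glued from two formulas. For the trace of [f] this is the Taylor remainder
    of order [n] divided by [w^n]. *)
Definition tailm rho n (h : R -> C) (w : C) : C := mean (fun t => h t / cir rho t ^ n * (cir rho t / (cir rho t - w)))%C.
Definition rem c rho n (f : C -> C) (w : C) : C := tailm rho n (fun t => f (c + cir rho t)%C) w.

Lemma ccont_coef h rho k t : 0 < rho -> ccont h t -> ccont (fun t => h t / cir rho t ^ k)%C t.
Proof. intros hr H. apply ccont_div; auto. apply ccont_pow, ccont_cir. apply Cpow_nz, cir_nz; auto. Qed.

Lemma ccont_tail h rho n w t : Cmod w < rho -> ccont h t -> ccont (fun t => h t / cir rho t ^ n * (cir rho t / (cir rho t - w)))%C t.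
Proof.
  intros hw H. have p := Cmod_ge_0 w. apply ccont_mult; [apply ccont_coef; auto; lra|apply ccont_kernel; auto].
Qed.

Lemma tail_bound h rho n w M : Cmod w < rho -> conth h -> (forall t, Cmod (h t) <= M) ->
  Cmod (tailm rho n h w) <= M / rho ^ n * (rho / (rho - Cmod w)).
Proof.
  intros hw H HM. have p := Cmod_ge_0 w. apply mean_bound.
  - intros t ht. apply ccont_tail; auto.
  - intros t _. rewrite Cmod_mult, Cmod_div, Cmod_pow, Cmod_cir by (try lra; apply Cpow_nz, cir_nz; lra).
    apply Rmult_le_compat; try apply Cmod_ge_0.
    + au.
    + apply Rmult_le_compat_r; auto. au.
    + apply Cmod_kernel; auto.
Qed.

Lemma taylor c r f rho n w : holball c r f -> Cmod w < rho -> rho < r ->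
  f (c + w)%C = (csum n (fun k => coef c rho k f * w ^ k) + w ^ n * rem c rho n f w)%C.
Proof.
  intros H hw hr. have p := Cmod_ge_0 w.
  have Cf : forall t, ccont (fun t => f (c + cir rho t)%C) t by (intros; eapply ccont_circ; eauto; lra).
  rewrite <- (cauchy_formula c r f rho w H hw hr).
  rewrite (mean_ext _ (fun t => csum n (fun k => w ^ k * (f (c + cir rho t)%C / cir rho t ^ k)) +
    w ^ n * (f (c + cir rho t)%C / cir rho t ^ n * (cir rho t / (cir rho t - w))))%C).
  2:{ intros t _. rewrite (geom_identity (cir rho t) w n) at 1 by (try apply cir_nz; try apply cir_minus_nz; auto; lra).
      rewrite Cmult_plus_distr_l, <- csum_scal. f_equal.
      - apply csum_ext. intros k _. field. apply Cpow_nz, cir_nz; lra.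
      - field. split; [apply cir_minus_nz; auto|apply Cpow_nz, cir_nz; lra]. }
  rewrite mean_plus.
  - rewrite mean_scal by (intros t _; apply ccont_tail; auto).
    f_equal. rewrite (mean_csum n (fun k t => w ^ k * (f (c + cir rho t)%C / cir rho t ^ k))%C).
    + apply csum_ext. intros k _. rewrite mean_scal by (intros t _; apply ccont_coef; auto; lra). unfold coef. ring.
    + intros k _ t _. apply ccont_scal, ccont_coef; auto; lra.
  - intros t _. clear - Cf p hw. induction n; simpl; [au|]. apply ccont_plus; auto.
    apply (ccont_scal (w ^ n)). apply ccont_coef; auto; lra.
  - intros t _. apply ccont_scal, ccont_tail; auto.
Qed.

Lemma coef_bound h rho k M : 0 < rho -> conth h -> (forall t, Cmod (h t) <= M) ->
  Cmod (mean (fun t => h t / cir rho t ^ k)%C) <= M / rho ^ k.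
Proof.
  intros hr H HM. apply mean_bound.
  - intros t ht. apply ccont_coef; auto.
  - intros t _. rewrite Cmod_div, Cmod_pow, Cmod_cir by (try lra; apply Cpow_nz, cir_nz; lra).
    apply Rmult_le_compat_r; auto. au.
Qed.

Lemma holball_bounded c r f r1 : holball c r f -> r1 < r -> exists M, 0 <= M /\ forall w, Cmod (w - c) <= r1 -> Cmod (f w) <= M.
Proof.
  intros H hr. destruct (Rle_lt_dec 0 r1) as [h0|h0].
  2:{ exists 0. split; [lra|]. intros w hw. have p := Cmod_ge_0 (w - c). lra. }
  set (rho := (r1 + r) / 2). have h1 : r1 < rho < r by (unfold rho; lra).
  have Cf : forall t, ccont (fun t => f (c + cir rho t)%C) t by (intros; eapply ccont_circ; eauto; lra).
  destruct (conth_bounded (fun t => f (c + cir rho t)%C)) as [M [hM0 hM]]; [intros t _; auto|].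
  have k1 : 0 < / (rho - r1) by pos.
  exists (M * (rho * / (rho - r1))). split; [repeat mono|]. intros w hw.
  have hw' : Cmod (w - c) < rho by lra.
  replace w with (c + (w - c))%C by ring. rewrite <- (cauchy_formula c r f rho (w - c)); auto; [|lra].
  have p := Cmod_ge_0 (w - c).
  apply mean_bound; [intros t _; apply ccont_mult; auto; apply ccont_kernel; auto|].
  intros t ht. rewrite Cmod_mult. apply Rmult_le_compat; try apply Cmod_ge_0; [au|].
  eapply Rle_trans; [apply Cmod_kernel; auto|]. apply Rmult_le_compat_l; [lra|]. apply Rinv_le_contravar; lra.
Qed.

(** Both bounds are read on the circle of radius [r / 2], whence the factors 2 and 8. One bound on a
    disc thus yields a derivative and a second-order remainder that are uniform over families of
    functions. *)
Lemma est2 c r f M : 0 < r -> holball c r f -> (forall w, Cmod (w - c) < r -> Cmod (f w) <= M) ->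
  Cmod (cD f c) <= 2 * M / r /\
  forall w, Cmod w <= r / 4 -> Cmod (f (c + w)%C - f c - cD f c * w) <= 8 * M / r ^ 2 * Cmod w ^ 2.
Proof.
  intros hr H HM. have hx : exists rho, rho = r / 2 by eauto. destruct hx as [rho erho]. have hrho : 0 < rho < r by lra.
  have Cf : conth (fun t => f (c + cir rho t)%C) by (intros t _; eapply ccont_circ; eauto; lra).
  have hb : forall t, Cmod (f (c + cir rho t)%C) <= M.
  { intros t. apply HM. replace (c + cir rho t - c)%C with (cir rho t) by ring. lra. }
  have hM0 : 0 <= M by (eapply Rle_trans; [mono|apply (hb 0)]).
  have T : forall w, Cmod w < rho -> f (c + w)%C = (coef c rho 0 f + coef c rho 1 f * w + w ^ 2 * rem c rho 2 f w)%C.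
  { intros w hw. rewrite (taylor c r f rho 2 w H hw _lra). simpl. ring. }
  have T0 : f c = coef c rho 0 f.
  { have h := T 0 ltac:(rewrite Cmod_0; lra). replace (c + 0)%C with c in h by ring. rewrite h. simpl. ring. }
  have Q : forall w, Cmod w <= r / 4 -> Cmod (f (c + w)%C - f c - coef c rho 1 f * w) <= 8 * M / r ^ 2 * Cmod w ^ 2.
  { intros w hw. rewrite T by lra. rewrite T0.
    replace (coef c rho 0 f + coef c rho 1 f * w + w ^ 2 * rem c rho 2 f w - coef c rho 0 f - coef c rho 1 f * w)%C with (w ^ 2 * rem c rho 2 f w)%C by ring.
    rewrite Cmod_mult, Cmod_pow, Rmult_comm. apply Rmult_le_compat_r; [apply pow_le, Cmod_ge_0|].
    eapply Rle_trans; [apply (tail_bound _ rho 2 w M); auto; lra|].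
    replace (8 * M / r ^ 2) with (M / rho ^ 2 * 2) by (rewrite erho; field; lra).
    apply Rmult_le_compat_l; [apply Rmult_le_pos; auto; apply Rlt_le, Rinv_0_lt_compat, pow_lt; lra|].
    apply Rmult_le_reg_r with (rho - Cmod w); [lra|]. replace (rho / (rho - Cmod w) * (rho - Cmod w)) with rho by (field; lra).
    lra. }
  have D : Cd f c (coef c rho 1 f).
  { apply Cd_quad with (K := 8 * M / r ^ 2) (r := r / 4); [lra|]. intros w hw.
    have q := Q (w - c)%C _lra. replace (c + (w - c))%C with w in q by ring. exact q. }
  rewrite (cD_eq _ _ _ D). split; auto.
  unfold coef. eapply Rle_trans; [apply (coef_bound (fun t => f (c + cir rho t)%C) rho 1 M); auto; lra|].
  apply Req_le. rewrite erho. field. lra.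
Qed.

Lemma lip_ball c r r1 f M : r1 < r -> holball c r f -> (forall w, Cmod (w - c) < r -> Cmod (f w) <= M) ->
  forall a b, Cmod (a - c) <= r1 -> Cmod (b - c) <= r1 -> Cmod (f b - f a) <= 2 * M / (r - r1) * Cmod (b - a).
Proof.
  intros hr H HM a b ha hb.
  have hin : forall t, 0 <= t <= 1 -> Cmod (a + t * (b - a) - c) <= r1.
  { intros t ht. replace (a + t * (b - a) - c)%C with ((a - c) + t * ((b - c) - (a - c)))%C by ring. apply seg_in; auto. }
  apply (MVT_C f (cD f)).
  - intros t ht. apply cD_spec, H. specialize (hin t ht). lra.
  - intros t ht. specialize (hin t ht). set (p := (a + t * (b - a))%C) in *.
    have tr : forall w, Cmod (w - p) < r - r1 -> Cmod (w - c) < r.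
    { intros w hw. eapply Rle_lt_trans; [apply (Cmod_tri _ p)|]. lra. }
    apply (est2 p (r - r1) f M); [lra| |].
    + au.
    + au.
Qed.

(** [est2] gives a second-order remainder uniform in [th], which can be integrated. What takes an
    argument is the continuity in [th] of the derivative [l]: it is approximated, uniformly in [th],
    by difference quotients with a fixed step. *)
Lemma param_int (F : C -> R -> C) t0 r M : 0 < r ->
  (forall th, holball t0 r (fun t => F t th)) ->
  (forall t th, Cmod (t - t0) < r -> Cmod (F t th) <= M) ->
  (forall t th, Cmod (t - t0) < r -> ccont (F t) th) ->
  hol (fun t => mean (F t)) t0.
Proof.
  intros hr HF HM HC.
  have h00 : Cmod (t0 - t0) < r by lra.
  set (l := fun th => cD (fun t => F t th) t0).
  have E : forall th w, Cmod w <= r / 4 -> Cmod (F (t0 + w)%C th - F t0 th - l th * w) <= 8 * M / r ^ 2 * Cmod w ^ 2.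
  { intros th w hw. apply (est2 t0 r (fun t => F t th) M hr (HF th) (fun w h => HM w th h)). auto. }
  have hM : 0 <= M by (eapply Rle_trans; [mono|apply (HM t0 0); auto]).
  set (A := 8 * M / r ^ 2). have hA : 0 <= A.
  { unfold A, Rdiv. mono. }
  have Cl : forall th, ccont l th.
  { intros th e he. small k ((1, r / 4) :: (1, e / (4 * (A + 1))) :: nil) as [hk [k1 [k2 _]]].
    have hmk : Cmod k = k by lra.
    have hin : Cmod (t0 + k - t0) < r by (replace (t0 + k - t0)%C with (RtoC k) by ring; lra).
    destruct (HC (t0 + k)%C th hin (e * k / 4)) as [d1 [h1 q1]]; [nra|].
    destruct (HC t0 th h00 (e * k / 4)) as [d2 [h2 q2]]; [nra|].
    small m ((1, d1) :: (1, d2) :: nil) as [hm [m1 [m2 _]]]. exists m. split; [auto|]. intros u hu. specialize (q1 u _lra). specialize (q2 u _lra).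
    have e1 := E th k _lra. have e2 := E u k _lra. rewrite hmk in e1, e2.
    apply Rmult_lt_reg_r with k; auto. rewrite <- hmk at 1. rewrite <- Cmod_mult.
    replace ((l u - l th) * k)%C with (((F (t0 + k)%C th - F t0 th - l th * k) - (F (t0 + k)%C u - F t0 u - l u * k)) +
      ((F (t0 + k)%C u - F (t0 + k)%C th) - (F t0 u - F t0 th)))%C by ring.
    eapply Rle_lt_trans; [mono|].
    have b1 := Cmod_minus_le (F (t0 + k)%C th - F t0 th - l th * k) (F (t0 + k)%C u - F t0 u - l u * k).
    have b2 := Cmod_minus_le (F (t0 + k)%C u - F (t0 + k)%C th) (F t0 u - F t0 th).
    fold A in e1, e2.
    assert (A * k <= e / 4).
    { apply Rle_trans with ((A + 1) * (e / (4 * (A + 1)))); [nra|]. apply Req_le; field; lra. }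
    nra. }
  exists (mean l). apply Cd_quad with (K := A) (r := r / 4); [lra|]. intros w hw.
  set (k := (w - t0)%C) in *. replace w with (t0 + k)%C by (unfold k; ring).
  have hin : Cmod (t0 + k - t0) < r by (replace (t0 + k - t0)%C with k by ring; lra).
  rewrite (Cmult_comm _ k). rewrite <- mean_scal by (intros t _; apply Cl).
  rewrite <- mean_minus by (intros t _; apply HC; auto).
  rewrite <- mean_minus by (intros t _; first [apply ccont_scal; apply Cl|apply ccont_minus; apply HC; auto]).
  apply mean_bound.
  - intros t _. apply ccont_minus; [apply ccont_minus; apply HC; auto|apply ccont_scal; auto].
  - intros t _. have e1 := E t k _lra. rewrite (Cmult_comm k). mono.
Qed.

(** Applied to [u n - u m], [est2] makes the derivatives at [c] a Cauchy sequence; applied to [u n],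
    it gives a remainder independent of [n]. *)
Lemma lim_hol (u : nat -> C -> C) f c r : 0 < r ->
  (forall n, holball c r (u n)) ->
  (forall e, 0 < e -> exists N, forall n z, (N <= n)%nat -> Cmod (z - c) < r -> Cmod (u n z - f z) <= e) ->
  hol f c.
Proof.
  intros hr H HL.
  have h00 : Cmod (c - c) < r by lra.
  destruct (HL 1 Rlt_0_1) as [N0 hN0].
  destruct (hol_cont _ _ (H N0 c h00) 1 Rlt_0_1) as [d [hd hcd]].
  small r' ((1, r) :: (1, d) :: nil) as [hr' [m1 [m2 _]]].
  set (M := Cmod (u N0 c) + 3). have hMp : 0 < M by (unfold M; have q := Cmod_ge_0 (u N0 c); lra).
  have HM : forall n z, (N0 <= n)%nat -> Cmod (z - c) < r' -> Cmod (u n z) <= M.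
  { intros n z hn hz. have a1 := hN0 n z hn _lra. have a2 := hN0 N0 z (le_n _) _lra.
    have a3 := hcd z _lra. have b1 := Cmod_rev (u n z) (f z). have b2 := Cmod_rev (f z) (u N0 z).
    have b3 := Cmod_rev (u N0 z) (u N0 c). rewrite (Cmod_sym (f z)) in b2. unfold M. lra. }
  have Hb : forall n, holball c r' (u n) by au.
  destruct (C_cauchy (fun n => cD (u n) c)) as [l hl].
  { intros e he. destruct (HL (e * r' / 4)) as [N hN]; [nra|]. exists N. intros n m hn hm.
    have Hd : holball c r' (fun z => u n z - u m z)%C by au.
    destruct (est2 c r' (fun z => u n z - u m z)%C (e * r' / 2)) as [a1 _]; auto.
    { intros w hw. via (Cmod_tri _ (f w)). rewrite (Cmod_sym (f w)).
      have x1 := hN n w hn _lra. have x2 := hN m w hm _lra. lra. }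
    rewrite (cD_eq _ _ (cD (u n) c - cD (u m) c)) in a1.
    - eapply Rle_trans; [exact a1|]. apply Req_le; field; lra.
    - have x1 := cD_spec _ _ (Hb n c _lra).
      have x2 := cD_spec _ _ (Hb m c _lra).
      refine (Cd_eq _ _ _ _ _ (Cd_ext (fun z => u n z + (-1) * u m z)%C _ _ _ 1 _ _ (Cd_plus _ _ _ _ _ x1 (Cd_scal (-1) _ _ _ x2)))); [ring|lra|intros; ring]. }
  exists l. apply Cd_quad with (K := 8 * M / r' ^ 2) (r := r' / 4); [lra|]. intros w hw.
  apply le_epsilon. intros e he.
  destruct (HL (e / 4)) as [N1 h1]; [lra|]. destruct (hl (e / (4 * r'))) as [N2 h2]; [pos|].
  set (n := (N0 + N1 + N2)%nat). specialize (h2 n ltac:(lia)).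
  have g1 := h1 n w ltac:(lia) _lra. have g2 := h1 n c ltac:(lia) h00.
  destruct (est2 c r' (u n) M hr' (Hb n)) as [_ a2]; [au|].
  specialize (a2 (w - c)%C _lra). replace (c + (w - c))%C with w in a2 by ring.
  replace (f w - f c - l * (w - c))%C with ((u n w - u n c - cD (u n) c * (w - c)) + ((cD (u n) c - l) * (w - c) - (u n w - f w)) + (u n c - f c))%C by ring.
  have t1 := Cmod_triangle ((u n w - u n c - cD (u n) c * (w - c)) + ((cD (u n) c - l) * (w - c) - (u n w - f w))) (u n c - f c).
  have t2 := Cmod_triangle (u n w - u n c - cD (u n) c * (w - c)) ((cD (u n) c - l) * (w - c) - (u n w - f w)).
  have t3 := Cmod_minus_le ((cD (u n) c - l) * (w - c)) (u n w - f w). rewrite Cmod_mult in t3.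
  assert (Cmod (cD (u n) c - l) * Cmod (w - c) <= e / (4 * r') * r').
  { au. }
  replace (e / (4 * r') * r') with (e / 4) in H0 by (field; lra).
  lra.
Qed.

(** * Zeros and normal families *)
Lemma holball_sub c r c' r' f : holball c r f -> Cmod (c' - c) + r' <= r -> holball c' r' f.
Proof. intros H h z hz. apply H. have t := Cmod_tri z c' c. lra. Qed.

Lemma csum_shift n (b : nat -> C) w :
  csum (S n) (fun k => b k * w ^ k)%C = (b 0%nat + w * csum n (fun k => b (S k) * w ^ k))%C.
Proof.
  induction n. simpl; ring. remember (S n) as m. simpl csum at 1. rewrite IHn. subst m. simpl csum at 2. rewrite Cpow_S. ring.
Qed.

Lemma csum_poly_bound n (b : nat -> C) : exists B, 0 <= B /\ forall w, Cmod w <= 1 -> Cmod (csum n (fun k => b k * w ^ k)%C) <= B.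
Proof.
  induction n as [|n [B [hB IH]]].
  - exists 0. split; [lra|]. intros. simpl. lra.
  - exists (B + Cmod (b n)). have p := Cmod_ge_0 (b n). split; [lra|]. intros w hw. simpl.
    via Cmod_triangle. specialize (IH w hw). rewrite Cmod_mult, Cmod_pow.
    have q := Cmod_ge_0 w. assert (Cmod w ^ n <= 1) by (apply pow_le_1; lra).
    assert (0 <= Cmod w ^ n) by mono. nra.
Qed.

Lemma poly_O n : forall (b : nat -> C) d K, 0 < d ->
  (forall w, 0 < Cmod w < d -> Cmod (csum n (fun k => b k * w ^ k)%C) <= K * Cmod w ^ n) ->
  forall k, (k < n)%nat -> b k = 0.
Proof.
  induction n; intros b d K hd H k hk; [lia|].
  have b0 : b 0%nat = 0.
  { destruct (csum_poly_bound n (fun k => b (S k))) as [B [hB HB]].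
    apply Cmod_small_eq. intros e he. replace (b 0%nat - 0)%C with (b 0%nat) by ring.
    set (A := B + Rabs K + 1). have hK := Rabs_pos K. have hA : 0 < A by (unfold A; lra).
    small s ((1, 1) :: (2, d) :: (A, e) :: nil) as [hs [s1 [s2 [s3 _]]]].
    have ms : Cmod s = s by lra.
    specialize (H (RtoC s) _lra). rewrite csum_shift in H. specialize (HB (RtoC s) _lra). rewrite ms in H.
    have r := Cmod_rev_plus (b 0%nat) (s * csum n (fun k => b (S k) * s ^ k))%C. rewrite Cmod_mult, ms in r.
    assert (K * s ^ S n <= Rabs K * s).
    { simpl. assert (0 <= s ^ n <= 1). { split; [mono|apply pow_le_1; lra]. }
      have a := Rle_abs K. apply Rle_trans with (Rabs K * (s * s ^ n)); [mono|apply Rmult_le_compat_l; nra]. }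

    unfold A in *. nra. }
  destruct k as [|k]; auto.
  apply (IHn (fun k => b (S k)) d K hd); [|lia]. intros w hw. specialize (H w hw). rewrite csum_shift, b0 in H.
  replace (0 + w * csum n (fun k => b (S k) * w ^ k))%C with (w * csum n (fun k => b (S k) * w ^ k))%C in H by ring.
  rewrite Cmod_mult in H. simpl in H. apply Rmult_le_reg_l with (Cmod w); [lra|]. lra.
Qed.

Lemma rem_bounded c r f rho n : holball c r f -> 0 < rho < r ->
  exists K, 0 <= K /\ forall w, Cmod w <= rho / 2 -> Cmod (rem c rho n f w) <= K.
Proof.
  intros H hr. destruct (holball_bounded c r f rho H _lra) as [M [hM0 hM]].
  have q : 0 <= M / rho ^ n by mono.
  exists (M / rho ^ n * 2). split; [lra|]. intros w hw.
  eapply Rle_trans; [apply (tail_bound _ _ _ _ M); [lra| |]|].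
  - intros t _. eapply ccont_circ; eauto; lra.
  - intros t. apply hM. replace (c + cir rho t - c)%C with (cir rho t) by ring. lra.
  - apply Rmult_le_compat_l; auto. apply Rmult_le_reg_r with (rho - Cmod w); [lra|].
    replace (rho / (rho - Cmod w) * (rho - Cmod w)) with rho by (field; lra). lra.
Qed.

(** Any expansion with error [O(w^n)] has the Taylor coefficients. Independence of the radius and
    the coefficients of functions built by hand are obtained in this way. *)
Lemma coef_unique c r f rho n b d K : holball c r f -> 0 < rho < r -> 0 < d ->
  (forall w, 0 < Cmod w < d -> Cmod (f (c + w)%C - csum n (fun k => b k * w ^ k)%C) <= K * Cmod w ^ n) ->
  forall k, (k < n)%nat -> coef c rho k f = b k.
Proof.
  intros H hr hd HK k hk. destruct (rem_bounded c r f rho n H hr) as [K' [hK' HK']].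
  apply Ceq_minus.
  small m ((1, d) :: (2, rho) :: nil) as [hm [m1 [m2 _]]]. apply (poly_O n (fun k => coef c rho k f - b k)%C m (K' + K)); auto.
  intros w hw. specialize (HK w _lra). rewrite (taylor c r f rho n w H) in HK by lra.
  rewrite (csum_ext n _ (fun k => coef c rho k f * w ^ k - b k * w ^ k)%C) by (intros; ring).
  rewrite csum_minus.
  replace (csum n (fun k => coef c rho k f * w ^ k) - csum n (fun k => b k * w ^ k))%C with
   ((csum n (fun k => coef c rho k f * w ^ k) + w ^ n * rem c rho n f w - csum n (fun k => b k * w ^ k)) - w ^ n * rem c rho n f w)%C by ring.
  via Cmod_minus_le. rewrite (Cmod_mult (w ^ n)), Cmod_pow. specialize (HK' w _lra).
  assert (0 <= Cmod w ^ n) by mono. nra.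
Qed.

Lemma coef_O c r f rho n d K : holball c r f -> 0 < rho < r -> 0 < d ->
  (forall w, 0 < Cmod w < d -> Cmod (f (c + w)%C) <= K * Cmod w ^ n) -> forall k, (k < n)%nat -> coef c rho k f = 0.
Proof.
  intros H hr hd HK k hk. apply (coef_unique c r f rho n (fun _ => RtoC 0) d K); auto.
  intros w hw. rewrite csum_0 by (intros; ring). replace (f (c + w)%C - 0)%C with (f (c + w)%C) by ring. au.
Qed.

Lemma coef_indep c r r' f rho rho' k : holball c r f -> 0 < rho < r -> holball c r' f -> 0 < rho' < r' -> coef c rho k f = coef c rho' k f.
Proof.
  intros H hr H' hr'. destruct (rem_bounded c r' f rho' (S k) H' hr') as [K [hK HK]].
  apply (coef_unique c r f rho (S k) (fun k => coef c rho' k f) (rho' / 2) K); auto; [lra|].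
  intros w hw. rewrite (taylor c r' f rho' (S k) w H') by lra.
  replace (csum (S k) (fun k0 => coef c rho' k0 f * w ^ k0) + w ^ S k * rem c rho' (S k) f w - csum (S k) (fun k0 => coef c rho' k0 f * w ^ k0))%C
   with (w ^ S k * rem c rho' (S k) f w)%C by ring.
  rewrite Cmod_mult, Cmod_pow, Rmult_comm. apply Rmult_le_compat_r; au.
Qed.

Lemma coef_0 c r f rho : holball c r f -> 0 < rho < r -> coef c rho 0 f = f c.
Proof.
  intros H hr. have E := taylor c r f rho 1 0 H _lra _lra.
  replace (c + 0)%C with c in E by ring. rewrite E. simpl. ring.
Qed.

Lemma coef_1 c r f rho : holball c r f -> 0 < rho < r -> coef c rho 1 f = cD f c.
Proof.
  intros H hr. destruct (holball_bounded c r f rho H _lra) as [M [hM0 hM]].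
  destruct (est2 c rho f M) as [_ e]; [lra| | |].
  - au.
  - au.
  - apply (coef_unique c r f rho 2 (fun k => match k with O => f c | _ => cD f c end) (rho / 4) (8 * M / rho ^ 2)); auto; [lra|].
    intros w hw. simpl csum. specialize (e w _lra).
    eapply Rle_trans; [|exact e]. apply Req_le. f_equal. simpl. ring.
Qed.

Lemma hol_tail rho n h w : conth h -> (forall t, ccont h t) -> (exists M, forall t, Cmod (h t) <= M) -> Cmod w < rho -> hol (tailm rho n h) w.
Proof.
  intros H0 H [M HM] hw. have p := Cmod_ge_0 w. set (r := (rho - Cmod w) / 2). have hr : 0 < r by mono.
  have hin : forall t, Cmod (t - w) < r -> Cmod t < rho /\ r <= rho - Cmod t.
  { intros t ht. have q := Cmod_rev t w. unfold r in *. lra. }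
  unfold tailm. apply (param_int (fun w t => (h t / cir rho t ^ n * (cir rho t / (cir rho t - w)))%C) w r (M / rho ^ n * (rho / r))); auto.
  - intros th z hz. destruct (hin z hz). apply hol_mult; [au|]. apply hol_div; [au| |apply cir_minus_nz; auto].
    au.
  - intros t th ht. destruct (hin t ht) as [h1 h2]. rewrite Cmod_mult, Cmod_div, Cmod_pow, Cmod_cir by (try lra; apply Cpow_nz, cir_nz; lra).
    assert (0 < / rho ^ n) by pos.
    apply Rmult_le_compat; try apply Cmod_ge_0.
    + au.
    + apply Rmult_le_compat_r; auto. lra.
    + eapply Rle_trans; [apply Cmod_kernel; auto|]. apply Rmult_le_compat_l; [lra|]. apply Rinv_le_contravar; lra.
  - intros t th ht. destruct (hin t ht). apply ccont_tail; auto.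
Qed.

Lemma circ_bounded c r f rho : holball c r f -> 0 <= rho < r -> exists M, forall t, Cmod (f (c + cir rho t)%C) <= M.
Proof.
  intros H hr. destruct (holball_bounded c r f rho H _lra) as [M [_ hM]]. exists M. intros t. apply hM.
  replace (c + cir rho t - c)%C with (cir rho t) by ring. lra.
Qed.

Lemma hol_rem c r f rho n w : holball c r f -> 0 < rho < r -> Cmod w < rho -> hol (rem c rho n f) w.
Proof.
  intros H hr hw. apply hol_tail; auto.
  - intros t _. eapply ccont_circ; eauto; lra.
  - intros t. eapply ccont_circ; eauto; lra.
  - eapply circ_bounded; eauto; lra.
Qed.

(** Cauchy's integral for the derivative, on a circle that follows the moving point [w0 t].
    Holomorphy of a derivative is the case where [G] does not depend on [t]. *)
Lemma hol_partial (G : C -> C -> C) (w0 : C -> C) t0 r eta M : 0 < r -> 0 < eta ->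
  (forall t, Cmod (t - t0) < r -> holball (w0 t) (2 * eta) (G t)) ->
  (forall z, Cmod z = eta -> holball t0 r (fun t => G t (w0 t + z)%C)) ->
  (forall t z, Cmod (t - t0) < r -> Cmod z = eta -> Cmod (G t (w0 t + z)%C) <= M) ->
  hol (fun t => cD (G t) (w0 t)) t0.
Proof.
  intros hr he H1 H2 HM.
  apply (hol_ext (fun t => mean (fun th => (G t (w0 t + cir eta th) / cir eta th ^ 1)%C)) _ t0 r hr).
  { intros t ht. apply (coef_1 (w0 t) (2 * eta) (G t) eta); au. }
  have hc : forall th, Cmod (cir eta th) = eta by (intros; apply Cmod_cir; lra).
  apply (param_int (fun t th => (G t (w0 t + cir eta th) / cir eta th ^ 1)%C) t0 r (M / eta)); auto.
  - intros th t ht. apply hol_div; [|au|apply Cpow_nz, cir_nz; auto]. au.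
  - intros t th ht. rewrite Cmod_div, Cmod_pow, hc, pow_1 by (apply Cpow_nz, cir_nz; auto).
    apply Rmult_le_compat_r; [mono|]. au.
  - intros t th ht. apply ccont_coef; auto. apply (ccont_circ (w0 t) (2 * eta)); auto; lra.
Qed.

Lemma holball_cD c r f : holball c r f -> holball c r (cD f).
Proof.
  intros H z hz. set (e := (r - Cmod (z - c)) / 4). have he : 0 < e by mono.
  destruct (holball_bounded c r f (r - e) H _lra) as [M [_ hM]].
  apply (hol_partial (fun _ => f) (fun t => t) z e e M); auto.
  - intros t ht. apply (holball_sub c r); auto. have q := Cmod_tri t z c. unfold e in *. lra.
  - intros w hw t ht. apply (hol_comp (fun t => t + w)%C f); [au|].
    apply H. replace (t + w - c)%C with ((t - z) + (w + (z - c)))%C by ring.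
    have q := Cmod_triangle (t - z) (w + (z - c)). have q' := Cmod_triangle w (z - c). unfold e in *. lra.
  - intros t w ht hw. apply hM. replace (t + w - c)%C with ((t - z) + (w + (z - c)))%C by ring.
    have q := Cmod_triangle (t - z) (w + (z - c)). have q' := Cmod_triangle w (z - c). unfold e in *. lra.
Qed.

(** Cauchy's formula for [1 / f]. Below it plays the role of Rouche's theorem: a function that is
    larger on a circle than at the centre has a zero in the disc. *)
Lemma min_principle c r f rho m : holball c r f -> 0 < rho < r -> (forall z, Cmod (z - c) < r -> f z <> 0) ->
  0 < m -> (forall t, m <= Cmod (f (c + cir rho t)%C)) -> m <= Cmod (f c).
Proof.
  intros H hr hz hm HM.
  have h0 : f c <> 0 by au.
  have H' : holball c r (fun z => / f z)%C by (intros z hz'; apply hol_inv; auto).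
  have hp := Cmod_pos _ h0.
  have E := cauchy_formula c r _ rho 0 H' _lra _lra. simpl in E.
  replace (c + 0)%C with c in E by ring.
  have B : Cmod (/ f c) <= / m.
  { rewrite <- E. apply mean_bound.
    - intros t _. apply ccont_mult; [eapply (ccont_circ c r (fun z => / f z)%C); eauto; lra|au].
    - intros t _. replace (cir rho t / (cir rho t - 0))%C with (RtoC 1) by (field; apply cir_nz; lra).
      rewrite Cmult_1_r, Cmod_inv.
      + apply Rinv_le_contravar; auto.
      + apply hz. replace (c + cir rho t - c)%C with (cir rho t) by ring. lra. }
  rewrite Cmod_inv in B by auto. apply Rinv_le_contravar in B; [|pos].
  rewrite !Rinv_inv in B. lra.
Qed.

Lemma rem_step c r f rho n w : holball c r f -> 0 < rho < r -> Cmod w < rho -> rem c rho n f w = (coef c rho n f + w * rem c rho (S n) f w)%C.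
Proof.
  intros H hr hw. have Cf : forall t, ccont (fun t => f (c + cir rho t)%C) t by (intros; eapply ccont_circ; eauto; lra).
  unfold rem, coef, tailm. rewrite <- mean_scal by (intros t _; apply ccont_tail; auto).
  rewrite <- mean_plus.
  - apply mean_ext. intros t _. rewrite Cpow_S.
    have a1 := cir_minus_nz rho t w hw. have a2 : cir rho t <> 0 by au.
    field. repeat split; auto. apply Cpow_nz; auto.
  - intros t _. apply ccont_coef; auto; lra.
  - intros t _. apply ccont_scal, ccont_tail; auto.
Qed.

Lemma taylor0 c r f rho n w : holball c r f -> 0 < rho < r -> Cmod w < rho -> (forall k, (k < n)%nat -> coef c rho k f = 0) ->
  f (c + w)%C = (w ^ n * rem c rho n f w)%C.
Proof.
  intros H hr hw H0. rewrite (taylor c r f rho n w H) by lra. rewrite csum_0; [ring|]. intros k hk. rewrite H0 by auto. ring.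
Qed.

Lemma coefs_zero c r f rho : holball c r f -> 0 < rho < r -> (forall k, coef c rho k f = 0) -> forall w, Cmod (w - c) < r -> f w = 0.
Proof.
  intros H hr H0 w hw. set (v := (w - c)%C) in *. replace w with (c + v)%C by (unfold v; ring).
  have pv := Cmod_ge_0 v. set (s := (Cmod v + r) / 2). have hs : 0 < s < r by (unfold s; lra). have hvs : Cmod v < s by (unfold s; lra).
  have H1 : forall k, coef c s k f = 0 by (intros k; rewrite <- (H0 k); eapply coef_indep; eauto).
  destruct (circ_bounded c r f s H _lra) as [M HM].
  have Cf : conth (fun t => f (c + cir s t)%C) by (intros t _; eapply ccont_circ; eauto; lra).
  have hM : 0 <= M by (eapply Rle_trans; [mono|apply (HM 0)]).
  have ks : 0 < s / (s - Cmod v) by pos.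
  have q0 : 0 <= Cmod v / s < 1.
  { split; [mono|].
    apply Rmult_lt_reg_r with s; [lra|]. field_simplify; lra. }
  apply Cmod_small_eq. intros e he. replace (f (c + v)%C - 0)%C with (f (c + v)%C) by ring.
  set (A := (M + 1) * (s / (s - Cmod v))). have hA : 0 < A by (unfold A; nra).
  destruct (pow_small (Cmod v / s) (e / A)) as [n hn]; auto. { pos. }
  specialize (hn n (le_n _)).
  rewrite (taylor0 c r f s n v); auto. rewrite Cmod_mult, Cmod_pow.
  eapply Rle_trans; [apply Rmult_le_compat_l; [apply pow_le; auto|apply (tail_bound _ s n v M); auto]|].
  replace (Cmod v ^ n * (M / s ^ n * (s / (s - Cmod v)))) with ((Cmod v / s) ^ n * (M * (s / (s - Cmod v)))).
  2:{ unfold Rdiv. rewrite Rpow_mult_distr, pow_inv. ring. }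
  apply Rle_trans with (e / A * A); [|apply Req_le; field; lra].
  apply Rmult_le_compat; auto; [apply pow_le; lra|nra|unfold A; nra].
Qed.

Lemma order_exists c r f : 0 < r -> holball c r f -> ~ (forall w, Cmod (w - c) < r -> f w = 0) ->
  exists k, (forall rho j, 0 < rho < r -> (j < k)%nat -> coef c rho j f = 0) /\ (forall rho, 0 < rho < r -> coef c rho k f <> 0).
Proof.
  intros hr H Hn. set (s := r / 2). have hs : 0 < s < r by (unfold s; lra).
  destruct (classic (exists k, coef c s k f <> 0)) as [[k hk]|h].
  - destruct (Wf_nat.dec_inh_nat_subset_has_unique_least_element (fun k => coef c s k f <> 0)) as [m [[h1 h2] _]].
    + intros n. apply classic.
    + exists k; auto.
    + exists m. split.
      * intros rho j hrho hj. rewrite (coef_indep c r r f rho s) by auto. apply NNPP. intros h. specialize (h2 j h). lia.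
      * intros rho hrho. rewrite (coef_indep c r r f rho s) by auto. au.
  - exfalso. apply Hn. apply (coefs_zero c r f s H hs). intros k. apply NNPP. intros hk. apply h. exists k; auto.
Qed.

Lemma local_form c r f : 0 < r -> holball c r f -> ~ (forall w, Cmod (w - c) < r -> f w = 0) ->
  exists k u, holball 0 (r / 2) u /\ u 0 <> 0 /\ (forall w, Cmod w < r / 2 -> f (c + w)%C = (w ^ k * u w)%C) /\
   (forall rho, 0 < rho < r -> coef c rho k f = u 0) /\ (forall rho j, 0 < rho < r -> (j < k)%nat -> coef c rho j f = 0).
Proof.
  intros hr H Hn. destruct (order_exists c r f hr H Hn) as [k [h1 h2]].
  set (s := r / 2). have hs : 0 < s < r by (unfold s; lra).
  have u0 : rem c s k f 0 = coef c s k f.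
  { rewrite (rem_step c r f s k 0) by au. ring. }
  exists k, (rem c s k f). split; [|split; [|split; [|split]]].
  - intros z hz. replace (z - 0)%C with z in hz by ring. apply (hol_rem c r); auto.
  - rewrite u0. au.
  - intros w hw. apply (taylor0 c r); auto.
  - intros rho hrho. rewrite u0. apply (coef_indep c r r); auto.
  - au.
Qed.

Lemma local_lower c r f : 0 < r -> holball c r f -> ~ (forall w, Cmod (w - c) < r -> f w = 0) ->
  exists k d a, 0 < d /\ 0 < a /\ forall w, Cmod w < d -> a * Cmod w ^ k <= Cmod (f (c + w)%C).
Proof.
  intros hr H Hn. destruct (local_form c r f hr H Hn) as [k [u [hu [u0 [E _]]]]].
  have p := Cmod_pos _ u0.
  destruct (hol_cont u 0 (hu 0 _lra) (Cmod (u 0) / 2) _lra) as [d [hd hc]].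
  small m ((1, d) :: (2, r) :: nil) as [hm [m1 [m2 _]]]. exists k, m, (Cmod (u 0) / 2). split; [auto|]. split; [lra|]. intros w hw. rewrite E by lra. rewrite Cmod_mult, Cmod_pow, Rmult_comm.
  apply Rmult_le_compat_l; [mono|]. specialize (hc w).
  replace (w - 0)%C with w in hc by ring. specialize (hc _lra).
  have q := Cmod_rev (u 0) (u w). rewrite Cmod_sym in q. lra.
Qed.

Lemma isolated c r f : 0 < r -> holball c r f -> ~ (forall w, Cmod (w - c) < r -> f w = 0) ->
  exists d, 0 < d /\ forall w, 0 < Cmod (w - c) < d -> f w <> 0.
Proof.
  intros hr H Hn. destruct (local_lower c r f hr H Hn) as [k [d [a [hd [ha L]]]]].
  exists d. split; auto. intros w hw. apply Cmod_neq0. specialize (L (w - c)%C _lra).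
  replace (c + (w - c))%C with w in L by ring. assert (0 < Cmod (w - c) ^ k) by pos. nra.
Qed.

Lemma identity_thm c r f : 0 < r -> holball c r f ->
  (forall d, 0 < d -> exists w, 0 < Cmod (w - c) < d /\ f w = 0) -> forall w, Cmod (w - c) < r -> f w = 0.
Proof.
  intros hr H Hz. apply NNPP. intros Hn. destruct (isolated c r f hr H Hn) as [d [hd h]].
  destruct (Hz d hd) as [w [hw e]]. apply (h w hw e).
Qed.

(** * Subsequences and Montel's theorem *)

Definition strictly (phi : nat -> nat) := forall n, (phi n < phi (S n))%nat.

Lemma strictly_ge phi : strictly phi -> forall n, (n <= phi n)%nat.
Proof. intros H n. induction n; [lia|]. specialize (H n). lia. Qed.

(** Until the diagonal extraction, subsequences are infinite sets of indices: predicates are easier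
    to split and to intersect than increasing maps. *)
Definition infn (A : nat -> Prop) := forall N, exists n, (N <= n)%nat /\ A n.

Lemma infn_split A B : infn A -> infn (fun n => A n /\ B n) \/ infn (fun n => A n /\ ~ B n).
Proof.
  intros H. apply NNPP. intros h. apply not_or_and in h. destruct h as [h1 h2].
  apply not_all_ex_not in h1. destruct h1 as [N1 h1]. apply not_all_ex_not in h2. destruct h2 as [N2 h2].
  destruct (H (max N1 N2)) as [n [hn an]].
  destruct (classic (B n)); [apply h1|apply h2]; exists n; repeat split; auto; lia.
Qed.

Lemma pigeon_R (m : nat) : forall (u : nat -> R) A a e, infn A -> 0 < e -> (forall n, A n -> a <= u n <= a + INR m * e) ->
  exists A', infn A' /\ (forall n, A' n -> A n) /\ forall n k, A' n -> A' k -> Rabs (u n - u k) <= e.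
Proof.
  induction m; intros u A a e HA he Hu.
  - exists A. split; auto. split; auto. intros n k hn hk. apply Hu in hn. apply Hu in hk. simpl in *. lra.
  - destruct (infn_split A (fun n => u n <= a + e) HA) as [h|h].
    + exists (fun n => A n /\ u n <= a + e). split; auto. split; [tauto|]. intros n k [hn1 hn2] [hk1 hk2].
      apply Hu in hn1. apply Hu in hk1. apply Rabs_le. lra.
    + destruct (IHm u _ (a + e) e h he) as [A' [h1 [h2 h3]]].
      * intros n [hn1 hn2]. apply Hu in hn1. rewrite S_INR in hn1. lra.
      * exists A'. split; auto. split; auto. intros n hn. apply h2; auto.
Qed.

Lemma pigeon_C (u : nat -> C) A B e : infn A -> 0 < e -> (forall n, A n -> Cmod (u n) <= B) ->
  exists A', infn A' /\ (forall n, A' n -> A n) /\ forall n k, A' n -> A' k -> Cmod (u n - u k) <= e.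
Proof.
  intros HA he HB.
  have Q : exists m : nat, 2 * B <= INR m * (e / 2).
  { destruct (INR_unbounded (2 * B / (e / 2))) as [m hm]. exists m.
    apply Rle_trans with (2 * B / (e / 2) * (e / 2)); [apply Req_le; field; lra|]. au. }
  destruct Q as [m hm].
  destruct (pigeon_R m (fun n => Re (u n)) A (- B) (e / 2) HA _lra) as [A1 [a1 [a2 a3]]].
  { intros n hn. specialize (HB n hn). have h := re_le (u n). apply Rabs_le_between in h. lra. }
  destruct (pigeon_R m (fun n => Im (u n)) A1 (- B) (e / 2) a1 _lra) as [A2 [b1 [b2 b3]]].
  { intros n hn. specialize (HB n (a2 n hn)). have h := im_le (u n). apply Rabs_le_between in h. lra. }
  exists A2. split; auto. split; auto. intros n k hn hk.
  via Cmod_2Rmax.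
  have s2 : sqrt 2 <= 2.
  { rewrite <- (sqrt_Rsqr 2) at 2 by lra. apply sqrt_le_1; unfold Rsqr; lra. }
  have X : Rmax (Rabs (fst (u n - u k)%C)) (Rabs (snd (u n - u k)%C)) <= e / 2.
  { apply Rmax_lub; [apply (a3 n k); auto|apply (b3 n k); auto]. }
  assert (0 <= Rmax (Rabs (fst (u n - u k)%C)) (Rabs (snd (u n - u k)%C))) by (eapply Rle_trans; [apply Rabs_pos|apply Rmax_l]).
  have s3 := sqrt_pos 2. nra.
Qed.

Lemma pigeon_coefs (K : nat) (u : nat -> nat -> C) A (B : nat -> R) e : infn A -> 0 < e -> (forall k n, A n -> Cmod (u k n) <= B k) ->
  exists A', infn A' /\ (forall n, A' n -> A n) /\ forall k n m, (k < K)%nat -> A' n -> A' m -> Cmod (u k n - u k m) <= e.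
Proof.
  intros HA he HB. induction K.
  - exists A. split; auto. split; auto. intros; lia.
  - destruct IHK as [A1 [a1 [a2 a3]]].
    destruct (pigeon_C (u K) A1 (B K) e a1 he) as [A2 [b1 [b2 b3]]]; [mono|].
    exists A2. split; auto. split; auto. intros k n m hk hn hm.
    destruct (Nat.eq_dec k K) as [->|]; auto. au.
Qed.

(** On the smaller disc a function bounded by [M] is determined up to [e / 4] by its first [K]
    coefficients, the remainder being geometric in [r1 / s]; the pigeonhole principle makes these
    finitely many coefficients nearly equal. *)
Lemma montel_step (u : nat -> C -> C) r r1 M A e : 0 < r1 < r -> (forall n, holball 0 r (u n)) ->
  (forall n z, Cmod z < r -> Cmod (u n z) <= M) -> infn A -> 0 < e ->
  exists A', infn A' /\ (forall n, A' n -> A n) /\ forall n m z, A' n -> A' m -> Cmod z <= r1 -> Cmod (u n z - u m z) <= e.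
Proof.
  intros hr H HM HA he. set (s := (r1 + r) / 2). have hs : r1 < s < r by (unfold s; lra).
  have hM : 0 <= M by (eapply Rle_trans; [mono|apply (HM 0%nat 0); rewrite Cmod_0; lra]).
  have Cf : forall n, conth (fun t => u n (0 + cir s t)%C) by (intros n t _; eapply ccont_circ; eauto; lra).
  have Bf : forall n t, Cmod (u n (0 + cir s t)%C) <= M.
  { intros. apply HM. lra. }
  set (A0 := (M + 1) * (s / (s - r1))). have ks : 0 < s / (s - r1) by pos. have hA0 : 0 < A0 by mono.
  have q0 : 0 <= r1 / s < 1.
  { split; [mono|]. apply Rmult_lt_reg_r with s; [lra|]. field_simplify; lra. }
  destruct (pow_small (r1 / s) (e / (4 * A0))) as [K hK]; auto. { pos. }
  specialize (hK K (le_n _)).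
  set (P := Rmax 1 r1 ^ K). have hP : 1 <= P by (apply pow_R1_Rle, Rmax_l).
  destruct (pigeon_coefs K (fun k n => coef 0 s k (u n)) A (fun k => M / s ^ k) (e / (2 * (INR K + 1) * P)) HA) as [A' [a1 [a2 a3]]].
  { apply Rdiv_lt_0_compat; auto. have q := pos_INR K. nra. }
  { intros k n _. apply coef_bound; auto; lra. }
  exists A'. split; auto. split; auto. intros n m z hn hm hz.
  have T : forall n, u n z = (csum K (fun k => coef 0 s k (u n) * z ^ k) + z ^ K * rem 0 s K (u n) z)%C.
  { intros i. rewrite <- (taylor 0 r (u i) s K z (H i)) by lra. f_equal. ring. }
  rewrite !T.
  replace (csum K (fun k => coef 0 s k (u n) * z ^ k) + z ^ K * rem 0 s K (u n) z - (csum K (fun k => coef 0 s k (u m) * z ^ k) + z ^ K * rem 0 s K (u m) z))%C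
   with ((csum K (fun k => coef 0 s k (u n) * z ^ k) - csum K (fun k => coef 0 s k (u m) * z ^ k)) + (z ^ K * rem 0 s K (u n) z - z ^ K * rem 0 s K (u m) z))%C by ring.
  rewrite <- csum_minus.
  have qz := Cmod_ge_0 z.
  have R1 : forall i, Cmod (z ^ K * rem 0 s K (u i) z) <= e / 4.
  { intros i. rewrite Cmod_mult, Cmod_pow.
    have b := tail_bound (fun t => u i (0 + cir s t)%C) s K z M _lra (Cf i) (Bf i).
    eapply Rle_trans; [apply Rmult_le_compat_l; [mono|exact b]|].
    have k1 : s / (s - Cmod z) <= s / (s - r1) by (apply Rmult_le_compat_l; [lra|apply Rinv_le_contravar; lra]).
    have k2 : 0 < s / (s - Cmod z) by pos.
    have k3 : Cmod z ^ K <= r1 ^ K by mono.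
    have k4 : 0 <= Cmod z ^ K by mono.
    have k5 : 0 < / s ^ K by pos.
    apply Rle_trans with ((r1 / s) ^ K * A0).
    - replace (Cmod z ^ K * (M / s ^ K * (s / (s - Cmod z)))) with ((Cmod z ^ K * / s ^ K) * (M * (s / (s - Cmod z)))) by lra.
      replace ((r1 / s) ^ K) with (r1 ^ K * / s ^ K) by (unfold Rdiv; rewrite Rpow_mult_distr, pow_inv; auto).
      apply Rmult_le_compat; [nra|nra|nra|]. unfold A0. mono.
    - apply Rle_trans with (e / (4 * A0) * A0); [mono|]. apply Req_le; field; lra. }
  have R2 : Cmod (csum K (fun k => coef 0 s k (u n) * z ^ k - coef 0 s k (u m) * z ^ k)%C) <= e / 2.
  { via (csum_bound K _ (e / (2 * (INR K + 1) * P) * P)).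
    - intros k hk. replace (coef 0 s k (u n) * z ^ k - coef 0 s k (u m) * z ^ k)%C with ((coef 0 s k (u n) - coef 0 s k (u m)) * z ^ k)%C by ring.
      rewrite Cmod_mult, Cmod_pow. apply Rmult_le_compat; try apply Cmod_ge_0; [mono|mono|].
      apply Rle_trans with (Rmax 1 r1 ^ k).
      + apply pow_incr. split; auto. eapply Rle_trans; [exact hz|apply Rmax_r].
      + apply Rle_pow; [apply Rmax_l|lia].
    - have q := pos_INR K. apply Rle_trans with (INR K * (e / (2 * (INR K + 1)))); [apply Req_le; field; lra|].
      apply Rmult_le_reg_r with (2 * (INR K + 1)); [lra|]. replace (INR K * (e / (2 * (INR K + 1))) * (2 * (INR K + 1))) with (INR K * e) by (field; lra). nra. }
  via Cmod_triangle.
  have b := Cmod_minus_le (z ^ K * rem 0 s K (u n) z) (z ^ K * rem 0 s K (u m) z). have b1 := R1 n. have b2 := R1 m. lra.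
Qed.

Lemma montel (u : nat -> C -> C) r r1 M : 0 < r1 < r -> (forall n, holball 0 r (u n)) ->
  (forall n z, Cmod z < r -> Cmod (u n z) <= M) ->
  exists phi f, strictly phi /\ forall e, 0 < e -> exists N, forall n z, (N <= n)%nat -> Cmod z <= r1 -> Cmod (u (phi n) z - f z) <= e.
Proof.
  intros hr H HM.
  set (T := {A : nat -> Prop | infn A}).
  have step : forall (A : T) (k : nat), exists A' : T, (forall n, proj1_sig A' n -> proj1_sig A n) /\
     forall n m z, proj1_sig A' n -> proj1_sig A' m -> Cmod z <= r1 -> Cmod (u n z - u m z) <= (/ 2) ^ k.
  { intros [A hA] k. destruct (montel_step u r r1 M A ((/ 2) ^ k) hr H HM hA) as [A' [a1 [a2 a3]]]; [pos|].
    exists (exist _ A' a1). au. }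
  set (nx := fun A k => proj1_sig (constructive_indefinite_description _ (step A k))).
  have nxs : forall A k, (forall n, proj1_sig (nx A k) n -> proj1_sig A n) /\
     forall n m z, proj1_sig (nx A k) n -> proj1_sig (nx A k) m -> Cmod z <= r1 -> Cmod (u n z - u m z) <= (/ 2) ^ k.
  { intros A k. unfold nx. destruct constructive_indefinite_description; auto. }
  have tt0 : infn (fun _ => True) by (intros N; exists N; auto).
  (* Nested infinite sets of indices, with oscillation at most [2^(-k)] on the [k]-th one; [phi]
     picks an index in each, increasingly. *)
  set (As := fix As k : T := match k with O => nx (exist _ _ tt0) O | S k => nx (As k) (S k) end).
  have mono : forall k j n, proj1_sig (As (j + k)%nat) n -> proj1_sig (As k) n.
  { intros k j n. induction j; auto. intros h. apply IHj. simpl in h. apply (proj1 (nxs _ _)) in h. au. }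
  have close : forall k n m z, proj1_sig (As k) n -> proj1_sig (As k) m -> Cmod z <= r1 -> Cmod (u n z - u m z) <= (/ 2) ^ k.
  { intros k. destruct k; apply (proj2 (nxs _ _)). }
  set (pk := fun k N => proj1_sig (constructive_indefinite_description _ (proj2_sig (As k) N))).
  have pks : forall k N, (N <= pk k N)%nat /\ proj1_sig (As k) (pk k N).
  { intros k N. unfold pk. destruct constructive_indefinite_description; auto. }
  set (phi := fix phi k := match k with O => pk O O | S k => pk (S k) (S (phi k)) end).
  have phiA : forall k, proj1_sig (As k) (phi k) by (intros k; destruct k; apply pks).
  have cl : forall k n m z, (k <= n)%nat -> (k <= m)%nat -> Cmod z <= r1 -> Cmod (u (phi n) z - u (phi m) z) <= (/ 2) ^ k.
  { intros k n m z hn hm hz. apply close; auto.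
    - apply (mono k (n - k)%nat). replace (n - k + k)%nat with n by lia. au.
    - apply (mono k (m - k)%nat). replace (m - k + k)%nat with m by lia. au. }
  have L : forall z, exists l, Cmod z <= r1 -> forall k n, (k <= n)%nat -> Cmod (u (phi n) z - l) <= (/ 2) ^ k.
  { intros z. destruct (Rle_dec (Cmod z) r1) as [hz|hz]; [|exists 0; intros; contradiction].
    destruct (C_cauchy (fun n => u (phi n) z)) as [l hl].
    - intros e he. destruct (pow_small (/2) e _lra he) as [N hN]. exists N. intros n m hn hm.
      via (cl N n m z hn hm hz). au.
    - exists l. intros _ k n hn. apply le_epsilon. intros e he. destruct (hl e he) as [N hN].
      via (Cmod_tri _ (u (phi (n + N)%nat) z)).
      apply Rplus_le_compat; au. }
  exists phi, (fun z => proj1_sig (constructive_indefinite_description _ (L z))). split.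
  - intros n. simpl. destruct (pks (S n) (S (phi n))) as [h _]. lia.
  - intros e he. destruct (pow_small (/2) e _lra he) as [N hN]. exists N. intros n z hn hz.
    destruct (constructive_indefinite_description _ (L z)) as [l hl]; simpl.
    via (hl hz N n hn). au.
Qed.

(** * Several variables and implicit functions *)
(** Holomorphy in several variables is tested on holomorphic curves, which makes composition and
    restriction immediate. Total differentiability is recovered at the end, in
    [holomorphic2_graph]. *)
Definition hol3 (P : C -> C -> C -> Prop) (F : C -> C -> C -> C) : Prop :=
  forall g1 g2 g3 t0 r, 0 < r ->
  (forall t, Cmod (t - t0) < r -> hol g1 t /\ hol g2 t /\ hol g3 t /\ P (g1 t) (g2 t) (g3 t)) ->
  hol (fun t => F (g1 t) (g2 t) (g3 t)) t0.
Definition hol2 (P : C -> C -> Prop) (F : C -> C -> C) : Prop :=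
  forall g1 g2 t0 r, 0 < r ->
  (forall t, Cmod (t - t0) < r -> hol g1 t /\ hol g2 t /\ P (g1 t) (g2 t)) ->
  hol (fun t => F (g1 t) (g2 t)) t0.

Definition pd3 a b c : C -> C -> C -> Prop := fun x u y => Cmod x < a /\ Cmod u < b /\ Cmod y < c.
Definition pd2 a c : C -> C -> Prop := fun x y => Cmod x < a /\ Cmod y < c.
#[global] Hint Unfold pd2 pd3 : hd.

Lemma ball_shrink (t0 t : C) r : Cmod (t - t0) < r -> 0 < r - Cmod (t - t0) /\
  forall s, Cmod (s - t) < r - Cmod (t - t0) -> Cmod (s - t0) < r.
Proof. intros h. split; [lra|]. intros s hs. have q := Cmod_tri s t t0. lra. Qed.

Lemma hol3_ball P F g1 g2 g3 t0 r : hol3 P F ->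
  (forall t, Cmod (t - t0) < r -> hol g1 t /\ hol g2 t /\ hol g3 t /\ P (g1 t) (g2 t) (g3 t)) ->
  holball t0 r (fun t => F (g1 t) (g2 t) (g3 t)).
Proof. intros H h t ht. destruct (ball_shrink t0 t r ht) as [a b]. apply (H g1 g2 g3 t _ a). au. Qed.
Lemma hol2_ball P F g1 g2 t0 r : hol2 P F ->
  (forall t, Cmod (t - t0) < r -> hol g1 t /\ hol g2 t /\ P (g1 t) (g2 t)) ->
  holball t0 r (fun t => F (g1 t) (g2 t)).
Proof. intros H h t ht. destruct (ball_shrink t0 t r ht) as [a b]. apply (H g1 g2 t _ a). au. Qed.

Lemma hol3_sub (P Q : C -> C -> C -> Prop) F : (forall x u y, Q x u y -> P x u y) -> hol3 P F -> hol3 Q F.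
Proof. intros I H g1 g2 g3 t0 r hr h. apply (H g1 g2 g3 t0 r hr). intros t ht. destruct (h t ht) as [a [b [c d]]]. au. Qed.
Lemma hol2_sub (P Q : C -> C -> Prop) F : (forall x y, Q x y -> P x y) -> hol2 P F -> hol2 Q F.
Proof. intros I H g1 g2 t0 r hr h. apply (H g1 g2 t0 r hr). intros t ht. destruct (h t ht) as [a [b c]]. au. Qed.

Lemma hol3_swap P F : hol3 P F -> hol3 (fun x u y => P x y u) (fun x u y => F x y u).
Proof. intros H g1 g2 g3 t0 r hr h. apply (H g1 g3 g2 t0 r hr). intros t ht. destruct (h t ht) as [a [b [c d]]]. au. Qed.

Lemma hol3_y P F x u c r : hol3 P F -> (forall y, Cmod (y - c) < r -> P x u y) -> holball c r (F x u).
Proof.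
  intros H h. apply (hol3_ball P F (fun _ => x) (fun _ => u) (fun y => y)); auto. au.
Qed.
Lemma hol3_u P F x y c r : hol3 P F -> (forall u, Cmod (u - c) < r -> P x u y) -> holball c r (fun u => F x u y).
Proof.
  intros H h. apply (hol3_ball P F (fun _ => x) (fun u => u) (fun _ => y)); auto. au.
Qed.
Lemma hol3_x P F u y c r : hol3 P F -> (forall x, Cmod (x - c) < r -> P x u y) -> holball c r (fun x => F x u y).
Proof.
  intros H h. apply (hol3_ball P F (fun x => x) (fun _ => u) (fun _ => y)); auto. au.
Qed.
Lemma hol2_y P F x c r : hol2 P F -> (forall y, Cmod (y - c) < r -> P x y) -> holball c r (F x).
Proof.
  intros H h. apply (hol2_ball P F (fun _ => x) (fun y => y)); auto. au.
Qed.
Lemma hol2_x P F y c r : hol2 P F -> (forall x, Cmod (x - c) < r -> P x y) -> holball c r (fun x => F x y).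
Proof.
  intros H h. apply (hol2_ball P F (fun x => x) (fun _ => y)); auto. au.
Qed.

Lemma lip0 r a f M x x' : 0 < a -> holball 0 r f -> (forall w, Cmod w < r -> Cmod (f w) <= M) -> Cmod x <= r - a -> Cmod x' <= r - a ->
  Cmod (f x' - f x) <= 2 * M / a * Cmod (x' - x).
Proof.
  intros ha H HM hx hx'. replace (2 * M / a) with (2 * M / (r - (r - a))) by (f_equal; ring).
  apply (lip_ball 0 r (r - a)); auto; try lra; intros; rewrite ?C0r in *; auto.
Qed.

Lemma lip3 a b c al be ga M F : 0 < al -> 0 < be -> 0 < ga ->
  hol3 (pd3 a b c) F -> (forall x u y, pd3 a b c x u y -> Cmod (F x u y) <= M) ->
  forall x u y x' u' y', Cmod x <= a - al -> Cmod x' <= a - al -> Cmod u <= b - be -> Cmod u' <= b - be ->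
  Cmod y <= c - ga -> Cmod y' <= c - ga ->
  Cmod (F x' u' y' - F x u y) <= 2 * M / al * Cmod (x' - x) + 2 * M / be * Cmod (u' - u) + 2 * M / ga * Cmod (y' - y).
Proof.
  intros ha hb hc H HM x u y x' u' y' hx hx' hu hu' hy hy'.
  replace (F x' u' y' - F x u y)%C with ((F x' u' y' - F x u' y') + (F x u' y' - F x u y') + (F x u y' - F x u y))%C by ring.
  via Cmod_triangle. apply Rplus_le_compat; [via Cmod_triangle; apply Rplus_le_compat|].
  - apply (lip0 a al (fun x => F x u' y') M); auto.
    + apply (hol3_x (pd3 a b c)); auto. au.
    + au.
  - apply (lip0 b be (fun u => F x u y') M); auto.
    + apply (hol3_u (pd3 a b c)); auto. au.
    + au.
  - apply (lip0 c ga (fun y => F x u y) M); auto.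
    + apply (hol3_y (pd3 a b c)); auto. au.
    + au.
Qed.

Lemma lip2 a c al ga M F : 0 < al -> 0 < ga ->
  hol2 (pd2 a c) F -> (forall x y, pd2 a c x y -> Cmod (F x y) <= M) ->
  forall x y x' y', Cmod x <= a - al -> Cmod x' <= a - al -> Cmod y <= c - ga -> Cmod y' <= c - ga ->
  Cmod (F x' y' - F x y) <= 2 * M / al * Cmod (x' - x) + 2 * M / ga * Cmod (y' - y).
Proof.
  intros ha hc H HM x y x' y' hx hx' hy hy'.
  replace (F x' y' - F x y)%C with ((F x' y' - F x y') + (F x y' - F x y))%C by ring.
  via Cmod_triangle. apply Rplus_le_compat.
  - apply (lip0 a al (fun x => F x y') M); auto.
    + apply (hol2_x (pd2 a c)); auto. au.
    + au.
  - apply (lip0 c ga (fun y => F x y) M); auto.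
    + apply (hol2_y (pd2 a c)); auto. au.
    + au.
Qed.

Lemma hol3_dy (P P' : C -> C -> C -> Prop) ga M F : 0 < ga -> hol3 P F -> (forall x u y, P x u y -> Cmod (F x u y) <= M) ->
  (forall x u y y', P' x u y -> Cmod (y' - y) < ga -> P x u y') ->
  hol3 P' (fun x u y => cD (F x u) y) /\ forall x u y, P' x u y -> Cmod (cD (F x u) y) <= 2 * M / ga.
Proof.
  intros hg H HM HP. split.
  - intros g1 g2 g3 t0 r hr h.
    apply (hol_partial (fun t => F (g1 t) (g2 t)) g3 t0 r (ga / 2) M); auto; [lra| | |].
    + intros t ht. apply (hol3_y P); auto. intros y hy. destruct (h t ht) as [_ [_ [_ k]]]. apply (HP _ _ (g3 t)); auto. lra.
    + intros z hz. apply (hol3_ball P F g1 g2 (fun t => g3 t + z)%C); auto. intros t ht.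
      destruct (h t ht) as [k1 [k2 [k3 k]]]. repeat split; auto.
      * au.
      * apply (HP _ _ (g3 t)); auto. replace (g3 t + z - g3 t)%C with z by ring. lra.
    + intros t z ht hz. destruct (h t ht) as [_ [_ [_ k]]]. apply HM. apply (HP _ _ (g3 t)); auto.
      replace (g3 t + z - g3 t)%C with z by ring. lra.
  - intros x u y h. apply (est2 y ga (F x u) M); auto.
    + apply (hol3_y P); auto. intros y' hy'. apply (HP _ _ y); auto.
    + intros w hw. apply HM. apply (HP _ _ y); auto.
Qed.

(** Newton's iteration with the slope frozen at [l] contracts by one half, uniformly in the
    parameters. There are two parameters because inverting [f x] uses the base point and the value;
    [eta0] lets the caller keep everything in a prescribed disc. *)
Lemma ift (G : C -> C -> C -> C) r M eta0 : 0 < r -> 0 < eta0 -> hol3 (pd3 r r r) G -> (forall x u y, pd3 r r r x u y -> Cmod (G x u y) <= M) ->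
  G 0 0 0 = 0 -> cD (G 0 0) 0 <> 0 ->
  exists d eta W, 0 < d <= eta0 /\ 0 < eta <= eta0 /\ eta < r /\ d < r /\ hol2 (pd2 d d) W /\
   forall p q, pd2 d d p q -> Cmod (W p q) < eta /\ G p q (W p q) = 0 /\ forall w, Cmod w < eta -> G p q w = 0 -> w = W p q.
Proof.
  intros hr he H HM G0 hl. set (l := cD (G 0 0) 0) in *. have hL := Cmod_pos _ hl.
  have m00 : Cmod 0 = 0 by apply Cmod_0.
  have hM : 0 <= M by (eapply Rle_trans; au).
  destruct (hol3_dy (pd3 r r r) (pd3 r r (r / 2)) (r / 2) M G) as [D1 D2]; auto; [lra| |].
  { unfold pd3. intros x u y y' [h1 [h2 h3]] hy. repeat split; auto. have q := Cmod_rev y' y. lra. }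
  set (M1 := 2 * M / (r / 2)) in *.
  have hM1 : 0 <= M1 by (unfold M1; mono).
  set (K := 2 * M1 / (r / 4)). have hK : 0 <= K by (unfold K; mono).
  have LD : forall p q w, Cmod p <= r / 4 -> Cmod q <= r / 4 -> Cmod w <= r / 4 -> Cmod (cD (G p q) w - l) <= K * (Cmod p + Cmod q + Cmod w).
  { intros p q w hp hq hw. have e := lip3 r r (r / 2) (r / 4) (r / 4) (r / 4) M1 (fun x u y => cD (G x u) y) _lra _lra _lra D1 D2 0 0 0 p q w.
    rewrite m00 in e. specialize (e _lra _lra _lra _lra _lra _lra). fold K in e. rewrite !C0r in e. unfold l. lra. }
  set (K2 := 2 * M / (r / 2)). have hK2 : 0 <= K2 by exact hM1.
  have LG : forall p q, Cmod p <= r / 2 -> Cmod q <= r / 2 -> Cmod (G p q 0) <= K2 * (Cmod p + Cmod q).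
  { intros p q hp hq. have e := lip3 r r r (r / 2) (r / 2) (r / 2) M G _lra _lra _lra H HM 0 0 0 p q 0.
    rewrite m00 in e. specialize (e _lra _lra _lra _lra _lra _lra). fold K2 in e. rewrite !C0r, G0, !C0r, m00 in e. lra. }
  small eta ((1, eta0) :: (1, r / 4) :: (6 * (K + 1), Cmod l) :: nil) as [he1 [he2 [he3 he4]]].
  assert (0 < Cmod l * eta) by pos.
  small d ((1, eta) :: (8 * (K2 + 1), Cmod l * eta) :: nil) as [hd [hd1 [hd2 _]]].
  have y1 : K * (3 * eta) <= Cmod l / 2 by lra. have y2 : K2 * (2 * d) <= Cmod l * eta / 4 by lra.
  set (N := fun p q w => (w - G p q w / l)%C).
  have NL : forall p q w w', pd2 d d p q -> Cmod w <= eta -> Cmod w' <= eta -> Cmod (N p q w' - N p q w) <= / 2 * Cmod (w' - w).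
  { intros p q w w' [hp hq] hw hw'.
    apply (MVT_C (N p q) (fun w => 1 - cD (G p q) w / l)%C).
    - intros t ht. have i := seg_in w w' eta t ht hw hw'. set (v := (w + t * (w' - w))%C) in *.
      have Hv : hol (G p q) v.
      { apply (hol3_y (pd3 r r r) G p q 0 r H); [|lra]. au. }
      refine (Cd_eq _ _ _ _ _ (Cd_ext (fun w => w + (- / l) * G p q w)%C _ _ _ 1 _lra _ (Cd_plus _ _ _ _ _ (Cd_id v) (Cd_scal (- / l) _ _ _ (cD_spec _ _ Hv))))).
      + unfold Cdiv. ring.
      + intros. unfold N, Cdiv. ring.
    - intros t ht. have i := seg_in w w' eta t ht hw hw'. set (v := (w + t * (w' - w))%C) in *.
      replace (1 - cD (G p q) v / l)%C with (- (cD (G p q) v - l) / l)%C by (field; auto).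
      rewrite Cmod_div, Cmod_opp by auto. specialize (LD p q v _lra _lra _lra).
      apply Rmult_le_reg_r with (Cmod l); auto. replace (Cmod (cD (G p q) v - l) / Cmod l * Cmod l) with (Cmod (cD (G p q) v - l)) by (field; lra).
      assert (K * (Cmod p + Cmod q + Cmod v) <= K * (3 * eta)) by mono. lra. }
  have N0 : forall p q, pd2 d d p q -> Cmod (N p q 0) <= eta / 4.
  { intros p q [hp hq]. unfold N. replace (0 - G p q 0 / l)%C with (- (G p q 0 / l))%C by ring. rewrite Cmod_opp, Cmod_div by auto.
    apply Rmult_le_reg_r with (Cmod l); auto. replace (Cmod (G p q 0) / Cmod l * Cmod l) with (Cmod (G p q 0)) by (field; lra).
    specialize (LG p q _lra _lra). assert (K2 * (Cmod p + Cmod q) <= K2 * (2 * d)) by mono. lra. }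
  set (Wk := fix Wk k p q : C := match k with O => RtoC 0 | S k => N p q (Wk k p q) end).
  have B : forall k p q, pd2 d d p q -> Cmod (Wk k p q) <= 3 / 4 * eta.
  { induction k; intros p q hp; simpl; [lra|]. specialize (IHk p q hp).
    have e1 := NL p q 0 (Wk k p q) hp _lra _lra. have e2 := N0 p q hp. rewrite C0r in e1.
    have t := Cmod_rev (N p q (Wk k p q)) (N p q 0). lra. }
  have S1 : forall p q, pd2 d d p q -> forall k, Cmod (Wk (S k) p q - Wk k p q) <= eta / 4 * (/ 2) ^ k.
  { intros p q hp. induction k.
    - simpl Wk. rewrite C0r. simpl. have e2 := N0 p q hp. lra.
    - change (Wk (S (S k)) p q) with (N p q (Wk (S k) p q)). change (Wk (S k) p q) with (N p q (Wk k p q)) at 2.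
      eapply Rle_trans; [apply NL; auto|].
      + have b := B k p q hp. lra.
      + have b := B (S k) p q hp. lra.
      + simpl pow. lra. }
  have L : forall p q, exists w, pd2 d d p q -> forall k, Cmod (Wk k p q - w) <= eta / 4 * (/ 2) ^ k / (1 - / 2).
  { intros p q. destruct (classic (pd2 d d p q)) as [hp|hp]; [|exists 0; intros; contradiction].
    destruct (geom_lim (fun k => Wk k p q) (eta / 4) (/ 2)) as [w hw]; [lra|lra|mono|]. exists w. au. }
  set (W := fun p q => proj1_sig (constructive_indefinite_description _ (L p q))).
  have HW : forall p q, pd2 d d p q -> forall k, Cmod (Wk k p q - W p q) <= eta / 2 * (/ 2) ^ k.
  { intros p q hp k. unfold W. destruct constructive_indefinite_description as [w hw]; simpl. via (hw hp). lra. }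
  have small : forall e, 0 < e -> exists n, forall k, (n <= k)%nat -> eta / 2 * (/ 2) ^ k <= e.
  { intros e hee. destruct (pow_small (/ 2) (e / eta)) as [n hn]; [lra|pos|]. exists n. intros k hk. specialize (hn k hk).
    apply Rle_trans with (eta * (e / eta)); [|apply Req_le; field; lra]. au. }
  have BW : forall p q, pd2 d d p q -> Cmod (W p q) <= 3 / 4 * eta.
  { intros p q hp. apply le_epsilon. intros e hee. destruct (small e hee) as [n hn]. specialize (hn n (le_n _)).
    have b := B n p q hp. have c := HW p q hp n. have t := Cmod_rev (W p q) (Wk n p q). rewrite Cmod_sym in t. lra. }
  have FW : forall p q, pd2 d d p q -> N p q (W p q) = W p q.
  { intros p q hp. apply Cmod_small_eq. intros e hee. destruct (small (e / 2) _lra) as [n hn].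
    have h1 := hn n (le_n _). have h2 := hn (S n) ltac:(lia).
    via (Cmod_tri _ (Wk (S n) p q)).
    have c := HW p q hp n. have c2 := HW p q hp (S n).
    have e1 := NL p q (Wk n p q) (W p q) hp. change (N p q (Wk n p q)) with (Wk (S n) p q) in e1.
    rewrite (Cmod_sym (W p q) (Wk n p q)) in e1. have b1 := B n p q hp. have b2 := BW p q hp. lra. }
  exists d, eta, W. split; [lra|]. split; [lra|]. split; [lra|]. split; [lra|]. split.
  - have Hk : forall k, hol2 (pd2 d d) (Wk k).
    { induction k; intros g1 g2 t0 s hs h.
      - exact (hol_const (RtoC 0) t0).
      - change (hol (fun t => Wk k (g1 t) (g2 t) - G (g1 t) (g2 t) (Wk k (g1 t) (g2 t)) / l)%C t0). apply hol_minus; [apply (IHk g1 g2 t0 s hs h)|].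
        apply hol_div; [|au|auto]. apply (H g1 g2 (fun t => Wk k (g1 t) (g2 t)) t0 s hs). intros t ht.
        destruct (h t ht) as [k1 [k2 k3]]. repeat split; auto.
        + apply (hol2_ball _ _ g1 g2 t0 s IHk h). auto.
        + destruct k3; lra.
        + destruct k3; lra.
        + have b := B k _ _ k3. lra. }
    intros g1 g2 t0 s hs h. apply (lim_hol (fun k t => Wk k (g1 t) (g2 t)) _ t0 s hs).
    + intros n. apply (hol2_ball _ _ g1 g2 t0 s (Hk n) h).
    + intros e hee. destruct (small e hee) as [n hn]. exists n. intros k z hk hz. eapply Rle_trans; [apply HW; apply h; auto|auto].
  - intros p q hp. split; [|split].
    + have b := BW p q hp. lra.
    + have e := FW p q hp. unfold N in e.
      replace (G p q (W p q)) with (l * (W p q - (W p q - G p q (W p q) / l)))%C by (field; auto). rewrite e. ring.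
    + intros w hw Gw. have Nw : N p q w = w by (unfold N; rewrite Gw; field; auto).
      have e1 := NL p q (W p q) w hp. rewrite Nw, FW in e1 by auto. have b2 := BW p q hp. specialize (e1 _lra _lra).
      apply Cmod_small_eq. au.
Qed.

(** * Translation to and from Coquelicot's derivatives *)

Lemma Cnorm (z : C) : norm (K := C_AbsRing) (V := C_NormedModule) z = Cmod z.
Proof. au. Qed.

Lemma ball_C (x y : C) e : Cmod (y - x) < e -> ball (M := C_UniformSpace) x e y.
Proof. apply (C_NormedModule_mixin_compat1 x y). Qed.

(** Balls of [C] are squares in the real and imaginary parts; the factor 2 covers the square root of
    2. *)
Lemma ball_C_inv (x y : C) (e : R) : 0 < e -> ball (M := C_UniformSpace) x e y -> Cmod (y - x) < 2 * e.
Proof.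
  intros he H. have h := C_NormedModule_mixin_compat2 x y (mkposreal e he) H. simpl in h.
  have s2 : sqrt 2 <= 2. { rewrite <- (sqrt_Rsqr 2) at 2 by lra. apply sqrt_le_1; unfold Rsqr; lra. }
  change (minus y x) with (y - x)%C in h. nra.
Qed.

Lemma near0_iff (P : C2 -> Prop) : near0 P <-> exists r, 0 < r /\ forall x y, Cmod x < r -> Cmod y < r -> P (x, y).
Proof.
  split.
  - intros [[e he] H]. exists e. split; auto. intros x y hx hy. apply H. split; apply ball_C; simpl; rewrite C0r; auto.
  - intros [r [hr H]]. exists (mkposreal (r / 2) _lra). intros [x y] [h1 h2]. simpl in *.
    apply H; [assert (q := ball_C_inv 0 x (r/2) _lra h1)|assert (q := ball_C_inv 0 y (r/2) _lra h2)]; rewrite C0r in q; lra.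
Qed.

Lemma locally_C1 (z : C) (P : C -> Prop) : locally (T := C_UniformSpace) z P <-> exists r, 0 < r /\ forall y, Cmod (y - z) < r -> P y.
Proof.
  split.
  - intros [[e he] H]. exists e. split; auto. intros y hy. apply H. apply ball_C; auto.
  - intros [r [hr H]]. exists (mkposreal (r / 2) _lra). intros y h. simpl in *. apply H. have q := ball_C_inv z y (r/2) _lra h. lra.
Qed.

Lemma is_derive_Cd (f : C -> C) z l : is_derive (K := C_AbsRing) (V := C_NormedModule) f z l -> Cd f z l.
Proof.
  intros [_ H] e he. specialize (H z (fun P h => h)). specialize (H (mkposreal e he)).
  destruct H as [[r hr] H]. exists r. split; auto. intros w hw. specialize (H w hw). rewrite !Cnorm in H. simpl in H.
  change (Cmod (f w - f z - (w - z) * l) <= e * Cmod (w - z)) in H.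
  rewrite Cmult_comm. lra.
Qed.

Lemma ex_derive_hol (f : C -> C) z : ex_derive (K := C_AbsRing) (V := C_NormedModule) f z -> hol f z.
Proof. intros [l H]. exists l. apply is_derive_Cd; auto. Qed.

Lemma C2norm (x y : C) : norm (K := C_AbsRing) (V := C2) (x, y) <= Cmod x + Cmod y /\
  Cmod x <= norm (K := C_AbsRing) (V := C2) (x, y) /\ Cmod y <= norm (K := C_AbsRing) (V := C2) (x, y).
Proof.
  change (norm (K := C_AbsRing) (V := C2) (x, y)) with (sqrt (Cmod x ^ 2 + Cmod y ^ 2)).
  have a := Cmod_ge_0 x. have b := Cmod_ge_0 y. split; [|split].
  - rewrite <- (sqrt_Rsqr (Cmod x + Cmod y)) by lra. apply sqrt_le_1; unfold Rsqr; nra.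
  - rewrite <- (sqrt_Rsqr (Cmod x)) at 1 by lra. apply sqrt_le_1; unfold Rsqr; nra.
  - rewrite <- (sqrt_Rsqr (Cmod y)) at 1 by lra. apply sqrt_le_1; unfold Rsqr; nra.
Qed.

(** Chain rule for a total differential along a curve; [a] and [b] are the partial derivatives of
    the second component, the one that carries the information for fibred maps. *)
Lemma filterdiff_curve (f : C2 -> C2) (g1 g2 : C -> C) t0 :
  ex_filterdiff (K := C_AbsRing) (U := C2) (V := C2) f (locally (g1 t0, g2 t0)) -> hol g1 t0 -> hol g2 t0 ->
  hol (fun t => snd (f (g1 t, g2 t))) t0.
Proof.
  intros [l [[lp ls _] H]] [m1 D1] [m2 D2]. specialize (H _ (fun P h => h)).
  set (a := snd (l (RtoC 1, RtoC 0))). set (b := snd (l (RtoC 0, RtoC 1))).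
  have El : forall h k : C, snd (l (h, k)) = (h * a + k * b)%C.
  { intros h k. have E : (h, k) = plus (scal (K := C_AbsRing) (V := C2) h (RtoC 1, RtoC 0) : C2) (scal (K := C_AbsRing) (V := C2) k (RtoC 0, RtoC 1) : C2).
    { change ((h, k) = ((h * 1 + k * 0)%C, (h * 0 + k * 1)%C)). f_equal; ring. }
    rewrite E, lp, !ls. au. }
  exists (m1 * a + m2 * b)%C. intros e he.
  have pa := Cmod_ge_0 a. have pb := Cmod_ge_0 b. have p1 := Cmod_ge_0 m1. have p2 := Cmod_ge_0 m2.
  set (A := Cmod m1 + Cmod m2 + 2). set (B := Cmod a + Cmod b + 1).
  set (e1 := e / (2 * A)). have he1 : 0 < e1 by (apply Rdiv_lt_0_compat; unfold A; lra).
  set (e2 := e / (2 * B)). have he2 : 0 < e2 by (apply Rdiv_lt_0_compat; unfold B; lra).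
  specialize (H (mkposreal e1 he1)). destruct H as [[r hr] H].
  destruct (Cd_lip _ _ _ D1) as [d1 [hd1 L1]]. destruct (Cd_lip _ _ _ D2) as [d2 [hd2 L2]].
  destruct (Cd_cont _ _ _ D1 r hr) as [d3 [hd3 L3]]. destruct (Cd_cont _ _ _ D2 r hr) as [d4 [hd4 L4]].
  destruct (D1 e2 he2) as [d5 [hd5 L5]]. destruct (D2 e2 he2) as [d6 [hd6 L6]].
  small m ((1, d1) :: (1, d2) :: (1, d3) :: (1, d4) :: (1, d5) :: (1, d6) :: nil) as [hm hms]. exists m. split; [auto|]. intros w hw.
  specialize (L1 w _lra). specialize (L2 w _lra). specialize (L3 w _lra). specialize (L4 w _lra). specialize (L5 w _lra). specialize (L6 w _lra).
  specialize (H (g1 w, g2 w)). have HH := H (conj (ball_C _ _ _ L3) (ball_C _ _ _ L4)). clear H.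
  set (h := (g1 w - g1 t0)%C) in *. set (k := (g2 w - g2 t0)%C) in *.
  change (minus (g1 w, g2 w) (g1 t0, g2 t0)) with ((h, k) : C2) in HH. simpl in HH.
  destruct (C2norm h k) as [n1 _].
  have E2 : Cmod (snd (f (g1 w, g2 w)) - snd (f (g1 t0, g2 t0)) - (h * a + k * b)) <= e1 * (Cmod h + Cmod k).
  { rewrite <- El. 
    eapply Rle_trans; [|eapply Rle_trans; [exact HH|mono]].
    match goal with |- _ <= norm ?v => destruct v as [v1 v2] eqn:Ev; destruct (C2norm v1 v2) as [_ [_ n3]];
      replace (snd (f (g1 w, g2 w)) - snd (f (g1 t0, g2 t0)) - snd (l (h, k)))%C with v2; [mono|] end.
    change v2 with (snd (v1, v2)). rewrite <- Ev. au. }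
  replace (snd (f (g1 w, g2 w)) - snd (f (g1 t0, g2 t0)) - (m1 * a + m2 * b) * (w - t0))%C with
   ((snd (f (g1 w, g2 w)) - snd (f (g1 t0, g2 t0)) - (h * a + k * b)) + ((h - m1 * (w - t0)) * a + (k - m2 * (w - t0)) * b))%C by ring.
  via Cmod_triangle.
  have T := Cmod_triangle ((h - m1 * (w - t0)) * a) ((k - m2 * (w - t0)) * b). rewrite !(Cmod_mult (_ - _) _) in T.
  fold h in L5. fold k in L6.
  have q := Cmod_ge_0 (w - t0).
  assert (e1 * (Cmod h + Cmod k) <= e / 2 * Cmod (w - t0)).
  { replace (e / 2) with (e1 * A) by (unfold e1; field; unfold A; lra). rewrite Rmult_assoc. apply Rmult_le_compat_l; [lra|]. unfold A. lra. }
  assert (Cmod (h - m1 * (w - t0)) * Cmod a <= e2 * Cmod (w - t0) * Cmod a) by mono.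
  assert (Cmod (k - m2 * (w - t0)) * Cmod b <= e2 * Cmod (w - t0) * Cmod b) by mono.
  assert (e2 * Cmod (w - t0) * Cmod a + e2 * Cmod (w - t0) * Cmod b <= e / 2 * Cmod (w - t0)).
  { replace (e / 2) with (e2 * B) by (unfold e2; field; unfold B; lra). unfold B. nra. }
  lra.
Qed.

Lemma hol2_of_holomorphic2 (D : C2 -> Prop) f : holomorphic2 D f -> hol2 (fun x y => D (x, y)) (fun x y => snd (f (x, y))).
Proof.
  intros H g1 g2 t0 r hr h. destruct (h t0 _lra) as [a [b c]].
  apply filterdiff_curve; auto.
Qed.

(** Total differentiability from separate expansions: one moves in [x] at height [y + k], and in [y]
    on the line [x]. The mismatch [(a k - a 0) * h] is controlled by the continuity of the partial
    derivative [a]. *)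
Lemma holomorphic2_graph (F : C -> C -> C) r M : 0 < r -> hol2 (pd2 (2 * r) (2 * r)) F -> (forall x y, pd2 (2 * r) (2 * r) x y -> Cmod (F x y) <= M) ->
  holomorphic2 (polydisc r r) (fun p => (fst p, F (fst p) (snd p))).
Proof.
  intros hr H HM [x y] [hx hy]. change C in (type of x). change C in (type of y). unfold Cdisc in *; simpl in hx, hy.
  have hM : 0 <= M by (eapply Rle_trans; au).
  have in2 : forall h k, Cmod h < r -> Cmod k < r -> pd2 (2 * r) (2 * r) (x + h) (y + k).
  { intros h k hh hk. split; [assert (t := Cmod_triangle x h)|assert (t := Cmod_triangle y k)]; lra. }
  set (K := 8 * M / r ^ 2). have hK : 0 <= K by (unfold K, Rdiv; mono).
  set (a := fun k => cD (fun x => F x (y + k)%C) x). set (b := cD (F x) y).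
  have Ex : forall h k, Cmod h <= r / 4 -> Cmod k < r -> Cmod (F (x + h)%C (y + k)%C - F x (y + k)%C - a k * h) <= K * Cmod h ^ 2.
  { intros h k hh hk. apply (est2 x r (fun x => F x (y + k)%C) M); auto.
    - apply (hol2_x (pd2 (2 * r) (2 * r))); auto. intros z hz. replace z with (x + (z - x))%C by ring. au.
    - intros w hw. apply HM. replace w with (x + (w - x))%C by ring. au. }
  have Ey : forall k, Cmod k <= r / 4 -> Cmod (F x (y + k)%C - F x y - b * k) <= K * Cmod k ^ 2.
  { intros k hk. apply (est2 y r (F x) M); auto.
    - apply (hol2_y (pd2 (2 * r) (2 * r))); auto. intros z hz. replace z with (y + (z - y))%C by ring. replace x with (x + 0)%C by ring. au.
    - intros w hw. apply HM. replace w with (y + (w - y))%C by ring. replace x with (x + 0)%C by ring. au. }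
  (* continuity of the partial derivative, through difference quotients with a fixed step *)
  have Ca : forall e, 0 < e -> exists d, 0 < d /\ forall k, Cmod k < d -> Cmod (a k - a 0) <= e.
  { intros e he. small s ((1, r / 4) :: (1, e / (4 * (K + 1))) :: nil) as [hs [s1 [s2 _]]].
    have ms : Cmod s = s by lra.
    have Cy : forall h, Cmod h < r -> Ccont (F (x + h)%C) y.
    { intros h hh. apply hol_cont. apply (hol2_y (pd2 (2 * r) (2 * r)) F (x + h)%C y r H); [|lra].
      intros z hz. replace z with (y + (z - y))%C by ring. au. }
    destruct (Cy (RtoC s) _lra (e * s / 4)) as [d1 [h1 q1]]; [nra|]. destruct (Cy 0 _lra (e * s / 4)) as [d2 [h2 q2]]; [nra|].
    small m ((1, r) :: (1, d1) :: (1, d2) :: nil) as [hm [m1 [m2 [m3 _]]]]. exists m. split; [auto|]. intros k hk.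
    specialize (q1 (y + k)%C). specialize (q2 (y + k)%C). replace (y + k - y)%C with k in q1, q2 by ring. specialize (q1 _lra). specialize (q2 _lra).
    replace (x + 0)%C with x in q2 by ring.
    have e1 := Ex s k _lra _lra. have e2 := Ex s 0 _lra _lra. replace (y + 0)%C with y in e2 by ring. rewrite ms in e1, e2.
    apply Rmult_le_reg_r with s; auto. rewrite <- ms at 1. rewrite <- Cmod_mult.
    replace ((a k - a 0) * s)%C with (((F (x + s)%C y - F x y - a 0 * s) - (F (x + s)%C (y + k)%C - F x (y + k)%C - a k * s)) +
       ((F (x + s)%C (y + k)%C - F (x + s)%C y) - (F x (y + k)%C - F x y)))%C by ring.
    via Cmod_triangle.
    have b1 := Cmod_minus_le (F (x + s)%C y - F x y - a 0 * s) (F (x + s)%C (y + k)%C - F x (y + k)%C - a k * s).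
    have b2 := Cmod_minus_le (F (x + s)%C (y + k)%C - F (x + s)%C y) (F x (y + k)%C - F x y).
    assert (K * s <= e / 4).
    { apply Rle_trans with ((K + 1) * (e / (4 * (K + 1)))); [nra|]. apply Req_le; field; lra. }
    nra. }
  set (l := fun h : C2 => ((fst h, fst h * a 0 + snd h * b)%C : C2)).
  exists l. split.
  - split.
    + intros [h1 k1] [h2 k2]. change ((h1 + h2, (h1 + h2) * a 0 + (k1 + k2) * b)%C = ((h1 + h2)%C, (h1 * a 0 + k1 * b + (h2 * a 0 + k2 * b))%C)). f_equal. ring.
    + intros c [h1 k1]. change ((c * h1, c * h1 * a 0 + c * k1 * b)%C = ((c * h1)%C, (c * (h1 * a 0 + k1 * b))%C)). f_equal. ring.
    + exists (1 + Cmod (a 0) + Cmod b). have p1 := Cmod_ge_0 (a 0). have p2 := Cmod_ge_0 b. split; [lra|]. intros [h k]. change C in (type of h). change C in (type of k).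
      destruct (C2norm h k) as [_ [n2 n3]]. unfold l; simpl fst; simpl snd.
      destruct (C2norm h (h * a 0 + k * b)%C) as [n1 _]. eapply Rle_trans; [exact n1|].
      have t := Cmod_triangle (h * a 0) (k * b). rewrite !Cmod_mult in t.
      have q1 := Cmod_ge_0 h. have q2 := Cmod_ge_0 k.
      assert (Cmod h * Cmod (a 0) <= norm (K := C_AbsRing) (V := C2) (h, k) * Cmod (a 0)) by mono.
      assert (Cmod k * Cmod b <= norm (K := C_AbsRing) (V := C2) (h, k) * Cmod b) by mono.
      have g : Cmod h + Cmod (h * a 0 + k * b)%C <= (1 + Cmod (a 0) + Cmod b) * norm (K := C_AbsRing) (V := C2) (h, k) by lra. au.
  - intros z hz. have hz' := is_filter_lim_locally_unique _ _ hz. subst z. intros [e he].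
    destruct (Ca (e / 2) _lra) as [d [hd ha]].
    small d' ((1, d) :: (1, r / 4) :: (1, e / (4 * (K + 1))) :: nil) as [hd' [y3 [y4 [y2 _]]]].
    exists (mkposreal (d' / 2) _lra). intros [x' y'] [b1 b2]. simpl in b1, b2. change C in (type of x'). change C in (type of y').
    apply ball_C_inv in b1; [|lra]. apply ball_C_inv in b2; [|lra].
    set (h := (x' - x)%C) in *. set (k := (y' - y)%C) in *.
    change (minus (x', y') (x, y)) with ((h, k) : C2). destruct (C2norm h k) as [_ [n2 n3]].
    match goal with |- norm ?v <= _ => replace v with ((RtoC 0, F x' y' - F x y - (h * a 0 + k * b))%C : C2) end.
    2:{ change ((RtoC 0, F x' y' - F x y - (h * a 0 + k * b))%C = ((x' - x - h)%C, (F x' y' - F x y - (h * a 0 + k * b))%C)). f_equal. unfold h. ring. }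
    match goal with |- norm (?u, ?v) <= _ => destruct (C2norm u v) as [n1 _] end.
    eapply Rle_trans; [exact n1|]. rewrite Cmod_0, Rplus_0_l.
    have e1 := Ex h k _lra _lra. have e2 := Ey k _lra. specialize (ha k _lra).
    replace (x + h)%C with x' in e1 by (unfold h; ring). replace (y + k)%C with y' in e1, e2 by (unfold k; ring).
    replace (F x' y' - F x y - (h * a 0 + k * b))%C with ((F x' y' - F x y' - a k * h) + (F x y' - F x y - b * k) + (a k - a 0) * h)%C by ring.
    have t1 := Cmod_triangle ((F x' y' - F x y' - a k * h) + (F x y' - F x y - b * k)) ((a k - a 0) * h).
    have t2 := Cmod_triangle (F x' y' - F x y' - a k * h) (F x y' - F x y - b * k). rewrite (Cmod_mult (a k - a 0)) in t1.
    have q1 := Cmod_ge_0 h. have q2 := Cmod_ge_0 k. set (n := norm (K := C_AbsRing) (V := C2) (h, k)) in *. simpl pos.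
    have Kd : K * d' <= e / 4.
    { apply Rle_trans with ((K + 1) * (e / (4 * (K + 1)))); [nra|]. apply Req_le; field; lra. }
    assert (K * Cmod h ^ 2 <= e / 4 * n).
    { apply Rle_trans with (K * d' * Cmod h); [simpl; rewrite Rmult_1_r, <- Rmult_assoc; mono|]. au. }
    assert (K * Cmod k ^ 2 <= e / 4 * n).
    { apply Rle_trans with (K * d' * Cmod k); [simpl; rewrite Rmult_1_r, <- Rmult_assoc; mono|]. au. }
    assert (Cmod (a k - a 0) * Cmod h <= e / 2 * n) by mono.
    lra.
Qed.

(** * Orders of vanishing and the linearised conjugacy equation *)
(** [h = O(y^n)] at the origin. The radius is at most 1, so that lowering the exponent keeps the
    constant. *)
Definition bo (n : nat) (h : C -> C) : Prop := exists K d, 0 <= K /\ 0 < d <= 1 /\ forall y, Cmod y < d -> Cmod (h y) <= K * Cmod y ^ n.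

Lemma bo_plus n g h : bo n g -> bo n h -> bo n (fun y => g y + h y)%C.
Proof.
  intros [K [d [hK [hd H]]]] [K' [d' [hK' [hd' H']]]]. small m ((1, d) :: (1, d') :: nil) as [hm [m1 [m2 _]]]. exists (K + K'), m. split; [lra|]. split; [lra|].
  intros y hy. via Cmod_triangle. specialize (H y _lra). specialize (H' y _lra). lra.
Qed.
Lemma bo_mult m n g h : bo m g -> bo n h -> bo (m + n) (fun y => g y * h y)%C.
Proof.
  intros [K [d [hK [hd H]]]] [K' [d' [hK' [hd' H']]]]. small m' ((1, d) :: (1, d') :: nil) as [hm [m1 [m2 _]]]. exists (K * K'), m'. split; [mono|]. split; [lra|].
  intros y hy. rewrite Cmod_mult, pow_add. specialize (H y _lra). specialize (H' y _lra).
  replace (K * K' * (Cmod y ^ m * Cmod y ^ n)) with ((K * Cmod y ^ m) * (K' * Cmod y ^ n)) by ring.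
  au.
Qed.
Lemma bo_weak m n h : (m <= n)%nat -> bo n h -> bo m h.
Proof.
  intros hmn [K [d [hK [hd H]]]]. exists K, d. split; auto. split; auto. intros y hy. eapply Rle_trans; [mono|].
  apply Rmult_le_compat_l; auto. replace n with (m + (n - m))%nat by lia. rewrite pow_add. have q := Cmod_ge_0 y.
  assert (0 <= Cmod y ^ m) by mono.
  assert (Cmod y ^ (n - m) <= 1) by (apply pow_le_1; lra). nra.
Qed.
Lemma bo_ext n g h : (forall y, g y = h y) -> bo n g -> bo n h.
Proof. intros E [K [d [hK [hd H]]]]. exists K, d. split; auto. split; auto. intros y hy. rewrite <- E. au. Qed.
Lemma bo_ext_loc n g h r : 0 < r -> (forall y, Cmod y < r -> g y = h y) -> bo n g -> bo n h.
Proof.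
  intros hr E [K [d [hK [hd H]]]]. small m ((1, d) :: (1, r) :: nil) as [hm [m1 [m2 _]]]. exists K, m. split; auto. split; [lra|]. intros y hy. rewrite <- E by lra. au.
Qed.
Lemma bo_mono n (c : C) : bo n (fun y => c * y ^ n)%C.
Proof.
  exists (Cmod c), 1. split; [mono|]. split; [lra|]. intros y _. rewrite Cmod_mult, Cmod_pow. lra.
Qed.
Lemma bo_pow n : bo n (fun y => y ^ n)%C.
Proof. apply (bo_ext n (fun y => 1 * y ^ n)%C); [intros; ring|apply bo_mono]. Qed.
Lemma bo_scal n (c : C) h : bo n h -> bo n (fun y => c * h y)%C.
Proof. intros H. apply (bo_mult 0 n (fun _ => c)); auto. apply (bo_ext 0 (fun y => c * y ^ 0)%C); [intros; simpl; ring|apply bo_mono]. Qed.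
Lemma bo_minus n g h : bo n g -> bo n h -> bo n (fun y => g y - h y)%C.
Proof. intros H K. apply (bo_ext n (fun y => g y + (-1) * h y)%C); [intros; ring|]. apply bo_plus; auto. apply bo_scal; auto. Qed.
Lemma bo_hol r h : 0 < r -> holball 0 r h -> bo 0 h.
Proof.
  intros hr H. destruct (holball_bounded 0 r h (r / 2) H _lra) as [M [hM HM]]. small m ((1, 1) :: (2, r) :: nil) as [hm [m1 [m2 _]]]. exists M, m. split; auto. split; [lra|]. intros y hy. simpl. rewrite Rmult_1_r. au.
Qed.
(** Away from [0], [est2] on the disc of centre [y] and radius [|y|], where [h] is at most
    [K (2 |y|)^(n+1)]. At [y = 0] this disc degenerates and the definition of the derivative is
    used. *)
Lemma bo_cD r n h : 0 < r -> holball 0 r h -> bo (S n) h -> bo n (cD h).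
Proof.
  intros hr H [K [d [hK [hd HK]]]]. small m ((2, d) :: (2, r) :: nil) as [hm [m1 [m2 _]]]. exists (4 * K * 2 ^ S n), m.
  have p2 : 0 < 2 ^ S n by pos. split; [nra|]. split; [lra|]. intros y hy. have q := Cmod_ge_0 y.
  destruct (Req_dec (Cmod y) 0) as [h0|h0].
  - have y0 := Cmod_eq_0 _ h0. subst y.
    destruct n as [|n].
    + simpl. have hh : Cd h 0 (cD h 0) by (apply cD_spec, H; rewrite C0r, Cmod_0; auto).
      apply le_epsilon. intros e he. destruct (hh e he) as [d1 [hd1 h1]].
      small s ((2, d1) :: (2, d) :: nil) as [hs [s1 [s2 _]]].
      have ms : Cmod s = s by lra.
      specialize (h1 (RtoC s)). rewrite C0r, ms in h1. specialize (h1 _lra).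
      have k1 := HK (RtoC s) _lra. have k2 := HK 0 _lra. rewrite ms in k1. rewrite Cmod_0 in k2. simpl in k1, k2.
      have h00 : h 0 = 0 by (apply Cmod_le_0; lra).
      rewrite h00 in h1. have t := Cmod_rev (cD h 0 * s) (h s). rewrite Cmod_mult, ms in t.
      rewrite (Cmod_sym (cD h 0 * s)) in t. replace (h s - 0 - cD h 0 * s)%C with (h s - cD h 0 * s)%C in h1 by ring.
      apply Rmult_le_reg_r with s; auto. nra.
    + have hh : Cd h 0 (cD h 0) by (apply cD_spec, H; rewrite C0r, Cmod_0; auto).
      have hh' : Cd h 0 0.
      { apply (Cd_quad h 0 0 K d); [lra|]. intros w hw. rewrite C0r in hw. have k1 := HK w hw. have k2 := HK 0 _lra.
        rewrite Cmod_0 in k2. simpl in k2. have h00 : h 0 = 0 by (apply Cmod_le_0; lra). rewrite h00.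
        replace (h w - 0 - 0 * (w - 0))%C with (h w) by ring. rewrite C0r. eapply Rle_trans; [mono|]. apply Rmult_le_compat_l; auto.
        have q' := Cmod_ge_0 w. simpl. rewrite Rmult_1_r. rewrite <- Rmult_assoc. rewrite <- (Rmult_1_r (Cmod w * Cmod w)) at 2.
        apply Rmult_le_compat_l; [nra|]. rewrite <- (pow1 n). au. }
      rewrite (Cd_unique _ _ _ _ hh hh'), Cmod_0. au.
  - have hp : 0 < Cmod y by lra. set (s := Cmod y) in *.
    destruct (est2 y s h (K * (2 * s) ^ S n)) as [e _]; auto.
    + intros z hz. apply H. rewrite C0r. have t := Cmod_rev z y. unfold s in *. lra.
    + intros w hw. have t := Cmod_rev w y. eapply Rle_trans; [apply HK; unfold s in *; lra|].
      apply Rmult_le_compat_l; auto. apply pow_incr. split; [mono|unfold s in *; lra].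
    + eapply Rle_trans; [exact e|]. rewrite Rpow_mult_distr. simpl. 
      replace (2 * (K * (2 * 2 ^ n * (s * s ^ n))) / s) with (2 * K * (2 * 2 ^ n) * s ^ n) by (field; lra).
      au.
Qed.

Lemma coef_plus c r g h rho k : holball c r g -> holball c r h -> 0 < rho < r -> coef c rho k (fun y => g y + h y)%C = (coef c rho k g + coef c rho k h)%C.
Proof.
  intros Hg Hh hr. unfold coef. rewrite <- mean_plus.
  - apply mean_ext. intros t _. unfold Cdiv. ring.
  - intros t _. apply ccont_coef; [lra|]. eapply ccont_circ; eauto; lra.
  - intros t _. apply ccont_coef; [lra|]. eapply ccont_circ; eauto; lra.
Qed.
Lemma coef_scal c r a g rho k : holball c r g -> 0 < rho < r -> coef c rho k (fun y => a * g y)%C = (a * coef c rho k g)%C.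
Proof.
  intros Hg hr. unfold coef. rewrite <- mean_scal.
  - apply mean_ext. intros t _. unfold Cdiv. ring.
  - intros t _. apply ccont_coef; [lra|]. eapply ccont_circ; eauto; lra.
Qed.
Lemma coef_minus c r g h rho k : holball c r g -> holball c r h -> 0 < rho < r -> coef c rho k (fun y => g y - h y)%C = (coef c rho k g - coef c rho k h)%C.
Proof.
  intros Hg Hh hr. unfold coef. rewrite <- mean_minus.
  - apply mean_ext. intros t _. unfold Cdiv. ring.
  - intros t _. apply ccont_coef; [lra|]. eapply ccont_circ; eauto; lra.
  - intros t _. apply ccont_coef; [lra|]. eapply ccont_circ; eauto; lra.
Qed.
Lemma coef_csum c r n (f : nat -> C -> C) rho k : (forall j, (j < n)%nat -> holball c r (f j)) -> 0 < rho < r ->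
  coef c rho k (fun y => csum n (fun j => f j y)) = csum n (fun j => coef c rho k (f j)).
Proof.
  intros H hr. induction n.
  - simpl. unfold coef. rewrite (mean_ext _ (fun _ => RtoC 0)); [apply mean_const|]. intros; unfold Cdiv; ring.
  - simpl. rewrite (coef_plus c r); auto. + rewrite IHn; auto. + intros z hz. apply hol_csum. au.
Qed.
Lemma coef_ext c g h rho k : 0 <= rho -> (forall z, Cmod (z - c) = rho -> g z = h z) -> coef c rho k g = coef c rho k h.
Proof.
  intros hr E. unfold coef. apply mean_ext. intros t _. rewrite E; auto. replace (c + cir rho t - c)%C with (cir rho t) by ring. lra.
Qed.
Lemma coef_bo r g rho n : holball 0 r g -> 0 < rho < r -> bo n g -> forall k, (k < n)%nat -> coef 0 rho k g = 0.
Proof.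
  intros H hr [K [d [hK [hd HK]]]]. apply (coef_O 0 r g rho n d K); auto; [lra|]. intros w hw.
  replace (0 + w)%C with w by ring. au.
Qed.

Section Triangular.
Variables (f0 : C -> C) (r : R) (a : C) (d : nat).
Hypothesis hr : 0 < r.
Hypothesis Hf : holball 0 r f0.
Hypothesis hd : (2 <= d)%nat.
Hypothesis Ef : bo (S d) (fun y => f0 y - y - a * y ^ d)%C.

Let q y := (f0 y - y)%C.
Lemma tri_q : bo d q.
Proof. apply (bo_ext d (fun y => (f0 y - y - a * y ^ d) + a * y ^ d)%C); [intros; unfold q; ring|]. apply bo_plus; [apply (bo_weak d (S d)); auto|apply bo_mono]. Qed.

Lemma tri_dq : bo d (fun y => cD f0 y - 1 - INR d * a * y ^ (d - 1))%C.
Proof.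
  apply (bo_ext_loc d (cD (fun y => f0 y - y - a * y ^ d)%C) _ r hr).
  - intros y hy. apply cD_eq.
    have P : forall n, Cd (fun w => w ^ n)%C y (INR n * y ^ (n - 1)).
    { induction n as [|n IH]; [refine (Cd_eq _ _ _ _ _ (Cd_const _ _)); simpl; ring|].
      refine (Cd_eq _ _ _ _ _ (Cd_mult _ _ _ _ _ (Cd_id y) IH)). rewrite S_INR, RtoC_plus.
      replace (S n - 1)%nat with n by lia. destruct n; [simpl; ring|]. replace (S n - 1)%nat with n by lia. rewrite !Cpow_S. ring. }
    have H0 := cD_spec _ _ (Hf y _lra).
    refine (Cd_eq _ _ _ _ _ (Cd_ext (fun w => (f0 w + (-1) * w) + (- a) * w ^ d)%C _ _ _ 1 _lra _
       (Cd_plus _ _ _ _ _ (Cd_plus _ _ _ _ _ H0 (Cd_scal (-1) _ _ _ (Cd_id y))) (Cd_scal (- a) _ _ _ (P d))))); [ring|intros; ring].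
  - apply (bo_cD r); auto. au.
Qed.

Lemma tri_dq1 : bo (d - 1) (fun y => 1 - cD f0 y)%C.
Proof.
  apply (bo_ext (d - 1) (fun y => (- (INR d * a)) * y ^ (d - 1) - (cD f0 y - 1 - INR d * a * y ^ (d - 1)))%C); [intros; ring|].
  apply bo_minus; [apply bo_mono|]. apply (bo_weak (d - 1) d); [lia|apply tri_dq].
Qed.

Lemma tri_pow k : bo (k + d) (fun y => f0 y ^ k - y ^ k - INR k * a * y ^ (k + d - 1))%C.
Proof.
  induction k.
  - apply (bo_ext (0 + d) (fun y => 0 * y ^ (0 + d))%C); [intros; simpl; ring|apply bo_mono].
  - apply (bo_ext _ (fun y => f0 y * (f0 y ^ k - y ^ k - INR k * a * y ^ (k + d - 1)) + (f0 y - y - a * y ^ d) * y ^ k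
       + INR k * a * (q y * y ^ (k + d - 1)))%C).
    { intros y. unfold q. rewrite S_INR, RtoC_plus. replace (S k + d - 1)%nat with (S (k + d - 1)) by lia.
      rewrite !Cpow_S. replace (y ^ (k + d - 1))%C with (y ^ k * y ^ (d - 1))%C by (rewrite <- Cpow_add_r; f_equal; lia).
      replace (y ^ d)%C with (y * y ^ (d - 1))%C by (rewrite <- Cpow_S; f_equal; lia). ring. }
    apply bo_plus; [apply bo_plus|].
    + replace (S k + d)%nat with (1 + (k + d))%nat by lia. apply bo_mult; auto.
      apply (bo_ext 1 (fun y => y ^ 1 + q y)%C); [intros; unfold q; simpl; ring|]. apply bo_plus; [apply bo_pow|]. apply (bo_weak 1 d); [lia|apply tri_q].
    + replace (S k + d)%nat with (S d + k)%nat by lia. apply bo_mult; auto. apply bo_pow.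
    + apply bo_scal. apply (bo_weak _ (d + (k + d - 1))); [lia|]. apply bo_mult; [apply tri_q|apply bo_pow].
Qed.

(** The image of the monomial [y^k] under [lin_op f0]. Its leading coefficient [(k - d) a] vanishes
    for [k = d] only, the direction of the field [a y^d] of which [f0] is the time-one flow to
    leading order: this resonance is why exactly one coefficient stays free. *)
Definition triB (k : nat) (y : C) : C := (f0 y ^ k - cD f0 y * y ^ k)%C.
Lemma triB_hol k : holball 0 r (triB k).
Proof.
  intros z hz. unfold triB. apply hol_minus; [au|]. apply hol_mult; [|au]. apply holball_cD in Hf. au.
Qed.
Lemma triB_bo k : bo (k + d) (fun y => triB k y - (INR k - INR d) * a * y ^ (k + d - 1))%C.
Proof.
  apply (bo_ext _ (fun y => (f0 y ^ k - y ^ k - INR k * a * y ^ (k + d - 1)) - (cD f0 y - 1 - INR d * a * y ^ (d - 1)) * y ^ k)%C).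
  { intros y. unfold triB. replace (y ^ (k + d - 1))%C with (y ^ k * y ^ (d - 1))%C by (rewrite <- Cpow_add_r; f_equal; lia). ring. }
  apply bo_minus; [apply tri_pow|]. rewrite Nat.add_comm. apply bo_mult; [apply tri_dq|apply bo_pow].
Qed.

Lemma coef_mono rho k (c : C) : 0 < rho < r -> coef 0 rho k (fun y => c * y ^ k)%C = c.
Proof.
  intros h. have E := coef_unique 0 r (fun y => c * y ^ k)%C rho (S k) (fun j => if Nat.eq_dec j k then c else RtoC 0) 1 0.
  rewrite E; auto; try lra; try lia.
  - destruct (Nat.eq_dec k k); auto. contradiction.
  - au.
  - intros w _. simpl csum. rewrite csum_0.
    + destruct (Nat.eq_dec k k); [|contradiction]. replace (0 + w)%C with w by ring.
      replace (c * w ^ k - (0 + c * w ^ k))%C with (RtoC 0) by ring. lra.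
    + intros j hj. destruct (Nat.eq_dec j k); [lia|ring].
Qed.

Lemma triB_coef rho k : 0 < rho < r -> coef 0 rho (k + d - 1) (triB k) = ((INR k - INR d) * a)%C.
Proof.
  intros h.
  rewrite (coef_ext 0 (triB k) (fun y => (triB k y - (INR k - INR d) * a * y ^ (k + d - 1)) + (INR k - INR d) * a * y ^ (k + d - 1))%C) by (try lra; intros; ring).
  rewrite (coef_plus 0 r); auto.
  - rewrite (coef_bo r _ rho (k + d)); [|intros z hz|auto|apply triB_bo|lia].
    + rewrite coef_mono; auto. ring.
    + apply hol_minus; [apply triB_hol; auto|]. au.
  - intros z hz. apply hol_minus; [apply triB_hol; auto|]. au.
  - au.
Qed.

(* the linearised conjugacy operator at the identity *)
Definition lin_op (W : C -> C) (y : C) : C := (W (f0 y) - cD f0 y * W y)%C.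

Lemma f0_0 : f0 0 = 0.
Proof.
  destruct tri_q as [K [e [hK [he H]]]]. specialize (H 0 _lra). unfold q in H.
  rewrite Cmod_0, pow_i in H by lia. rewrite C0r in H. apply Cmod_le_0. lra.
Qed.

Lemma lin_op_hol W rho r' : holball 0 rho W -> r' <= r -> r' <= rho -> (forall y, Cmod y < r' -> Cmod (f0 y) < rho) -> holball 0 r' (lin_op W).
Proof.
  intros HW h1 h2 h3 z hz. rewrite C0r in hz. unfold lin_op. apply hol_minus.
  - apply (hol_comp f0 W); [au|]. apply HW. rewrite C0r. au.
  - apply hol_mult; [apply holball_cD in Hf; apply Hf; rewrite C0r; lra|]. au.
Qed.

(** Up to the shift [d - 1], the matrix of the linearised operator is triangular: the part of [W]
    beyond order [k] contributes [X], which vanishes to order [k + d]. The two terms of [X] are only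
    [O(y^(k+1))] each; the rest is cancellation, because [f0] is tangent to the identity to order
    [d]. *)
Lemma lin_op_coef W rho r' r0 k : holball 0 rho W -> 0 < r' <= r -> r' <= rho -> (forall y, Cmod y < r' -> Cmod (f0 y) < rho) -> 0 < r0 < r' ->
  coef 0 r0 (k + d - 1) (lin_op W) = csum (S k) (fun j => coef 0 r0 j W * coef 0 r0 (k + d - 1) (triB j))%C.
Proof.
  intros HW h1 h2 h3 h4. set (r1 := (r0 + r') / 2). have hr1 : r0 < r1 < r' by (unfold r1; lra).
  set (U := rem 0 r1 (S k) W).
  have HU : forall w, Cmod w < r1 -> hol U w by (intros w hw; apply (hol_rem 0 rho); auto; lra).
  have HUb : holball 0 r1 U by au.
  have T : forall y, Cmod y < r1 -> W y = (csum (S k) (fun j => coef 0 r0 j W * y ^ j) + y ^ S k * U y)%C.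
  { intros y hy. have E := taylor 0 rho W r1 (S k) y HW hy _lra. replace (0 + y)%C with y in E by ring. rewrite E. f_equal.
    apply csum_ext. intros j _. f_equal. apply (coef_indep 0 rho rho); auto; lra. }
  set (X := fun y => (f0 y ^ S k * U (f0 y) - cD f0 y * (y ^ S k * U y))%C).
  have Q := tri_q.
  destruct (hol_cont f0 0 (Hf 0 _lra) r1 _lra) as [e [he Ce]].
  small r2 ((1, e) :: (1, r1) :: nil) as [hr2 [m1 [m2 _]]].
  have Fin : forall y, Cmod y < r2 -> Cmod (f0 y) < r1.
  { intros y hy. specialize (Ce y). rewrite C0r in Ce. specialize (Ce _lra). rewrite f0_0, C0r in Ce. auto. }
  have Xl : forall y, Cmod y < r2 -> lin_op W y = (csum (S k) (fun j => coef 0 r0 j W * triB j y) + X y)%C.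
  { intros y hy. unfold lin_op. rewrite (T y) by lra. rewrite (T (f0 y)) by auto. unfold X, triB.
    rewrite (csum_ext (S k) (fun j => coef 0 r0 j W * (f0 y ^ j - cD f0 y * y ^ j))%C (fun j => coef 0 r0 j W * f0 y ^ j - cD f0 y * (coef 0 r0 j W * y ^ j))%C) by (intros; ring).
    rewrite csum_minus, csum_scal. ring. }
  have Xh : holball 0 r2 X.
  { intros z hz. rewrite C0r in hz. unfold X. have hf : hol f0 z by au.
    apply hol_minus; apply hol_mult.
    - au.
    - apply (hol_comp f0 U); auto.
    - apply holball_cD in Hf. au.
    - au. }
  have U0 : bo 0 (fun y => U (f0 y)).
  { apply (bo_hol r2); auto. intros z hz. rewrite C0r in hz. apply (hol_comp f0 U); au. }
  have U1 : bo 0 U by (apply (bo_hol r1); auto; lra).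
  have P1 : bo (k + d) (fun y => f0 y ^ S k - y ^ S k)%C.
  { apply (bo_ext _ (fun y => (f0 y ^ S k - y ^ S k - INR (S k) * a * y ^ (S k + d - 1)) + INR (S k) * a * y ^ (k + d))%C).
    { intros y. replace (S k + d - 1)%nat with (k + d)%nat by lia. ring. }
    apply bo_plus; [apply (bo_weak _ (S k + d)); [lia|apply tri_pow]|]. apply bo_mono. }
  have P2 : bo d (fun y => U (f0 y) - U y)%C.
  { destruct Q as [K [e1 [hK [he1 HK]]]]. destruct (holball_bounded 0 r1 U (3 * r1 / 4) HUb _lra) as [M [hM HM]].
    small m ((1, e1) :: (4, r2) :: (4 * (K + 1), r1) :: nil) as [hm [n1 [n2 [n3 _]]]]. exists (2 * M / (r1 / 4) * K), m.
    have x2 : 0 <= 2 * M / (r1 / 4) by mono.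
    split; [nra|]. split; [lra|]. intros y hy. have qy := HK y _lra. unfold q in qy. have py := Cmod_ge_0 y.
    assert (Cmod (f0 y - y) <= r1 / 4).
    { eapply Rle_trans; [exact qy|]. apply Rle_trans with ((K + 1) * m); [|lra].
      apply Rmult_le_compat; try lra. mono. apply Rle_trans with (Cmod y); [|lra].
      replace d with (S (d - 1)) by lia. simpl. apply Rle_trans with (Cmod y * 1); [|lra]. apply Rmult_le_compat_l; auto.
      rewrite <- (pow1 (d - 1)). au. }
    have t := Cmod_rev (f0 y) y.
    eapply Rle_trans; [apply (lip0 (3 * r1 / 4) (r1 / 4) U M); try lra|].
    - apply (holball_sub 0 r1); auto. lra.
    - au.
    - rewrite Rmult_assoc. au. }
  have Xb : bo (k + d) X.
  { apply (bo_ext _ (fun y => (f0 y ^ S k - y ^ S k) * U (f0 y) + (y ^ S k * (U (f0 y) - U y) + (1 - cD f0 y) * (y ^ S k * U y)))%C).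
    { intros y. unfold X. ring. }
    apply bo_plus; [|apply bo_plus].
    - replace (k + d)%nat with (k + d + 0)%nat by lia. apply bo_mult; auto.
    - apply (bo_weak _ (S k + d)); [lia|]. apply bo_mult; auto. apply bo_pow.
    - replace (k + d)%nat with (d - 1 + (S k + 0))%nat by lia. apply bo_mult; [apply tri_dq1|]. apply bo_mult; auto. apply bo_pow. }
  set (r3 := r2 / 2). have hr3 : 0 < r3 < r2 by (unfold r3; lra).
  have HL := lin_op_hol W rho r' HW _lra _lra h3.
  rewrite (coef_indep 0 r' r' (lin_op W) r0 r3) by mono.
  rewrite (coef_ext 0 (lin_op W) (fun y => csum (S k) (fun j => coef 0 r0 j W * triB j y) + X y)%C).
  2:{ lra. } 2:{ intros z hz. au. }
  have Hj : forall j, holball 0 r2 (fun y => coef 0 r0 j W * triB j y)%C.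
  { intros j z hz. apply hol_mult; [au|]. apply triB_hol. lra. }
  rewrite (coef_plus 0 r2); auto.
  - rewrite (coef_bo r2 X r3 (k + d)) by au.
    rewrite (coef_csum 0 r2 (S k) (fun j y => coef 0 r0 j W * triB j y)%C) by auto. rewrite Cplus_0_r.
    apply csum_ext. intros j _. rewrite (coef_scal 0 r2); auto.
    + f_equal. apply (coef_indep 0 r r); try apply triB_hol; lra.
    + intros z hz. apply triB_hol. lra.
  - intros z hz. apply (hol_csum (S k) (fun j y => coef 0 r0 j W * triB j y)%C). au.
Qed.
End Triangular.

(** * The contraction on a circle *)
(** The bound concerns sequences that grow at most like Taylor coefficients read on the circle of
    radius [r0]. Holomorphy along curves lets the functional act on holomorphic families, and the
    last clause lets it act on sequences known pointwise. *)
Definition seq_fun (r0 : R) (La : (nat -> C) -> C) : Prop :=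
  (forall e e', La (fun j => e j - e' j)%C = (La e - La e')%C) /\
  (exists K, 0 <= K /\ forall e eta, 0 <= eta -> (forall i, Cmod (e i) <= eta / r0 ^ i) -> Cmod (La e) <= K * eta) /\
  (forall (e : C -> nat -> C) t, (forall i, hol (fun s => e s i) t) -> hol (fun s => La (e s)) t) /\
  (forall e e', (forall i, e i = e' i) -> La e = La e').

Lemma seq_fun_csum r0 (A : nat -> (nat -> C) -> C) (m : nat -> C) k : (forall j, (j < k)%nat -> seq_fun r0 (A j)) ->
  seq_fun r0 (fun e => csum k (fun j => A j e * m j)%C).
Proof.
  intros H. induction k as [|k IH].
  - split; [|split; [|split]]; simpl; intros.
    + ring.
    + exists 0. au.
    + au.
    + au.
  - destruct IH as [I1 [[K [hK I2]] [I3 I4]]]; [mono|].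
    destruct (H k ltac:(lia)) as [J1 [[K' [hK' J2]] [J3 J4]]]. have pm := Cmod_ge_0 (m k).
    split; [|split; [|split]]; simpl.
    + intros e e'. rewrite I1, J1. ring.
    + exists (K + K' * Cmod (m k)). split; [nra|]. intros e eta he hi. via Cmod_triangle. rewrite Cmod_mult.
      specialize (I2 e eta he hi). specialize (J2 e eta he hi). nra.
    + au.
    + intros e e' E. rewrite (I4 e e' E), (J4 e e' E). au.
Qed.

(* The low-order coefficients of [W] are recovered from those of the linearised operator: its matrix is triangular
   with diagonal entries [(k - d) a]. *)
Lemma low_functional f0 r (a : C) d rho r' r0 : 0 < r -> holball 0 r f0 -> (2 <= d)%nat -> a <> 0 ->
  bo (S d) (fun y => f0 y - y - a * y ^ d)%C -> 0 < r' <= r -> r' <= rho -> (forall y, Cmod y < r' -> Cmod (f0 y) < rho) -> 0 < r0 < r' ->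
  forall k, exists La, seq_fun r0 La /\ forall W, holball 0 rho W -> coef 0 r0 d W = 0 -> La (fun j => coef 0 r0 j (lin_op f0 W)) = coef 0 r0 k W.
Proof.
  intros hr Hf hd ha Ef h1 h2 h3 h4 k. induction k as [k IH] using (well_founded_induction Wf_nat.lt_wf).
  (* At the resonant index the coefficient is zero by hypothesis and the zero functional returns it;
     at any other index the row [k + d - 1] is solved for its [k]-th unknown. *)
  destruct (Nat.eq_dec k d) as [->|hk].
  { exists (fun _ => RtoC 0). split.
    - split; [intros; ring|split; [exists 0; split; au|au]].
    - au. }
  have IH' : forall j, exists La, (j < k)%nat -> seq_fun r0 La /\ forall W, holball 0 rho W -> coef 0 r0 d W = 0 -> La (fun j => coef 0 r0 j (lin_op f0 W)) = coef 0 r0 j W.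
  { intros j. destruct (Compare_dec.le_lt_dec k j); [exists (fun _ => RtoC 0); lia|]. destruct (IH j l) as [La hLa]. exists La. au. }
  set (A := fun j => proj1_sig (constructive_indefinite_description _ (IH' j))).
  have HA : forall j, (j < k)%nat -> seq_fun r0 (A j) /\ forall W, holball 0 rho W -> coef 0 r0 d W = 0 -> A j (fun j => coef 0 r0 j (lin_op f0 W)) = coef 0 r0 j W.
  { intros j. unfold A. destruct constructive_indefinite_description; auto. }
  set (m := fun j => coef 0 r0 (k + d - 1) (triB f0 j)). set (D := ((INR k - INR d) * a)%C).
  have hD : D <> 0.
  { apply Cmult_neq_0; auto. intro E. apply (proj2 (Ceq_minus _ _)) in E. apply RtoC_inj, INR_eq in E. au. }
  destruct (seq_fun_csum r0 A m k) as [I1 [[K [hK I2]] [I3 I4]]]; [intros; apply HA; auto|].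
  have pD := Cmod_pos _ hD.
  exists (fun e => (e (k + d - 1)%nat - csum k (fun j => A j e * m j)) / D)%C. split; [split; [|split; [|split]]|].
  - intros e e'. rewrite I1. field. au.
  - exists ((/ r0 ^ (k + d - 1) + K) / Cmod D). have x1 : 0 < / r0 ^ (k + d - 1) by pos.
    split; [mono|]. intros e eta he hi. rewrite Cmod_div by auto.
    unfold Rdiv. rewrite (Rmult_comm _ (/ Cmod D)), (Rmult_comm (_ + _)), Rmult_assoc. apply Rmult_le_compat_l; [mono|].
    via Cmod_minus_le. specialize (I2 e eta he hi). specialize (hi (k + d - 1)%nat). lra.
  - au. 
  - intros e e' E. rewrite (I4 e e' E), E. au.
  - intros W HW hW.
    rewrite (lin_op_coef f0 r a d hr Hf hd Ef W rho r' r0 k HW h1 h2 h3 h4). simpl csum.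
    rewrite (triB_coef f0 r a d hr Hf hd Ef r0 k) by lra. fold D.
    rewrite (csum_ext k (fun j => A j _ * m j)%C (fun j => coef 0 r0 j W * m j)%C).
    + unfold m. field. au.
    + intros j hj. rewrite (proj2 (HA j hj)); auto.
Qed.

(** The sequence [h k] may vary with [k], so that the resonant index can be given the zero
    sequence. *)
Lemma low_bound r0 (La : nat -> (nat -> C) -> C) n : (forall k, seq_fun r0 (La k)) -> exists K, 0 <= K /\ forall eta (h : nat -> nat -> C), 0 <= eta -> (forall k j, Cmod (h k j) <= eta / r0 ^ j) ->
  forall y, Cmod y <= 1 -> Cmod (csum n (fun k => La k (h k) * y ^ k)%C) <= K * eta.
Proof.
  intros HLa. induction n as [|n [K [hK IH]]].
  - exists 0. split; [lra|]. intros. simpl. lra.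
  - destruct (HLa n) as [_ [[K' [hK' H']] _]].
    exists (K + K'). split; [lra|]. intros eta h he Hb y hy. simpl. via Cmod_triangle.
    specialize (IH eta h he Hb y hy). rewrite Cmod_mult, Cmod_pow. have b := H' (h n) eta he (Hb n).
    assert (Cmod y ^ n <= 1) by (have py := Cmod_ge_0 y; apply pow_le_1; lra).
    assert (Cmod (La n (h n)) * Cmod y ^ n <= K' * eta * 1) by mono. lra.
Qed.

(** Where the weight vanishes the product is continuous because [h] stays bounded on the support of
    the weight; outside of it nothing is known of [h]. *)
Lemma ccont_weight (p : R -> R) (h : R -> C) B t : (forall u, 0 <= p u) -> ccont (fun u => RtoC (p u)) t ->
  (forall u, 0 < p u -> Cmod (h u) <= B) -> (0 < p t -> ccont h t) -> ccont (fun u => RtoC (p u) * h u)%C t.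
Proof.
  intros hp Cp HB Hh. destruct (Rle_lt_or_eq_dec 0 (p t) (hp t)) as [h0|h0].
  - au.
  - intros e he. have q := Rabs_pos B. destruct (Cp (e / (Rabs B + 1))) as [d [hd h1]]; [pos|].
    exists d; split; auto. intros u hu. specialize (h1 u hu). rewrite <- h0 in *. rewrite C0r, Cmod_R, Rabs_pos_eq in h1 by auto.
    replace (RtoC (p u) * h u - RtoC 0 * h t)%C with (RtoC (p u) * h u)%C by ring. rewrite Cmod_mult, Cmod_R, Rabs_pos_eq by auto.
    destruct (Rle_lt_or_eq_dec 0 (p u) (hp u)) as [h2|h2]; [|rewrite <- h2; lra].
    specialize (HB u h2). have a := Rle_abs B.
    assert (p u * (Rabs B + 1) < e).
    { apply Rlt_le_trans with (e / (Rabs B + 1) * (Rabs B + 1)); [au|]. apply Req_le; field; lra. }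
    assert (p u * Cmod (h u) <= p u * (Rabs B + 1)) by mono. lra.
Qed.

Lemma ccont_Rmax (h : R -> C) s t : ccont h t -> ccont (fun u => RtoC (Rmax 0 (s - Cmod (h u)))) t.
Proof.
  intros H e he. destruct (H e he) as [d [hd h1]]. exists d; split; auto. intros u hu. specialize (h1 u hu).
  rewrite <- RtoC_minus, Cmod_R. eapply Rle_lt_trans; [|exact h1].
  have a := Cmod_rev (h u) (h t). have b := Cmod_rev (h t) (h u). rewrite Cmod_sym in b.
  apply Rabs_le. unfold Rmax. repeat destruct Rle_dec; lra.
Qed.

Section Setup.
Variables f g fi gi : C -> C -> C.
Variables R1 L : R.
Variables (a : C) (d : nat).
Definition lipschitz2 (h : C -> C -> C) := forall x y x' y', Cmod x < R1 -> Cmod y < R1 -> Cmod x' < R1 -> Cmod y' < R1 ->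
  Cmod (h x y - h x' y') <= L * (Cmod (x - x') + Cmod (y - y')).
(** The normalised situation: [f] and [g] agree on [x = 0], and all maps share one radius and one
    Lipschitz constant. [c_dg] combines that agreement with a Lipschitz bound for the derivative of
    [g]; it measures how far [g x] is from the linearisation of [f 0]. *)
Record core : Prop := {
  c_R1 : 0 < R1 <= 1; c_L : 1 <= L;
  c_f : hol2 (pd2 R1 R1) f; c_g : hol2 (pd2 R1 R1) g; c_fi : hol2 (pd2 R1 R1) fi; c_gi : hol2 (pd2 R1 R1) gi;
  c_fl : lipschitz2 f; c_gl : lipschitz2 g; c_fil : lipschitz2 fi; c_gil : lipschitz2 gi;
  c_f1 : forall x y, Cmod x < R1 -> Cmod y < R1 -> fi x (f x y) = y;
  c_f2 : forall x y, Cmod x < R1 -> Cmod y < R1 -> f x (fi x y) = y;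
  c_g1 : forall x y, Cmod x < R1 -> Cmod y < R1 -> gi x (g x y) = y;
  c_fg : forall y, Cmod y < R1 -> f 0 y = g 0 y;
  c_f0 : f 0 0 = 0; c_g0 : g 0 0 = 0; c_fi0 : fi 0 0 = 0; c_gi0 : gi 0 0 = 0;
  c_dg : forall x y y', Cmod x < R1 -> Cmod y < R1 -> Cmod y' < R1 -> Cmod (cD (g x) y - cD (f 0) y') <= L * (Cmod x + Cmod (y - y'));
  c_a : a <> 0; c_d : (2 <= d)%nat; c_exp : bo (S d) (fun y => f 0 y - y - a * y ^ d)%C }.
Hypothesis HC : core.

Definition Fd (x : C) (V : C -> C) (y : C) : C := (f x y + V (f x y) - g x (y + V y))%C.

(** Nested radii: boundary values are taken on the circle [s], the unknown [V] lives on the disc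
    [rho], at each point of the circle one branch leads into the disc [s'], and [s2] is the cut-off
    of the weights. The gaps leave room for the perturbation by [x]. *)
Variables s s' s2 rho : R.
Hypothesis Hs : 0 < s' < s2 /\ s2 < rho < s /\ 16 * L * s <= R1.
Hypothesis Hgeo : forall t, Cmod (f 0 (cir s t)) <= s' \/ Cmod (fi 0 (cir s t)) <= s'.

Lemma su_le (h : C -> C -> C) x y : lipschitz2 h -> h 0 0 = 0 -> Cmod x < R1 -> Cmod y < R1 -> Cmod (h x y) <= L * (Cmod x + Cmod y).
Proof.
  intros hl h0 hx hy. have a1 := c_R1 HC. have e := hl x y 0 0 hx hy. rewrite Cmod_0 in e. specialize (e _lra _lra). rewrite h0, !C0r in e. lra.
Qed.

Variables x1 beta : R.
Hypothesis Hx1 : 0 < x1 /\ 16 * L * x1 <= rho /\ 2 * L * x1 <= rho - s2 /\ 0 < beta /\ 16 * L * beta <= R1.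
Definition rr : R := rho / (4 * L).
Definition r0 : R := rr / 2.
Lemma consts : (0 < R1 <= 1 /\ 1 <= L) /\ (16 * s <= R1 /\ 0 < s' < s2 /\ s2 < rho < s) /\ (0 < r0 < rr /\ rr <= rho /\ 4 * L * rr = rho) /\ 0 < beta <= R1 / 16 /\ x1 <= rho / 16.
Proof.
  have a1 := c_R1 HC. have a2 := c_L HC. destruct Hs as [q1 [q2 q3]]. destruct Hx1 as [q4 [q5 [q6 [q7 q8]]]].
  have e : 4 * L * rr = rho by (unfold rr; field; lra). assert (0 < rr) by mono.
  have m : forall u, 0 < u -> 1 * u <= L * u by au.
  have m1 := m s _lra. have m2 := m x1 _lra. have m3 := m beta _lra. have m4 := m rr _lra. unfold r0. lra.
Qed.
Ltac su := let H := fresh in have H := consts; decompose [and] H; clear H; destruct Hx1 as [? [? [? [? ?]]]].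

Lemma su_x x : Cmod x < x1 -> Cmod x < R1 /\ L * Cmod x <= rho / 16 /\ L * Cmod x < rho - s2.
Proof. intros hx. su. assert (L * Cmod x < L * x1) by (apply Rmult_lt_compat_l; lra). lra. Qed.
Lemma su_cir t : Cmod (cir s t) = s.
Proof. lra. Qed.
Lemma su_0 x y : Cmod x < x1 -> Cmod y < R1 -> forall v, lipschitz2 v -> Cmod (v x y - v 0 y) <= L * Cmod x.
Proof.
  intros hx hy v hv. destruct (su_x x hx) as [h1 _]. su. have e := hv x y 0 y h1 hy _lra hy. lra.
Qed.

(* Each point of the circle is moved inside by [f] or by its inverse, so a conjugacy [id + V] is determined on the circle by its values
   inside; the two expressions for [V], [Ta gi f] and [Ta g fi], are glued with weights supported where [f], resp. [fi], moves inside. *)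
Definition branch (u v : C -> C -> C) : Prop := (hol2 (pd2 R1 R1) u /\ hol2 (pd2 R1 R1) v) /\ (lipschitz2 u /\ lipschitz2 v) /\ u 0 0 = 0 /\ v 0 0 = 0.
Lemma branch_f : branch gi f.
Proof. repeat split; apply HC. Qed.
Lemma branch_fi : branch g fi.
Proof. repeat split; apply HC. Qed.
Definition pp (v : C -> C -> C) (t : R) : R := Rmax 0 (s2 - Cmod (v 0 (cir s t))).
Definition ww v t := pp v t / (pp f t + pp fi t).
Definition Ta (u v : C -> C -> C) x (V : C -> C) t : C := (u x (v x (cir s t) + V (v x (cir s t))) - cir s t)%C.
Definition TT x V t : C := (RtoC (ww f t) * Ta gi f x V t + RtoC (ww fi t) * Ta g fi x V t)%C.

Lemma pp_pos v t : 0 <= pp v t.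
Proof. apply Rmax_l. Qed.
Lemma pp_sum t : 0 < pp f t + pp fi t.
Proof.
  su. have a2 := Rmax_r 0 (s2 - Cmod (f 0 (cir s t))). have b2 := Rmax_r 0 (s2 - Cmod (fi 0 (cir s t))).
  fold (pp f t) in a2. fold (pp fi t) in b2. have a1 := pp_pos f t. have b1 := pp_pos fi t. destruct (Hgeo t); lra.
Qed.
Lemma ww_pos v t : 0 <= ww v t.
Proof. apply Rmult_le_pos; [apply pp_pos|apply Rlt_le, Rinv_0_lt_compat, pp_sum]. Qed.
(** Each bound is asked for only where its weight is positive, since elsewhere the corresponding
    formula may leave the domain of [V]. *)
Lemma weighted t (A B : C) M : (0 < ww f t -> Cmod A <= M) -> (0 < ww fi t -> Cmod B <= M) -> Cmod (ww f t * A + ww fi t * B) <= M.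
Proof.
  intros hA hB. have E : ww f t + ww fi t = 1 by (unfold ww; field; have q := pp_sum t; lra).
  via Cmod_triangle. rewrite !Cmod_mult, !Cmod_R, !Rabs_pos_eq by apply ww_pos.
  have P : forall w X : R, 0 <= w -> (0 < w -> X <= M) -> w * X <= w * M.
  { intros w X h hX. destruct (Rle_lt_or_eq_dec 0 w h) as [|<-]; au. }
  have p1 := P _ _ (ww_pos f t) hA. have p2 := P _ _ (ww_pos fi t) hB.
  replace M with ((ww f t + ww fi t) * M) by (rewrite E; ring). lra.
Qed.
Lemma su_in u v x t : branch u v -> Cmod x < x1 -> 0 < ww v t -> Cmod (v x (cir s t)) < rho.
Proof.
  intros [_ [[_ hl] _]] hx h. destruct (su_x x hx) as [h1 [h2 h3]]. su.
  have e := su_0 x (cir s t) hx _lra v hl. have e2 := Cmod_rev (v x (cir s t)) (v 0 (cir s t)).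
  revert h. unfold ww, pp at 1, Rmax. destruct Rle_dec; intros; [lra|]. lra.
Qed.

Lemma su_ccont (h : C -> C -> C) x t : hol2 (pd2 R1 R1) h -> Cmod x < R1 -> ccont (fun t => h x (cir s t)) t.
Proof.
  intros H hx. su. apply (ccont_hol (h x) (cir s)); [au|].
  apply (hol2_y (pd2 R1 R1) h x 0 R1 H); [|lra]. au.
Qed.
Lemma ww_cont u v t : branch u v -> ccont (fun t => RtoC (ww v t)) t.
Proof.
  intros [[_ H] _]. have z : Cmod 0 < R1 by (su; rewrite Cmod_0; lra).
  have c : forall v, hol2 (pd2 R1 R1) v -> ccont (fun t => RtoC (pp v t)) t by (intros w hw; apply (ccont_Rmax (fun t => w 0 (cir s t))), su_ccont; auto).
  have nz : forall t, (RtoC (pp f t) + RtoC (pp fi t))%C <> 0.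
  { intros u' E. rewrite <- RtoC_plus in E. apply RtoC_inj in E. have q := pp_sum u'. lra. }
  apply (ccont_ext (fun t => RtoC (pp v t) / (RtoC (pp f t) + RtoC (pp fi t)))%C).
  - intros w. unfold ww. rewrite RtoC_div, RtoC_plus; auto. have q := pp_sum w. lra.
  - apply ccont_div; auto. apply ccont_plus; apply c; apply HC.
Qed.

Definition good (V : C -> C) := holball 0 rho V /\ forall y, Cmod y < rho -> Cmod (V y) <= beta.
Lemma good_in V y : good V -> Cmod y < rho -> Cmod (y + V y) < R1 /\ Cmod (V y) <= beta.
Proof. intros [_ h] hy. specialize (h y hy). su. have t := Cmod_triangle y (V y). lra. Qed.
Lemma good_minus V W : good V -> good W -> holball 0 rho (fun y => V y - W y)%C.
Proof. intros GV GW z hz. apply hol_minus; [apply GV|apply GW]; auto. Qed.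

(** The boundary operator is only [L]-Lipschitz. The contraction comes from the factor [(rho / s)^N]
    gained on the way from the circle to the smaller disc. *)
Lemma T_diff x V W (D : R) t : Cmod x < x1 -> good V -> good W -> (forall y, Cmod y < rho -> Cmod (V y - W y) <= D) ->
  Cmod (TT x V t - TT x W t) <= L * D.
Proof.
  intros hx GV GW HD. destruct (su_x x hx) as [h1 _]. unfold TT.
  replace (ww f t * Ta gi f x V t + ww fi t * Ta g fi x V t - (ww f t * Ta gi f x W t + ww fi t * Ta g fi x W t))%C with
    (ww f t * (Ta gi f x V t - Ta gi f x W t) + ww fi t * (Ta g fi x V t - Ta g fi x W t))%C by ring.
  have P : forall u v, branch u v -> 0 < ww v t -> Cmod (Ta u v x V t - Ta u v x W t) <= L * D.
  { intros u v hb h. have i := su_in u v x t hb hx h. destruct hb as [_ [[hu _] _]]. unfold Ta. set (w := v x (cir s t)) in *.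
    replace (u x (w + V w) - cir s t - (u x (w + W w) - cir s t))%C with (u x (w + V w)%C - u x (w + W w)%C)%C by ring.
    eapply Rle_trans; [apply hu; auto; apply good_in; auto|]. rewrite Cmod_self.
    replace (w + V w - (w + W w))%C with (V w - W w)%C by ring. specialize (HD _ i). su. au. }
  apply weighted; apply P; [exact branch_f|exact branch_fi].
Qed.

Lemma Ta_bound u v x V t : branch u v -> Cmod x < x1 -> good V -> 0 < ww v t -> Cmod (Ta u v x V t) <= 3 * L.
Proof.
  intros hb hx GV h. destruct (su_x x hx) as [h1 _]. have i := su_in u v x t hb hx h. destruct hb as [_ [[hu _] [hu0 _]]]. destruct (good_in V _ GV i) as [i2 _].
  unfold Ta. via Cmod_minus_le. rewrite su_cir. have e := su_le u x _ hu hu0 h1 i2. su.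
  assert (L * (Cmod x + Cmod (v x (cir s t) + V (v x (cir s t)))) <= L * 2) by mono. lra.
Qed.
Lemma T_bound x V t : Cmod x < x1 -> good V -> Cmod (TT x V t) <= 3 * L.
Proof. intros hx GV. apply weighted; apply Ta_bound; auto; [exact branch_f|exact branch_fi]. Qed.

Lemma hol_of_hol2 (h : C -> C -> C) x (u : C -> C) z : hol2 (pd2 R1 R1) h -> Cmod x < R1 -> hol u z -> Cmod (u z) < R1 -> hol (fun w => h x (u w)) z.
Proof.
  intros H hx Hu hz. apply (hol_comp u (h x)); auto. apply (hol2_y (pd2 R1 R1) h x 0 R1 H); [|lra].
  au.
Qed.
Lemma hol_f0 : holball 0 R1 (f 0).
Proof.
  have a1 := c_R1 HC. intros z hz. rewrite C0r in hz. apply (hol_of_hol2 f 0 (fun w => w)); auto; [apply (c_f HC)|lra|au].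
Qed.

Lemma T_cont x V t : Cmod x < x1 -> good V -> ccont (TT x V) t.
Proof.
  intros hx GV. destruct (su_x x hx) as [h1 _].
  have P : forall u v, branch u v -> ccont (fun t => ww v t * Ta u v x V t)%C t.
  { intros u v hb. apply (ccont_weight (ww v) (Ta u v x V) (3 * L)); [apply ww_pos|apply (ww_cont u); auto|intros; apply Ta_bound; auto|].
    intros h. have i := su_in u v x t hb hx h. destruct hb as [[Hu Hv] _]. unfold Ta. apply ccont_minus; [|au].
    apply (ccont_hol (fun w => u x (w + V w)%C) (fun t => v x (cir s t))); [apply su_ccont; auto|].
    apply hol_of_hol2; auto; [|apply good_in; auto]. apply hol_plus; [au|apply GV; rewrite C0r; auto]. }
  apply (ccont_plus (fun t => ww f t * Ta gi f x V t)%C (fun t => ww fi t * Ta g fi x V t)%C); apply P; [exact branch_f|exact branch_fi].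
Qed.

(* here [X t, V t] is a holomorphic curve in the space of parameters and functions *)
Lemma T_hol (X : C -> C) (V : C -> C -> C) th t0 r : 0 < r -> (forall t, Cmod (t - t0) < r -> hol X t /\ Cmod (X t) < x1 /\ good (V t)) ->
  (forall y, holball t0 r y -> (forall t, Cmod (t - t0) < r -> Cmod (y t) < rho) -> holball t0 r (fun t => V t (y t))) ->
  holball t0 r (fun t => TT (X t) (V t) th).
Proof.
  intros hr H HV.
  have P : forall (h : C -> C -> C) (u : C -> C), hol2 (pd2 R1 R1) h -> holball t0 r u -> (forall t, Cmod (t - t0) < r -> Cmod (u t) < R1) ->
     holball t0 r (fun t => h (X t) (u t)).
  { intros h u Hh Hu Bu. apply (hol2_ball (pd2 R1 R1) h X u t0 r Hh). intros t ht. split; [apply H; auto|split; [mono|split; auto]]. apply su_x, H; auto. }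
  have Q : forall u v, branch u v -> holball t0 r (fun t => ww v th * Ta u v (X t) (V t) th)%C.
  { intros u v hb. destruct (Rle_lt_or_eq_dec 0 _ (ww_pos v th)) as [h|<-].
    - have i : forall t, Cmod (t - t0) < r -> Cmod (v (X t) (cir s th)) < rho by (intros t ht; apply (su_in u); auto; apply H; auto). destruct hb as [[Hu Hv] _].
      have Pc : holball t0 r (fun t => v (X t) (cir s th)) by (apply P; auto; [au|intros; rewrite su_cir; su; lra]).
      intros z hz. apply hol_mult; [au|]. apply hol_minus; [|au].
      apply (P u (fun t => v (X t) (cir s th) + V t (v (X t) (cir s th)))%C); auto.
      + intros t ht. apply hol_plus; auto. apply (HV (fun t => v (X t) (cir s th))); auto.
      + intros t ht. apply good_in; auto. apply H; auto.
    - intros z hz. apply (hol_ext_all (fun _ => RtoC 0)); [intros; ring|au]. }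
  intros z hz. unfold TT. apply hol_plus; [apply (Q gi f branch_f)|apply (Q g fi branch_fi)]; auto.
Qed.

Lemma su_f x y : Cmod x < x1 -> Cmod y < rr -> Cmod (f x y) <= rho - rho / 4.
Proof.
  intros hx hy. destruct (su_x x hx) as [h1 [h2 _]]. su.
  have e := su_le f x y (c_fl HC) (c_f0 HC) h1 _lra. assert (L * Cmod y <= L * rr) by mono. lra.
Qed.
Lemma su_f' x y : Cmod x < x1 -> Cmod y < rr -> Cmod (f x y) < rho.
Proof. intros hx hy. have q := su_f x y hx hy. lra. Qed.

Lemma Fd_hol x V : Cmod x < x1 -> good V -> holball 0 rr (Fd x V).
Proof.
  intros hx GV z hz. rewrite C0r in hz. destruct (su_x x hx) as [h1 _]. su.
  have Hf : hol (f x) z by (apply (hol_of_hol2 f x (fun w => w)); auto; [apply (c_f HC)|au|lra]).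
  unfold Fd. apply hol_minus; [apply hol_plus; auto|].
  - apply (hol_comp (f x) V); auto. apply GV. rewrite C0r. apply su_f'; auto.
  - apply hol_of_hol2; auto; [apply (c_g HC)| |apply good_in; auto; lra]. apply hol_plus; [au|apply GV; rewrite C0r; lra].
Qed.

Variable La : nat -> (nat -> C) -> C.
Variable N : nat.
Hypothesis HLa : forall k, seq_fun r0 (La k) /\ forall W, holball 0 rho W -> coef 0 r0 d W = 0 -> La k (fun j => coef 0 r0 j (lin_op (f 0) W)) = coef 0 r0 k W.
Hypothesis HN : (d < N)%nat.

(** A Newton correction of the low-order coefficients by the inverse of the linearised operator; the
    coefficient of index [d], which that inverse does not reach, is prescribed as [c]. *)
Definition bb x c V (k : nat) : C := if Nat.eq_dec k d then c else (coef 0 r0 k V - La k (fun j => coef 0 r0 j (Fd x V)))%C.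
(** A function is rebuilt from its first [N] coefficients and, through the Cauchy integral of the
    remainder, from its values on the circle [s]; each kind of data is replaced by its corrected
    version. *)
Definition Psi (x c : C) (V : C -> C) (y : C) : C := (csum N (fun k => bb x c V k * y ^ k) + y ^ N * tailm s N (TT x V) y)%C.

Lemma La_0 k : La k (fun _ => RtoC 0) = 0.
Proof.
  destruct (HLa k) as [[J1 [_ [_ J4]]] _]. transitivity (La k (fun _ => (RtoC 0 - RtoC 0)%C)); [apply J4; intros; ring|].
  rewrite (J1 (fun _ => RtoC 0) (fun _ => RtoC 0)). ring.
Qed.

Lemma tail_T_hol x V y : Cmod x < x1 -> good V -> Cmod y < s -> hol (tailm s N (TT x V)) y.
Proof. intros hx GV hy. apply hol_tail; auto; intros; try (apply T_cont; auto). intros t _. apply T_cont; auto.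
  exists (3 * L). intros t. apply T_bound; auto. Qed.
Lemma Psi_hol x c V : Cmod x < x1 -> good V -> holball 0 s (Psi x c V).
Proof.
  intros hx GV z hz. rewrite C0r in hz. unfold Psi. apply hol_plus.
  - apply (hol_csum N (fun k y => bb x c V k * y ^ k)%C). au.
  - apply hol_mult; [au|apply tail_T_hol; auto].
Qed.

Lemma Psi_coef x c V : Cmod x < x1 -> good V -> coef 0 r0 d (Psi x c V) = c.
Proof.
  intros hx GV. su. rewrite (coef_unique 0 s (Psi x c V) r0 N (bb x c V) (s / 2) (3 * L / s ^ N * 2)); auto; try lra.
  - unfold bb. destruct Nat.eq_dec; auto. contradiction.
  - apply Psi_hol; auto.
  - intros w hw. replace (0 + w)%C with w by ring. unfold Psi.
    replace (csum N (fun k => bb x c V k * w ^ k) + w ^ N * tailm s N (TT x V) w - csum N (fun k => bb x c V k * w ^ k))%C with (w ^ N * tailm s N (TT x V) w)%C by ring.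
    rewrite Cmod_mult, Cmod_pow, Rmult_comm. apply Rmult_le_compat_r; [mono|].
    eapply Rle_trans; [apply (tail_bound _ _ _ _ (3 * L)); [lra|intros t _; apply T_cont; auto|intros; apply T_bound; auto]|]. apply Rmult_le_compat_l.
    + au.
    + apply Rmult_le_reg_r with (s - Cmod w); [lra|]. replace (s / (s - Cmod w) * (s - Cmod w)) with s by (field; lra). lra.
Qed.

Lemma su_in0 t : Cmod (0 + cir r0 t) = r0.
Proof. su. lra. Qed.
Lemma coef_r0 r h eta k : holball 0 r h -> r0 < r -> (forall y, Cmod y = r0 -> Cmod (h y) <= eta) -> Cmod (coef 0 r0 k h) <= eta / r0 ^ k.
Proof.
  intros H hr B. su. apply (coef_bound (fun t => h (0 + cir r0 t)%C)); [lra|intros t _; apply (ccont_circ 0 r); auto; lra|].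
  intros t. apply B, su_in0.
Qed.

Definition K1 := 8 * L / rho + L + L.
Lemma K1_pos : 0 < K1.
Proof. su. mono. Qed.
(** The linearisation at the identity on [x = 0] serves for all small [x] and [V]. This is the
    price, small because [x] and [V] are. *)
Lemma Fd_diff x V W D y : Cmod x < x1 -> good V -> good W -> (forall y, Cmod y < rho -> Cmod (V y - W y) <= D) -> Cmod y < rr ->
  Cmod (lin_op (f 0) (fun y => V y - W y)%C y - (Fd x V y - Fd x W y)) <= K1 * (Cmod x + beta) * D.
Proof.
  intros hx GV GW HD hy. destruct (su_x x hx) as [h1 [h1' _]]. su.
  have px := Cmod_ge_0 x. set (Z := fun y => (V y - W y)%C). have HZ : holball 0 rho Z by (apply good_minus; auto).
  have hD : 0 <= D by (eapply Rle_trans; au).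
  have z0 : Cmod 0 < x1 by lra.
  unfold Fd, lin_op. replace (Z (f 0 y) - cD (f 0) y * Z y - (f x y + V (f x y) - g x (y + V y) - (f x y + W (f x y) - g x (y + W y))))%C
    with (((g x (y + V y)%C - cD (f 0) y * (y + V y)) - (g x (y + W y)%C - cD (f 0) y * (y + W y))) - (Z (f x y) - Z (f 0 y)))%C by (unfold Z; ring).
  via Cmod_minus_le.
  have E1 : Cmod (Z (f x y) - Z (f 0 y)) <= 8 * L / rho * (Cmod x + beta) * D.
  { eapply Rle_trans; [apply (lip0 rho (rho / 4) Z D); auto; try lra; apply su_f; auto|]. have e := su_0 x y hx _lra f (c_fl HC).
    replace (8 * L / rho * (Cmod x + beta) * D) with (2 * D / (rho / 4) * (L * (Cmod x + beta))) by (field; lra).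
    apply Rmult_le_compat_l; [mono|]. eapply Rle_trans; [exact e|]. mono. }
  have LB : 0 <= L * (Cmod x + beta) by mono.
  have E2 : Cmod ((g x (y + V y)%C - cD (f 0) y * (y + V y)) - (g x (y + W y)%C - cD (f 0) y * (y + W y))) <= L * (Cmod x + beta) * D.
  { have yr : Cmod y < rho by lra. destruct (good_in V y GV yr) as [i1 i2]. destruct (good_in W y GW yr) as [i3 i4].
    have Hv : forall t, 0 <= t <= 1 -> Cmod (y + W y + t * (y + V y - (y + W y)))%C < R1.
    { intros t ht. eapply Rle_lt_trans; [apply (seg_in (y + W y) (y + V y) _ t ht (Rmax_l _ _) (Rmax_r _ _))|]. apply Rmax_lub_lt; auto. }
    via (MVT_C (fun w => g x w - cD (f 0) y * w)%C (fun w => cD (g x) w - cD (f 0) y)%C (y + W y) (y + V y) (L * (Cmod x + beta))).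
    - intros t ht. specialize (Hv t ht). set (v := (y + W y + t * (y + V y - (y + W y)))%C) in *.
      have Hg : hol (g x) v by (apply (hol_of_hol2 g x (fun w => w)); auto; [apply (c_g HC)|au]).
      refine (Cd_ext (fun w => g x w + (- cD (f 0) y) * w)%C _ _ _ 1 _lra _ (Cd_eq _ _ _ _ _ (Cd_plus _ _ _ _ _ (cD_spec _ _ Hg) (Cd_scal (- cD (f 0) y) _ _ _ (Cd_id v))))); [intros; ring|ring].
    - intros t ht. specialize (Hv t ht). set (v := (y + W y + t * (y + V y - (y + W y)))%C) in *.
      eapply Rle_trans; [apply (c_dg HC); auto; lra|]. apply Rmult_le_compat_l; [lra|]. apply Rplus_le_compat_l.
      replace (v - y)%C with (W y + t * (V y - W y))%C by (unfold v; ring). apply seg_in; auto.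
    - replace (y + V y - (y + W y))%C with (V y - W y)%C by ring. au. }
  assert (0 <= L * (Cmod x + beta) * D) by mono.
  replace (K1 * (Cmod x + beta) * D) with (8 * L / rho * (Cmod x + beta) * D + L * (Cmod x + beta) * D + L * (Cmod x + beta) * D) by (unfold K1; ring). lra.
Qed.

Lemma tail_sub V W y : (forall t, ccont V t) -> (forall t, ccont W t) -> Cmod y < s -> tailm s N (fun t => V t - W t)%C y = (tailm s N V y - tailm s N W y)%C.
Proof.
  intros HV HW hy. unfold tailm. rewrite <- mean_minus by (intros t _; apply ccont_tail; auto). apply mean_ext. intros t _. unfold Cdiv. ring.
Qed.

Hypothesis HN2 : L * ((rho / s) ^ N * (s / (s - rho))) <= / 4.
(** [N] is so large that passing from the circle [s] to the disc [rho] gains a factor [1 / (4 L)],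
    enough to beat the Lipschitz constant of the boundary operator. *)
Lemma tail_small V y B : (forall t, ccont V t) -> (forall t, Cmod (V t) <= L * B) -> Cmod y < rho -> Cmod (y ^ N * tailm s N V y) <= B / 4.
Proof.
  intros HV HB hy. su. have py := Cmod_ge_0 y.
  have hB : 0 <= B by (apply Rmult_le_reg_l with L; [lra|]; rewrite Rmult_0_r; eapply Rle_trans; [mono|apply (HB 0)]).
  rewrite Cmod_mult, Cmod_pow. eapply Rle_trans; [apply Rmult_le_compat_l; [apply pow_le; auto|apply (tail_bound V s N y (L * B)); auto; lra || (intros t _; auto)]|].
  replace (Cmod y ^ N * (L * B / s ^ N * (s / (s - Cmod y)))) with (B * (L * (Cmod y ^ N * / s ^ N * (s / (s - Cmod y))))) by (unfold Rdiv; ring).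
  apply Rmult_le_compat_l; auto. eapply Rle_trans; [|exact HN2]. apply Rmult_le_compat_l; [lra|]. unfold Rdiv at 2. rewrite Rpow_mult_distr, pow_inv.
  assert (0 < / s ^ N) by pos.
  apply Rmult_le_compat.
  - mono.
  - mono.
  - apply Rmult_le_compat_r; [lra|]. apply pow_incr. lra.
  - apply Rmult_le_compat_l; [lra|]. apply Rinv_le_contravar; lra.
Qed.

Variable K0 : R.
Hypothesis HK0 : 0 <= K0 /\ forall eta (h : nat -> nat -> C), 0 <= eta -> (forall k j, Cmod (h k j) <= eta / r0 ^ j) ->
  forall y, Cmod y <= 1 -> Cmod (csum N (fun k => La k (h k) * y ^ k)%C) <= K0 * eta.
Hypothesis Hx2 : K0 * (K1 * (x1 + beta)) <= / 4.

(** Common core of contraction and stability: the low coefficients differ by functionals of a single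
    sequence [h], except at the index [d] where they agree, and the boundary values differ by at
    most [L * B]. *)
Lemma Psi_form (b b' : nat -> C) (T T' : R -> C) h eta B y : (forall k, (k < N)%nat -> k = d -> b k = b' k) -> (forall k, k <> d -> (b k - b' k)%C = La k h) ->
  0 <= eta -> (forall j, Cmod (h j) <= eta / r0 ^ j) -> (forall t, ccont T t) -> (forall t, ccont T' t) -> (forall t, Cmod (T t - T' t) <= L * B) -> Cmod y < rho ->
  Cmod ((csum N (fun k => b k * y ^ k)%C + y ^ N * tailm s N T y) - (csum N (fun k => b' k * y ^ k)%C + y ^ N * tailm s N T' y))%C <= K0 * eta + B / 4.
Proof.
  intros Hd Hk he hh cT cT' TB hy.
  replace ((csum N (fun k => b k * y ^ k) + y ^ N * tailm s N T y) - (csum N (fun k => b' k * y ^ k) + y ^ N * tailm s N T' y))%C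
    with ((csum N (fun k => b k * y ^ k) - csum N (fun k => b' k * y ^ k)) + y ^ N * (tailm s N T y - tailm s N T' y))%C by ring.
  rewrite <- csum_minus, <- tail_sub by mono. via Cmod_triangle. apply Rplus_le_compat.
  - rewrite (csum_ext N _ (fun k => La k (if Nat.eq_dec k d then fun _ => RtoC 0 else h) * y ^ k)%C).
    + apply (proj2 HK0); auto; [|su; lra]. intros k j. destruct Nat.eq_dec; auto. rewrite Cmod_0. eapply Rle_trans; au.
    + intros k hk. destruct Nat.eq_dec as [e|e]; [rewrite La_0, (Hd k hk e); ring|rewrite <- (Hk k e); ring].
  - apply tail_small; auto. au.
Qed.

(** Equality of the [d]-th coefficients puts [V - W] in the space where [La] inverts [lin_op]. The
    low-order part then sees only the error of linearisation, the rest only the tail; each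
    contributes at most [D / 4]. *)
Lemma Psi_contract x c V W D : Cmod x < x1 -> good V -> good W -> coef 0 r0 d V = coef 0 r0 d W ->
  (forall y, Cmod y < rho -> Cmod (V y - W y) <= D) -> forall y, Cmod y < rho -> Cmod (Psi x c V y - Psi x c W y) <= D / 2.
Proof.
  intros hx GV GW hc HD y hy. have k1 := K1_pos. su.
  have px := Cmod_ge_0 x. have hD : 0 <= D by (eapply Rle_trans; au).
  set (Z := fun y => (V y - W y)%C). have HZ : holball 0 rho Z by (apply good_minus; auto).
  set (lo := lin_op (f 0) Z). set (er := fun y => (lo y - (Fd x V y - Fd x W y))%C).
  have Hlo : holball 0 rr lo.
  { apply (lin_op_hol (f 0) R1 hol_f0 Z rho rr HZ); try lra. intros; apply su_f'; auto. lra. }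
  have HFV := Fd_hol x V hx GV. have HFW := Fd_hol x W hx GW.
  have HF : holball 0 rr (fun y => Fd x V y - Fd x W y)%C by au.
  set (eta := K1 * (Cmod x + beta) * D).
  have heta : 0 <= eta by (apply Rmult_le_pos; auto; apply Rmult_le_pos; lra).
  eapply Rle_trans; [apply (Psi_form _ _ _ _ (fun j => coef 0 r0 j er) eta D); auto|].
  - intros k _ ->. unfold bb. destruct Nat.eq_dec; congruence.
  - intros k hk. unfold bb. destruct Nat.eq_dec; [congruence|]. destruct (HLa k) as [[J1 [J2 [_ J4]]] J5].
    rewrite (J4 (fun j => coef 0 r0 j er) (fun j => coef 0 r0 j lo - (coef 0 r0 j (Fd x V) - coef 0 r0 j (Fd x W)))%C).
    + rewrite !J1. unfold lo. rewrite J5; auto.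
      * unfold Z. rewrite (coef_minus 0 rho); try apply GV; try apply GW; try lra. ring.
      * unfold Z. rewrite (coef_minus 0 rho); try apply GV; try apply GW; try lra. rewrite hc. ring.
    + intros i. unfold er. rewrite (coef_minus 0 rr), (coef_minus 0 rr); auto.
  - intros j. apply (coef_r0 rr); [intros z hz; apply hol_minus; auto|lra|]. intros z hz. apply Fd_diff; auto. lra.
  - intros; apply T_cont; auto.
  - intros; apply T_cont; auto.
  - intros t. apply T_diff; auto.
  - assert (K0 * eta <= D / 4); [|lra]. apply Rle_trans with (K0 * (K1 * (x1 + beta)) * D).
    + unfold eta. rewrite <- !Rmult_assoc. au.
    + apply Rle_trans with (/ 4 * D); au.
Qed.

(** An approximate conjugacy is almost fixed by [Psi]: the correction of its coefficients is [La] of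
    the defect, and on the circle it satisfies both boundary formulas up to [L * eta] where their
    weights are positive. The margin [del] makes [W] holomorphic across the circle. *)
Lemma Psi_stab x W eta del c : Cmod x < x1 -> 0 < del -> holball 0 (s + del) W -> (forall y, Cmod y <= s -> Cmod (W y) <= beta) -> coef 0 r0 d W = c ->
  (forall y, Cmod y <= s -> Cmod (f x y) <= s -> Cmod (Fd x W y) <= eta) -> 0 <= eta /\ forall y, Cmod y < rho -> Cmod (W y - Psi x c W y) <= (K0 + 1) * eta.
Proof.
  intros hx hdel HW BW hc HE. destruct (su_x x hx) as [h1 [h1' _]]. su.
  have GW : good W by (split; au).
  have he : 0 <= eta.
  { have q := su_f x 0 hx _lra. eapply Rle_trans; [mono|apply (HE 0)]; [lra|]; lra. }
  split; [auto|]. intros y hy.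
  have CW : forall t, ccont (fun t => W (cir s t)) t.
  { intros t. apply (ccont_ext (fun t => W (0 + cir s t)%C)); [intros; f_equal; ring|]. apply (ccont_circ 0 (s + del)); auto; lra. }
  have TB : forall t, Cmod (W (cir s t) - TT x W t) <= L * eta.
  { intros t. set (z := cir s t). have hz : Cmod z = s by apply su_cir.
    have E : W z = (ww f t * W z + ww fi t * W z)%C.
    { replace (ww f t * W z + ww fi t * W z)%C with (RtoC (ww f t + ww fi t) * W z)%C by (rewrite RtoC_plus; ring).
      replace (ww f t + ww fi t) with 1 by (unfold ww; field; have q := pp_sum t; lra). ring. }
    rewrite E. unfold TT. replace (ww f t * W z + ww fi t * W z - (ww f t * Ta gi f x W t + ww fi t * Ta g fi x W t))%C
      with (ww f t * (W z - Ta gi f x W t) + ww fi t * (W z - Ta g fi x W t))%C by ring. apply weighted; intros h.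
    (* In the first branch the equation is used at [z] and solved by [gi x]; in the second it is
       used at the preimage [w] of [z] under [f x]. *)
    - have i := su_in gi f x t branch_f hx h. destruct (good_in _ _ GW i) as [i2 _]. fold z in i, i2.
      have hzW := Cmod_triangle z (W z). have bz := BW z _lra. have q := HE z _lra _lra. unfold Fd in q.
      unfold Ta. fold z. replace (W z - (gi x (f x z + W (f x z)) - z))%C with ((z + W z) - gi x (f x z + W (f x z))%C)%C by ring.
      rewrite <- (c_g1 HC x (z + W z)%C h1) at 1 by lra. rewrite Cmod_sym.
      have hg := su_le g x (z + W z)%C (c_gl HC) (c_g0 HC) h1 _lra.
      assert (L * (Cmod x + Cmod (z + W z)) <= L * (x1 + (s + beta))) by mono. destruct Hs as [_ [_ hs3]].
      eapply Rle_trans; [apply (c_gil HC); auto; lra|]. rewrite Cmod_self. au.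
    - have i := su_in g fi x t branch_fi hx h. unfold Ta. fold z in i |- *. set (w := fi x z) in *. have fw : f x w = z by (apply (c_f2 HC); auto; lra).
      replace (W z - (g x (w + W w) - z))%C with (z + W z - g x (w + W w)%C)%C by ring. rewrite <- fw.
      have q := HE w _lra ltac:(rewrite fw; lra). unfold Fd in q. assert (1 * eta <= L * eta) by mono. lra. }
  have E := taylor 0 (s + del) W s N y HW _lra _lra. replace (0 + y)%C with y in E by ring. rewrite E at 1.
  replace (rem 0 s N W y) with (tailm s N (fun t => W (cir s t)) y) by (unfold rem, tailm; apply mean_ext; intros t _; do 2 f_equal; f_equal; ring).
  eapply Rle_trans; [apply (Psi_form _ _ _ _ (fun j => coef 0 r0 j (Fd x W)) eta eta); auto|].
  - intros k _ ->. rewrite (coef_indep 0 (s + del) (s + del) W s r0) by mono. unfold bb. destruct Nat.eq_dec; congruence.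
  - intros k hk. rewrite (coef_indep 0 (s + del) (s + del) W s r0) by mono. unfold bb. destruct Nat.eq_dec; [congruence|ring].
  - intros j. apply (coef_r0 rr); [apply Fd_hol; auto|lra|]. intros z hz. have q := su_f x z hx _lra. au.
  - intros; apply T_cont; auto.
  - lra.
Qed.

(** * The fixed point and its dependence on the parameters *)

Variable c1 : R.
Hypothesis Hc1 : 0 < c1 <= beta / 8 /\ (K0 + 1) * (2 * L * (x1 + c1)) <= beta / 8.

(** Starting point of the iteration: it has the prescribed coefficient, and its defect is small with
    [x] and [c] because [f] and [g] agree on [x = 0]. *)
Definition V0 (c y : C) : C := (c * y ^ d)%C.
Lemma V0_le c y : Cmod y <= 1 -> Cmod (V0 c y) <= Cmod c.
Proof.
  intros hy. unfold V0. rewrite Cmod_mult, Cmod_pow. have p := Cmod_ge_0 y.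
  assert (Cmod y ^ d <= 1) by (apply pow_le_1; lra). assert (Cmod c * Cmod y ^ d <= Cmod c * 1) by mono. lra.
Qed.
Lemma V0_hol c r : holball 0 r (V0 c).
Proof. intros z _. apply hol_mult; au. Qed.

Lemma Psi_base x c y : Cmod x < x1 -> Cmod c < c1 -> Cmod y < rho -> Cmod (Psi x c (V0 c) y - V0 c y) <= beta / 8.
Proof.
  intros hx hc hy. destruct (su_x x hx) as [h1 _]. su. destruct HK0 as [hK0 _]. destruct Hc1 as [hc1 hc2]. rewrite Cmod_sym.
  eapply Rle_trans; [apply (Psi_stab x (V0 c) (2 * L * (x1 + c1)) 1); auto; [lra|apply V0_hol| |apply (coef_mono R1 d (c_d HC)); lra|]|exact hc2].
  - intros z hz. eapply Rle_trans; [apply V0_le; lra|lra].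
  - intros z hz hfz. unfold Fd. have b0 := V0_le c z _lra. have b1 := V0_le c (f x z) _lra.
    replace (f x z + V0 c (f x z) - g x (z + V0 c z))%C with (((f x z - f 0 z) - (g x z - g 0 z)) + V0 c (f x z) - (g x (z + V0 c z)%C - g x z))%C by (rewrite (c_fg HC z) by lra; ring).
    via Cmod_minus_le. have b2 := Cmod_triangle ((f x z - f 0 z) - (g x z - g 0 z)) (V0 c (f x z)).
    have b3 := Cmod_minus_le (f x z - f 0 z) (g x z - g 0 z). have b4 := su_0 x z hx _lra f (c_fl HC). have b5 := su_0 x z hx _lra g (c_gl HC).
    have b6 := Cmod_triangle z (V0 c z). have b7 := c_gl HC x (z + V0 c z)%C x z h1 _lra h1 _lra.
    rewrite Cmod_self in b7. replace (z + V0 c z - z)%C with (V0 c z) in b7 by ring.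
    assert (L * Cmod x <= L * x1) by mono. assert (L * (0 + Cmod (V0 c z)) <= L * c1) by mono.
    assert (1 * c1 <= L * c1) by mono. lra.
Qed.

Fixpoint Vk (n : nat) (x c : C) : C -> C := match n with O => V0 c | S n => Psi x c (Vk n x c) end.

Lemma half_pos n : 0 < (/ 2) ^ n.
Proof. mono. Qed.
Lemma Vk_spec x c : Cmod x < x1 -> Cmod c < c1 -> forall n, good (Vk n x c) /\ coef 0 r0 d (Vk n x c) = c /\
  (forall y, Cmod y < rho -> Cmod (Vk n x c y - V0 c y) <= beta / 4 * (1 - (/ 2) ^ n) /\ Cmod (Vk (S n) x c y - Vk n x c y) <= beta / 8 * (/ 2) ^ n).
Proof.
  intros hx hc. su. destruct Hc1 as [hc1 hc2].
  have G : forall V, holball 0 s V -> (forall y, Cmod y < rho -> Cmod (V y - V0 c y) <= beta / 4) -> good V.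
  { intros V HV D. split; [au|]. intros y hy. specialize (D y hy).
    have t := Cmod_rev (V y) (V0 c y). have q := V0_le c y _lra. lra. }
  induction n.
  - split; [apply G; [apply V0_hol|]; intros; simpl; rewrite Cmod_self; lra|split].
    + simpl. unfold V0. apply (coef_mono R1 d (c_d HC)); lra.
    + intros y hy. simpl. rewrite Cmod_self. split; [lra|]. eapply Rle_trans; [apply Psi_base; auto|lra].
  - destruct IHn as [i1 [i2 i3]].
    have D : forall y, Cmod y < rho -> Cmod (Vk (S n) x c y - V0 c y) <= beta / 4 * (1 - (/ 2) ^ S n).
    { intros y hy. destruct (i3 y hy) as [j1 j2]. via (Cmod_tri _ (Vk n x c y)). simpl pow. lra. }
    have G1 : good (Vk (S n) x c).
    { apply G; [apply Psi_hol; auto|]. intros y hy. eapply Rle_trans; [au|]. have h := half_pos (S n).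
      assert (0 < beta / 4 * (/ 2) ^ S n) by pos. lra. }
    have Cf : coef 0 r0 d (Vk (S n) x c) = c by (apply Psi_coef; auto).
    split; [auto|split; [auto|]]. intros y hy. split; [mono|].
    eapply Rle_trans; [apply (Psi_contract x c (Vk (S n) x c) (Vk n x c) (beta / 8 * (/ 2) ^ n)); auto|simpl; lra].
    + rewrite i2, Cf. au.
    + intros z hz. apply i3; auto.
Qed.

Lemma VV_ex x c y : exists v, Cmod x < x1 -> Cmod c < c1 -> Cmod y < rho -> forall n, Cmod (Vk n x c y - v) <= beta / 4 * (/ 2) ^ n.
Proof.
  destruct (classic (Cmod x < x1 /\ Cmod c < c1 /\ Cmod y < rho)) as [[hx [hc hy]]|h]; [|exists 0; intros; tauto]. su.
  destruct (geom_lim (fun n => Vk n x c y) (beta / 8) (/ 2)) as [v hv]; [lra|lra| |].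
  - intros n. apply (Vk_spec x c hx hc n); auto.
  - exists v. intros _ _ _ n. via hv. lra.
Qed.
Definition VV x c y : C := proj1_sig (constructive_indefinite_description _ (VV_ex x c y)).
Lemma VV_lim x c y : Cmod x < x1 -> Cmod c < c1 -> Cmod y < rho -> forall n, Cmod (Vk n x c y - VV x c y) <= beta / 4 * (/ 2) ^ n.
Proof. unfold VV. destruct constructive_indefinite_description as [v hv]. au. Qed.

Lemma VV_unif e : 0 < e -> exists n, 2 * beta * (/ 2) ^ n <= e /\ forall k x c y, (n <= k)%nat -> Cmod x < x1 -> Cmod c < c1 -> Cmod y < rho -> Cmod (Vk k x c y - VV x c y) <= e.
Proof.
  intros he. su. destruct (pow_small (/ 2) (e / (2 * beta))) as [n hn]; [lra|pos|].
  have h : forall k, (n <= k)%nat -> 2 * beta * (/ 2) ^ k <= e.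
  { intros k hk. apply Rle_trans with (2 * beta * (e / (2 * beta))); [mono|apply Req_le; field; lra]. }
  exists n. split; [auto|]. intros k x c y hk hx hc hy. eapply Rle_trans; [apply VV_lim; auto|]. specialize (h k hk).
  assert (0 < beta * (/ 2) ^ k) by mono. lra.
Qed.

Lemma VV_good x c : Cmod x < x1 -> Cmod c < c1 -> good (VV x c).
Proof.
  intros hx hc. split.
  - intros z hz. rewrite C0r in hz. set (r := rho - Cmod z). have hr : 0 < r by (unfold r; lra).
    have hi : forall w, Cmod (w - z) < r -> Cmod w < rho by (intros w hw; have q := Cmod_rev w z; unfold r in hw; lra).
    apply (lim_hol (fun n => Vk n x c) (VV x c) z r hr).
    + intros n w hw. destruct (Vk_spec x c hx hc n) as [[G _] _]. au.
    + intros e he. destruct (VV_unif e he) as [n [_ hn]]. exists n. au.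
  - intros y hy. su. destruct Hc1 as [hc1 _]. have q := VV_lim x c y hx hc hy 0. simpl in q.
    have q2 := V0_le c y _lra. have t := Cmod_rev (VV x c y) (V0 c y). rewrite Cmod_sym in t. lra.
Qed.

Lemma VV_coef x c : Cmod x < x1 -> Cmod c < c1 -> coef 0 r0 d (VV x c) = c.
Proof.
  intros hx hc. destruct (VV_good x c hx hc) as [G _]. su. apply Cmod_small_eq. intros e he. have pr : 0 < r0 ^ d by pos.
  destruct (VV_unif (e * r0 ^ d)) as [n [_ hn]]; [pos|]. destruct (Vk_spec x c hx hc n) as [[Gn _] [h _]].
  rewrite <- h at 2. rewrite <- (coef_minus 0 rho) by mono.
  eapply Rle_trans; [apply (coef_r0 rho _ (e * r0 ^ d)); [au|lra|]|].
  - intros y hy. rewrite Cmod_sym. au.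
  - apply Req_le. field. lra.
Qed.

Lemma VV_fix x c y : Cmod x < x1 -> Cmod c < c1 -> Cmod y < rho -> Psi x c (VV x c) y = VV x c y.
Proof.
  intros hx hc hy. apply Cmod_small_eq. intros e he. destruct (VV_unif (e / 2) _lra) as [n [_ hn]].
  destruct (Vk_spec x c hx hc n) as [Gn [h _]]. have G := VV_good x c hx hc.
  via (Cmod_tri _ (Vk (S n) x c y)). have q1 := hn (S n) x c y ltac:(lia) hx hc hy.
  have q2 : Cmod (Psi x c (VV x c) y - Vk (S n) x c y) <= e / 2 / 2.
  { apply (Psi_contract x c (VV x c) (Vk n x c) (e / 2)); auto; [rewrite h; apply VV_coef; auto|].
    intros z hz. rewrite Cmod_sym. au. }
  lra.
Qed.

Lemma coef_curve_hol (h : C -> C -> C) t0 r r' M k : 0 < r -> r0 < r' -> (forall t, Cmod (t - t0) < r -> holball 0 r' (h t)) -> (forall y, Cmod y = r0 -> holball t0 r (fun t => h t y)) ->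
  (forall t y, Cmod (t - t0) < r -> Cmod y = r0 -> Cmod (h t y) <= M) -> hol (fun t => coef 0 r0 k (h t)) t0.
Proof.
  intros hr hr' H1 H2 HM. su. have nz : forall th, (cir r0 th ^ k)%C <> 0 by (intros; apply Cpow_nz, cir_nz; lra).
  apply (param_int (fun t th => (h t (0 + cir r0 th) / cir r0 th ^ k)%C) t0 r (M / r0 ^ k)); auto.
  - au.
  - intros t th ht. rewrite Cmod_div, Cmod_pow, Cmod_cir by mono. apply Rmult_le_compat_r; [mono|]. apply HM; auto. lra.
  - intros t th ht. apply ccont_coef; [lra|]. apply (ccont_circ 0 r'); au.
Qed.

(** Coefficients and boundary means are integrals with parameters, and the functionals [La] are
    holomorphic along curves by [seq_fun]; thus holomorphy in [(x, c, y)] passes from each iterate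
    to the next. *)
Lemma Psi_hol3 (Vf : C -> C -> C -> C) : hol3 (pd3 x1 c1 rho) Vf -> (forall x c, Cmod x < x1 -> Cmod c < c1 -> good (Vf x c)) ->
  hol3 (pd3 x1 c1 rho) (fun x c y => Psi x c (Vf x c) y).
Proof.
  intros H G g1 g2 g3 t0 r hr h. su. have h00 : Cmod (t0 - t0) < r by lra.
  have GG : forall t, Cmod (t - t0) < r -> good (Vf (g1 t) (g2 t)) /\ Cmod (g1 t) < x1 by (intros t ht; destruct (h t ht) as [_ [_ [_ [p1 [p2 p3]]]]]; auto).
  have HV : forall y, holball t0 r y -> (forall t, Cmod (t - t0) < r -> Cmod (y t) < rho) -> holball t0 r (fun t => Vf (g1 t) (g2 t) (y t)).
  { intros y hy by'. apply (hol3_ball _ _ g1 g2 y t0 r H). intros t ht. destruct (h t ht) as [p1 [p2 [_ [p3 [p4 _]]]]]. split; [|au]; auto. }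
  have Cc : forall k, hol (fun t => coef 0 r0 k (Vf (g1 t) (g2 t))) t0.
  { intros k. apply (coef_curve_hol (fun t => Vf (g1 t) (g2 t)) t0 r rho beta); auto; [lra|intros; apply GG; auto| |].
    - au.
    - intros t y ht hy. apply GG; auto. lra. }
  have Cf : forall k, hol (fun t => coef 0 r0 k (Fd (g1 t) (Vf (g1 t) (g2 t)))) t0.
  { intros k. apply (coef_curve_hol (fun t => Fd (g1 t) (Vf (g1 t) (g2 t))) t0 r rr (4 * L)); auto; [intros; apply Fd_hol; apply GG; auto| |].
    - intros z hz t ht. have gx : forall u, Cmod (u - t0) < r -> Cmod (g1 u) < R1 by (intros u hu; apply su_x, GG; auto).
      have Hf : holball t0 r (fun t => f (g1 t) z).
      { apply (hol2_ball (pd2 R1 R1) f g1 (fun _ => z) t0 r (c_f HC)). intros u hu. split; [apply h; auto|au]. }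
      unfold Fd. apply hol_minus; [apply hol_plus; auto|].
      + apply (HV (fun t => f (g1 t) z)); auto. intros u hu. apply su_f'; [apply GG; auto|lra].
      + apply (hol2_ball (pd2 R1 R1) g g1 (fun t => z + Vf (g1 t) (g2 t) z)%C t0 r (c_g HC)); auto. intros u hu. split; [apply h; auto|split; [|split; [auto|]]].
        * apply hol_plus; [au|]. apply (HV (fun _ => z)); auto; au.
        * apply good_in; [apply GG; auto|lra].
    - intros t z ht hz. destruct (GG t ht) as [gt xt]. unfold Fd.
      have b1 := su_f' (g1 t) z xt _lra. destruct (good_in _ _ gt b1) as [_ b2]. destruct (good_in _ z gt _lra) as [b3 _].
      destruct (su_x _ xt) as [b4 _]. have b5 := su_le g _ _ (c_gl HC) (c_g0 HC) b4 b3.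
      assert (L * (Cmod (g1 t) + Cmod (z + Vf (g1 t) (g2 t) z)) <= L * 2) by mono.
      via Cmod_minus_le. have b6 := Cmod_triangle (f (g1 t) z) (Vf (g1 t) (g2 t) (f (g1 t) z)). lra. }
  unfold Psi. apply hol_plus.
  - apply (hol_csum N (fun k t => bb (g1 t) (g2 t) (Vf (g1 t) (g2 t)) k * g3 t ^ k)%C). intros k _. apply hol_mult; [|apply hol_pow, h; auto].
    unfold bb. destruct (Nat.eq_dec k d); [apply h; auto|]. apply hol_minus; auto. destruct (HLa k) as [[_ [_ [J3 _]]] _].
    au.
  - apply hol_mult; [apply hol_pow, h; auto|]. have nz : forall th, (cir s th ^ N)%C <> 0 by (intros; apply Cpow_nz, cir_nz; lra).
    have P3 : 0 < / s ^ N by pos.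
    have h3 : forall t, Cmod (t - t0) < r -> Cmod (g3 t) < rho by (intros t ht; apply (h t ht)).
    apply (param_int (fun t th => (TT (g1 t) (Vf (g1 t) (g2 t)) th / cir s th ^ N * (cir s th / (cir s th - g3 t)))%C) t0 r (3 * L / s ^ N * (s / (s - rho)))); auto.
    + intros th t ht. specialize (h3 t ht). apply hol_mult.
      * apply hol_div; [|au|auto]. apply (T_hol g1 (fun t => Vf (g1 t) (g2 t)) th t0 r hr); auto. intros u hu. destruct (GG u hu). split; [apply h; auto|auto].
      * apply hol_div; [au|apply hol_minus; [au|apply h; auto]|]. apply cir_minus_nz. lra.
    + intros t th ht. specialize (h3 t ht). rewrite Cmod_mult, Cmod_div, Cmod_pow, Cmod_cir by mono.
      apply Rmult_le_compat; try apply Cmod_ge_0; [mono| |].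
      * apply Rmult_le_compat_r; [lra|]. apply T_bound; apply GG; auto.
      * eapply Rle_trans; [apply Cmod_kernel; lra|]. apply Rmult_le_compat_l; [lra|]. apply Rinv_le_contravar; lra.
    + intros t th ht. specialize (h3 t ht). apply ccont_tail; [lra|]. apply T_cont; apply GG; auto.
Qed.

Lemma VV_hol3 : hol3 (pd3 x1 c1 rho) VV.
Proof.
  have Hn : forall n, hol3 (pd3 x1 c1 rho) (Vk n).
  { induction n.
    - intros g1 g2 g3 t0 r hr h. unfold Vk, V0. destruct (h t0 _lra) as [_ [q2 [q3 _]]]. au.
    - apply (Psi_hol3 (Vk n)); auto. intros; apply Vk_spec; auto. }
  intros g1 g2 g3 t0 r hr h. apply (lim_hol (fun n t => Vk n (g1 t) (g2 t) (g3 t)) _ t0 r hr).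
  - intros n. apply (hol3_ball _ _ g1 g2 g3 t0 r (Hn n)); auto.
  - intros e he. destruct (VV_unif e he) as [n [_ hn]]. exists n. intros k z hk hz. destruct (h z hz) as [_ [_ [_ [p1 [p2 p3]]]]]. au.
Qed.

(** [W] and [VV x c] have the same [d]-th coefficient, so [Psi] halves their distance: a bound [D]
    improves to [D / 2] plus the defect term [Q], and this is iterated from the trivial bound
    [2 beta]. *)
Lemma VV_stab x W eta del : Cmod x < x1 -> 0 < del -> holball 0 (s + del) W -> (forall y, Cmod y <= s -> Cmod (W y) <= beta) -> Cmod (coef 0 r0 d W) < c1 ->
  (forall y, Cmod y <= s -> Cmod (f x y) <= s -> Cmod (Fd x W y) <= eta) -> forall y, Cmod y < rho -> Cmod (W y - VV x (coef 0 r0 d W) y) <= 2 * (K0 + 1) * eta.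
Proof.
  intros hx hdel HW BW hc HE y hy. set (c := coef 0 r0 d W) in *. destruct (Psi_stab x W eta del c hx hdel HW BW eq_refl HE) as [he BP]. su. destruct HK0 as [hK0 _].
  have GW : good W by (split; au).
  have GV := VV_good x c hx hc. set (Q := (K0 + 1) * eta) in *. have hQ : 0 <= Q by (apply Rmult_le_pos; lra).
  have I : forall n y, Cmod y < rho -> Cmod (W y - VV x c y) <= 2 * Q + 2 * beta * (/ 2) ^ n.
  { induction n; intros z hz.
    - destruct (good_in _ z GW hz) as [_ b1]. destruct (good_in _ z GV hz) as [_ b2]. have t := Cmod_minus_le (W z) (VV x c z). lra.
    - rewrite <- (VV_fix x c z) by auto. via (Cmod_tri _ (Psi x c W z)).
      have q := Psi_contract x c W (VV x c) (2 * Q + 2 * beta * (/ 2) ^ n) hx GW GV ltac:(rewrite VV_coef; auto) IHn z hz.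
      specialize (BP z hz). simpl pow. lra. }
  apply le_epsilon. intros e hee. destruct (VV_unif e hee) as [n [hn _]]. specialize (I n y hy). unfold Q in I. lra.
Qed.
End Setup.

(** * Adapted families of approximate conjugacies *)
Lemma Cmod_sq (z : C) : Cmod z ^ 2 = Re z ^ 2 + Im z ^ 2.
Proof. unfold Cmod. rewrite pow2_sqrt; [reflexivity|]. nra. Qed.

Lemma Cmod_1_plus (z : C) : Cmod (1 + z) <= 1 + Re z + Cmod z ^ 2 / 2.
Proof.
  have e := Cmod_sq (1 + z). have e2 := Cmod_sq z. assert (Re (1 + z) = 1 + Re z) by reflexivity. assert (Im (1 + z) = Im z) by (unfold Im; simpl; ring).
  rewrite H, H0 in e. have h := pow2_ge_0 (Cmod (1 + z) - 1). nra.
Qed.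
Lemma Re_le_Cmod_1_plus (z : C) : 1 + Re z <= Cmod (1 + z).
Proof. have e := re_le (1 + z). apply Rabs_le_between in e. unfold Re in *. simpl in *. lra. Qed.
Lemma Re_diff (u v : C) e : Cmod (u - v) <= e -> Re u <= Re v + e /\ Re v - e <= Re u.
Proof. intros h. have q := re_le (u - v). apply Rabs_le_between in q. unfold Re in *. simpl in *. lra. Qed.

(** To be read with [r = |w|], [P = r^(d-1)] and [rho = a w^(d-1)]: for [y = f0 w], the numbers
    [1 + th] and [1 + th + th2] are [y / w] and [f0 y / w]. If [Re rho] exceeds a multiple of [P r],
    then [w] is inside; if it is below the opposite value, [f0 y] is inside; otherwise [rho] is
    nearly imaginary, [rho^2] is close to [- A^2 P^2], and the second-order term decides. *)
Lemma geo_core (A K m : R) : 0 < A -> 0 <= K -> 1 <= m -> exists del, 0 < del <= 1 /\ forall (r P : R) (th th2 rho : C),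
  0 < P <= r -> r < del -> Cmod rho = A * P -> Cmod (th - rho) <= K * (P * r) -> Cmod (th2 - rho) <= K * (P * r) ->
  Cmod (1 + th + th2 - (1 + th) ^ 2 - m * rho ^ 2) <= K * (P ^ 2 * r) ->
  / 2 <= Cmod (1 + th) <= 2 /\ (1 + P * r <= Cmod (1 + th) \/ Cmod (1 + th + th2) <= Cmod (1 + th) - P * r \/ Cmod (1 + th + th2) <= Cmod (1 + th) ^ 2 * (1 - A ^ 2 * P ^ 2 / 2)).
Proof.
  (* Beyond the threshold [ka], the size of [Re rho / (P r)] lets the first-order term win; [K4]
     collects all errors of relative order [r] in the remaining case. *)
  intros hA hK hm. set (ka := 10 * (A + K + 1) ^ 2). set (B0 := m * A ^ 2 + K).
  set (K4 := 6 * (A + K) * B0 + K + 2 * B0 ^ 2 + m * 2 * ka ^ 2).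
  have hB0 : 0 < B0 by (unfold B0; assert (0 < m * A ^ 2) by pos; lra).
  have hka : K + 2 * (A + K) ^ 2 + 1 <= ka /\ 0 < ka by (unfold ka; assert (0 <= (A + K) ^ 2) by mono; split; nra).
  have hK4 : 0 < K4 by (unfold K4; assert (0 < 6 * (A + K) * B0) by pos; assert (0 < 2 * B0 ^ 2) by pos; assert (0 < m * 2 * ka ^ 2) by pos; lra).
  have hA2 : 0 < A ^ 2 by pos.
  small del ((1, 1) :: (8 * (A + K + 1), 1) :: (2 * K4, A ^ 2) :: nil) as [hdel [hd1 [hd2 [hd3 _]]]].
  exists del. split; [lra|]. intros r P th th2 rho hP hr hrho h1 h2 h3.
  have r1 : (A + K + 1) * r <= / 8 by (have q : (A + K + 1) * r <= (A + K + 1) * del by mono; lra).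
  have r2 : K4 * r <= A ^ 2 / 2 by (have q : K4 * r <= K4 * del by mono; lra).
  clear hd2 hd3 hdel. have AK : 0 <= (A + K) * r by mono. have rr8 : r <= / 8 by lra.
  have Pr : 0 < P * r by pos. have PrP : P * r <= P * 1 by mono.
  have KP : K * (P * r) <= K * (P * 1) by mono. have Pr2 : P * P <= P * r by mono.
  have SP : (A + K) * P <= (A + K) * r by mono.
  have t1 : Cmod th <= (A + K) * P by (have q := Cmod_rev th rho; lra).
  have t2 : Cmod th2 <= (A + K) * P by (have q := Cmod_rev th2 rho; lra).
  destruct (Re_diff _ _ _ h1) as [a1 a2]. destruct (Re_diff _ _ _ h2) as [b1 b2].
  have c1 := Cmod_triangle 1 th. rewrite Cmod_1 in c1. have c2 := Re_le_Cmod_1_plus th. have c3 := re_le th. apply Rabs_le_between in c3.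
  split; [lra|].
  have k1 : (K + 2 * (A + K) ^ 2 + 1) * (P * r) <= ka * (P * r) by mono.
  have k2 : 0 <= (A + K) ^ 2 * (P * r) by mono.
  destruct (Rle_dec (ka * (P * r)) (Re rho)) as [d1|d1]; [left; lra|right].
  destruct (Rle_dec (Re rho) (- (ka * (P * r)))) as [d2|d2]; [left|right].
  { have c4 := Cmod_1_plus (th + th2). replace (1 + (th + th2))%C with (1 + th + th2)%C in c4 by ring.
    replace (Re (th + th2)) with (Re th + Re th2) in c4 by reflexivity. have c5 := Cmod_triangle th th2. have p5 := Cmod_ge_0 (th + th2).
    assert (Cmod (th + th2) ^ 2 <= (2 * (A + K) * P) ^ 2) by mono.
    assert (4 * (A + K) ^ 2 * (P * P) <= 4 * (A + K) ^ 2 * (P * r)) by mono. lra. }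
  set (B := (1 + th + th2 - (1 + th) ^ 2)%C) in *. set (T := (1 + th)%C) in *.
  have Tn : 7 / 8 <= Cmod T by lra. have Tz : T <> 0 by au.
  set (nu := (B / T ^ 2)%C).
  have E : (T + th2)%C = (T ^ 2 * (1 + nu))%C.
  { unfold nu. replace (T + th2)%C with (B + T ^ 2)%C by (unfold B; ring). field. au. }
  rewrite E, Cmod_mult, Cmod_pow. apply Rmult_le_compat_l; [mono|].
  have PP : 0 < P ^ 2 by pos. set (Z := P ^ 2 * r) in *. have PPr : Z <= P ^ 2 * 1 by (apply Rmult_le_compat_l; lra). have Zp : 0 < Z by pos.
  have cr2 : Cmod (m * rho ^ 2) = m * A ^ 2 * P ^ 2 by (rewrite Cmod_mult, Cmod_pow, hrho, Cmod_R, Rabs_pos_eq by lra; ring).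
  have KZ : K * Z <= K * (P ^ 2 * 1) by mono.
  have bB : Cmod B <= B0 * P ^ 2 by (have q := Cmod_rev B (m * rho ^ 2); rewrite cr2 in q; unfold B0; lra).
  have pT : 7 / 8 * (7 / 8) <= Cmod T * Cmod T by mono.
  have bp : 0 < B0 * P ^ 2 by pos.
  have bnu : Cmod nu <= 2 * (B0 * P ^ 2).
  { unfold nu. rewrite Cmod_div, Cmod_pow by (apply Cpow_nz; auto). apply Rmult_le_reg_r with (Cmod T ^ 2); [lra|].
    unfold Rdiv. rewrite Rmult_assoc, Rinv_l, Rmult_1_r by lra. assert (2 * (B0 * P ^ 2) * (7 / 8 * (7 / 8)) <= 2 * (B0 * P ^ 2) * (Cmod T * Cmod T)) by mono.
    lra. }
  have bd : Cmod (nu - B) <= 6 * (A + K) * B0 * Z.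
  { replace (nu - B)%C with (- (nu * (th * (2 + th))))%C by (unfold nu, T; field; exact Tz).
    rewrite Cmod_opp, !Cmod_mult. have q : Cmod (2 + th) <= 3.
    { via Cmod_triangle. lra. }
    assert (Cmod th * Cmod (2 + th) <= (A + K) * r * 3) by mono.
    replace (6 * (A + K) * B0 * Z) with (2 * (B0 * P ^ 2) * ((A + K) * r * 3)) by (unfold Z; ring).
    au. }
  destruct (Re_diff _ _ _ bd) as [e1 _]. destruct (Re_diff _ _ _ h3) as [e2 _].
  have er : Re (m * rho ^ 2) = m * (2 * Re rho ^ 2 - A ^ 2 * P ^ 2).
  { have q := Cmod_sq rho. rewrite hrho in q. apply (f_equal (Rmult m)) in q. clear - q. destruct rho as [u v]. unfold Re, Im in *. simpl in *. lra. }
  rewrite er in e2. have rr2 : Re rho ^ 2 <= ka ^ 2 * Z.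
  { apply Rle_trans with ((ka * (P * r)) ^ 2).
    - rewrite <- (pow2_abs (Re rho)). apply pow_incr. split; [apply Rabs_pos|apply Rabs_le; lra].
    - replace ((ka * (P * r)) ^ 2) with (ka ^ 2 * Z * r) by (unfold Z; ring). assert (0 < ka ^ 2 * Z) by mono.
      assert (ka ^ 2 * Z * r <= ka ^ 2 * Z * 1) by mono. lra. }
  have bn2 : Cmod nu ^ 2 / 2 <= 2 * B0 ^ 2 * Z.
  { have pn := Cmod_ge_0 nu. apply Rle_trans with ((2 * (B0 * P ^ 2)) ^ 2 / 2); [apply Rmult_le_compat_r; au|].
    replace ((2 * (B0 * P ^ 2)) ^ 2 / 2) with (2 * B0 ^ 2 * (P ^ 2 * (P * P))) by field.
    apply Rmult_le_compat_l; [assert (0 < B0 ^ 2) by pos; lra|]. apply Rmult_le_compat_l; lra. }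
  have c4 := Cmod_1_plus nu.
  have q1 : P ^ 2 * (K4 * r) <= P ^ 2 * (A ^ 2 / 2) by mono.
  have q2 : m * Re rho ^ 2 <= m * (ka ^ 2 * Z) by mono.
  have q3 : 1 * (A ^ 2 * P ^ 2) <= m * (A ^ 2 * P ^ 2) by mono.
  replace (P ^ 2 * (K4 * r)) with (K4 * Z) in q1 by (unfold Z; ring). unfold K4 in q1. lra.
Qed.

Lemma bo_lin f0 d : (1 <= d)%nat -> bo d (fun y => f0 y - y)%C -> exists K e, 0 < e <= 1 /\ 1 <= K /\ forall y, Cmod y < e -> Cmod (f0 y) <= K * Cmod y.
Proof.
  intros hd [K [e [hK [he h]]]]. exists (K + 1), e. split; [auto|]. split; [lra|]. intros y hy. specialize (h y hy).
  have p := Cmod_ge_0 y. assert (K * Cmod y ^ d <= K * Cmod y) by (apply Rmult_le_compat_l; [auto|apply pow_le_self; au]).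
  have t := Cmod_rev (f0 y) y. nra.
Qed.
Lemma bo_comp f0 d n h : (1 <= d)%nat -> bo d (fun y => f0 y - y)%C -> bo n h -> bo n (fun y => h (f0 y)).
Proof.
  intros hd Hq [K [e [hK [he H]]]]. destruct (bo_lin f0 d hd Hq) as [K2 [e2 [he2 [hK2 H2]]]].
  small m ((1, e2) :: (K2, e) :: nil) as [hm [m1 [m2 _]]]. exists (K * K2 ^ n), m.
  split; [mono|]. split; [lra|].
  intros y hy. specialize (H2 y _lra). assert (K2 * Cmod y < K2 * m) by (apply Rmult_lt_compat_l; lra).
  eapply Rle_trans; [au|]. rewrite Rmult_assoc, <- Rpow_mult_distr. au.
Qed.
Lemma bo_diff f0 d n r h : (1 <= d)%nat -> 0 < r -> bo d (fun y => f0 y - y)%C -> holball 0 r h -> bo (S n) h -> bo (n + d) (fun y => h (f0 y) - h y)%C.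
Proof.
  intros hd hr Hq Hh Bh. destruct (bo_cD r n h hr Hh Bh) as [K [e [hK [he H]]]]. destruct (bo_lin f0 d hd Hq) as [K2 [e2 [he2 [hK2 H2]]]].
  destruct Hq as [K3 [e3 [hK3 [he3 H3]]]].
  small m ((K2, e) :: (K2, r) :: (1, e2) :: (1, e3) :: nil) as [hm [m1 [m2 [m3 [m4 _]]]]]. exists (K * K2 ^ n * K3), m.
  split; [mono|]. split; [lra|].
  intros y hy. specialize (H2 y _lra). specialize (H3 y _lra). have p := Cmod_ge_0 y. have hK2y : K2 * Cmod y < K2 * m by (apply Rmult_lt_compat_l; lra).
  have S : forall t, 0 <= t <= 1 -> Cmod (y + t * (f0 y - y))%C <= K2 * Cmod y by (intros t ht; apply seg_in; auto; nra).
  via (MVT_C h (cD h) y (f0 y) (K * (K2 * Cmod y) ^ n)).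
  - intros t ht. apply cD_spec, Hh. rewrite C0r. specialize (S t ht). lra.
  - intros t ht. specialize (S t ht). eapply Rle_trans; [au|]. au.
  - rewrite Rpow_mult_distr, pow_add. apply Rle_trans with (K * (K2 ^ n * Cmod y ^ n) * (K3 * Cmod y ^ d)); [|lra].
    au.
Qed.

Lemma div_bound (z w : C) (B : R) : w <> 0 -> Cmod z <= B * Cmod w -> Cmod (z / w) <= B.
Proof.
  intros hw h. have p := Cmod_pos w hw. rewrite Cmod_div by auto. apply Rmult_le_reg_r with (Cmod w); auto.
  unfold Rdiv. rewrite Rmult_assoc, Rinv_l by lra. lra.
Qed.

(* [f0 y * w - y^2 ~ (d - 1) a^2 w^(2 d)] where [w] is the preimage of [y]: when neither [f0 y] nor [w] is inside at first order,
   [(a w^(d-1))^2] is nearly a negative real and their product is smaller than [s^2]. *)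
Lemma circle_inward f0 fi0 R1 L (a : C) d : 0 < R1 -> holball 0 R1 f0 -> a <> 0 -> (2 <= d)%nat -> bo (S d) (fun y => f0 y - y - a * y ^ d)%C ->
  1 <= L -> (forall y, Cmod y < R1 -> f0 (fi0 y) = y /\ Cmod (fi0 y) <= L * Cmod y) ->
  exists smax, 0 < smax <= R1 /\ forall s, 0 < s < smax -> exists s', 0 < s' < s /\ forall y, Cmod y = s -> Cmod (f0 y) <= s' \/ Cmod (fi0 y) <= s'.
Proof.
  intros hR Hf ha hd Ef hL Hi. destruct d as [|m]; [lia|]. have hm : (1 <= m)%nat by lia.
  set (q := fun y => (f0 y - y)%C). set (e := fun y => (f0 y - y - a * y ^ S m)%C).
  have Bq : bo (S m) q by (apply (tri_q f0 a); auto).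
  have he : holball 0 R1 e.
  { intros z hz. apply hol_minus; [au|]. au. }
  have TP := tri_pow f0 a (S m) hd Ef (S m).
  have B2 : bo (S (S m)) (fun w => f0 (f0 w) - f0 w - a * w ^ S m)%C.
  { apply (bo_ext _ (fun w => e (f0 w) + a * (f0 w ^ S m - w ^ S m))%C); [intros; unfold e; ring|]. apply bo_plus.
    - apply (bo_comp f0 (S m)); [lia|mono|mono].
    - apply bo_scal. apply (bo_ext _ (fun y => (f0 y ^ S m - y ^ S m - INR (S m) * a * y ^ (S m + S m - 1)) + INR (S m) * a * y ^ (S m + S m - 1))%C); [intros; ring|].
      apply bo_plus; [apply (bo_weak _ (S m + S m)); [lia|auto]|]. apply (bo_weak _ (S m + S m - 1)); [lia|]. apply bo_mono. }
  have B3 : bo (S (2 * S m)) (fun w => f0 (f0 w) * w - f0 w ^ 2 - INR m * (a * w ^ S m) ^ 2)%C.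
  (* The error [e] of the expansion enters through [e (f0 w) - e w], which gains [d - 1] orders over
     [e] itself; this keeps the leading term of order [2 d] visible. *)
  { apply (bo_ext _ (fun w => (w ^ 1 * (a * (f0 w ^ S m - w ^ S m - INR (S m) * a * w ^ (S m + S m - 1)) + (e (f0 w) - e w))) - e w * (q w + a * w ^ S m))%C).
    - intros w. replace (S m + S m - 1)%nat with (m + S m)%nat by lia. unfold e, q. rewrite S_INR, RtoC_plus, Cpow_add_r. simpl Cpow. ring.
    - apply bo_minus.
      + apply (bo_weak _ (1 + (S m + S m))); [lia|]. apply bo_mult; [apply bo_pow|]. apply bo_plus; [apply bo_scal; auto|].
        apply (bo_diff f0 (S m) (S m) R1); [lia|auto|mono|mono|mono].
      + apply (bo_weak _ (S (S m) + S m)); [lia|]. apply bo_mult; [auto|]. apply bo_plus; [auto|apply bo_mono]. }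
  destruct Ef as [K1 [d1 [hK1 [hd1 E1]]]]. destruct B2 as [K2 [d2 [hK2 [hd2 E2]]]]. destruct B3 as [K3 [d3 [hK3 [hd3 E3]]]].
  set (A := Cmod a). have hA : 0 < A by (apply Cmod_pos; auto). set (K := K1 + K2 + K3).
  destruct (geo_core A K (INR m)) as [del [hdel GC]]; [auto|unfold K; lra|apply (le_INR 1); auto|].
  small dd ((1, 1) :: (1, d1) :: (1, d2) :: (1, d3) :: (1, del) :: nil) as [hdd [ddl0 [ddl1 [ddl2 [ddl3 [ddl4 _]]]]]].
  small sm ((1, R1) :: (1, 1) :: (L, dd) :: (A, 1) :: nil) as [hsm [m1 [m2 [m3 [m4 _]]]]]. exists sm. split; [lra|]. intros s [hs hs2].
  have sL : L * s < L * sm by (apply Rmult_lt_compat_l; lra). have sA : A * s < A * sm by (apply Rmult_lt_compat_l; lra).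
  (* [p] and [h] are lower bounds for [P] and [P * r] that are uniform on the circle, as
     [r >= s / 2] will follow from the first conclusion of [geo_core]. *)
  set (p := (s / 2) ^ m). have hp : 0 < p by pos.
  have pm : p <= s / 2. { apply pow_le_self; au. }
  set (h := p * (s / 2)). have hh : 0 < h <= s / 4 by (unfold h; split; nra).
  set (t := 1 - A ^ 2 * p ^ 2 / 2). have ht : / 2 <= t < 1.
  { unfold t. assert (A * p <= A * (s / 2)) by mono. assert (0 < A * p) by pos.
    replace (A ^ 2 * p ^ 2) with ((A * p) * (A * p)) by ring. assert (0 < A * p * (A * p)) by pos.
    assert (A * p * (A * p) <= / 2 * / 2) by mono. lra. }
  have hst : 0 < sqrt t < 1 by (split; [apply sqrt_lt_R0; lra|rewrite <- sqrt_1; apply sqrt_lt_1; lra]).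
  (* One candidate for each alternative of [geo_core]; in the third one, a product at most [s^2 * t]
     forces one of its factors to be at most [s * sqrt t]. *)
  set (s' := Rmax (Rmax (s / (1 + h)) (s - h * (s / 2))) (s * sqrt t)).
  have m0 : s / (1 + h) <= s' /\ s - h * (s / 2) <= s' /\ s * sqrt t <= s'.
  { unfold s'. have u1 := Rmax_l (Rmax (s / (1 + h)) (s - h * (s / 2))) (s * sqrt t). have u2 := Rmax_r (Rmax (s / (1 + h)) (s - h * (s / 2))) (s * sqrt t).
    have u3 := Rmax_l (s / (1 + h)) (s - h * (s / 2)). have u4 := Rmax_r (s / (1 + h)) (s - h * (s / 2)). lra. }
  exists s'. split.
  { assert (0 < h * s) by pos. assert (s * sqrt t < s * 1) by (apply Rmult_lt_compat_l; lra).
    split; [assert (0 < s * sqrt t) by pos; lra|]. unfold s'. repeat apply Rmax_lub_lt; [|lra|lra].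
    apply Rmult_lt_reg_r with (1 + h); [lra|]. unfold Rdiv. rewrite Rmult_assoc, Rinv_l by lra. lra. }
  intros y hy. destruct (Hi y _lra) as [i1 i2]. set (w := fi0 y) in *. set (r := Cmod w). fold r in i2.
  have wdd : r < dd by (rewrite hy in i2; lra).
  have w0 : w <> 0.
  { intros E. have z : f0 0 = 0. { destruct Bq as [Kq [dq [hKq [hdq Hq]]]]. specialize (Hq 0). rewrite Cmod_0 in Hq. specialize (Hq _lra). rewrite pow_i in Hq by lia. 
      rewrite Rmult_0_r in Hq. apply Cmod_le_0 in Hq. unfold q in Hq. rewrite C0r in Hq. au. }
    rewrite E, z in i1. rewrite <- i1, Cmod_0 in hy. lra. }
  have hr : 0 < r by (apply Cmod_pos; auto).
  set (P := r ^ m). have hP : 0 < P by pos.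
  have PR : P <= r by (apply pow_le_self; au).
  have rP : 0 < r * (r * P) by pos. have rP2 : 0 < r * (r * (r * (P * P))) by pos.
  set (th := ((y - w) / w)%C). set (th2 := ((f0 y - y) / w)%C). set (rho := (a * w ^ m)%C).
  destruct (GC r P th th2 rho) as [G1 G2]; auto; try lra.
  - unfold rho. rewrite Cmod_mult, Cmod_pow. au.
  - unfold th, rho. replace ((y - w) / w - a * w ^ m)%C with ((y - w - a * w ^ S m) / w)%C by (simpl; field; auto).
    apply div_bound; auto. specialize (E1 w ltac:(fold r; lra)). rewrite i1 in E1. eapply Rle_trans; [exact E1|]. fold r. simpl pow. fold P.
    replace (K * (P * r) * r) with (K * (r * (r * P))) by ring. apply Rmult_le_compat_r; [lra|unfold K; lra].
  - unfold th2, rho. replace ((f0 y - y) / w - a * w ^ m)%C with ((f0 y - y - a * w ^ S m) / w)%C by (simpl; field; auto).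
    apply div_bound; auto. specialize (E2 w ltac:(fold r; lra)). rewrite i1 in E2. eapply Rle_trans; [exact E2|]. fold r. simpl pow. fold P.
    replace (K * (P * r) * r) with (K * (r * (r * P))) by ring. apply Rmult_le_compat_r; [lra|unfold K; lra].
  - replace (1 + th + th2 - (1 + th) ^ 2 - INR m * rho ^ 2)%C with ((f0 y * w - y ^ 2 - INR m * (a * w ^ S m) ^ 2) / w ^ 2)%C by (unfold th, th2, rho; simpl; field; auto).
    apply div_bound; [apply Cpow_nz; auto|]. specialize (E3 w ltac:(fold r; lra)). rewrite i1 in E3. eapply Rle_trans; [exact E3|]. rewrite Cmod_pow. fold r.
    replace (S (2 * S m)) with (S (S (S (m + m)))) by lia. simpl pow. rewrite pow_add. fold P.
    replace (K * (P * (P * 1) * r) * (r * (r * 1))) with (K * (r * (r * (r * (P * P))))) by ring. apply Rmult_le_compat_r; [lra|unfold K; lra].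
  - have F1 : (1 + th)%C = (y / w)%C by (unfold th; field; auto). have F2 : (1 + th + th2)%C = (f0 y / w)%C by (unfold th, th2; field; auto).
    rewrite F2, F1, !Cmod_div, hy in G2 by auto. rewrite F1, Cmod_div, hy in G1 by auto. fold r in G1, G2.
    have sr : s / 2 <= r.
    { apply Rmult_le_reg_r with (/ r); [pos|]. rewrite Rinv_r by lra. lra. }
    have pP : p <= P by (apply pow_incr; lra). have hPr : h <= P * r by (unfold h; mono).
    set (k := s / r) in *. have sk : s = k * r by (unfold k; field; lra).
    set (Y := Cmod (f0 y)) in *. have ey : Y = Y / r * r by (field; lra). have pY : 0 <= Y by apply Cmod_ge_0.
    destruct G2 as [G2|[G2|G2]].
    + right. fold r. eapply Rle_trans; [|exact (proj1 m0)]. apply Rmult_le_reg_r with (1 + h); [lra|]. replace (s / (1 + h) * (1 + h)) with s by (field; lra).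
      apply Rle_trans with (r * (1 + P * r)); [mono|]. assert (r * (1 + P * r) <= r * k) by mono. lra.
    + left. eapply Rle_trans; [|exact (proj1 (proj2 m0))].
      assert (Y / r * r <= (k - P * r) * r) by mono.
      assert (h * (s / 2) <= P * r * r) by mono. lra.
    + destruct (Rle_dec Y s') as [|n1]; [left; auto|]. destruct (Rle_dec r s') as [|n2]; [right; auto|]. exfalso.
      assert (Y * r <= s ^ 2 * t).
      { rewrite ey, sk. unfold t. have q1 : Y / r <= k ^ 2 * (1 - A ^ 2 * p ^ 2 / 2).
        { eapply Rle_trans; [exact G2|]. apply Rmult_le_compat_l; [mono|].
          assert (A ^ 2 * p ^ 2 <= A ^ 2 * P ^ 2) by mono. lra. }
        replace ((k * r) ^ 2 * (1 - A ^ 2 * p ^ 2 / 2)) with (k ^ 2 * (1 - A ^ 2 * p ^ 2 / 2) * (r * r)) by ring.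
        rewrite Rmult_assoc. au. }
      have z1 : s * sqrt t * (s * sqrt t) < Y * r.
      { assert (0 < s * sqrt t) by pos. apply Rmult_gt_0_lt_compat; lra. }
      have z2 : sqrt t * sqrt t = t by (apply sqrt_sqrt; lra).
      replace (s * sqrt t * (s * sqrt t)) with (s ^ 2 * (sqrt t * sqrt t)) in z1 by ring. rewrite z2 in z1. lra.
Qed.

(* [V x c] is the approximate solution of [(id + V) o f x = g x o (id + V)] with [d]-th coefficient [c]; the last clause
   says that every other approximate solution [W] is close to it. *)
Definition adapted (f g : C -> C -> C) (d : nat) (s rho x1 c1 beta K : R) (V : C -> C -> C -> C) : Prop :=
  hol3 (pd3 x1 c1 rho) V /\ (forall x c y, pd3 x1 c1 rho x c y -> Cmod (V x c y) <= beta) /\ (forall y, Cmod y < rho -> V 0 0 y = 0) /\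
  (forall x c r, Cmod x < x1 -> Cmod c < c1 -> 0 < r < rho -> coef 0 r d (V x c) = c) /\
  (forall x W eta del r c, Cmod x < x1 -> 0 < del -> holball 0 (s + del) W -> (forall y, Cmod y <= s -> Cmod (W y) <= beta) ->
    0 < r < s -> coef 0 r d W = c -> Cmod c < c1 -> (forall y, Cmod y <= s -> Cmod (f x y) <= s -> Cmod (Fd f g x W y) <= eta) ->
    forall y, Cmod y < rho -> Cmod (W y - V x c y) <= K * eta).

(** The order of the choices matters: [s'] comes from the geometry of the circle, [rho], [N], the
    functionals and [K0] depend on it, and [beta], [c1], [x1] are small against all of these. The
    lower bound [s_] for [rho] says that the loss of domain is as small as desired, which repeated
    changes of family require. *)
Lemma adapted_family f g fi gi R1 L a d : core f g fi gi R1 L a d -> exists smax, 0 < smax /\ 16 * L * smax <= R1 /\ forall s s_, 0 < s_ < s -> s < smax ->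
  exists rho x1 c1 beta K V, s_ < rho < s /\ 0 < x1 <= R1 / 16 /\ L * x1 <= R1 / 16 /\ 0 < c1 /\ 0 < beta <= R1 / 16 /\ L * beta <= R1 / 16 /\ 0 < K /\ adapted f g d s rho x1 c1 beta K V.
Proof.
  intros HC. have hR := c_R1 _ _ _ _ _ _ _ _ HC. have hL := c_L _ _ _ _ _ _ _ _ HC. have z0 : Cmod 0 < R1 by lra.
  have Lm : forall u, 0 < u -> u <= L * u by (intros u hu; assert (1 * u <= L * u) by mono; lra).
  have Hf := hol_f0 _ _ _ _ _ _ _ _ HC.
  destruct (circle_inward (f 0) (fi 0) R1 L a d) as [sm [hsm HG]]; auto; try apply HC; try lra.
  { intros y hy. split; [apply HC; auto|]. have q := su_le _ _ _ _ _ _ _ _ HC fi 0 y (c_fil _ _ _ _ _ _ _ _ HC) (c_fi0 _ _ _ _ _ _ _ _ HC) z0 hy. lra. }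
  small smax ((1, sm) :: (16 * L, R1) :: nil) as [hmx [mx1 [mx2 _]]]. exists smax. split; [auto|]. split; [auto|].
  intros s s_ hs_ hs. destruct (HG s _lra) as [s' [hs' Hg]].
  set (s2 := (Rmax s' s_ + s) / 2). set (rho := (s2 + s) / 2).
  have hm1 := Rmax_l s' s_. have hm2 := Rmax_r s' s_. have hm : Rmax s' s_ < s by (apply Rmax_lub_lt; lra).
  have sL : L * s < L * smax by (apply Rmult_lt_compat_l; lra). have s1 := Lm s _lra.
  have Hs : 0 < s' < s2 /\ s2 < rho < s /\ 16 * L * s <= R1 by (unfold rho, s2; repeat split; lra).
  have Hgeo : forall t, Cmod (f 0 (cir s t)) <= s' \/ Cmod (fi 0 (cir s t)) <= s' by (intros t; apply Hg; apply Cmod_cir; lra).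
  have E4 : 4 * L * rr L rho = rho by (unfold rr; field; lra).
  have hrr : 0 < rr L rho by mono. have r1 := Lm _ hrr.
  have hr0 : 0 < r0 L rho < rr L rho by (unfold r0; lra).
  have LF := low_functional (f 0) R1 a d rho (rr L rho) (r0 L rho) _lra Hf (c_d _ _ _ _ _ _ _ _ HC) (c_a _ _ _ _ _ _ _ _ HC) (c_exp _ _ _ _ _ _ _ _ HC) _lra _lra.
  have fr : forall y, Cmod y < rr L rho -> Cmod (f 0 y) < rho.
  { intros y hy. have q := su_le _ _ _ _ _ _ _ _ HC f 0 y (c_fl _ _ _ _ _ _ _ _ HC) (c_f0 _ _ _ _ _ _ _ _ HC) z0 _lra. rewrite Cmod_0 in q.
    assert (L * Cmod y < L * rr L rho) by (apply Rmult_lt_compat_l; lra). lra. }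
  specialize (LF fr hr0). set (La := fun k => proj1_sig (constructive_indefinite_description _ (LF k))).
  have HLa : forall k, seq_fun (r0 L rho) (La k) /\ forall W, holball 0 rho W -> coef 0 (r0 L rho) d W = 0 -> La k (fun j => coef 0 (r0 L rho) j (lin_op (f 0) W)) = coef 0 (r0 L rho) k W.
  { intros k. unfold La. destruct constructive_indefinite_description; auto. }
  have p : 0 < s / (s - rho) by pos.
  destruct (pow_small (rho / s) (/ (4 * L * (s / (s - rho))))) as [N0 hN0].
  { split; [mono|]. apply Rmult_lt_reg_r with s; [lra|]. unfold Rdiv. rewrite Rmult_assoc, Rinv_l; lra. }
  { pos. }
  set (N := (N0 + S d)%nat). have HN : (d < N)%nat by au.
  have HN2 : L * ((rho / s) ^ N * (s / (s - rho))) <= / 4.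
  { specialize (hN0 N ltac:(au)).
    apply Rle_trans with (L * (/ (4 * L * (s / (s - rho))) * (s / (s - rho)))); [|apply Req_le; field; lra].
    au. }
  destruct (low_bound (r0 L rho) La N (fun k => proj1 (HLa k))) as [K0 HK0]. have hK0 := proj1 HK0.
  have hK1 : 0 < K1 L rho by mono.
  set (Z := (K0 + 1) * K1 L rho). have hZ : 0 < Z by pos.
  small beta ((16 * L, R1) :: (8 * Z, 1) :: nil) as [hb [hb1 [hb2 _]]]. have Lb := Lm beta hb.
  set (Y := (K0 + 1) * (2 * L)). have hY : 0 < Y by pos.
  small c1 ((8, beta) :: (16 * Y, beta) :: nil) as [hc1 [hc2 [hc3 _]]].
  small x1 ((16 * L, rho) :: (2 * L, rho - s2) :: (1, c1) :: (8 * Z, 1) :: nil) as [x1p [xa [xb [xc [xd _]]]]]. have Lx := Lm x1 x1p.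
  have Hx1 : 0 < x1 /\ 16 * L * x1 <= rho /\ 2 * L * x1 <= rho - s2 /\ 0 < beta /\ 16 * L * beta <= R1 by auto.
  have Hx2 : K0 * (K1 L rho * (x1 + beta)) <= / 4.
  { apply Rle_trans with (Z * (x1 + beta)); [|lra]. unfold Z. rewrite Rmult_assoc. au. }
  have Hc1 : 0 < c1 <= beta / 8 /\ (K0 + 1) * (2 * L * (x1 + c1)) <= beta / 8.
  { split; [lra|]. rewrite <- Rmult_assoc. fold Y. assert (Y * (x1 + c1) <= Y * (c1 + c1)) by mono. lra. }
  set (V := VV f g fi gi R1 L a d HC s s' s2 rho Hs Hgeo x1 beta Hx1 La N HLa HN HN2 K0 HK0 Hx2 c1 Hc1).
  have VG : forall x c, Cmod x < x1 -> Cmod c < c1 -> good rho beta (V x c) by (intros; apply VV_good; auto).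
  have St : forall x W eta del r c, Cmod x < x1 -> 0 < del -> holball 0 (s + del) W -> (forall y, Cmod y <= s -> Cmod (W y) <= beta) ->
    0 < r < s -> coef 0 r d W = c -> Cmod c < c1 -> (forall y, Cmod y <= s -> Cmod (f x y) <= s -> Cmod (Fd f g x W y) <= eta) ->
    forall y, Cmod y < rho -> Cmod (W y - V x c y) <= 2 * (K0 + 1) * eta.
  { intros x W eta del r c hx hdel HW BW hr Hc hc HE y hy. rewrite (coef_indep 0 (s + del) (s + del) W r (r0 L rho)) in Hc by mono. rewrite <- Hc in *. eapply VV_stab; eauto. }
  exists rho, x1, c1, beta, (2 * (K0 + 1)), V. repeat (split; [unfold rho, s2; lra|]).
  split; [apply VV_hol3|]. split; [|split; [|split; auto]].
  - intros x c y [hx [hc hy]]. apply VG; auto.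
  (* On [x = 0] the identity is an exact conjugacy with coefficient [0], so stability identifies the
     zero function with [V 0 0]. *)
  - intros y hy. apply Cmod_small_eq. intros e he.
    have q := St 0 (fun _ => RtoC 0) 0 1 (s / 2) 0 _lra _lra ltac:(au).
    rewrite Cmod_sym. eapply Rle_trans; [apply q; auto; try lra|lra].
    + au.
    + unfold coef. rewrite (mean_ext _ (fun _ => RtoC 0)); [apply mean_const|]. intros; unfold Cdiv; ring.
    + intros z hz _. unfold Fd. replace (z + 0)%C with z by ring. rewrite (c_fg _ _ _ _ _ _ _ _ HC z) by lra.
      replace (g 0 z + 0 - g 0 z)%C with (RtoC 0) by ring. lra.
  - intros x c r hx hc hr. rewrite (coef_indep 0 rho rho (V x c) r (r0 L rho)); try (apply VG; auto); try lra. apply VV_coef; auto.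
Qed.

(** * Division by powers of x *)
Definition box (e b : R) (Y : C -> Prop) : C -> C -> C -> Prop := fun x c y => Cmod x < e /\ Cmod c < b /\ Y y.

Lemma hol3_circle e b Y F th rho g2 g3 t0 r : 0 <= rho < e -> hol3 (box e b Y) F ->
  (forall t, Cmod (t - t0) < r -> hol g2 t /\ hol g3 t /\ Cmod (g2 t) < b /\ Y (g3 t)) -> holball t0 r (fun t => F (0 + cir rho th)%C (g2 t) (g3 t)).
Proof.
  intros hr HF H. apply (hol3_ball (box e b Y) F (fun _ => 0 + cir rho th)%C g2 g3 t0 r HF). intros t ht.
  destruct (H t ht) as [h1 [h2 [h3 h4]]]. split; [au|]. split; [auto|]. split; [auto|]. split; [|auto].
  lra.
Qed.
Lemma box_x e b Y F c y : hol3 (box e b Y) F -> Cmod c < b -> Y y -> holball 0 e (fun x => F x c y).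
Proof. intros HF hc hy. apply (hol3_x (box e b Y) F c y 0 e HF). intros x hx. rewrite C0r in hx. split; auto. Qed.
Section Divide.
Variables (e b : R) (Y : C -> Prop) (F : C -> C -> C -> C) (M : R).
Hypothesis he : 0 < e.
Hypothesis HF : hol3 (box e b Y) F.
Hypothesis BF : forall x c y, box e b Y x c y -> Cmod (F x c y) <= M.

Lemma coef_param k g2 g3 t0 r : 0 < r -> (forall t, Cmod (t - t0) < r -> hol g2 t /\ hol g3 t /\ Cmod (g2 t) < b /\ Y (g3 t)) ->
  hol (fun t => coef 0 (e / 2) k (fun x => F x (g2 t) (g3 t))) t0.
Proof.
  intros hr H. apply (param_int (fun t th => F (0 + cir (e / 2) th) (g2 t) (g3 t) / cir (e / 2) th ^ k)%C t0 r (M / (e / 2) ^ k) hr).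
  - intros th t ht. apply hol_div; [|au|apply Cpow_nz, cir_nz; lra]. apply (hol3_circle e b Y F th (e / 2) g2 g3 t0 r); auto; lra.
  - intros t th ht. destruct (H t ht) as [_ [_ [h3 h4]]]. rewrite Cmod_div, Cmod_pow, Cmod_cir by (try lra; apply Cpow_nz, cir_nz; lra).
    apply Rmult_le_compat_r; [mono|]. apply BF. split; au.
  - intros t th ht. destruct (H t ht) as [_ [_ [h3 h4]]]. apply ccont_coef; [lra|]. lazymatch goal with |- ccont (fun _ => F _ ?u ?v) _ => apply (ccont_circ 0 e (fun x => F x u v)) end; [apply (box_x e b Y); auto|lra].
Qed.

Variable m : nat.
(** A Taylor remainder in [x], defined and holomorphic whether or not [F] is divisible by [x^m];
    [quot_spec] identifies it with the quotient when it is. *)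
Definition quot (x c y : C) : C := rem 0 (e / 2) m (fun x => F x c y) x.

Lemma quot_hol : hol3 (box (e / 4) b Y) quot.
Proof.
  intros g1 g2 g3 t0 r hr H. 
  have P : 0 < / (e / 2) ^ m by pos.
  apply (param_int (fun t th => F (0 + cir (e / 2) th) (g2 t) (g3 t) / cir (e / 2) th ^ m * (cir (e / 2) th / (cir (e / 2) th - g1 t)))%C t0 r (M / (e / 2) ^ m * 2) hr).
  - intros th t ht. destruct (H t ht) as [h1 [h2 [h3 [h4 [h5 h6]]]]]. apply hol_mult.
    + apply hol_div; [|au|apply Cpow_nz, cir_nz; lra]. apply (hol3_circle e b Y F th (e / 2) g2 g3 t0 r); auto; try lra.
      intros u hu. destruct (H u hu) as [k1 [k2 [k3 [k4 [k5 k6]]]]]. au.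
    + apply hol_div; [au|au|]. apply cir_minus_nz. lra.
  - intros t th ht. destruct (H t ht) as [h1 [h2 [h3 [h4 [h5 h6]]]]]. rewrite Cmod_mult, Cmod_div, Cmod_pow, Cmod_cir by (try lra; apply Cpow_nz, cir_nz; lra).
    apply Rmult_le_compat; try apply Cmod_ge_0; [mono| |].
    + apply Rmult_le_compat_r; [lra|]. apply BF. split; au.
    + eapply Rle_trans; [apply Cmod_kernel; lra|]. apply Rmult_le_reg_r with (e / 2 - Cmod (g1 t)); [lra|]. unfold Rdiv. rewrite Rmult_assoc, Rinv_l by lra. lra.
  - intros t th ht. destruct (H t ht) as [h1 [h2 [h3 [h4 [h5 h6]]]]]. apply ccont_tail; [lra|]. lazymatch goal with |- ccont (fun _ => F _ ?u ?v) _ => apply (ccont_circ 0 e (fun x => F x u v)) end; [apply (box_x e b Y); auto|lra].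
Qed.
Lemma quot_bound x c y : box (e / 4) b Y x c y -> Cmod (quot x c y) <= M / (e / 2) ^ m * 2.
Proof.
  intros [h1 [h2 h3]]. unfold quot, rem. have P : 0 < / (e / 2) ^ m by pos.
  have hM : 0 <= M. { eapply Rle_trans; [mono|apply (BF 0 c y)]. split; au. }
  via (tail_bound _ _ _ _ M).
  - lra.
  - intros t _. lazymatch goal with |- ccont (fun _ => F _ ?u ?v) _ => apply (ccont_circ 0 e (fun x => F x u v)) end; [apply (box_x e b Y); auto|lra].
  - intros t. apply BF. split; au.
  - apply Rmult_le_compat_l; [mono|]. apply Rmult_le_reg_r with (e / 2 - Cmod x); [lra|]. unfold Rdiv. rewrite Rmult_assoc, Rinv_l by lra. lra.
Qed.
Lemma quot_spec e' M' x c y : 0 < e' -> Cmod c < b -> Y y -> (forall x, Cmod x < e' -> Cmod (F x c y) <= M' * Cmod x ^ m) -> Cmod x < e / 2 ->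
  F x c y = (x ^ m * quot x c y)%C.
Proof.
  intros he' hc hy HO hx. have hb := box_x e b Y F c y HF hc hy.
  have E := taylor0 0 e (fun x => F x c y) (e / 2) m x hb _lra hx. cbv beta in E. replace (0 + x)%C with x in E by ring. rewrite E; [reflexivity|].
  intros k hk. apply (coef_O 0 e _ _ m (Rmin e' e) M'); auto; [lra|apply Rmin_pos; auto|]. intros w hw. replace (0 + w)%C with w by ring.
  apply HO. eapply Rlt_le_trans; [apply hw|apply Rmin_l].
Qed.
End Divide.

(** The Taylor coefficients in [x] are holomorphic in [c]. One of them, of index [k], is nonzero
    somewhere, so by the identity theorem it cannot vanish for all small [c]; therefore shrinking
    the range of [x] and [c] does not allow an order greater than [k]. *)
Lemma order_bounded e F M : 0 < e -> hol3 (box e e (fun y => Cmod y < e)) F -> (forall x c y, box e e (fun y => Cmod y < e) x c y -> Cmod (F x c y) <= M) ->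
  (exists x c y, box e e (fun y => Cmod y < e) x c y /\ F x c y <> 0) ->
  exists k, forall m e' M', 0 < e' <= e -> (forall x c y, box e' e' (fun y => Cmod y < e) x c y -> Cmod (F x c y) <= M' * Cmod x ^ m) -> (m <= k)%nat.
Proof.
  intros he HF BF [x [c [y [[hx [hc hy]] hn]]]].
  destruct (order_exists 0 e (fun x => F x c y) he) as [k [_ h2]].
  - apply (box_x e e (fun y => Cmod y < e)); auto.
  - au.
  - exists k. intros m e' M' he' HO. destruct (Nat.le_gt_cases m k) as [|hk]; auto. exfalso. apply (h2 (e / 2)); [lra|].
    apply (identity_thm 0 e (fun c => coef 0 (e / 2) k (fun x => F x c y)) he).
    + intros c0 hc0. rewrite C0r in hc0. apply (coef_param e e (fun y => Cmod y < e) F M he HF BF k (fun c => c) (fun _ => y) c0 (e - Cmod c0)); [lra|].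
      intros t ht. split; [au|split; [au|split; [|auto]]]. have q := Cmod_rev t c0. lra.
    + intros d0 hd0. exists (RtoC (Rmin d0 e' / 2)). assert (0 < Rmin d0 e') by (apply Rmin_pos; lra). have q1 := Rmin_l d0 e'. have q2 := Rmin_r d0 e'.
      rewrite C0r, Cmod_R, Rabs_pos_eq by lra. split; [lra|].
      apply (coef_O 0 e _ (e / 2) m e' M'); auto; [|lra|lra|].
      * apply (box_x e e (fun y => Cmod y < e)); auto. lra.
      * intros w hw. replace (0 + w)%C with w by ring. apply HO. split; [lra|]. lra.
    + lra.
Qed.

(** * Iterated Euler steps *)
Lemma pow_exp (u : R) k : 0 <= u -> INR k * u <= 1 -> (1 + u) ^ k <= 3.
Proof.
  intros hu h. apply Rle_trans with (exp (INR k * u)).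
  - clear h. induction k as [|k IH].
    + simpl. rewrite Rmult_0_l, exp_0. lra.
    + rewrite S_INR, Rmult_plus_distr_r, exp_plus, Rmult_1_l. simpl. rewrite Rmult_comm. apply Rmult_le_compat; auto; [mono|lra|apply exp_ineq1_le].
  - apply Rle_trans with (exp 1); [|apply exp_le_3]. destruct (Rle_lt_or_eq_dec _ _ h) as [l|e]; [apply Rlt_le, exp_increasing; auto|rewrite e; lra].
Qed.

Section Euler.
Variables (F Z D : C -> C) (r B Lz CF eps tau : R).
Hypothesis htau : 0 < tau.
Hypothesis hB : 0 <= B. Hypothesis hLz : 0 <= Lz. Hypothesis hCF : 0 <= CF. Hypothesis heps : 0 <= eps.
Hypothesis ZB : forall y, Cmod y < r -> Cmod (Z y) <= B.
Hypothesis ZL : forall y y', Cmod y < r -> Cmod y' < r -> Cmod (Z y - Z y') <= Lz * Cmod (y - y').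
Hypothesis FT : forall y h, Cmod y < r -> Cmod h <= tau * B -> Cmod (F (y + h)%C - F y - D y * h) <= CF * Cmod h ^ 2.
Hypothesis ZC : forall y, Cmod y < r -> Cmod (F y) < r -> Cmod (Z (F y) - D y * Z y) <= eps.

(** Euler steps of the field [Z] stand for its flow: no differential equation has to be solved,
    holomorphy in [y] is that of a composition, and the number of steps can be chosen at the end.
    [D] plays the role of the derivative of [F], and [eps] measures how far [Z] is from being
    invariant under [F]. *)
Definition estep (y : C) : C := (y + tau * Z y)%C.
Fixpoint eiter (k : nat) (y : C) : C := match k with O => y | S k => estep (eiter k y) end.

Lemma eiter_drift y k : Cmod y + INR k * tau * B < r -> Cmod (eiter k y - y) <= INR k * tau * B.
Proof.
  induction k as [|k IH]; intros h.
  - simpl. lra.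
  - rewrite S_INR in h. have kp := pos_INR k. have tb : 0 <= tau * B by nra. specialize (IH ltac:(nra)). simpl eiter. unfold estep.
    replace (eiter k y + tau * Z (eiter k y) - y)%C with ((eiter k y - y) + tau * Z (eiter k y))%C by ring.
    via Cmod_triangle. rewrite Cmod_mult, Cmod_R, Rabs_pos_eq by lra.
    have q := Cmod_rev (eiter k y) y. assert (Cmod (Z (eiter k y)) <= B) by au. rewrite S_INR. nra.
Qed.
Lemma eiter_in y k : Cmod y + INR k * tau * B < r -> Cmod (eiter k y) < r.
Proof. intros h. have q := eiter_drift y k h. have q2 := Cmod_rev (eiter k y) y. lra. Qed.

Lemma eiter_second y k : Cmod y + INR k * tau * B < r -> Cmod (eiter k y - y - INR k * tau * Z y) <= (INR k * tau) ^ 2 * (Lz * B).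
Proof.
  induction k as [|k IH]; intros h.
  - simpl. replace (y - y - 0 * tau * Z y)%C with (RtoC 0) by ring. lra.
  - rewrite S_INR in *. have kp := pos_INR k. have tb : 0 <= tau * B by nra. have h' : Cmod y + INR k * tau * B < r by nra. specialize (IH h').
    have q := eiter_drift y k h'. have i := eiter_in y k h'. simpl eiter. unfold estep. rewrite RtoC_plus.
    replace (eiter k y + tau * Z (eiter k y) - y - (INR k + 1) * tau * Z y)%C with ((eiter k y - y - INR k * tau * Z y) + tau * (Z (eiter k y) - Z y))%C by ring.
    via Cmod_triangle. rewrite Cmod_mult, Cmod_R, Rabs_pos_eq by lra.
    have z := ZL (eiter k y) y i ltac:(assert (0 <= INR k * tau * B) by mono; lra).
    assert (Lz * Cmod (eiter k y - y) <= Lz * (INR k * tau * B)) by mono.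
    assert (tau * Cmod (Z (eiter k y) - Z y) <= tau * (Lz * (INR k * tau * B))) by mono.
    assert (0 <= tau ^ 2 * (Lz * B)) by mono. assert (0 <= INR k * (tau ^ 2 * (Lz * B))) by mono.
    lra.
Qed.

(** The defect of commutation created by one step: [eps] comes from the approximate invariance of
    [Z], the other term from the second-order remainder of [F]. *)
Let del := tau * eps + CF * (tau * B) ^ 2.
(** Discrete Gronwall inequality. The factor [(1 + tau * Lz)^k] is at most 3 because total time
    times [Lz] is at most 1; with this, the last hypothesis keeps [F (eiter k y)] in the disc. *)
Lemma eiter_commute y k : INR k * tau * Lz <= 1 -> Cmod y + INR k * tau * B < r -> Cmod (F y) + INR k * tau * B + 3 * (INR k * del) < r ->
  Cmod (eiter k (F y) - F (eiter k y)) <= INR k * del * (1 + tau * Lz) ^ k.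
Proof.
  have hd : 0 <= del by (unfold del; assert (0 <= (tau * B) ^ 2) by apply pow2_ge_0; nra). have tb : 0 <= tau * B by nra. have tl : 0 <= tau * Lz by nra.
  induction k as [|k IH]; intros h0 h1 h2.
  - simpl. lra.
  - rewrite S_INR in *. have kp := pos_INR k. specialize (IH ltac:(nra) ltac:(nra) ltac:(nra)).
    have p3 : (1 + tau * Lz) ^ k <= 3 by (apply pow_exp; nra). have p1 : 1 <= (1 + tau * Lz) ^ k by (apply pow_R1_Rle; lra).
    have kd : 0 <= INR k * del by nra.
    have a1 := eiter_in y k ltac:(nra). have a2 := eiter_drift (F y) k ltac:(nra).
    have a3 : Cmod (eiter k (F y)) <= Cmod (F y) + INR k * tau * B by (have q := Cmod_rev (eiter k (F y)) (F y); lra).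
    have a4 : Cmod (F (eiter k y)) < r.
    { have q := Cmod_rev (F (eiter k y)) (eiter k (F y)). rewrite Cmod_sym in q. nra. }
    simpl eiter. unfold estep at 1. set (u := eiter k (F y)) in *. set (v := eiter k y) in *.
    have hh : Cmod (tau * Z v) <= tau * B. { rewrite Cmod_mult, Cmod_R, Rabs_pos_eq by lra. au. }
    replace (u + tau * Z u - F (estep v))%C with ((u - F v) + tau * (Z u - Z (F v)) + (tau * (Z (F v) - D v * Z v) - (F (v + tau * Z v)%C - F v - D v * (tau * Z v))))%C by (unfold estep; ring).
    via Cmod_triangle. eapply Rle_trans; [apply Rplus_le_compat; [mono|apply Cmod_minus_le]|].
    rewrite (Cmod_mult tau (Z u - Z (F v))), (Cmod_mult tau (Z (F v) - D v * Z v)), Cmod_R, Rabs_pos_eq by lra.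
    have b1 := ZL u (F v) ltac:(nra) a4. have b2 := ZC v a1 a4. have b3 := FT v (tau * Z v) a1 hh.
    have b4 : CF * Cmod (tau * Z v) ^ 2 <= CF * (tau * B) ^ 2 by mono.
    have b5 : tau * Cmod (Z u - Z (F v)) <= tau * Lz * Cmod (u - F v) by (rewrite Rmult_assoc; mono).
    have b6 : tau * Cmod (Z (F v) - D v * Z v) <= tau * eps by mono.
    have b7 : Cmod (u - F v) * (1 + tau * Lz) <= INR k * del * (1 + tau * Lz) ^ k * (1 + tau * Lz) by mono.
    simpl pow. assert (del <= del * ((1 + tau * Lz) ^ k * (1 + tau * Lz))) by (assert (1 <= (1 + tau * Lz) ^ k * (1 + tau * Lz)) by nra; nra).
    unfold del in *. nra.
Qed.
Lemma eiter_hol y k r1 : holball 0 r Z -> r1 + INR k * tau * B < r -> Cmod y < r1 -> hol (eiter k) y.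
Proof.
  intros HZ h hy. induction k as [|k IH].
  - au.
  - rewrite S_INR in h. have kp := pos_INR k. have tb : 0 <= tau * B by nra. specialize (IH ltac:(nra)).
    change (eiter (S k)) with (fun y => eiter k y + tau * Z (eiter k y))%C. apply hol_plus; auto. apply hol_mult; [au|].
    apply (hol_comp (eiter k) Z); auto. apply HZ. rewrite C0r. apply eiter_in. nra.
Qed.
End Euler.

(** * From conjugacies on lines to conjugacies of germs *)
Section Order.
Variables f g fi gi : C -> C -> C.
Variables R1 L : R.
Variables (a : C) (d : nat).
Hypothesis HC : core f g fi gi R1 L a d.
Variable smax : R.
Hypothesis Hsm : 0 < smax /\ 16 * L * smax <= R1.

Definition EE (V : C -> C -> C -> C) (x c y : C) : C := Fd f g x (V x c) y.
(** At these points the defect makes sense for every sufficiently small [x], since [f x y] is close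
    to [f 0 y]. *)
Definition Ydom (r : R) (y : C) : Prop := Cmod y < r /\ Cmod (f 0 y) < r.
(** The part of [adapted] that does not concern stability, with [beta] relaxed to [R1 / 16]; it
    survives a shrinking of the parameter ranges. *)
Definition fam (rV x1 c1 : R) (V : C -> C -> C -> C) : Prop :=
  0 < x1 <= R1 / 16 /\ L * x1 <= R1 / 16 /\ 0 < c1 /\ 0 < rV < smax /\ hol3 (pd3 x1 c1 rV) V /\ (forall x c y, pd3 x1 c1 rV x c y -> Cmod (V x c y) <= R1 / 16) /\
  (forall y, Cmod y < rV -> V 0 0 y = 0) /\ (forall x c r, Cmod x < x1 -> Cmod c < c1 -> 0 < r < rV -> coef 0 r d (V x c) = c).

Lemma or_const : 0 < R1 <= 1 /\ 1 <= L /\ 16 * smax <= R1 /\ L * smax <= R1 / 16.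
Proof.
  have a1 := c_R1 _ _ _ _ _ _ _ _ HC. have a2 := c_L _ _ _ _ _ _ _ _ HC. destruct Hsm. assert (1 * smax <= L * smax) by mono. lra.
Qed.
Lemma le_L u : 0 <= u -> u <= L * u.
Proof. intros h. have q := c_L _ _ _ _ _ _ _ _ HC. assert (1 * u <= L * u) by mono. lra. Qed.
Lemma L_lt u v : u < v -> L * u < L * v.
Proof. intros h. have q := c_L _ _ _ _ _ _ _ _ HC. apply Rmult_lt_compat_l; lra. Qed.
Lemma L_le u v : u <= v -> L * u <= L * v.
Proof. intros h. have q := c_L _ _ _ _ _ _ _ _ HC. au. Qed.
Lemma f_close x y : Cmod x < R1 -> Cmod y < R1 -> Cmod (f x y - f 0 y) <= L * Cmod x.
Proof.
  intros hx hy. destruct or_const as [hR _]. have q := c_fl _ _ _ _ _ _ _ _ HC x y 0 y hx hy _lra hy. lra.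
Qed.
Lemma f_le x y : Cmod x < R1 -> Cmod y < R1 -> Cmod (f x y) <= L * (Cmod x + Cmod y).
Proof. intros hx hy. apply (su_le f g fi gi R1 L a d HC f); auto; apply HC. Qed.
Lemma Ydom_in r y : Cmod y < R1 -> L * Cmod y < r -> Ydom r y.
Proof.
  intros hy h. have q := le_L (Cmod y) (Cmod_ge_0 y). split; [lra|]. destruct or_const as [hR _].
  have q2 := f_le 0 y _lra hy. lra.
Qed.

Lemma fam_shrink rV x1 c1 V x2 c2 : fam rV x1 c1 V -> 0 < x2 <= x1 -> 0 < c2 <= c1 -> fam rV x2 c2 V.
Proof.
  destruct or_const as [hR [hL [h1 h2]]]. intros [F1 [F2 [F3 [F4 [F5 [F6 [F7 F8]]]]]]] hx hc.
  split; [lra|]. split; [have q := L_le x2 x1 _lra; lra|]. split; [lra|]. split; [auto|]. split.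
  - apply (hol3_sub (pd3 x1 c1 rV)); auto. au.
  - split; [|split; auto].
    + intros x c y [q1 [q2 q3]]. apply F6. repeat split; auto; lra.
    + intros x c r q1 q2 q3. au.
Qed.

Lemma f_move r rV x1 x y : Ydom r y -> Cmod x < x1 -> x1 <= R1 / 16 -> r <= rV -> rV < smax -> L * x1 <= rV - r -> Cmod (f x y) < rV.
Proof.
  intros [hy1 hy2] hx hx1 h1 h2 h3. destruct or_const as [hR [hL [h4 h5]]].
  have q := f_close x y _lra _lra. have q2 := Cmod_rev (f x y) (f 0 y). have q3 := L_lt _ _ hx. lra.
Qed.

Lemma EE_hol r rV x1 c1 V : fam rV x1 c1 V -> L * x1 <= rV - r -> hol3 (box x1 c1 (Ydom r)) (EE V).
Proof.
  destruct or_const as [hR [hL [h1 h2]]]. intros [F1 [F2 [F3 [F4 [F5 [F6 [F7 F8]]]]]]] hr g1 g2 g3 t0 rr hrr H.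
  have rl := le_L x1 _lra.
  have Hm : forall t, Cmod (t - t0) < rr -> Cmod (f (g1 t) (g3 t)) < rV.
  { intros t ht. destruct (H t ht) as [k1 [k2 [k3 [k4 [k5 k6]]]]]. apply (f_move r rV x1); auto; lra. }
  have Hf : holball t0 rr (fun t => f (g1 t) (g3 t)).
  { apply (hol2_ball (pd2 R1 R1) f g1 g3 t0 rr (c_f _ _ _ _ _ _ _ _ HC)). intros t ht. destruct (H t ht) as [k1 [k2 [k3 [k4 [k5 [k6 k7]]]]]]. au. }
  have h0 : Cmod (t0 - t0) < rr by lra.
  unfold EE, Fd. apply hol_minus; [apply hol_plus; [mono|]|].
  - apply (F5 g1 g2 (fun t => f (g1 t) (g3 t)) t0 rr hrr). intros t ht. destruct (H t ht) as [k1 [k2 [k3 [k4 [k5 k6]]]]].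
    split; [auto|]. au.
  - apply (c_g _ _ _ _ _ _ _ _ HC g1 (fun t => g3 t + V (g1 t) (g2 t) (g3 t))%C t0 rr hrr). intros t ht. destruct (H t ht) as [k1 [k2 [k3 [k4 [k5 [k6 k7]]]]]].
    split; [auto|]. split; [|split; [lra|]].
    + apply hol_plus; auto. apply (hol3_ball (pd3 x1 c1 rV) V g1 g2 g3 t0 rr F5); auto. intros u hu. destruct (H u hu) as [l1 [l2 [l3 [l4 [l5 [l6 l7]]]]]]. au.
    + eapply Rle_lt_trans; [mono|]. assert (Cmod (V (g1 t) (g2 t) (g3 t)) <= R1 / 16) by au. lra.
Qed.
Lemma EE_bound r rV x1 c1 V x c y : fam rV x1 c1 V -> L * x1 <= rV - r -> box x1 c1 (Ydom r) x c y -> Cmod (EE V x c y) <= 4 * L.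
Proof.
  destruct or_const as [hR [hL [h1 h2]]]. intros [F1 [F2 [F3 [F4 [F5 [F6 [F7 F8]]]]]]] hr [hx [hc [hy1 hy2]]].
  have rl := le_L x1 _lra. have Hm : Cmod (f x y) < rV by (apply (f_move r rV x1); auto; try lra; split; auto).
  have v1 : Cmod (V x c (f x y)) <= R1 / 16 by au.
  have v2 : Cmod (V x c y) <= R1 / 16 by au.
  have v3 := Cmod_triangle y (V x c y).
  have v4 := su_le f g fi gi R1 L a d HC g x (y + V x c y)%C (c_gl _ _ _ _ _ _ _ _ HC) (c_g0 _ _ _ _ _ _ _ _ HC) _lra _lra.
  unfold EE, Fd. via Cmod_minus_le. have v5 := Cmod_triangle (f x y) (V x c (f x y)).
  have q := L_le (Cmod x + Cmod (y + V x c y)) 1 _lra. lra.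
Qed.

Lemma Fd_close x V W y D : Cmod x < R1 -> Cmod y < R1 / 16 -> Cmod (V y) <= R1 / 8 -> Cmod (W y) <= R1 / 8 -> Cmod (V y - W y) <= D -> Cmod (V (f x y) - W (f x y)) <= D ->
  Cmod (Fd f g x V y - Fd f g x W y) <= (1 + L) * D.
Proof.
  destruct or_const as [hR [hL [h1 h2]]]. intros hx hy b1 b2 D1 D2. unfold Fd.
  replace (f x y + V (f x y) - g x (y + V y) - (f x y + W (f x y) - g x (y + W y)))%C with ((V (f x y) - W (f x y)) - (g x (y + V y)%C - g x (y + W y)%C))%C by ring.
  via Cmod_minus_le. have t1 := Cmod_triangle y (V y). have t2 := Cmod_triangle y (W y).
  have q := c_gl _ _ _ _ _ _ _ _ HC x (y + V y)%C x (y + W y)%C hx _lra hx _lra. rewrite Cmod_self in q.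
  replace (y + V y - (y + W y))%C with (V y - W y)%C in q by ring. have q3 := L_le (0 + Cmod (V y - W y)) D _lra. lra.
Qed.

(** To use the stability clause of another family, the members must satisfy the bound [beta] of that
    family. This holds near the origin because [V 0 0 = 0]. *)
Lemma fam_small rV x1 c1 V s b : fam rV x1 c1 V -> s < rV -> 0 < b -> exists x2 c2, 0 < x2 <= x1 /\ 0 < c2 <= c1 /\ forall x c y, Cmod x < x2 -> Cmod c < c2 -> Cmod y <= s -> Cmod (V x c y) <= b.
Proof.
  destruct or_const as [hR [hL [h1 h2]]]. intros [F1 [F2 [F3 [F4 [F5 [F6 [F7 F8]]]]]]] hs hb.
  set (Kx := 2 * (R1 / 16) / (x1 / 2)). set (Kc := 2 * (R1 / 16) / (c1 / 2)).
  have kx : 0 < Kx by pos. have kc : 0 < Kc by pos.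
  small x2 ((2, x1) :: (2 * Kx, b) :: nil) as [p1 [l1 [l2 _]]]. small c2 ((2, c1) :: (2 * Kc, b) :: nil) as [p2 [l3 [l4 _]]].
  exists x2, c2. split; [lra|]. split; [lra|]. intros x c y hx hc hy.
  have q := lip3 x1 c1 rV (x1 / 2) (c1 / 2) (rV - s) (R1 / 16) V _lra _lra _lra F5 F6 0 0 y x c y.
  rewrite Cmod_0 in q. specialize (q _lra _lra _lra _lra _lra _lra). rewrite (F7 y) in q by lra. rewrite !C0r, Cmod_self in q. fold Kx Kc in q.
  assert (Kx * Cmod x <= Kx * x2) by mono. assert (Kc * Cmod c <= Kc * c2) by mono. lra.
Qed.

Definition appV (m : nat) (r rV x1 c1 M : R) (V : C -> C -> C -> C) : Prop :=
  fam rV x1 c1 V /\ 0 < r /\ L * x1 <= rV - r /\ 0 <= M /\ forall x c y, box x1 c1 (Ydom r) x c y -> Cmod (EE V x c y) <= M * Cmod x ^ m.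

Lemma adapted_fam s rho x1 c1 beta K V : 0 < x1 <= R1 / 16 /\ L * x1 <= R1 / 16 /\ 0 < c1 /\ 0 < beta <= R1 / 16 -> 0 < rho < smax -> adapted f g d s rho x1 c1 beta K V -> fam rho x1 c1 V.
Proof.
  intros [h1 [h2 [h3 h4]]] hr [A1 [A2 [A3 [A4 A5]]]]. split; [auto|]. split; [auto|]. split; [auto|]. split; [auto|]. split; [auto|]. split; [|auto].
  intros x c y h. eapply Rle_trans; au.
Qed.

(** A member of [V] has defect at most [M |x|^m], so stability puts it within [K M |x|^m] of the
    member of the adapted family with the same coefficient, whose defect is then of the same order.
    The order in [x] thus does not depend on the family, at the cost of a smaller disc. *)
Lemma transfer m r rV x1 c1 M V s rho x1' c1' beta K V' r' : appV m r rV x1 c1 M V -> 0 < s < r -> 0 < r' < rho -> rho < s -> 0 < x1' <= R1 / 16 /\ L * x1' <= R1 / 16 /\ 0 < c1' /\ 0 < beta <= R1 / 16 -> 0 < K ->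
  adapted f g d s rho x1' c1' beta K V' -> exists x2 c2 M', 0 < x2 <= x1' /\ 0 < c2 <= c1' /\ appV m r' rho x2 c2 M' V'.
Proof.
  destruct or_const as [hR [hL [h1 h2]]]. intros [FA [hr0 [hLx [hM HE]]]] hs hr' hrs Hc hK HA. have FA' := FA. destruct FA' as [F1 [F2 [F3 [F4 [F5 [F6 [F7 F8]]]]]]].
  have rl := le_L x1 _lra. have FB := adapted_fam s rho x1' c1' beta K V' Hc _lra HA.
  destruct (fam_small rV x1 c1 V s beta FA _lra _lra) as [x3 [c3 [hx3 [hc3 Hsm3]]]].
  small x2 ((1, x3) :: (1, x1') :: (L, rho - r') :: (L, r - s) :: nil) as [x2p [xa [xb [xc [xd _]]]]]. small c2 ((1, c3) :: (1, c1') :: nil) as [c2p [c2l [c2r _]]].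
  exists x2, c2, (M + (1 + L) * K * M). have KM : 0 <= (1 + L) * K * M by mono.
  split; [lra|]. split; [lra|]. split; [apply (fam_shrink rho x1' c1'); auto; lra|]. split; [lra|]. split; [auto|]. split; [lra|].
  intros x c y [hx [hc hy]]. destruct HA as [A1 [A2 [A3 [A4 A5]]]].
  have px : 0 <= Cmod x ^ m by mono.
  have ine : forall y, Cmod y <= s -> Cmod (f x y) <= s -> Ydom r y.
  { intros z hz hfz. split; [lra|]. have q := f_close x z _lra _lra. have q2 := Cmod_rev (f 0 z) (f x z). rewrite Cmod_sym in q2. have q3 := L_lt _ _ hx. lra. }
  have St : forall y, Cmod y < rho -> Cmod (V x c y - V' x c y) <= K * (M * Cmod x ^ m).
  { apply (A5 x (V x c) (M * Cmod x ^ m) (r - s) (s / 2) c); try lra.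
    - intros z hz. rewrite C0r in hz. apply (hol3_y (pd3 x1 c1 rV) V x c 0 rV F5).
      + au.
      + lra.
    - au.
    - au.
    - intros z hz hfz. apply HE. split; [lra|]. au. }
  have hf := f_move r' rho x2 x y hy _lra _lra _lra _lra xc. destruct hy as [hy1 hy2].
  have v1 : Cmod (V' x c y) <= R1 / 16 by (eapply Rle_trans; au).
  have v2 : Cmod (V x c y) <= R1 / 16 by au.
  have Q := Fd_close x (V x c) (V' x c) y (K * (M * Cmod x ^ m)) _lra _lra _lra _lra (St y _lra) (St _ hf).
  have Q2 : Cmod (EE V x c y) <= M * Cmod x ^ m.
  { apply HE. split; [lra|]. au. }
  unfold EE in *. have Q3 := Cmod_rev (Fd f g x (V' x c) y) (Fd f g x (V x c) y). rewrite Cmod_sym in Q3. lra.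
Qed.

(** * Exact solutions on the lines [x = xs n] *)

Variables (s0 : R) (xs : nat -> C) (W : nat -> C -> C).
Hypothesis Hs0 : 0 < s0 <= R1.
Hypothesis Hxs : (forall n, xs n <> 0) /\ forall e, 0 < e -> exists N, forall n, (N <= n)%nat -> Cmod (xs n) <= e.
Hypothesis HW : forall n, holball 0 s0 (W n).
Hypothesis HW0 : forall e, 0 < e -> exists N, forall n y, (N <= n)%nat -> Cmod y < s0 -> Cmod (W n y) <= e.
Hypothesis HWe : forall n y, Cmod y < s0 -> Cmod (f (xs n) y) < s0 -> Fd f g (xs n) (W n) y = 0.

Definition cn (n : nat) : C := coef 0 (s0 / 2) d (W n).
Lemma cn_small e : 0 < e -> exists N, forall n, (N <= n)%nat -> Cmod (cn n) <= e.
Proof.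
  intros he. have p : 0 < (s0 / 2) ^ d by pos. destruct (HW0 (e * (s0 / 2) ^ d)) as [N HN]; [pos|]. exists N. intros n hn.
  via (coef_bound (fun t => W n (0 + cir (s0 / 2) t)%C) (s0 / 2) d (e * (s0 / 2) ^ d)).
  - lra.
  - intros t _. apply (ccont_circ 0 s0); au.
  - au.
  - apply Req_le. field. lra.
Qed.

Lemma Fd_ext x V V' y : V y = V' y -> V (f x y) = V' (f x y) -> Fd f g x V y = Fd f g x V' y.
Proof. intros h1 h2. unfold Fd. rewrite h1, h2. au. Qed.

Lemma cn_sol s rho x1 c1 beta K V : s < s0 -> 0 < rho < s -> 0 < x1 -> 0 < c1 -> 0 < beta -> adapted f g d s rho x1 c1 beta K V ->
  exists N, forall n, (N <= n)%nat -> Cmod (xs n) < x1 /\ Cmod (cn n) < c1 /\ forall y, Cmod y < rho -> W n y = V (xs n) (cn n) y.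
Proof.
  intros hs hr hx hc hb [A1 [A2 [A3 [A4 A5]]]]. destruct (proj2 Hxs (x1 / 2)) as [N1 H1]; [lra|]. destruct (cn_small (c1 / 2)) as [N2 H2]; [lra|].
  destruct (HW0 beta hb) as [N3 H3]. exists (N1 + N2 + N3)%nat. intros n hn. specialize (H1 n ltac:(lia)). specialize (H2 n ltac:(lia)).
  split; [lra|]. split; [lra|]. intros y hy. apply Cmod_small_eq. intros e he.
  eapply Rle_trans; [apply (A5 (xs n) (W n) 0 (s0 - s) (s / 2) (cn n)); auto; try lra|lra].
  - au.
  - au.
  - unfold cn. apply (coef_indep 0 s0 s0 (W n)); try apply HW; lra.
  - intros z hz hf. rewrite HWe by lra. lra.
Qed.

Lemma EE_cn rho x c V n y : Cmod y < s0 -> Cmod y < rho -> Cmod (f (xs n) y) < rho -> rho <= s0 -> (forall y, Cmod y < rho -> W n y = V (xs n) (cn n) y) -> x = xs n -> c = cn n -> EE V x c y = 0.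
Proof.
  intros h1 h2 h3 h4 H -> ->. unfold EE. rewrite <- (HWe n y) by lra. apply Fd_ext; symmetry; apply H; auto.
Qed.

Lemma dW_small s e : s < s0 -> 0 < e -> exists N, forall n y, (N <= n)%nat -> Cmod y <= s -> Cmod (cD (W n) y) <= e.
Proof.
  intros hs he. destruct (HW0 (e * (s0 - s) / 2)) as [N HN]; [pos|]. exists N. intros n y hn hy.
  destruct (est2 y (s0 - s) (W n) (e * (s0 - s) / 2)) as [h _]; [lra| | |].
  - apply (holball_sub 0 s0); [mono|]. lra.
  - intros w hw. apply HN; auto. have q := Cmod_rev w y. lra.
  - eapply Rle_trans; [exact h|]. apply Req_le. field. lra.
Qed.

Lemma dc_lip e b Y F M : 0 < e -> 0 < b -> hol3 (box e b Y) F -> (forall x c y, box e b Y x c y -> Cmod (F x c y) <= M) ->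
  (forall y, Y y -> cD (fun c => F 0 c y) 0 = 0) ->
  exists K, 0 < K /\ forall x c y, Cmod x <= e / 2 -> Cmod c <= b / 4 -> Y y -> Cmod (cD (fun c => F x c y) c) <= K * (Cmod x + Cmod c).
Proof.
  intros he hb HF BF H0. set (M' := 2 * M / (b / 2)). set (Ka := 2 * M' / (e / 2)). set (Kb := 2 * M' / (b / 4)).
  exists (Rabs Ka + Rabs Kb + 1). have ra := Rabs_pos Ka. have rb := Rabs_pos Kb. split; [lra|].
  intros x c y hx hc hy.
  (* The middle variable is a dummy of radius 1, which brings the lemmas on three variables to
     bear. *)
  destruct (hol3_dy (pd3 e 1 b) (pd3 e 1 (b / 2)) (b / 2) M (fun x _ c => F x c y) _lra) as [D1 D2].
  - intros g1 g2 g3 t0 r hr h. apply (HF g1 g3 (fun _ => y) t0 r hr). intros t ht. destruct (h t ht) as [k1 [k2 [k3 [k4 [k5 k6]]]]].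
    split; [auto|]. split; [auto|]. split; [au|]. split; auto.
  - intros x' _ c' [k1 [_ k2]]. apply BF. split; auto.
  - intros x' u c' c'' [k1 [k2 k3]] hh. split; [auto|]. split; [auto|]. have q := Cmod_rev c'' c'. lra.
  - fold M' in D2. have q := lip3 e 1 (b / 2) (e / 2) (1 / 2) (b / 4) M' (fun x u c => cD (fun c => F x c y) c) _lra _lra _lra D1 D2 0 0 0 x 0 c.
    rewrite !Cmod_0 in q. specialize (q _lra _lra _lra _lra _lra _lra). cbv beta in q. rewrite (H0 y hy), !C0r, Cmod_0 in q.
    fold Ka Kb in q. have px := Cmod_ge_0 x. have pc := Cmod_ge_0 c. have k1 := Rle_abs Ka. have k2 := Rle_abs Kb.
    assert (Ka * Cmod x <= (Rabs Ka + Rabs Kb + 1) * Cmod x) by mono.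
    assert (Kb * Cmod c <= (Rabs Ka + Rabs Kb + 1) * Cmod c) by mono. lra.
Qed.

(** The velocity of the family with respect to its parameter. As the [d]-th coefficient of [V x c]
    is [c], that of the velocity is 1, so moving along it changes the parameter at unit speed. *)
Definition vel (V : C -> C -> C -> C) (x c y : C) : C := cD (fun c => V x c y) c.
Lemma vel_spec rV x1 c1 V : fam rV x1 c1 V -> forall x c, Cmod x < x1 -> Cmod c < c1 / 2 ->
  (forall y, Cmod y < rV -> Cd (fun c => V x c y) c (vel V x c y) /\ Cmod (vel V x c y) <= R1 / (4 * c1)) /\ holball 0 rV (vel V x c) /\ forall r, 0 < r < rV -> coef 0 r d (vel V x c) = 1.
Proof.
  destruct or_const as [hR [hL [h1 h2]]]. intros [F1 [F2 [F3 [F4 [F5 [F6 [F7 F8]]]]]]] x c hx hc.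
  have hc2 : forall u, Cmod (u - c) < c1 / 2 -> Cmod u < c1 by (intros u hu; have q := Cmod_rev u c; lra).
  have Hh : forall y, Cmod y < rV -> holball c (c1 / 2) (fun c => V x c y).
  { intros y hy. apply (hol3_u (pd3 x1 c1 rV) V x y c (c1 / 2) F5). au. }
  have E2 : forall y, Cmod y < rV -> Cmod (vel V x c y) <= R1 / (4 * c1) /\ forall w, Cmod w <= c1 / 2 / 4 -> Cmod (V x (c + w)%C y - V x c y - vel V x c y * w) <= 8 * (R1 / 16) / (c1 / 2) ^ 2 * Cmod w ^ 2.
  { intros y hy. destruct (est2 c (c1 / 2) (fun c => V x c y) (R1 / 16) _lra (Hh y hy)) as [e1 e2].
    - au.
    - split; [|mono]. eapply Rle_trans; [exact e1|]. apply Req_le. field. lra. }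
  have HV : holball 0 rV (vel V x c).
  { destruct (hol3_dy (fun x y c => pd3 x1 c1 rV x c y) (fun x y c => Cmod x < x1 /\ Cmod c < c1 / 2 /\ Cmod y < rV) (c1 / 2) (R1 / 16) (fun x y c => V x c y) _lra) as [D1 _].
    - apply hol3_swap; auto.
    - au.
    - intros x' u c' c'' [k1 [k2 k3]] hh. split; [auto|]. split; [|auto]. have q := Cmod_rev c'' c'. lra.
    - intros z hz. rewrite C0r in hz.
      apply (D1 (fun _ => x) (fun z => z) (fun _ => c) z (rV - Cmod z) _lra). intros t ht. split; [au|]. split; [au|]. split; [au|].
      have q := Cmod_rev t z. lra. }
  split; [|split; auto].
  - intros y hy. split; [|apply E2; auto]. apply cD_spec. au.
  - intros r hr. set (v := coef 0 r d (vel V x c)). set (Kq := 8 * (R1 / 16) / (c1 / 2) ^ 2).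
    have hrd : 0 < r ^ d by pos. have c12 : 0 < (c1 / 2) ^ 2 by pos. have kq : 0 < Kq by pos.
    apply Cmod_small_eq. intros e he.
    have er : 0 < e * r ^ d by pos. small h ((1, c1 / 16) :: (Kq, e * r ^ d) :: nil) as [hh [hl [hr2 _]]].
    have mh : Cmod h = h by lra.
    have hch : Cmod (c + h) < c1 by (eapply Rle_lt_trans; [mono|]; rewrite mh; lra).
    have Vy : forall c', Cmod c' < c1 -> holball 0 rV (V x c').
    { intros c' hc'. apply (hol3_y (pd3 x1 c1 rV) V x c' 0 rV F5). au. }
    have Ec : coef 0 r d (fun y => V x (c + h)%C y - V x c y - h * vel V x c y)%C = (h - h * v)%C.
    { rewrite (coef_minus 0 rV), (coef_minus 0 rV), (coef_scal 0 rV); auto; try (apply Vy; auto; lra).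
      - rewrite !F8 by lra. fold v. ring.
      - au.
      - au. }
    have B : Cmod (h - h * v) <= Kq * h ^ 2 / r ^ d.
    { rewrite <- Ec. apply (coef_bound (fun t => V x (c + h)%C (0 + cir r t)%C - V x c (0 + cir r t)%C - h * vel V x c (0 + cir r t)%C)%C r d); [lra| |].
      - intros t _. apply (ccont_circ 0 rV (fun y => V x (c + h)%C y - V x c y - h * vel V x c y)%C); [|lra].
        au.
      - intros t. destruct (E2 (0 + cir r t)%C _lra) as [_ q]. specialize (q h _lra). rewrite mh, (Cmult_comm _ h) in q. au. }
    replace (h - h * v)%C with (- (h * (v - 1)))%C in B by ring. rewrite Cmod_opp, Cmod_mult, mh in B.
    apply Rmult_le_reg_l with h; auto. eapply Rle_trans; [exact B|]. apply Rmult_le_reg_r with (r ^ d); auto. unfold Rdiv. rewrite Rmult_assoc, Rinv_l by lra.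
    assert (h * (Kq * h) <= h * (e * r ^ d)) by mono. lra.
Qed.

Lemma hol_slice (h : C -> C -> C) x y : hol2 (pd2 R1 R1) h -> Cmod x < R1 -> Cmod y < R1 -> hol (h x) y.
Proof.
  intros H hx hy. apply (hol2_y (pd2 R1 R1) h x 0 R1 H); [|lra]. au.
Qed.

Lemma quot_fam m r rV x1 c1 V : fam rV x1 c1 V -> L * x1 <= rV - r -> hol3 (box (x1 / 4) c1 (Ydom r)) (quot x1 (EE V) m) /\
  forall x c y, box (x1 / 4) c1 (Ydom r) x c y -> Cmod (quot x1 (EE V) m x c y) <= 4 * L / (x1 / 2) ^ m * 2.
Proof.
  intros FA hL. have x0 : 0 < x1 by apply FA. have EH := EE_hol r rV x1 c1 V FA hL. have EB := fun x c y => EE_bound r rV x1 c1 V x c y FA hL.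
  split; [exact (quot_hol x1 c1 (Ydom r) (EE V) (4 * L) x0 EH EB m)|exact (quot_bound x1 c1 (Ydom r) (EE V) (4 * L) x0 EH EB m)].
Qed.

(* If [d/dc] of the leading part of the error vanishes at the origin, the velocity of the family along the exact solution is, up to
   [o(x^m)], an infinitesimal symmetry of [f x]. *)
Lemma vel_field m r r1 rho x1 c1 M V : appV m r1 rho x1 c1 M V -> r < r1 -> rho < s0 ->
  (exists N, forall n, (N <= n)%nat -> forall y, Cmod y < rho -> W n y = V (xs n) (cn n) y) ->
  (forall y, Ydom r1 y -> cD (fun c => quot x1 (EE V) m 0 c y) 0 = 0) ->
  exists Kd N, 0 < Kd /\ forall n, (N <= n)%nat -> exists Z, holball 0 rho Z /\ (forall y, Cmod y < rho -> Cmod (Z y) <= R1 / (2 * c1) /\ ((1 + cD (W n) y) * Z y)%C = vel V (xs n) (cn n) y) /\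
    forall y, Cmod y < r -> Cmod (f (xs n) y) < r -> Cmod (Z (f (xs n) y) - cD (f (xs n)) y * Z y) <= Kd * (Cmod (xs n) + Cmod (cn n)) * Cmod (xs n) ^ m.
Proof.
  destruct or_const as [hR [hL [h1 h2]]]. intros HA hr hrs HS H0. have HA' := HA. destruct HA' as [FA [hr1 [hLx [hM HE]]]]. have FA' := FA. destruct FA' as [F1 [F2 [F3 [F4 [F5 [F6 [F7 F8]]]]]]].
  have rl := le_L x1 _lra. destruct (quot_fam m r1 rho x1 c1 V FA hLx) as [QH QB].
  destruct (dc_lip (x1 / 4) c1 (Ydom r1) (quot x1 (EE V) m) _ _lra F3 QH QB H0) as [K [hK HK]].
  destruct HS as [N1 HS]. destruct (dW_small rho (/ 2) hrs _lra) as [N2 HdW].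
  small ex ((16, x1) :: (2 * L, r1 - r) :: nil) as [hex [xm1 [xm2 _]]]. destruct (proj2 Hxs ex hex) as [N3 HX].
  destruct (cn_small (c1 / 8)) as [N4 HCn]; [lra|].
  exists (2 * K), (N1 + N2 + N3 + N4)%nat. split; [lra|]. intros n hn. specialize (HS n ltac:(lia)). specialize (HX n ltac:(lia)). specialize (HCn n ltac:(lia)).
  have HdW' : forall y, Cmod y <= rho -> Cmod (cD (W n) y) <= / 2 by au.
  set (x := xs n) in *. set (c0 := cn n) in *.
  have Lx := L_le _ _ HX.
  destruct (vel_spec rho x1 c1 V FA x c0 _lra _lra) as [VS [VH _]].
  have kl : forall y, Cmod y <= rho -> / 2 <= Cmod (1 + cD (W n) y).
  { intros y hy. have q := Cmod_rev_plus 1 (cD (W n) y). rewrite Cmod_1 in q. specialize (HdW' y hy). lra. }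
  have knz : forall y, Cmod y <= rho -> (1 + cD (W n) y)%C <> 0 by (intros y hy; apply Cmod_neq0; specialize (kl y hy); lra).
  (* The velocity pulled back by the conjugacy [id + W n], that is, divided by its derivative. *)
  exists (fun y => vel V x c0 y / (1 + cD (W n) y))%C. split; [|split].
  - intros z hz. have hz' := hz. rewrite C0r in hz. apply hol_div; [mono| |au]. apply hol_plus; [au|].
    apply (holball_cD 0 s0); [mono|]. lra.
  - intros y hy. split; [|field; apply knz; lra]. apply div_bound; [au|]. destruct (VS y hy) as [_ q]. eapply Rle_trans; [exact q|].
    specialize (kl y _lra). assert (0 < R1 / (2 * c1)) by pos.
    apply Rle_trans with (R1 / (2 * c1) * / 2); [apply Req_le; field; lra|]. au.
  - intros y hy hfy. set (w := f x y) in *.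
    have Yy : Ydom r1 y.
    { split; [lra|]. have q := f_close x y _lra _lra. fold w in q. have q2 := Cmod_rev (f 0 y) w. rewrite Cmod_sym in q2. lra. }
    destruct (VS y _lra) as [Vy _]. destruct (VS w _lra) as [Vw _].
    have Ky : Cmod (y + V x c0 y) < R1.
    { eapply Rle_lt_trans; [mono|]. assert (Cmod (V x c0 y) <= R1 / 16) by au. lra. }
    set (gp := cD (g x) (y + V x c0 y)%C).
    have Hg : Cd (g x) (y + V x c0 y)%C gp by (apply cD_spec, hol_slice; auto; [apply HC|lra]).
    have D1 : Cd (fun c => EE V x c y) c0 (vel V x c0 w - gp * vel V x c0 y).
    { apply (Cd_ext (fun c => (w + V x c w) + (- (1)) * g x (y + V x c y)%C)%C _ _ _ 1); [lra|intros c _; unfold EE, Fd; fold w; ring|].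
      eapply Cd_eq; [|apply Cd_plus; [apply Cd_plus; [apply Cd_const|exact Vw]|apply Cd_scal; apply (Cd_comp (fun c => y + V x c y)%C (g x)); [apply Cd_plus; [apply Cd_const|exact Vy]|exact Hg]]]. ring. }
    have D2 : Cd (fun c => EE V x c y) c0 (x ^ m * cD (fun c => quot x1 (EE V) m x c y) c0).
    { apply (Cd_ext (fun c => x ^ m * quot x1 (EE V) m x c y)%C _ _ _ (c1 / 2)); [lra| |].
      - intros c hc. symmetry. have qc := Cmod_rev c c0. have hc1 : Cmod c < c1 by lra.
        apply (quot_spec x1 c1 (Ydom r1) (EE V)) with (e' := x1) (M' := M); auto; try lra; [apply (EE_hol r1 rho); auto|].
        intros x' hx'. apply HE. split; auto.
      - apply Cd_scal, cD_spec. apply (hol3_u (box (x1 / 4) c1 (Ydom r1)) _ x y c0 (c1 / 2) QH).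
        + intros c hc. have qc := Cmod_rev c c0. split; [lra|]. au.
        + lra. }
    (* The defect is differentiated in [c] twice over, directly and through its factor [x^m]. *)
    have E12 := Cd_unique _ _ _ _ D1 D2.
    have Wy : Cd (fun z => z + W n z)%C y (1 + cD (W n) y) by (apply Cd_plus; [apply Cd_id|apply cD_spec, HW; rewrite C0r; lra]).
    have Ww : Cd (fun z => z + W n z)%C w (1 + cD (W n) w) by (apply Cd_plus; [apply Cd_id|apply cD_spec, HW; rewrite C0r; lra]).
    have Hf : Cd (f x) y (cD (f x) y) by (apply cD_spec, hol_slice; [apply HC|lra|lra]).
    have D3 : Cd (fun z => f x z + W n (f x z))%C y ((1 + cD (W n) w) * cD (f x) y) by (apply (Cd_comp (f x) (fun z => z + W n z)%C); auto).
    have D4 : Cd (fun z => f x z + W n (f x z))%C y (gp * (1 + cD (W n) y)).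
    { destruct (Cd_cont _ _ _ Hf (s0 - r) _lra) as [dd [hdd Hdd]]. fold w in Hdd.
      small mm ((1, dd) :: (1, s0 - r) :: nil) as [hmm [mm1 [mm2 _]]]. apply (Cd_ext (fun z => g x (z + W n z)%C) _ _ _ mm hmm).
      - intros z hz. specialize (Hdd z _lra).
        have q1 := Cmod_rev z y. have q2 := Cmod_rev (f x z) w. have q := HWe n z _lra ltac:(fold x; lra). fold x in q. unfold Fd in q.
        symmetry. apply (proj2 (Ceq_minus _ _)). au.
      - apply (Cd_comp (fun z => z + W n z)%C (g x)); [auto|]. rewrite HS by lra. au. }
    (* The exact conjugacy is differentiated in [y] through either side; this eliminates [gp], the
       derivative of [g x]. *)
    have E34 := Cd_unique _ _ _ _ D3 D4.
    have Kq := HK x c0 y _lra _lra Yy.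
    set (Q := cD (fun c => quot x1 (EE V) m x c y) c0) in *. set (kw := (1 + cD (W n) w)%C) in *. set (ky := (1 + cD (W n) y)%C) in *.
    have nw : kw <> 0 by (apply knz; lra). have ny : ky <> 0 by (apply knz; lra).
    replace (vel V x c0 w / kw - cD (f x) y * (vel V x c0 y / ky))%C with ((x ^ m * Q) / kw)%C.
    + apply div_bound; auto. rewrite Cmod_mult, Cmod_pow. specialize (kl w _lra). fold kw in kl.
      have px : 0 <= Cmod x ^ m by mono. have p1 := Cmod_ge_0 x. have p2 := Cmod_ge_0 c0.
      apply Rle_trans with (Cmod x ^ m * (K * (Cmod x + Cmod c0))); [mono|].
      replace (2 * K * (Cmod x + Cmod c0) * Cmod x ^ m * Cmod kw) with (Cmod x ^ m * (K * (Cmod x + Cmod c0)) * (2 * Cmod kw)) by ring.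
      rewrite <- (Rmult_1_r (_ * (K * _))) at 1. au.
    + rewrite <- E12. replace (cD (f x) y) with (gp * ky / kw)%C; [field; auto|]. rewrite <- E34. field. au.
Qed.

Lemma Lip_W n s K : s < s0 -> (forall y, Cmod y <= s -> Cmod (cD (W n) y) <= K) -> forall u v, Cmod u <= s -> Cmod v <= s -> Cmod (W n u - W n v) <= K * Cmod (u - v).
Proof.
  intros hs H u v hu hv. apply (MVT_C (W n) (cD (W n)) v u K).
  - intros t ht. apply cD_spec, HW. rewrite C0r. have q := seg_in v u s t ht hv hu. lra.
  - intros t ht. apply H. apply seg_in; auto.
Qed.

(* Composing the exact solution with the (Euler) flow of [vel_field] moves its coefficient from [cn n] to about [cn n + t]
   while keeping the error [o(x^m)]. *)
Lemma flow_approx m s2 r r1 rho x1 c1 M V b : appV m r1 rho x1 c1 M V -> 0 < s2 < r -> r < r1 -> rho < s0 -> 0 < b ->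
  (exists N, forall n, (N <= n)%nat -> forall y, Cmod y < rho -> W n y = V (xs n) (cn n) y) ->
  (forall y, Ydom r1 y -> cD (fun c => quot x1 (EE V) m 0 c y) 0 = 0) ->
  exists t0 C3 Kd, 0 < t0 /\ 0 <= C3 /\ 0 < Kd /\ forall t, 0 < t <= t0 -> exists N, forall n, (N <= n)%nat -> exists T del, 0 < del /\ holball 0 (s2 + del) T /\
    (forall y, Cmod y <= s2 -> Cmod (T y) <= b) /\ (forall y, Cmod y <= s2 -> Cmod (f (xs n) y) <= s2 -> Cmod (Fd f g (xs n) T y) <= Kd * (Cmod (xs n) + Cmod (cn n)) * Cmod (xs n) ^ m) /\
    Cmod (coef 0 (s2 / 2) d T - cn n - t) <= C3 * t ^ 2.
Proof.
  destruct or_const as [hR [hL [h1 h2]]]. intros HA hs2 hr hrs hb HS H0.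
  have HA' := HA. destruct HA' as [FA [hr1 [hLx [hM HE]]]]. have FA' := FA. destruct FA' as [F1 [F2 [F3 [F4 [F5 [F6 [F7 F8]]]]]]].
  have rl := le_L x1 _lra. destruct (vel_field m r r1 rho x1 c1 M V HA hr hrs HS H0) as [Kd [N1 [hKd HZ]]].
  set (B := R1 / (2 * c1)). have hB : 0 < B by pos. set (Lz := 2 * B / (rho - r)). have hLz : 0 < Lz by pos.
  set (CF := 8 * (2 * L) / (R1 / 2) ^ 2). have hCF : 0 < CF by pos. have hp2 : 0 < 8 * 1 / (s0 - s2) ^ 2 by pos. have hB2 : 0 < B ^ 2 by pos.
  set (C4 := 2 * (Lz * B) + 8 * 1 / (s0 - s2) ^ 2 * B ^ 2). have hC4 : 0 < C4 by pos. have hsd : 0 < (s2 / 2) ^ d by pos.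
  small t0 ((4 * B, r - s2) :: (Lz, 1) :: (2 * B, b) :: (1, 1) :: nil) as [ht0 [t01 [t02 [t03 [t04 _]]]]].
  exists t0, (C4 / (s2 / 2) ^ d), (12 * Kd). split; [auto|]. split; [mono|]. split; [lra|]. intros t ht.
  have tB0 : B * t <= B * t0 by mono. have tL0 : Lz * t <= Lz * t0 by mono.
  have tB : t * B <= (r - s2) / 4 by lra. have tL : t * Lz <= 1 by lra. have tb : t * B <= b / 2 by lra.
  small e0 ((64 * Kd, r - s2) :: (2, x1) :: (4, c1) :: (1, 1) :: nil) as [he0 [he0K [ex1 [ec1 [e01 _]]]]].
  destruct (dW_small r (/ 2) _lra _lra) as [N2 HdW]. destruct (proj2 Hxs e0 he0) as [N3 HX]. destruct (cn_small e0 he0) as [N4 HCn].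
  small e5 ((2, b) :: (1, 1) :: nil) as [he5 [e51 [e52 _]]]. destruct (HW0 e5 he5) as [N5 HW5]. destruct HS as [N6 HS].
  exists (N1 + N2 + N3 + N4 + N5 + N6)%nat. intros n hn. specialize (HX n ltac:(lia)). specialize (HCn n ltac:(lia)). specialize (HS n ltac:(lia)).
  have HdW' : forall y, Cmod y <= r -> Cmod (cD (W n) y) <= / 2 by au.
  have HW5' : forall y, Cmod y < s0 -> Cmod (W n y) <= b / 2 /\ Cmod (W n y) <= 1.
  { intros y hy. specialize (HW5 n y ltac:(lia) hy). lra. }
  destruct (HZ n ltac:(lia)) as [Z [Zh [ZB ZC]]].
  have hxn := proj1 Hxs n. set (x := xs n) in *. set (c0 := cn n) in *. have px : 0 < Cmod x by au. have pc := Cmod_ge_0 c0.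
  set (eps := Kd * (Cmod x + Cmod c0) * Cmod x ^ m) in *.
  have pxm : 0 < Cmod x ^ m by pos. have pxm1 : Cmod x ^ m <= 1 by (apply pow_le_1; lra).
  have heps : 0 < eps by mono.
  have heps2 : eps <= (r - s2) / 32.
  { unfold eps. have q0 : 0 < Kd * (Cmod x + Cmod c0) by pos.
    assert (Kd * (Cmod x + Cmod c0) <= Kd * (e0 + e0)) by mono.
    assert (Kd * (Cmod x + Cmod c0) * Cmod x ^ m <= Kd * (Cmod x + Cmod c0) * 1) by mono. lra. }
  (* The number of Euler steps is chosen after [n], so that the discretisation error stays below
     [eps], which depends on [x]. *)
  destruct (INR_unbounded (CF * t * B ^ 2 / eps)) as [k0 hk0]. set (k := S k0). have hk : 0 < INR k by (apply (lt_INR 0); unfold k; lia).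
  have hk1 : CF * t * B ^ 2 / eps <= INR k by (unfold k; rewrite S_INR; lra).
  set (tau := t / INR k). have htau : 0 < tau by pos. have kt : INR k * tau = t by (unfold tau; field; lra).
  have hCt : CF * tau * B ^ 2 <= eps.
  { unfold tau. replace (CF * (t / INR k) * B ^ 2) with (CF * t * B ^ 2 / eps * (eps / INR k)) by (field; lra).
    apply Rle_trans with (INR k * (eps / INR k)); [|apply Req_le; field; lra]. au. }
  have hdel : INR k * (tau * eps + CF * (tau * B) ^ 2) <= 2 * t * eps.
  { replace (INR k * (tau * eps + CF * (tau * B) ^ 2)) with (INR k * tau * (eps + CF * tau * B ^ 2)) by ring. rewrite kt.
    assert (t * (eps + CF * tau * B ^ 2) <= t * (2 * eps)) by mono. lra. }
  have hte : t * eps <= 1 * eps by mono.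
  have tauB : tau * B <= t * B.
  { apply Rmult_le_compat_r; [lra|]. rewrite <- kt. assert (1 * tau <= INR k * tau) by (apply Rmult_le_compat_r; [lra|apply (le_INR 1); unfold k; lia]). lra. }
  have ZB' : forall y, Cmod y < r -> Cmod (Z y) <= B by (intros y hy; apply ZB; lra).
  have ZL' : forall y y', Cmod y < r -> Cmod y' < r -> Cmod (Z y - Z y') <= Lz * Cmod (y - y').
  { intros y y' hy hy'. apply (lip_ball 0 rho r Z B); try rewrite C0r; auto; try lra. intros w hw. rewrite C0r in hw. apply ZB; auto. }
  have hf : forall y, Cmod y < R1 -> hol (f x) y by (intros y hy; apply hol_slice; auto; [apply HC|lra]).
  have FT' : forall y h, Cmod y < r -> Cmod h <= tau * B -> Cmod (f x (y + h)%C - f x y - cD (f x) y * h) <= CF * Cmod h ^ 2.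
  { intros y h hy hh. destruct (est2 y (R1 / 2) (f x) (2 * L) _lra) as [_ q].
    - intros z hz. apply hf. have q := Cmod_rev z y. lra.
    - intros z hz. have q := Cmod_rev z y. eapply Rle_trans; [apply f_le; lra|]. have q2 := L_le (Cmod x + Cmod z) 2 _lra. lra.
    - au. }
  have ZC' : forall y, Cmod y < r -> Cmod (f x y) < r -> Cmod (Z (f x y) - cD (f x) y * Z y) <= eps by mono.
  set (A := eiter Z tau k).
  have DR : forall y, Cmod y + t * B < r -> Cmod (A y - y) <= t * B.
  { intros y hy. have q := eiter_drift Z r B tau htau _lra ZB' y k. rewrite kt in q. au. }
  have SE : forall y, Cmod y + t * B < r -> Cmod (A y - y - t * Z y) <= t ^ 2 * (Lz * B).
  { intros y hy. have q := eiter_second Z r B Lz tau htau _lra _lra ZB' ZL' y k. rewrite kt in q. rewrite <- RtoC_mult, kt in q. au. }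
  have CM : forall y, Cmod y <= s2 -> Cmod (f x y) <= s2 -> Cmod (A (f x y) - f x (A y)) <= 6 * eps.
  { intros y hy hfy. have q := eiter_commute (f x) Z (cD (f x)) r B Lz CF eps tau htau _lra _lra _lra _lra ZB' ZL' FT' ZC' y k.
    have p3 : (1 + tau * Lz) ^ k <= 3 by (apply pow_exp; [mono|rewrite <- Rmult_assoc, kt; auto]).
    rewrite kt in q. specialize (q tL _lra _lra). fold A in q. eapply Rle_trans; [exact q|].
    have dp : 0 <= INR k * (tau * eps + CF * (tau * B) ^ 2).
    { apply Rmult_le_pos; [lra|]. apply Rplus_le_le_0_compat; apply Rmult_le_pos; try lra. apply pow2_ge_0. }
    apply Rle_trans with (INR k * (tau * eps + CF * (tau * B) ^ 2) * 3); au. }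
  (* [id + T] is the exact conjugacy after the approximate symmetry [A] of [f x]: its defect is the
     defect of commutation of [A] with [f x], carried over by [id + W n]. *)
  exists (fun y => A y + W n (A y) - y)%C, ((r - s2) / 4). split; [lra|].
  have AH : forall y, Cmod y < s2 + (r - s2) / 4 -> hol A y /\ Cmod (A y) < r.
  { intros y hy. split.
    - apply (eiter_hol Z r B tau htau _lra ZB' y k (s2 + (r - s2) / 4)); auto; [|rewrite kt; lra].
      au.
    - have q := DR y _lra. have q2 := Cmod_rev (A y) y. lra. }
  have TH : holball 0 (s2 + (r - s2) / 4) (fun y => A y + W n (A y) - y)%C.
  { intros y hy. rewrite C0r in hy. destruct (AH y hy) as [a1 a2]. apply hol_minus; [apply hol_plus; auto|au].
    apply (hol_comp A (W n)); auto. au. }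
  split; [auto|]. split; [|split].
  - intros y hy. destruct (AH y _lra) as [a1 a2]. replace (A y + W n (A y) - y)%C with ((A y - y) + W n (A y))%C by ring.
    via Cmod_triangle. have q := DR y _lra. destruct (HW5' (A y) _lra) as [q2 _]. lra.
  - intros y hy hfy. destruct (AH y _lra) as [a1 a2]. destruct (AH (f x y) _lra) as [_ a3]. have cm := CM y hy hfy.
    have a3' : Cmod (A (f x y)) <= s2 + (r - s2) / 4 by (have q := DR (f x y) _lra; have q2 := Cmod_rev (A (f x y)) (f x y); lra).
    have a4 : Cmod (f x (A y)) < r by (have q2 := Cmod_rev (f x (A y)) (A (f x y)); rewrite Cmod_sym in q2; lra).
    have q := HWe n (A y) _lra ltac:(fold x; lra). fold x in q. unfold Fd in q |- *.
    have q' : g x (A y + W n (A y))%C = (f x (A y) + W n (f x (A y)))%C by (symmetry; apply (proj2 (Ceq_minus _ _)); exact q).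
    replace (y + (A y + W n (A y) - y))%C with (A y + W n (A y))%C by ring. rewrite q'.
    replace (f x y + (A (f x y) + W n (A (f x y)) - f x y) - (f x (A y) + W n (f x (A y))))%C with ((A (f x y) - f x (A y)) + (W n (A (f x y)) - W n (f x (A y))))%C by ring.
    via Cmod_triangle. have lw := Lip_W n r (/ 2) _lra HdW' (A (f x y)) (f x (A y)) _lra _lra.
    unfold eps in cm, heps. lra.
  - destruct (vel_spec rho x1 c1 V FA x c0) as [VS [VH Vc]]; [lra|lra|].
    (* To first order in [t] the displacement of [W n] is [t] times the velocity, whose [d]-th
       coefficient is 1. *)
    replace (coef 0 (s2 / 2) d (fun y => A y + W n (A y) - y)%C - c0 - t)%C with (coef 0 (s2 / 2) d (fun y => (A y + W n (A y) - y) - W n y - t * vel V x c0 y)%C).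
    + eapply Rle_trans; [apply (coef_bound (fun th => (fun y => (A y + W n (A y) - y) - W n y - t * vel V x c0 y)%C (0 + cir (s2 / 2) th)%C) (s2 / 2) d (C4 * t ^ 2)); [lra| |]|lra].
      * intros th _. apply (ccont_circ 0 s2 (fun y => (A y + W n (A y) - y) - W n y - t * vel V x c0 y)%C); [|lra]. au.
      * intros th. cbv beta. set (y := (0 + cir (s2 / 2) th)%C). have hy : Cmod y = s2 / 2 by (apply in0; lra).
        destruct (ZB y _lra) as [_ zv]. rewrite <- zv. set (u := A y). set (w' := cD (W n) y).
        have q1 := DR y _lra. have q2 := SE y _lra. fold u in q1, q2. have q3 := HdW' y _lra. fold w' in q3.
        destruct (est2 y (s0 - s2) (W n) 1 _lra) as [_ q4].
        { apply (holball_sub 0 s0); [mono|]. lra. }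
        { intros w hw. apply HW5'. have q := Cmod_rev w y. lra. }
        specialize (q4 (u - y)%C _lra). replace (y + (u - y))%C with u in q4 by ring. fold w' in q4.
        replace (u + W n u - y - W n y - t * ((1 + w') * Z y))%C with ((u - y - t * Z y) + (W n u - W n y - w' * (u - y)) + w' * (u - y - t * Z y))%C by ring.
        via Cmod_triangle. eapply Rle_trans; [apply Rplus_le_compat_r, Cmod_triangle|]. rewrite Cmod_mult.
        have q5 : 8 * 1 / (s0 - s2) ^ 2 * Cmod (u - y) ^ 2 <= 8 * 1 / (s0 - s2) ^ 2 * (t * B) ^ 2 by mono.
        have q6 : Cmod w' * Cmod (u - y - t * Z y) <= 1 * (t ^ 2 * (Lz * B)) by mono.
        unfold C4. lra.
    + rewrite (coef_minus 0 s2), (coef_minus 0 s2), (coef_scal 0 s2), Vc; try lra.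
      * rewrite (coef_indep 0 s0 s0 (W n) (s2 / 2) (s0 / 2)); try apply HW; try lra. fold (cn n). fold c0. ring.
      * au.
      * au.
      * au.
      * au.
      * au.
Qed.

Lemma quot_lip r rV x1 c1 V m : fam rV x1 c1 V -> L * x1 <= rV - r -> exists K, 0 <= K /\ forall x c c' y, Ydom r y -> Cmod x <= x1 / 8 -> Cmod c <= c1 / 2 -> Cmod c' <= c1 / 2 ->
  Cmod (quot x1 (EE V) m x c y - quot x1 (EE V) m 0 c' y) <= K * (Cmod x + Cmod (c - c')).
Proof.
  intros FA hLx. destruct or_const as [hR [hL _]]. destruct (quot_fam m r rV x1 c1 V FA hLx) as [QH QB]. destruct FA as [F1 [F2 [F3 _]]].
  set (MQ := 4 * L / (x1 / 2) ^ m * 2) in *. have hMQ : 0 < MQ by pos.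
  set (Ka := 2 * MQ / (x1 / 8)). set (Kb := 2 * MQ / (c1 / 2)). assert (0 < Ka) by pos. assert (0 < Kb) by pos.
  exists (Ka + Kb). split; [lra|]. intros x c c' y hy hx hc hc'.
  have q := lip2 (x1 / 4) c1 (x1 / 8) (c1 / 2) MQ (fun x c => quot x1 (EE V) m x c y) _lra _lra.
  cbv beta in q. fold Ka Kb in q. via q.
  - intros g1 g2 t0 rr hrr h. apply (QH g1 g2 (fun _ => y) t0 rr hrr). intros t ht. destruct (h t ht) as [k1 [k2 [k3 k4]]]. split; [auto|]. split; [auto|]. split; [au|]. split; auto.
  - intros x' u [k1 k2]. apply QB. split; auto.
  - lra.
  - lra.
  - lra.
  - lra.
  - rewrite C0r. assert (0 <= Kb * Cmod x) by mono. assert (0 <= Ka * Cmod (c - c')) by mono. lra.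
Qed.
Lemma quot_EE m r rV x1 c1 M V x c y : appV m r rV x1 c1 M V -> Cmod x < x1 / 2 -> Cmod c < c1 -> Ydom r y -> EE V x c y = (x ^ m * quot x1 (EE V) m x c y)%C.
Proof.
  intros [FA [hr1 [hLx [hM HE]]]] hx hc hy. have FA' := FA. destruct FA' as [F1 [F2 [F3 _]]].
  apply (quot_spec x1 c1 (Ydom r) (EE V)) with (e' := x1) (M' := M); auto; try lra; [apply (EE_hol r rV); auto|]. intros x' hx'. apply HE. split; auto.
Qed.

(** If all these derivatives in [c] vanished, the flow would give, for a fixed small [t] and large
    [n], an approximate solution with coefficient [cT] near [t] and defect [o(x^m)]. By stability
    the quotient of [V2] at [(0, cT)] would be nearly zero, against its lower bound [al |cT|^k]. Two
    families occur because the flow consumes a part of the disc on which [V1] is of order [m]. *)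
Lemma nondegenerate m s2 rho2 x2a c2a beta2 K2 V2 r2 x2 c2 M2 r1 rho1 x1 c1 M1 V1 :
  adapted f g d s2 rho2 x2a c2a beta2 K2 V2 -> 0 < beta2 <= R1 / 16 -> 0 < K2 -> x2 <= x2a -> c2 <= c2a -> appV m r2 rho2 x2 c2 M2 V2 ->
  appV m r1 rho1 x1 c1 M1 V1 -> 0 < rho2 < s2 -> s2 < r1 -> rho1 < s0 ->
  (exists N, forall n, (N <= n)%nat -> forall y, Cmod y < rho1 -> W n y = V1 (xs n) (cn n) y) ->
  (exists c y, Cmod c < c2 /\ Ydom r2 y /\ quot x2 (EE V2) m 0 c y <> 0) ->
  exists y, Ydom r1 y /\ cD (fun c => quot x1 (EE V1) m 0 c y) 0 <> 0.
Proof.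
  destruct or_const as [hR [hL [h1 h2]]]. intros A2 hb2 hK2 hx2 hc2 HA2 HA1 hrs hsr hrs0 HS [cq [y [hcq [hy hq]]]].
  destruct (classic (exists y, Ydom r1 y /\ cD (fun c => quot x1 (EE V1) m 0 c y) 0 <> 0)) as [|hn]; auto. exfalso.
  have H0 : forall y, Ydom r1 y -> cD (fun c => quot x1 (EE V1) m 0 c y) 0 = 0.
  { intros z hz. destruct (classic (cD (fun c => quot x1 (EE V1) m 0 c z) 0 = 0)); auto. exfalso. apply hn. exists z. au. }
  destruct (flow_approx m s2 ((s2 + r1) / 2) r1 rho1 x1 c1 M1 V1 beta2 HA1 _lra _lra hrs0 _lra HS H0) as [t0 [C3 [Kd [ht0 [hC3 [hKd HT]]]]]].
  have HA2' := HA2. destruct HA2' as [FA [hr2 [hLx [hM HE]]]]. have FA' := FA. destruct FA' as [F1 [F2 [F3 [F4 _]]]].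
  destruct (quot_fam m r2 rho2 x2 c2 V2 FA hLx) as [QH _].
  destruct (local_lower 0 c2 (fun c => quot x2 (EE V2) m 0 c y) F3) as [k [dl [al [hdl [hal HL]]]]].
  { apply (hol3_u (box (x2 / 4) c2 (Ydom r2)) _ 0 y 0 c2 QH). intros u hu. rewrite C0r in hu. split; au. }
  { au. }
  destruct (quot_lip r2 rho2 x2 c2 V2 m FA hLx) as [K6 [hK6 HK6]].
  (* [t] is fixed before [n]: then [|cT| >= t / 2] persists while [x] and [c0] tend to zero. *)
  small t ((1, t0) :: (2, dl) :: (4, c2) :: (8 * (C3 + 1), 1) :: nil) as [ht [ta [tb [tc [td _]]]]].
  destruct (HT t _lra) as [N1 HN1]. destruct (cn_small (t / 8)) as [N2 HN2]; [lra|].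
  set (C5 := (1 + (1 + L) * K2) * Kd). have hC5 : 0 < C5 by mono.
  set (lo := al * (t / 2) ^ k). have hlo : 0 < lo by mono.
  small e ((16, x2) :: (4 * (C5 + K6), lo) :: nil) as [he [xl [hee _]]]. assert (0 <= K6 * e) by mono.
  destruct (proj2 Hxs e he) as [N3 HN3]. destruct (cn_small e he) as [N4 HN4].
  set (n := (N1 + N2 + N3 + N4)%nat). destruct (HN1 n ltac:(au)) as [T [del [hdel [TH [TB [TF TC]]]]]].
  specialize (HN2 n ltac:(au)). specialize (HN3 n ltac:(au)). specialize (HN4 n ltac:(au)).
  have hxn := proj1 Hxs n. set (x := xs n) in *. set (c0 := cn n) in *.
  have px : 0 < Cmod x by au. have pc := Cmod_ge_0 c0.
  set (cT := coef 0 (s2 / 2) d T) in *.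
  have cd : Cmod (cT - t) <= t / 4.
  { replace (cT - t)%C with ((cT - c0 - t) + c0)%C by ring. via Cmod_triangle. assert (t * (8 * (C3 + 1) * t) <= t * 1) by mono. assert (0 < t * t) by pos. lra. }
  have mt : Cmod t = t by lra.
  have cl : t / 2 <= Cmod cT. { have q := Cmod_rev t cT. rewrite Cmod_sym in q. lra. }
  have cu : Cmod cT <= 5 / 4 * t by (have q := Cmod_rev cT t; lra).
  set (eta := Kd * (Cmod x + Cmod c0) * Cmod x ^ m) in *. have pm : 0 < Cmod x ^ m by pos.
  have heta : 0 < eta by mono.
  destruct A2 as [A21 [A22 [A23 [A24 A25]]]].
  have St : forall y, Cmod y < rho2 -> Cmod (T y - V2 x cT y) <= K2 * eta.
  { apply (A25 x T eta del (s2 / 2) cT); auto; lra. }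
  have r2l := le_L x2 _lra. have hmv := f_move r2 rho2 x2 x y hy _lra _lra _lra _lra hLx.
  have b1 : Cmod (T y) <= beta2 by (apply TB; destruct hy; lra).
  have b2 : Cmod (V2 x cT y) <= beta2 by (apply A22; destruct hy; repeat split; lra).
  have Q := Fd_close x T (V2 x cT) y (K2 * eta) _lra ltac:(destruct hy; lra) _lra _lra (St y ltac:(destruct hy; lra)) (St _ hmv).
  have Q2 := TF y ltac:(destruct hy; lra) _lra.
  have Q3 : Cmod (EE V2 x cT y) <= (1 + (1 + L) * K2) * eta.
  { unfold EE. have q := Cmod_rev (Fd f g x (V2 x cT) y) (Fd f g x T y). rewrite Cmod_sym in q. lra. }
  rewrite (quot_EE m r2 rho2 x2 c2 M2 V2 x cT y HA2) in Q3 by (auto; lra). rewrite Cmod_mult, Cmod_pow in Q3.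
  have Q4 : Cmod (quot x2 (EE V2) m x cT y) <= C5 * (Cmod x + Cmod c0).
  { apply Rmult_le_reg_l with (Cmod x ^ m); auto. eapply Rle_trans; [exact Q3|]. unfold eta, C5. lra. }
  have Q5 := HK6 x cT cT y hy _lra _lra _lra. rewrite Cmod_self in Q5.
  have Q6 := HL cT _lra. cbv beta in Q6. replace (0 + cT)%C with cT in Q6 by ring.
  have Q7 : lo <= al * Cmod cT ^ k by (apply Rmult_le_compat_l; au).
  have Q8 := Cmod_rev (quot x2 (EE V2) m 0 cT y) (quot x2 (EE V2) m x cT y). rewrite Cmod_sym in Q8.
  assert (C5 * (Cmod x + Cmod c0) <= C5 * (e + e)) by mono.
  assert (K6 * (Cmod x + 0) <= K6 * e) by mono. lra.
Qed.

(** The last clause remembers the exact solutions at fixed points only. This is what the control of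
    the final map on the fixed points uses, and it also holds when every parameter gives a conjugacy
    and the curve of parameters is unrelated to [cn]. *)
Definition conjugacy (S : C -> C -> C) : Prop := exists r r', 0 < r' <= r /\ hol2 (pd2 r r) S /\ (forall y, Cmod y < r -> S 0 y = y) /\
  (forall x y, pd2 r r x y -> Cmod (S x y) <= R1 / 2) /\ (forall x y, pd2 r' r' x y -> Cmod (f x y) < r /\ S x (f x y) = g x (S x y)) /\
  exists N, forall n, (N <= n)%nat -> forall p, Cmod p < r' -> f (xs n) p = p -> S (xs n) p = (p + W n p)%C.

Lemma conj_of_curve rV x1 c1 V gam e : fam rV x1 c1 V -> 0 < e -> e <= x1 -> e <= rV -> holball 0 e gam -> (forall x, Cmod x < e -> Cmod (gam x) < c1) -> gam 0 = 0 ->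
  (forall x y, Cmod x < e -> Cmod y < e -> Cmod (f x y) < rV -> EE V x (gam x) y = 0) ->
  (exists N, forall n, (N <= n)%nat -> forall p, Cmod p < e -> f (xs n) p = p -> V (xs n) (gam (xs n)) p = W n p) -> exists S, conjugacy S.
Proof.
  destruct or_const as [hR [hL [h1 h2]]]. intros FA he hex her Hg Bg g0 HE [N HN]. have FA' := FA. destruct FA' as [F1 [F2 [F3 [F4 [F5 [F6 [F7 F8]]]]]]].
  exists (fun x y => y + V x (gam x) y)%C. small e' ((2 * L, e) :: nil) as [he' [hee _]]. have e'e := le_L e' _lra.
  exists e, e'. split; [lra|]. split; [|split; [|split; [|split]]].
  - intros g1 g2 t0 r hr h. apply hol_plus; [apply h; rewrite Cmod_self; auto|].
    apply (F5 g1 (fun t => gam (g1 t)) g2 t0 r hr). intros t ht. destruct (h t ht) as [k1 [k2 [k3 k4]]]. split; [auto|]. split; [|au].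
    apply (hol_comp g1 gam); auto. au.
  - intros y hy. rewrite g0, F7 by lra. ring.
  - intros x y [hx hy]. via Cmod_triangle. assert (Cmod (V x (gam x) y) <= R1 / 16) by au. lra.
  - intros x y [hx hy].
    have q : Cmod (f x y) < e by (have q := f_le x y _lra _lra; have q2 := L_lt (Cmod x + Cmod y) (e' + e') _lra; lra).
    split; [auto|]. apply (proj2 (Ceq_minus _ _)). apply (HE x y); lra.
  - exists N. intros n hn p hp hfp. rewrite HN; auto. lra.
Qed.

Lemma nonfixed b : 0 < b -> exists y, Cmod y < b /\ Cmod y < R1 /\ f 0 y <> y.
Proof.
  intros hb. destruct or_const as [hR _]. destruct (c_exp _ _ _ _ _ _ _ _ HC) as [K [e [hK [he H]]]]. have ha := Cmod_pos _ (c_a _ _ _ _ _ _ _ _ HC).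
  small y ((2, b) :: (2, e) :: (2 * (K + 1), Cmod a) :: (2, R1) :: nil) as [hy [y1 [y2 [y3 [y4 _]]]]].
  have m : Cmod y = y by lra.
  exists (RtoC y). split; [lra|]. split; [lra|]. intros E. specialize (H y _lra). rewrite E in H. replace (y - y - a * y ^ d)%C with (- (a * y ^ d))%C in H by ring.
  rewrite Cmod_opp, Cmod_mult, Cmod_pow, m in H. simpl in H. have p : 0 < y ^ d by pos.
  assert (Cmod a * y ^ d <= (Cmod a / 2) * y ^ d); [|assert (0 < Cmod a * y ^ d) by pos; lra]. eapply Rle_trans; [exact H|]. rewrite <- Rmult_assoc. au.
Qed.

(* If all members of the family are exact conjugacies, they agree on the fixed points, which are isolated. *)
Lemma exact_family rV x1 c1 V e : fam rV x1 c1 V -> 0 < e -> e <= x1 -> e <= c1 -> e <= rV ->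
  (exists N, forall n, (N <= n)%nat -> forall y, Cmod y < rV -> W n y = V (xs n) (cn n) y) ->
  (forall x c y, Cmod x < e -> Cmod c < e -> Cmod y < e -> EE V x c y = 0) -> exists S, conjugacy S.
Proof.
  destruct or_const as [hR [hL [h1 h2]]]. intros FA he hex hec her [N1 HS] HE. have FA' := FA. destruct FA' as [F1 [F2 [F3 [F4 [F5 [F6 [F7 F8]]]]]]].
  apply (conj_of_curve rV x1 c1 V (fun _ => RtoC 0) e); auto.
  - au.
  - au.
  - au.
  - destruct (nonfixed (R1 / 8)) as [ys [hys1 [hys2 hys3]]]; [lra|].
    have hz : 0 < Cmod (f 0 ys - ys) by (apply Cmod_pos; intros E; apply hys3; apply (proj2 (Ceq_minus _ _)); auto).
    small e1 ((2, e) :: (2 * L, Cmod (f 0 ys - ys)) :: nil) as [he1 [xl [xr _]]]. destruct (proj2 Hxs e1 he1) as [N2 HN2].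
    destruct (cn_small (e / 2)) as [N3 HN3]; [lra|]. exists (N1 + N2 + N3)%nat. intros n hn p hp hfp.
    specialize (HS n ltac:(lia)). specialize (HN2 n ltac:(lia)). specialize (HN3 n ltac:(lia)).
    rewrite HS by lra. set (x := xs n) in *. set (c0 := cn n) in *.
    have Lx := L_le _ _ HN2.
    set (u := fun c => V x c p).
    have ub : forall c, Cmod c < e -> Cmod (u c) <= R1 / 16 by (intros c hc; apply F6; repeat split; lra).
    have uh : holball 0 e u.
    { apply (hol3_u (pd3 x1 c1 rV) V x p 0 e F5). au. }
    (* Every member of the family sends a fixed point of [f x] to a fixed point of [g x]. *)
    have ug : forall c, Cmod c < e -> (g x (p + u c) - (p + u c))%C = 0.
    { intros c hc. have q := HE x c p _lra hc hp. unfold EE, Fd in q. rewrite hfp in q. fold (u c) in q.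
      replace (g x (p + u c)%C - (p + u c))%C with (- (p + u c - g x (p + u c)%C))%C by ring. rewrite q. ring. }
    have uc : forall c, Cmod (c - 0) < e -> (u c - u 0)%C = 0.
    { apply (identity_thm 0 e (fun c => u c - u 0)%C he).
      - au.
      - intros dd hdd. destruct (classic (exists w, 0 < Cmod (w - 0) < dd /\ (u w - u 0)%C = 0)) as [|hno]; auto. exfalso.
        have e00 : Cmod 0 < e by lra. have b0 := ub 0 e00. have tp := Cmod_triangle p (u 0).
        (* Fixed points of [g x] would accumulate at [p + u 0], so [g x] would fix [ys] as well; but
           [f 0] moves [ys] by more than [L |x|], which bounds the difference between [g x] and
           [g 0]. *)
        have I : (g x ys - ys)%C = 0.
        { apply (identity_thm (p + u 0) (R1 / 2) (fun w => g x w - w)%C _lra).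
          - intros w hw. apply hol_minus; [|au]. apply hol_slice; [apply HC|lra|]. have q := Cmod_rev w (p + u 0). lra.
          - intros d1 hd1. destruct (hol_cont u 0 (uh 0 _lra) d1 hd1) as [d2 [hd2 hc2]].
            small h ((2, d2) :: (2, e) :: (2, dd) :: nil) as [hh [w1 [w2 [w3 _]]]]. set (w := RtoC h). have mw : Cmod w = h by (unfold w; rewrite Cmod_R, Rabs_pos_eq; lra).
            exists (p + u w)%C. replace (p + u w - (p + u 0))%C with (u w - u 0)%C by ring. split.
            + split; [|au]. apply Cmod_pos. intros E. apply hno. exists w. au.
            + au.
          - have q := Cmod_minus_le ys (p + u 0). lra. }
        have z0 : Cmod 0 < R1 by lra.
        have q := c_gl _ _ _ _ _ _ _ _ HC x ys 0 ys _lra hys2 z0 hys2. rewrite Cmod_self, C0r, <- (c_fg _ _ _ _ _ _ _ _ HC ys hys2) in q.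
        rewrite (proj2 (Ceq_minus _ _) I), Cmod_sym in q. lra. }
    have q := uc c0 _lra. fold (u 0). fold (u c0). symmetry. apply (proj2 (Ceq_minus _ _)). au.
Qed.

Hypothesis Hss : smax <= s0.
Hypothesis HAF : forall s s_, 0 < s_ < s -> s < smax ->
  exists rho x1 c1 beta K V, s_ < rho < s /\ 0 < x1 <= R1 / 16 /\ L * x1 <= R1 / 16 /\ 0 < c1 /\ 0 < beta <= R1 / 16 /\ L * beta <= R1 / 16 /\ 0 < K /\ adapted f g d s rho x1 c1 beta K V.

Lemma app_adapted m r rV x1 c1 M V s s_ : appV m r rV x1 c1 M V -> 0 < s_ < s -> s < r -> s < smax ->
  exists r' rho x1a c1a beta K V' x2 c2 M', s_ < r' < rho /\ rho < s /\ 0 < beta <= R1 / 16 /\ 0 < K /\ x2 <= x1a /\ c2 <= c1a /\ adapted f g d s rho x1a c1a beta K V' /\ appV m r' rho x2 c2 M' V' /\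
    exists N, forall n, (N <= n)%nat -> forall y, Cmod y < rho -> W n y = V' (xs n) (cn n) y.
Proof.
  intros HA hs hsr hsm. destruct (HAF s s_ hs hsm) as [rho [x1a [c1a [beta [K [V' [q1 [q2 [q3 [q4 [q5 [q6 [q7 q8]]]]]]]]]]]]].
  destruct (transfer m r rV x1 c1 M V s rho x1a c1a beta K V' ((s_ + rho) / 2) HA _lra _lra _lra _lra q7 q8) as [x2 [c2 [M' [t1 [t2 t3]]]]].
  destruct (cn_sol s rho x1a c1a beta K V' _lra _lra _lra q4 _lra q8) as [N HN].
  exists ((s_ + rho) / 2), rho, x1a, c1a, beta, K, V', x2, c2, M'. split; [lra|]. split; [lra|]. split; [lra|]. split; [auto|]. split; [lra|]. split; [lra|]. split; [auto|]. split; [auto|]. exists N. intros n hn. apply HN; auto.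
Qed.

(** The order [m] is maximised over all families on discs of radius greater than [so], rather than
    for one family: such a maximum is insensitive to the loss of domain. The fixed family [Vo],
    built from the circle [so], bounds [m], and the spare radius [r - so] of an optimal family
    leaves room for the two families that nondegeneracy requires. *)
Lemma conjugacy_exists : exists S, conjugacy S.
Proof.
  destruct or_const as [hR [hL [h1 h2]]]. destruct Hsm as [sm0 sm1].
  set (so := smax / 2).
  destruct (HAF (smax * 3 / 4) so ltac:(unfold so; lra) _lra) as [ra [xa [ca [ba [Ka [Va [q1 [q2 [q3 [q4 [q5 [q6 [q7 q8]]]]]]]]]]]]].
  have FAa := adapted_fam _ ra xa ca ba Ka Va _lra ltac:(unfold so in *; lra) q8.
  set (P := fun m => exists r rV x1 c1 M V, so < r /\ appV m r rV x1 c1 M V).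
  have P0 : P 0%nat.
  { small x1 ((1, xa) :: (2 * L, ra - so) :: nil) as [hx1 [xl [xr _]]].
    have F := fam_shrink ra xa ca Va x1 ca FAa _lra _lra.
    exists ((so + ra) / 2), ra, x1, ca, (4 * L), Va. split; [lra|]. split; [auto|]. split; [unfold so in *; lra|]. split; [lra|]. split; [lra|].
    intros x c y hb. simpl. rewrite Rmult_1_r. apply (EE_bound ((so + ra) / 2) ra x1 ca Va); auto. lra. }
  destruct (HAF so (so / 2) ltac:(unfold so; lra) _lra) as [ro [xo [co [bo_ [Ko [Vo [o1 [o2 [o3 [o4 [o5 [o6 [o7 o8]]]]]]]]]]]]].
  have FAo := adapted_fam so ro xo co bo_ Ko Vo _lra _lra o8.
  set (r' := ro / 2). have hr' : 0 < r' by mono. small e ((1, xo) :: (1, co) :: (L, r') :: nil) as [he [ex [ec [eL _]]]]. have er' := le_L e _lra.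
  have Yin : forall y, Cmod y < e -> Ydom r' y.
  { intros y hy. apply Ydom_in; [lra|have q := L_lt _ _ hy; lra]. }
  destruct (classic (exists x c y, box e e (fun y => Cmod y < e) x c y /\ EE Vo x c y <> 0)) as [hnz|hz].
  2:{ apply (exact_family ro xo co Vo e); auto; [unfold r' in *; lra| |].
      - destruct (cn_sol so ro xo co bo_ Ko Vo _lra _lra _lra o4 _lra o8) as [N HN]. exists N. intros n hn. apply HN; auto.
      - intros x c y hx hc hy. destruct (classic (EE Vo x c y = 0)); auto. exfalso. apply hz. exists x, c, y. split; [split; auto|auto]. }
  have FAe := fam_shrink ro xo co Vo e e FAo _lra _lra.
  have eLr : L * e <= ro - r' by (unfold r' in *; lra).
  destruct (order_bounded e (EE Vo) (4 * L) he) as [k hk]; auto.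
  { intros g1 g2 g3 t0 rr hrr h. apply (EE_hol r' ro e e Vo FAe eLr g1 g2 g3 t0 rr hrr). intros t ht. destruct (h t ht) as [k1 [k2 [k3 [k4 [k5 k6]]]]].
    split; [auto|]. split; [auto|]. split; [auto|]. split; [auto|]. au. }
  { intros x c y [b1 [b2 b3]]. apply (EE_bound r' ro e e Vo); auto. split; [auto|]. au. }
  have PB : forall m, P m -> (m <= k)%nat.
  { intros m [r [rV [x1 [c1 [M [V [hr HA]]]]]]].
    destruct (transfer m r rV x1 c1 M V so ro xo co bo_ Ko Vo r' HA _lra _lra _lra _lra o7 o8) as [x2 [c2 [M' [t1 [t2 [t3 [t4 [t5 [t6 t7]]]]]]]]].
    small e' ((1, x2) :: (1, c2) :: (1, e) :: nil) as [he' [e1 [e2 [e3 _]]]].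
    apply (hk m e' M'); [lra|]. intros x c y [b1 [b2 b3]]. apply t7. split; [lra|]. au. }
  have PM : exists m, P m /\ ~ P (S m).
  { destruct (classic (exists m, P m /\ ~ P (S m))) as [|hno]; auto. exfalso.
    have all : forall m, P m.
    { induction m; auto. destruct (classic (P (S m))) as [|hS]; auto. exfalso. apply hno. exists m. au. }
    have q := PB (S k) (all (S k)). lia. }
  destruct PM as [m [[r [rV [x1 [c1 [M [V [hr HA]]]]]]] hmax]].
  have HA' := HA. destruct HA' as [FA [hr0 [hLx [hM HE]]]]. have rm : r < smax by (destruct FA as [F1 [F2 [F3 [F4 _]]]]; have q := le_L x1 _lra; lra).
  destruct (app_adapted m r rV x1 c1 M V (so + (r - so) * 3 / 4) (so + (r - so) / 2) HA _lra _lra _lra) as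
    [r1 [rho1 [x1a [c1a [b1 [K1' [V1 [x1' [c1' [M1 [A1 [A2 [A3 [A4 [A5 [A6 [A7 [A8 A9]]]]]]]]]]]]]]]]]].
  destruct (app_adapted m r rV x1 c1 M V (so + (r - so) / 2) (so + (r - so) / 4) HA _lra _lra _lra) as
    [r2 [rho2 [x2a [c2a [b2 [K2' [V2 [x2' [c2' [M2 [B1 [B2 [B3 [B4 [B5 [B6 [B7 [B8 B9]]]]]]]]]]]]]]]]]].
  destruct (nondegenerate m (so + (r - so) / 2) rho2 x2a c2a b2 K2' V2 r2 x2' c2' M2 r1 rho1 x1' c1' M1 V1) as [y1 [hy1 hD]]; auto; try (unfold so in *; lra).
  (* If the quotient of [V2] vanished identically at [x = 0], one more power of [x] could be divided
     out, against the choice of [m]. *)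
  { destruct (classic (exists c y, Cmod c < c2' /\ Ydom r2 y /\ quot x2' (EE V2) m 0 c y <> 0)) as [|hno]; auto. exfalso. apply hmax.
    have B8' := B8. destruct B8' as [FA2 [hr2 [hLx2 [hM2 HE2]]]]. have FA2' := FA2. destruct FA2' as [G1 [G2 [G3 [G4 _]]]].
    destruct (quot_lip r2 rho2 x2' c2' V2 m FA2 hLx2) as [K6 [hK6 HK6]].
    exists r2, rho2, (x2' / 8), (c2' / 2), K6, V2. split; [lra|]. split; [apply (fam_shrink rho2 x2' c2'); auto; lra|]. split; [auto|]. split; [lra|]. split; [auto|].
    intros x c y [hx [hc hy]]. rewrite (quot_EE m r2 rho2 x2' c2' M2 V2) by mono. rewrite Cmod_mult, Cmod_pow.
    have q := HK6 x c c y hy _lra _lra _lra. rewrite Cmod_self in q.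
    have z : quot x2' (EE V2) m 0 c y = 0 by (destruct (classic (quot x2' (EE V2) m 0 c y = 0)); auto; exfalso; apply hno; exists c, y; repeat split; auto; try lra; apply hy).
    rewrite z, C0r in q. simpl. assert (Cmod x ^ m * Cmod (quot x2' (EE V2) m x c y) <= Cmod x ^ m * (K6 * (Cmod x + 0))) by mono. lra. }
  have A8' := A8. destruct A8' as [FA1 [hr1 [hLx1 [hM1 HE1]]]]. have FA1' := FA1. destruct FA1' as [G1 [G2 [G3 [G4 _]]]].
  destruct (quot_fam m r1 rho1 x1' c1' V1 FA1 hLx1) as [QH QB].
  destruct A9 as [N1 HN1].
  have QZ : forall n y, Cmod (xs n) < x1' / 4 -> Cmod (cn n) < c1' / 2 -> Ydom r1 y -> EE V1 (xs n) (cn n) y = 0 -> quot x1' (EE V1) m (xs n) (cn n) y = 0.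
  { intros n y b1' b2' b3 E. rewrite (quot_EE m r1 rho1 x1' c1' M1 V1 (xs n) (cn n) y A8) in E by (auto; lra).
    destruct (classic (quot x1' (EE V1) m (xs n) (cn n) y = 0)) as [|nz]; auto. exfalso. revert E. apply Cmult_neq_0; auto. apply Cpow_nz. apply Hxs. }
  have EZ : forall N0, exists N, (N0 <= N)%nat /\ forall n, (N <= n)%nat -> Cmod (xs n) < x1' / 4 /\ Cmod (cn n) < c1' / 2 /\ forall y, Ydom r1 y -> EE V1 (xs n) (cn n) y = 0.
  { intros N0. destruct (proj2 Hxs (x1' / 8)) as [N2 HN2]; [lra|]. destruct (cn_small (c1' / 4)) as [N3 HN3]; [lra|]. exists (N0 + N1 + N2 + N3)%nat. split; [lia|]. intros n hn.
    specialize (HN2 n ltac:(lia)). specialize (HN3 n ltac:(lia)). split; [lra|]. split; [lra|]. intros y hy.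
    have q := f_move r1 rho1 x1' (xs n) y hy _lra _lra _lra _lra hLx1. destruct hy as [hy1' hy2].
    apply (EE_cn rho1 (xs n) (cn n) V1 n y); auto; try lra. au. }
  (* The exact solutions are zeros of the quotient, because [xs n] is not zero, and their parameters
     tend to the origin. *)
  have H00 : quot x1' (EE V1) m 0 0 y1 = 0.
  { destruct (quot_lip r1 rho1 x1' c1' V1 m FA1 hLx1) as [K6 [hK6 HK6]]. symmetry. apply Cmod_small_eq. intros ee hee. rewrite Cmod_sym.
    small e2 ((2 * (K6 + 1), ee) :: (8, x1') :: nil) as [he2 [hee2 [xr _]]]. destruct (proj2 Hxs e2 he2) as [N2 HN2]. destruct (cn_small e2 he2) as [N3 HN3]. destruct (EZ (N2 + N3)%nat) as [n [hn En]].
    specialize (HN2 n ltac:(lia)). specialize (HN3 n ltac:(lia)). destruct (En n (le_n _)) as [E1 [E2 E3]]. specialize (E3 y1 hy1).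
    have qz := QZ n y1 E1 E2 hy1 E3.
    have q := HK6 (xs n) (cn n) 0 y1 hy1 _lra _lra _lra. rewrite qz, Cmod_sym, !C0r in q.
    rewrite C0r. have px := Cmod_ge_0 (xs n). have pc := Cmod_ge_0 (cn n). assert (K6 * (Cmod (xs n) + Cmod (cn n)) <= K6 * (e2 + e2)) by mono. lra. }
  small rG ((4, x1') :: (2, c1') :: nil) as [hrG [rG1 [rG2 _]]].
  (* The middle variable is a dummy again: [Wf x 0] is the parameter [c] solving the equation at the
     single height [y1]. *)
  destruct (ift (fun x _ c => quot x1' (EE V1) m x c y1) rG (4 * L / (x1' / 2) ^ m * 2) rG hrG hrG) as [dd [eta [Wf [i1 [i2 [i3 [i4 [i5 i6]]]]]]]]; auto.
  { intros g1 g2 g3 t0 rr hrr h. apply (QH g1 g3 (fun _ => y1) t0 rr hrr). intros t ht. destruct (h t ht) as [k1 [k2 [k3 [k4 [k5 k6]]]]].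
    split; [auto|]. split; [auto|]. split; [au|]. split; [lra|]. au. }
  { intros x u c [w1 [w2 w3]]. apply QB. split; [lra|]. au. }
  have z0d : Cmod 0 < dd by lra.
  set (gam := fun x => Wf x 0).
  have gh : holball 0 dd gam.
  { apply (hol2_x (pd2 dd dd) Wf 0 0 dd i5). au. }
  have gb : forall x, Cmod x < dd -> Cmod (gam x) < c1' / 2 by (intros x hx; destruct (i6 x 0 (conj hx z0d)) as [w1 _]; unfold gam; lra).
  have gcn : exists N, forall n, (N <= n)%nat -> Cmod (xs n) < dd /\ cn n = gam (xs n) /\ forall y, Ydom r1 y -> EE V1 (xs n) (cn n) y = 0.
  { destruct (proj2 Hxs (dd / 2)) as [N2 HN2]; [lra|]. destruct (cn_small (eta / 2)) as [N3 HN3]; [lra|]. destruct (EZ (N2 + N3)%nat) as [N [hN En]]. exists N. intros n hn.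
    specialize (HN2 n ltac:(lia)). specialize (HN3 n ltac:(lia)). destruct (En n hn) as [E1 [E2 E3]]. split; [lra|]. split; [|auto].
    destruct (i6 (xs n) 0) as [_ [_ un]]; [au|]. au. }
  have r1l : r1 < rho1 by lra. small ey ((L, r1) :: (1, dd) :: nil) as [hey [heyL [e31 _]]].
  have Yin1 : forall y, Cmod y < ey -> Ydom r1 y.
  { intros y hy. have q := le_L ey _lra. apply Ydom_in; [lra|have qq := L_lt _ _ hy; lra]. }
  destruct gcn as [N Hgcn].
  (* The curve was determined at [y1] alone, but at [x = xs n] the defect vanishes for all [y]; the
     identity theorem in [x] extends this height by height. *)
  have EX : forall y, Cmod y < ey -> forall x, Cmod (x - 0) < dd -> EE V1 x (gam x) y = 0.
  { intros y hy. apply (identity_thm 0 dd (fun x => EE V1 x (gam x) y)); [lra| |].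
    - intros x hx. have hx' := hx. rewrite C0r in hx. apply (EE_hol r1 rho1 x1' c1' V1 FA1 hLx1 (fun x => x) gam (fun _ => y) x (dd - Cmod x) _lra).
      intros t ht. have q := Cmod_rev t x. split; [au|]. split; [au|]. split; [au|]. split; [lra|]. split; [have qq2 := gb t _lra; lra|auto].
    - intros d1 hd1. destruct (proj2 Hxs (d1 / 2)) as [N2 HN2]; [lra|]. exists (xs (N + N2)%nat). specialize (HN2 (N + N2)%nat ltac:(lia)). rewrite C0r.
      split; [split; [apply Cmod_pos, Hxs|lra]|]. destruct (Hgcn (N + N2)%nat ltac:(lia)) as [w1 [w2 w3]]. rewrite <- w2. au. }
  have eyL := le_L ey _lra. apply (conj_of_curve rho1 x1' c1' V1 gam ey); auto; try lra.
  - au.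
  - intros x hx. have q := gb x _lra. lra.
  - destruct (i6 0 0 (conj z0d z0d)) as [_ [_ un]]. symmetry. au.
  - au.
  - exists (N + N1)%nat. intros n hn p hp _. destruct (Hgcn n ltac:(lia)) as [w1 [w2 w3]]. rewrite <- w2. symmetry. au.
Qed.
End Order.

(** * Distortion of injective functions *)
(** A bootstrap: a bound [B] for [X] improves to [1 + B / 2], whose fixed point is 2. *)
Lemma gronwall_disc (X : C -> C) c r k : 0 < r -> 0 <= k -> k * r <= / 2 -> holball c r X -> X c = 1 ->
  (forall z, Cmod (z - c) < r -> Cmod (cD X z) <= k * Cmod (X z)) -> forall z, Cmod (z - c) < r -> Cmod (X z - 1) <= 2 * k * Cmod (z - c).
Proof.
  intros hr hk hkr HX X1 HD z hz. destruct (holball_bounded c r X (Cmod (z - c)) HX hz) as [m [hm Hm]].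
  have I : forall j w, Cmod (w - c) <= Cmod (z - c) -> Cmod (X w) <= 2 + m * (/ 2) ^ j /\ Cmod (X w - 1) <= k * (2 + m * (/ 2) ^ j) * Cmod (w - c).
  { have st : forall B, (forall w, Cmod (w - c) <= Cmod (z - c) -> Cmod (X w) <= B) -> forall w, Cmod (w - c) <= Cmod (z - c) -> Cmod (X w - 1) <= k * B * Cmod (w - c).
    { intros B HB w hw. rewrite <- X1.
      have S : forall t, 0 <= t <= 1 -> Cmod (c + t * (w - c) - c) <= Cmod (w - c).
      { intros t ht. replace (c + t * (w - c) - c)%C with (t * (w - c))%C by ring. rewrite Cmod_mult, Cmod_R, Rabs_pos_eq by lra. have q := Cmod_ge_0 (w - c). nra. }
      apply (MVT_C X (cD X) c w (k * B)).
      - intros t ht. apply cD_spec, HX. specialize (S t ht). lra.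
      - intros t ht. specialize (S t ht). eapply Rle_trans; [au|]. apply Rmult_le_compat_l; auto. au. }
    have I : forall j w, Cmod (w - c) <= Cmod (z - c) -> Cmod (X w) <= 2 + m * (/ 2) ^ j.
    { induction j; intros w hw.
      - simpl. specialize (Hm w hw). lra.
      - have q := st _ IHj w hw. have p : 0 < (/ 2) ^ j by pos. have pw := Cmod_ge_0 (w - c).
        assert (k * (2 + m * (/ 2) ^ j) * Cmod (w - c) <= / 2 * (2 + m * (/ 2) ^ j)).
        { replace (k * (2 + m * (/ 2) ^ j) * Cmod (w - c)) with (k * Cmod (w - c) * (2 + m * (/ 2) ^ j)) by ring. apply Rmult_le_compat_r; nra. }
        have t := Cmod_rev (X w) 1. rewrite Cmod_1 in t. simpl pow. lra. }
    au. }
  have pz := Cmod_ge_0 (z - c). apply le_epsilon. intros e he.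
  destruct (pow_small (/ 2) (e / (k * m * Cmod (z - c) + 1))) as [j hj]; [lra|apply Rdiv_lt_0_compat; [lra|]; assert (0 <= k * m) by nra; nra|].
  specialize (hj j (le_n _)). destruct (I j z (Rle_refl _)) as [_ q].
  have y : 0 <= k * m * Cmod (z - c) by (assert (0 <= k * m) by nra; nra).
  assert (k * m * Cmod (z - c) * (/ 2) ^ j <= e).
  { apply Rle_trans with ((k * m * Cmod (z - c) + 1) * (e / (k * m * Cmod (z - c) + 1))); [|apply Req_le; field; lra].
    au. }
  lra.
Qed.

(* Schwarz's lemma for [(u - e) / (u + e)]. *)
Lemma harnack_small u r (e : R) : 0 < r -> 0 < e -> holball 0 r u -> (forall z, Cmod z < r -> 0 <= Re (u z)) -> u 0 = e -> forall z, Cmod z <= r / 8 -> Cmod (u z) <= 3 * e.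
Proof.
  intros hr he Hu HR u0 z hz.
  have sq : forall z, Cmod z < r -> 0 < Cmod (u z + e) /\ Cmod (u z - e) <= Cmod (u z + e).
  { intros w hw. specialize (HR w hw). have q1 := re_le (u w + e). have q2 := Rle_abs (Re (u w + e)). replace (Re (u w + e)) with (Re (u w) + e) in * by reflexivity.
    split; [lra|]. have s1 := Cmod_sq (u w + e). have s2 := Cmod_sq (u w - e). destruct (u w) as [p q]. unfold Re, Im in *. simpl in *.
    apply Rsqr_incr_0; try apply Cmod_ge_0. unfold Rsqr. nra. }
  set (h := fun w => ((u w - e) / (u w + e))%C).
  have nz : forall w, Cmod w < r -> (u w + e)%C <> 0 by (intros w hw; apply Cmod_neq0, sq; auto).
  have hh : holball 0 r h.
  { intros w hw. have hw' := hw. rewrite C0r in hw. apply hol_div; au. }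
  have hb : forall w, Cmod w < r -> Cmod (h w) <= 1.
  { intros w hw. apply div_bound; auto. destruct (sq w hw). lra. }
  have q := lip_ball 0 r (r / 2) h 1 _lra hh. have q' := q ltac:(au) 0 z _lra _lra. clear q.
  have h0 : h 0 = 0. { unfold h. rewrite u0. replace (e - e)%C with (RtoC 0) by ring. unfold Cdiv. ring. }
  rewrite h0, !C0r in q'. replace (2 * 1 / (r - r / 2)) with (4 / r) in q' by (field; lra).
  have b : Cmod (h z) <= / 2.
  { eapply Rle_trans; [exact q'|]. apply Rle_trans with (4 / r * (r / 8)); [mono|apply Req_le; field; lra]. }
  have E : (u z - e)%C = (h z * (u z + e))%C by (unfold h; field; apply nz; lra).
  have m : Cmod (u z - e) <= / 2 * Cmod (u z + e) by (rewrite E, Cmod_mult; mono).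
  have t1 := Cmod_rev (u z) e. have t2 := Cmod_triangle (u z) e. rewrite Cmod_R, Rabs_pos_eq in t1, t2 by lra. lra.
Qed.

(** Relative margin by which the rescaled [k'' / k'] may exceed 1. The factor [exp 10] bounds
    [exp (al z)] on the disc of radius 10 where the comparison with the exponential takes place. *)
Definition eps0 : R := / (100000 * exp 10).
Lemma eps0_pos : 0 < eps0 <= / 100000 /\ eps0 * exp 10 = / 100000.
Proof.
  have p := exp_pos 10. have q : 1 <= exp 10 by (have t := exp_ineq1_le 10; lra). unfold eps0. split; [split|field; lra].
  - pos.
  - apply Rinv_le_contravar; lra.
Qed.

Lemma Cmod_tpi : 4 < Cmod tpi <= 8.
Proof.
  assert (Cmod tpi = 2 * PI). { unfold tpi, Cmod. simpl. replace (0 * (0 * 1) + 2 * PI * (2 * PI * 1)) with ((2 * PI) * (2 * PI)) by ring. apply sqrt_square. have q := PI_RGT_0. lra. }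
  have a := PI2_1. have b := PI_4. lra.
Qed.

(* Such a [G] is close to [(exp (al z) - 1) / al], which takes the same value at [0] and at [2 i pi / al]. *)
Lemma not_exp_like (G F q : C -> C) : (forall z, Cmod z < 80 -> Cd G z (F z) /\ Cd F z (q z * F z)) -> holball 0 80 q -> F 0 = 1 -> (forall z, Cmod z < 80 -> Cmod (q z) <= 1 + eps0) ->
  Cmod (q 0) = 1 -> exists z : C, z <> 0 /\ Cmod z < 80 /\ G z = G 0.
Proof.
  intros HG Hq F0 Bq q0. destruct eps0_pos as [[e1 e2] e3]. set (al := q 0) in *. have aln : al <> 0 by au.
  (* [(1 + eps0) - q / al] has nonnegative real part and the small value [eps0] at [0]; by
     [harnack_small] it stays small, so [q] is nearly the constant [al]. *)
  have Q : forall z, Cmod z <= 10 -> Cmod (q z - al) <= 4 * eps0.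
  { intros z hz. have H := harnack_small (fun z => (1 + eps0)%R - q z / al)%C 80 eps0 _lra e1.
    have H' : Cmod ((1 + eps0)%R - q z / al) <= 3 * eps0.
    { apply H; try lra.
      - au.
      - intros w hw. have t := re_le (q w / al). have t2 := Rle_abs (Re (q w / al)). rewrite Cmod_div, q0 in t by auto. specialize (Bq w hw).
        unfold Rdiv in t. rewrite Rinv_1, Rmult_1_r in t.
        replace (Re ((1 + eps0)%R - q w / al)) with (1 + eps0 - Re (q w / al)) by reflexivity. lra.
      - fold al. rewrite RtoC_plus. field. au. }
    replace (q z - al)%C with (al * (eps0 - ((1 + eps0)%R - q z / al)))%C by (rewrite RtoC_plus; field; auto). rewrite Cmod_mult, q0, Rmult_1_l.
    via Cmod_minus_le. lra. }
  (* Since [F' = q F], dividing [F] by [exp (al z)] leaves a nearly constant function. *)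
  set (X := fun z => (F z * cexp (- al * z))%C).
  have HX : forall z, Cmod z < 80 -> Cd X z ((q z - al) * X z).
  { intros z hz. destruct (HG z hz) as [_ h]. unfold X. eapply Cd_eq; [|apply Cd_mult; [exact h|apply (Cd_comp (fun z => - al * z)%C cexp); [apply Cd_scal, Cd_id|apply Cd_cexp]]]. cbv beta. ring. }
  have XB : forall z, Cmod (z - 0) < 10 -> Cmod (X z - 1) <= 2 * (4 * eps0) * Cmod (z - 0).
  { apply gronwall_disc; try lra.
    - intros z hz. rewrite C0r in hz. eexists. au.
    - unfold X. rewrite F0. replace (- al * 0)%C with (RtoC 0) by ring. rewrite cexp_0. ring.
    - intros z hz. rewrite C0r in hz. rewrite (cD_eq _ _ _ (HX z _lra)), Cmod_mult. apply Rmult_le_compat_r; [mono|]. au. }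
  have ce : forall z, Cmod z < 10 -> Cmod (cexp (al * z)) <= exp 10.
  { intros z hz. rewrite Cmod_cexp. apply Rlt_le, exp_increasing. have t := re_le (al * z). have t2 := Rle_abs (Re (al * z)). rewrite Cmod_mult, q0 in t. lra. }
  have GB : forall z, Cmod z < 10 -> Cmod (G z - G 0 - (cexp (al * z) - 1) / al) <= 8 / 1000.
  { intros z hz. set (D := fun z => (G z - (/ al) * cexp (al * z))%C).
    replace (G z - G 0 - (cexp (al * z) - 1) / al)%C with (D z - D 0)%C.
    2:{ unfold D. replace (al * 0)%C with (RtoC 0) by ring. rewrite cexp_0. field. au. }
    have S : forall t, 0 <= t <= 1 -> Cmod (0 + t * (z - 0)) < 10.
    { intros t ht. replace (0 + t * (z - 0))%C with (t * z)%C by ring. rewrite Cmod_mult, Cmod_R, Rabs_pos_eq by lra. have pz := Cmod_ge_0 z. nra. }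
    via (MVT_C D (fun z => F z - cexp (al * z))%C 0 z (80 * (eps0 * exp 10))).
    - intros t ht. specialize (S t ht). destruct (HG _ (Rlt_trans _ _ 80 S _lra)) as [h _]. unfold D.
      apply (Cd_ext (fun z => G z + (- / al) * cexp (al * z))%C _ _ _ 1); [lra|intros; ring|].
      eapply Cd_eq; [|apply Cd_plus; [exact h|apply Cd_scal, (Cd_comp (fun z => al * z)%C cexp); [apply Cd_scal, Cd_id|apply Cd_cexp]]]. field. au.
    - intros t ht. specialize (S t ht). set (w := (0 + t * (z - 0))%C) in *. have b := XB w _lra. rewrite C0r in b.
      replace (F w - cexp (al * w))%C with ((X w - 1) * cexp (al * w))%C.
      2:{ unfold X. replace ((F w * cexp (- al * w) - 1) * cexp (al * w))%C with (F w * (cexp (- al * w) * cexp (al * w)) - cexp (al * w))%C by ring.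
          rewrite <- cexp_plus. replace (- al * w + al * w)%C with (RtoC 0) by ring. rewrite cexp_0. ring. }
      rewrite Cmod_mult, <- Rmult_assoc. apply Rmult_le_compat; try apply Cmod_ge_0; auto. eapply Rle_trans; [exact b|]. nra.
    - rewrite e3, C0r. lra. }
  (* [zs] is a nonzero period of [exp (al z)]; its modulus lies between 4 and 8, well inside the
     disc of radius 10 and away from [0]. *)
  destruct Cmod_tpi as [t1 t2]. set (zs := (tpi / al)%C). have mz : Cmod zs = Cmod tpi by (unfold zs; rewrite Cmod_div, q0 by auto; field).
  destruct (classic (exists z : C, z <> 0 /\ Cmod z < 80 /\ G z = G 0)) as [|hn]; auto. exfalso.
  (* On the circle of radius [1/20] about [zs] the model has modulus at least [1/40], while at [zs]
     itself [G - G 0] is below [1/80]; a zero must lie between. *)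
  have MP := min_principle zs 1 (fun z => G z - G 0)%C (/ 20) (/ 80).
  have MP' : / 80 <= Cmod (G zs - G 0).
  { apply MP; try lra.
    - intros z hz. apply hol_minus; [|au]. have t := Cmod_rev z zs. eexists. apply HG. lra.
    - intros z hz E. apply hn. exists z. have t := Cmod_rev z zs. have t' := Cmod_rev zs z. rewrite Cmod_sym in t'. split; [au|]. split; [lra|]. apply (proj2 (Ceq_minus _ _)). au.
    - intros t. set (w := cir (/ 20) t). have mw : Cmod w = / 20 by (apply Cmod_cir; lra). have ti := Cmod_triangle zs w.
      have b := GB (zs + w)%C _lra.
      have E : (cexp (al * (zs + w)) - 1)%C = (cexp (al * w) - 1)%C.
      { replace (al * (zs + w))%C with (tpi + al * w)%C by (unfold zs; field; auto). rewrite cexp_plus, cexp_tpi. ring. }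
      rewrite E in b. have mw2 : Cmod (al * w) = / 20 by (rewrite Cmod_mult, q0; lra).
      have cq := cexp_quad (al * w) _lra. rewrite mw2 in cq.
      have r1 := Cmod_rev (al * w) (cexp (al * w) - 1)%C. rewrite (Cmod_sym (al * w)) in r1. rewrite mw2 in r1.
      have l1 : / 40 <= Cmod ((cexp (al * w) - 1) / al). { rewrite Cmod_div, q0 by auto. lra. }
      have r2 := Cmod_rev ((cexp (al * w) - 1) / al) (G (zs + w)%C - G 0). rewrite (Cmod_sym ((cexp (al * w) - 1) / al)) in r2. lra. }
  have b := GB zs _lra. replace (al * zs)%C with tpi in b by (unfold zs; field; auto). rewrite cexp_tpi in b.
  replace (G zs - G 0 - (1 - 1) / al)%C with (G zs - G 0)%C in b by (field; auto). lra.
Qed.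

Definition C0 : R := 1000 / eps0.

(** Rescaling argument. If the weighted quantity exceeds [C0], it is nearly maximal at some [z0]; in
    the unit [1 / A] around [z0], the function [k'' / k'] has modulus 1 at the centre and at most
    [1 + eps0] on the disc of radius 80, so [not_exp_like] contradicts injectivity. The radius
    [s' < s] makes the supremum finite. *)
Lemma preschwarz_bound k s s' : holball 0 s k -> (forall y z, Cmod y < s -> Cmod z < s -> k y = k z -> y = z) -> (forall z, Cmod z < s -> cD k z <> 0) -> 0 < s' < s ->
  forall z, Cmod z < s' -> (s' - Cmod z) * Cmod (cD (cD k) z / cD k z) <= C0.
Proof.
  intros Hk Hinj Hd hs z hz. destruct eps0_pos as [[e1 e2] _]. set (P := fun z => (cD (cD k) z / cD k z)%C).
  have Hk1 : holball 0 s (cD k) by (apply holball_cD; auto). have Hk2 : holball 0 s (cD (cD k)) by (apply holball_cD; auto).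
  have HP : holball 0 s P. { intros w hw. apply hol_div; auto. au. }
  destruct (holball_bounded 0 s P s' HP _lra) as [M [hM BM]].
  destruct (Rle_dec ((s' - Cmod z) * Cmod (P z)) C0) as [|hn]; auto. exfalso.
  have hC0 : 0 < C0 by pos.
  set (E := fun v => exists w, Cmod w < s' /\ v = (s' - Cmod w) * Cmod (P w)).
  destruct (completeness E) as [m [m1 m2]].
  { exists (s' * M). intros v [w [hw ->]]. specialize (BM w _lra). have p := Cmod_ge_0 w. au. }
  { exists ((s' - Cmod z) * Cmod (P z)). exists z. auto. }
  have mC : C0 < m by (eapply Rlt_le_trans; [apply Rnot_le_lt, hn|apply m1; exists z; auto]).
  (* A value below the supremum [m], within the factor [1 + eps0 / 4] of it, and still at least
     [C0]. *)
  set (m' := Rmax C0 (m / (1 + eps0 / 4))). have m'l := Rmax_l C0 (m / (1 + eps0 / 4)). have m'r := Rmax_r C0 (m / (1 + eps0 / 4)). fold m' in m'l, m'r.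
  have m'm : m' < m.
  { apply Rmax_lub_lt; auto. apply Rmult_lt_reg_r with (1 + eps0 / 4); [lra|]. unfold Rdiv at 1. rewrite Rmult_assoc, Rinv_l by lra. nra. }
  destruct (classic (exists z0, Cmod z0 < s' /\ m' < (s' - Cmod z0) * Cmod (P z0))) as [[z0 [h0 h1]]|hno].
  2:{ apply (Rlt_irrefl m). apply Rle_lt_trans with m'; auto. apply m2. intros v [w [hw ->]]. apply Rnot_lt_le. intros h. apply hno. exists w. auto. }
  set (A := Cmod (P z0)) in *. set (d0 := s' - Cmod z0) in *. have hd0 : 0 < d0 by (unfold d0; lra). have hA : 0 < A by nra.
  set (N := d0 * A) in *. have hN : C0 < N by lra. have hNe : eps0 * N > 1000. { assert (eps0 * C0 = 1000) by (unfold C0; field; lra). nra. }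
  have mN : m <= N * (1 + eps0 / 4).
  { apply Rle_trans with (m / (1 + eps0 / 4) * (1 + eps0 / 4)); [apply Req_le; field; lra|]. au. }
  have d80 : 80 < N. { nra. }
  have dk0 := Hd z0 _lra. have pk0 : P z0 <> 0 by au.
  have An : RtoC A <> 0 by au.
  have inw : forall u, Cmod u < 80 -> Cmod (u / A) < d0 /\ Cmod (z0 + u / A) < s' /\ d0 - 80 / A <= s' - Cmod (z0 + u / A).
  { intros u hu. have mu : Cmod (u / A) = Cmod u / A by (rewrite Cmod_div, Cmod_R, Rabs_pos_eq by mono; reflexivity).
    assert (Cmod u / A < 80 / A) by (apply Rmult_lt_compat_r; [pos|auto]).
    assert (80 / A < d0). { apply Rmult_lt_reg_r with A; auto. unfold Rdiv. rewrite Rmult_assoc, Rinv_l by lra. unfold N in d80. lra. }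
    have t := Cmod_triangle z0 (u / A). unfold d0 in *. lra. }
  set (sc := fun u : C => (z0 + u / A)%C).
  have Hsc : forall u, Cd sc u (/ A).
  { intros u. unfold sc. apply (Cd_ext (fun u => z0 + (/ A) * u)%C _ _ _ 1); [lra|intros; unfold Cdiv; ring|]. eapply Cd_eq; [|apply Cd_plus; [apply Cd_const|apply Cd_scal, Cd_id]]. ring. }
  have Pb : forall u, Cmod u < 80 -> Cmod (P (sc u)) <= A * (1 + eps0).
  { intros u hu. destruct (inw u hu) as [i1 [i2 i3]]. fold (sc u) in i2, i3.
    have q : (s' - Cmod (sc u)) * Cmod (P (sc u)) <= m by (apply m1; exists (sc u); auto).
    have g80 : 0 < d0 - 80 / A. { apply Rmult_lt_reg_r with A; auto. replace ((d0 - 80 / A) * A) with (N - 80) by (unfold N; field; lra). lra. }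
    have q2 : (d0 - 80 / A) * Cmod (P (sc u)) <= N * (1 + eps0 / 4).
    { eapply Rle_trans; [|exact mN]. eapply Rle_trans; [|exact q]. au. }
    apply Rmult_le_reg_l with (d0 - 80 / A); auto. eapply Rle_trans; [exact q2|].
    replace ((d0 - 80 / A) * (A * (1 + eps0))) with ((N - 80) * (1 + eps0)) by (unfold N; field; lra). nra. }
  destruct (not_exp_like (fun u => A / cD k z0 * k (sc u))%C (fun u => cD k (sc u) / cD k z0)%C (fun u => P (sc u) / A)%C) as [u [u1 [u2 u3]]].
  - intros u hu. destruct (inw u hu) as [i1 [i2 i3]]. fold (sc u) in i2. split.
    + eapply Cd_eq; [|apply Cd_scal, (Cd_comp sc k); [mono|apply cD_spec, Hk; rewrite C0r; lra]]. field. au.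
    + apply (Cd_ext (fun u => / cD k z0 * cD k (sc u))%C _ _ _ 1); [lra|intros; unfold Cdiv; ring|].
      eapply Cd_eq; [|apply Cd_scal, (Cd_comp sc (cD k)); [mono|apply cD_spec, Hk1; rewrite C0r; lra]]. unfold P. field. au.
  - intros u hu. rewrite C0r in hu. destruct (inw u hu) as [i1 [i2 i3]]. fold (sc u) in i2. apply hol_div; [|au|auto].
    apply (hol_comp sc P); [eexists; apply Hsc|au].
  - unfold sc. replace (z0 + 0 / A)%C with z0 by (field; auto). field. au.
  - intros u hu. apply div_bound; auto. rewrite Cmod_R, Rabs_pos_eq by lra. rewrite Rmult_comm. au.
  - unfold sc. replace (z0 + 0 / A)%C with z0 by (field; auto). rewrite Cmod_div, Cmod_R, Rabs_pos_eq by mono. fold A. field. lra.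
  - destruct (inw u u2) as [i1 [i2 i3]]. fold (sc u) in i2. have s0 : sc 0 = z0 by (unfold sc; field; auto).
    have E1 : k (sc u) = k z0.
    { rewrite s0 in u3. have nn : (A / cD k z0)%C <> 0. { unfold Cdiv. apply Cmult_neq_0; auto. intros h. apply dk0. rewrite <- (Cmult_1_r (cD k z0)). 
        have hh := Cinv_r (cD k z0) dk0. rewrite h in hh. exfalso. rewrite Cmult_0_r in hh. symmetry in hh. apply RtoC_inj in hh. lra. }
      replace (k (sc u)) with ((A / cD k z0 * k (sc u)) / (A / cD k z0))%C by (field; auto). rewrite u3. field. au. }
    apply Hinj in E1; try lra. apply u1. replace u with ((sc u - z0) * A)%C by (unfold sc; field; auto). rewrite E1. ring.
Qed.

(** Suppose the derivative vanishes at [a0]. For [a] near [a0] where it does not vanish, injectivity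
    leaves the difference quotient [q] based at [a] without zeros, and the minimum principle bounds
    [|q a0|] below by a constant independent of [a]; but [k a - k a0] is [o(a - a0)]. So the
    derivative vanishes near [a0] and [k] is constant there. *)
Lemma inj_deriv k s : holball 0 s k -> (forall y z, Cmod y < s -> Cmod z < s -> k y = k z -> y = z) -> forall a, Cmod a < s -> cD k a <> 0.
Proof.
  intros Hk Hinj a0 ha0 E. set (R0 := s - Cmod a0). have hR : 0 < R0 by (unfold R0; lra).
  have inb : forall w, Cmod (w - a0) < R0 -> Cmod w < s by (intros w hw; have q := Cmod_rev w a0; unfold R0 in hw; lra).
  have Hb : holball a0 R0 k by au.
  have Hb' : holball a0 R0 (fun w => k w - k a0)%C by au.
  destruct (local_lower a0 R0 (fun w => k w - k a0)%C hR Hb') as [n [dl [al [hdl [hal HL]]]]].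
  { intros h. set (w := (a0 + (R0 / 2)%R)%C). have mw : Cmod (w - a0) = R0 / 2. { unfold w. replace (a0 + (R0 / 2)%R - a0)%C with (RtoC (R0 / 2)) by ring. lra. }
    have q := h w _lra. apply (proj2 (Ceq_minus _ _)) in q. apply Hinj in q; auto; [|au]. rewrite q, Cmod_self in mw. lra. }
  small r ((2, dl) :: (8, R0) :: nil) as [hr [r1 [r2 _]]].
  set (c := al * r ^ n). have hc : 0 < c by mono.
  have D0 : Cd k a0 0 by (rewrite <- E; apply cD_spec, Hb; rewrite Cmod_self; auto).
  destruct (D0 (c / (16 * r))) as [d1 [hd1 h1]]; [pos|].
  have cc : c / (16 * r) * r = c / 16 by (field; lra).
  small d2 ((1, d1) :: (1, r) :: nil) as [hd2 [d21 [d22 _]]].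
  have Z : forall a, 0 < Cmod (a - a0) < d2 -> cD k a = 0.
  { intros a ha. destruct (classic (cD k a = 0)) as [|hn]; auto. exfalso.
    have h1a := h1 a _lra. replace (k a - k a0 - 0 * (a - a0))%C with (k a - k a0)%C in h1a by ring.
    have ka : Cmod (k a - k a0) <= c / 16.
    { eapply Rle_trans; [exact h1a|]. rewrite <- cc. mono. }
    set (rh := R0 / 2). have Ha : holball a (R0 - r) k by (apply (holball_sub a0 R0); au).
    set (q := fun w => rem a rh 1 k (w - a)).
    have T : forall w, Cmod (w - a) < rh -> k w = (k a + (w - a) * q w)%C.
    { intros w hw. have t := taylor a (R0 - r) k rh 1 (w - a) Ha hw ltac:(unfold rh; lra). replace (a + (w - a))%C with w in t by ring. rewrite t. simpl.
      rewrite (coef_0 a (R0 - r)) by (auto; unfold rh; lra). unfold q. ring. }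
    have qa : q a = cD k a.
    { have t := taylor a (R0 - r) k rh 2 0 Ha. unfold q. replace (a - a)%C with (RtoC 0) by ring.
      rewrite (rem_step a (R0 - r)) by (auto; try (unfold rh; lra); rewrite Cmod_0; unfold rh; lra). rewrite (coef_1 a (R0 - r)) by (auto; unfold rh; lra). ring. }
    have qh : holball a0 (2 * r) q.
    { intros w hw. unfold q. apply (hol_comp (fun w => w - a)%C (rem a rh 1 k)); [au|].
      apply (hol_rem a (R0 - r)); auto; [unfold rh; lra|]. have t := Cmod_tri w a0 a. rewrite (Cmod_sym a0 a) in t. unfold rh. lra. }
    have MP := min_principle a0 (2 * r) q r (c / (4 * r)) qh _lra.
    have MP' : c / (4 * r) <= Cmod (q a0).
    { apply MP.
      - intros w hw Ew. destruct (classic (w = a)) as [->|hwa]; [rewrite qa in Ew; auto|]. apply hwa.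
        have t := Cmod_tri w a0 a. rewrite (Cmod_sym a0 a) in t. apply Hinj; [au|au|]. rewrite (T w) by (unfold rh; lra). rewrite Ew. ring.
      - pos.
      - intros t. set (w := (a0 + cir r t)%C). have mw : Cmod (w - a0) = r. { unfold w. replace (a0 + cir r t - a0)%C with (cir r t) by ring. lra. }
        have tw := Cmod_tri w a0 a. rewrite (Cmod_sym a0 a) in tw.
        have l := HL (cir r t) _lra. rewrite Cmod_cir in l by lra. fold w c in l. cbv beta in l.
        have e1 := T w ltac:(unfold rh; lra). have e2 : (k w - k a)%C = ((w - a) * q w)%C by (rewrite e1 at 1; ring).
        have t3 := Cmod_tri (k w) (k a) (k a0). rewrite e2, Cmod_mult in t3.
        have pq := Cmod_ge_0 (q w). assert (Cmod (w - a) * Cmod (q w) <= 2 * r * Cmod (q w)) by mono.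
        apply Rmult_le_reg_l with (4 * r); [lra|]. replace (4 * r * (c / (4 * r))) with c by (field; lra). lra. }
    have e1 := T a0 ltac:(rewrite Cmod_sym; unfold rh; lra). have e2 : (k a - k a0)%C = ((a - a0) * q a0)%C by (rewrite e1 at 1; ring).
    rewrite e2, Cmod_mult in h1a. assert (Cmod (q a0) <= c / (16 * r)) by (apply Rmult_le_reg_l with (Cmod (a - a0)); [lra|]; rewrite (Rmult_comm _ (c / (16 * r))); auto).
    assert (c / (16 * r) < c / (4 * r)). { apply Rmult_lt_compat_l; auto. apply Rinv_lt_contravar; [|lra]. mono. } lra. }
  set (b := (a0 + (d2 / 2)%R)%C). have mb : Cmod (b - a0) = d2 / 2. { unfold b. replace (a0 + (d2 / 2)%R - a0)%C with (RtoC (d2 / 2)) by ring. lra. }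
  have K : Cmod (k b - k a0) <= 0 * Cmod (b - a0).
  { have S : forall t, 0 <= t <= 1 -> Cmod (a0 + t * (b - a0) - a0) <= d2 / 2.
    { intros t ht. replace (a0 + t * (b - a0) - a0)%C with (t * (b - a0))%C by ring. rewrite Cmod_mult, Cmod_R, Rabs_pos_eq by lra. nra. }
    apply (MVT_C k (cD k)).
    - intros t ht. specialize (S t ht). apply cD_spec, Hb. lra.
    - intros t ht. specialize (S t ht). set (w := (a0 + t * (b - a0))%C) in *. destruct (Req_dec (Cmod (w - a0)) 0) as [z|nz].
      + replace w with a0; [rewrite E, Cmod_0; lra|]. symmetry. apply (proj2 (Ceq_minus _ _)). apply Cmod_le_0. lra.
      + rewrite Z, Cmod_0; [lra|]. have p := Cmod_ge_0 (w - a0). lra. }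
  rewrite Rmult_0_l in K. apply Cmod_le_0 in K. apply (proj2 (Ceq_minus _ _)) in K. apply Hinj in K; [|au|auto]. rewrite K, Cmod_self in mb. lra.
Qed.

(** The bound on [k'' / k'] keeps the relative variation of [k'] below one half on a disc whose
    radius depends on [s] only, so every injective [k] is there close to its linear part. *)
Lemma univalent_distortion s : 0 < s -> exists s1, 0 < s1 < s /\ forall k, holball 0 s k -> (forall y z, Cmod y < s -> Cmod z < s -> k y = k z -> y = z) ->
  (forall z, Cmod z < s1 -> cD k z <> 0) /\ forall z w, Cmod z < s1 -> Cmod w < s1 -> Cmod (k z - k w - cD k w * (z - w)) <= / 2 * Cmod (cD k w) * Cmod (z - w).
Proof.
  intros hs. destruct eps0_pos as [[e1 e2] _]. have hC0 : 0 < C0 by pos.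
  set (B := 4 * C0 / s). have hB : 0 < B by pos.
  small s1 ((8, s) :: (16 * B, 1) :: nil) as [h1 [l1 [l2 _]]]. have Bs : B * s1 <= / 16 by lra.
  exists s1. split; [lra|]. intros k Hk Hinj. have Hd := inj_deriv k s Hk Hinj. split; [au|].
  have Hk1 : holball 0 s (cD k) by (apply holball_cD; auto).
  have HB : forall z, Cmod z <= s / 2 -> Cmod (cD (cD k) z) <= B * Cmod (cD k z).
  { intros z hz. have q := preschwarz_bound k s (3 / 4 * s) Hk Hinj Hd _lra z _lra. have dz := Hd z _lra. rewrite Cmod_div in q by auto.
    have p := Cmod_pos _ dz. set (x := Cmod (cD (cD k) z)) in *. set (y := Cmod (cD k z)) in *. have px : 0 <= x / y by mono.
    assert (s / 4 * (x / y) <= C0) by (eapply Rle_trans; [|exact q]; mono).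
    assert (x / y <= B). { unfold B. apply Rmult_le_reg_l with (s / 4); [lra|]. replace (s / 4 * (4 * C0 / s)) with C0 by (field; lra). auto. }
    replace x with (x / y * y) by (field; lra). au. }
  intros z w hz hw. have dw := Hd w _lra. set (X := fun u => (/ cD k w * cD k u)%C).
  have HX : forall u, Cmod (u - w) < 2 * s1 -> Cmod (X u - 1) <= 2 * B * Cmod (u - w).
  { apply gronwall_disc; try lra.
    - intros u hu. have q := Cmod_rev u w. apply hol_mult; au.
    - unfold X. field. au.
    - intros u hu. have q := Cmod_rev u w. have cdx : Cd X u (/ cD k w * cD (cD k) u) by (apply Cd_scal, cD_spec, Hk1; rewrite C0r; lra).
      rewrite (cD_eq _ _ _ cdx). unfold X. rewrite !Cmod_mult. have b := HB u _lra. have p := Cmod_ge_0 (/ cD k w).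
      replace (B * (Cmod (/ cD k w) * Cmod (cD k u))) with (Cmod (/ cD k w) * (B * Cmod (cD k u))) by ring. au. }
  replace (k z - k w - cD k w * (z - w))%C with ((k z - cD k w * z) - (k w - cD k w * w))%C by ring.
  apply (MVT_C (fun u => k u - cD k w * u)%C (fun u => cD k w * (X u - 1))%C w z).
  - intros t ht. set (u := (w + t * (z - w))%C). have hu : Cmod u < s1.
    { eapply Rle_lt_trans; [apply (seg_in w z (Rmax (Cmod w) (Cmod z)) t ht (Rmax_l _ _) (Rmax_r _ _))|]. apply Rmax_lub_lt; auto. }
    apply (Cd_ext (fun u => k u + (- cD k w) * u)%C _ _ _ 1); [lra|intros; ring|].
    eapply Cd_eq; [|apply Cd_plus; [apply cD_spec, Hk; rewrite C0r; lra|apply Cd_scal, Cd_id]]. unfold X. field. au.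
  - intros t ht. set (u := (w + t * (z - w))%C). have hu : Cmod (u - w) < 2 * s1.
    { unfold u. replace (w + t * (z - w) - w)%C with (t * (z - w))%C by ring. rewrite Cmod_mult, Cmod_R, Rabs_pos_eq by lra. have q := Cmod_minus_le z w. have p := Cmod_ge_0 (z - w). nra. }
    rewrite Cmod_mult, (Rmult_comm (/ 2)). apply Rmult_le_compat_l; [mono|]. eapply Rle_trans; [au|]. have p := Cmod_ge_0 (u - w). nra.
Qed.

(** * Limits of the conjugacies on lines *)
Definition lip_on (R L : R) (U : C -> C -> C) : Prop := forall x y x' y', Cmod x < R -> Cmod y < R -> Cmod x' < R -> Cmod y' < R ->
  Cmod (U x y - U x' y') <= L * (Cmod (x - x') + Cmod (y - y')).

Lemma lip_exists U R M : 0 < R -> hol2 (pd2 R R) U -> (forall x y, pd2 R R x y -> Cmod (U x y) <= M) -> exists L, 1 <= L /\ lip_on (R / 2) L U.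
Proof.
  intros hR HU BU. exists (Rmax 1 (2 * M / (R / 2))). split; [apply Rmax_l|]. intros x y x' y' hx hy hx' hy'.
  eapply Rle_trans; [apply (lip2 R R (R / 2) (R / 2) M U); auto; lra|]. rewrite <- Rmult_plus_distr_l. apply Rmult_le_compat_r; [|apply Rmax_r].
  au.
Qed.
Lemma dy_lip U R M : 0 < R -> hol2 (pd2 R R) U -> (forall x y, pd2 R R x y -> Cmod (U x y) <= M) -> exists L, 1 <= L /\ forall x y x' y', Cmod x < R / 4 -> Cmod y < R / 4 -> Cmod x' < R / 4 -> Cmod y' < R / 4 ->
  Cmod (cD (U x) y - cD (U x') y') <= L * (Cmod (x - x') + Cmod (y - y')).
Proof.
  intros hR HU BU.
  destruct (hol3_dy (pd3 R 1 R) (pd3 R 1 (R / 2)) (R / 2) M (fun x _ y => U x y) _lra) as [D1 D2].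
  - intros g1 g2 g3 t0 r hr h. apply (HU g1 g3 t0 r hr). intros t ht. destruct (h t ht) as [k1 [k2 [k3 [k4 [k5 k6]]]]]. au.
  - intros x u y [k1 [k2 k3]]. au.
  - intros x u y y' [k1 [k2 k3]] hh. split; [auto|]. split; [auto|]. have q := Cmod_rev y' y. lra.
  - destruct (lip_exists (fun x y => cD (U x) y) (R / 2) (2 * M / (R / 2)) _lra) as [L [hL H]].
    + intros g1 g2 t0 r hr h. apply (D1 g1 (fun _ => RtoC 0) g2 t0 r hr). intros t ht. destruct (h t ht) as [k1 [k2 [k3 k4]]].
      au.
    + intros x y [k1 k2]. apply (D2 x 0 y). au.
    + exists L. au.
Qed.
Lemma hol2_slice R U x y : hol2 (pd2 R R) U -> Cmod x < R -> Cmod y < R -> hol (U x) y.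
Proof. intros H hx hy. apply (hol2_y (pd2 R R) U x 0 R H); [|lra]. au. Qed.

Lemma small_lip U R M mu : 0 < R -> hol2 (pd2 R R) U -> (forall x y, pd2 R R x y -> Cmod (U x y) <= M) -> cD (U 0) 0 = 0 -> 0 < mu ->
  exists del, 0 < del <= R / 4 /\ forall x y y', Cmod x < del -> Cmod y < del -> Cmod y' < del -> Cmod (U x y - U x y') <= mu * Cmod (y - y').
Proof.
  intros hR HU BU U0 hmu. destruct (dy_lip U R M hR HU BU) as [L [hL HL]]. small del ((1, R / 4) :: (2 * L, mu) :: nil) as [hd [d1 [dL _]]].
  exists del. split; [lra|]. intros x y y' hx hy hy'.
  have S : forall t, 0 <= t <= 1 -> Cmod (y' + t * (y - y')) < del.
  { intros t ht. eapply Rle_lt_trans; [apply (seg_in y' y (Rmax (Cmod y') (Cmod y)) t ht (Rmax_l _ _) (Rmax_r _ _))|]. apply Rmax_lub_lt; auto. }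
  apply (MVT_C (U x) (cD (U x)) y' y mu).
  - intros t ht. specialize (S t ht). apply cD_spec, (hol2_slice R); auto; lra.
  - intros t ht. specialize (S t ht). have z : Cmod 0 < R / 4 by lra.
    have q := HL x _ 0 0 _lra (Rlt_le_trans _ _ _ S d1) z z. rewrite U0, !C0r in q. assert (L * (Cmod x + Cmod (y' + t * (y - y'))) <= L * (del + del)) by mono. lra.
Qed.

Section Limit.
Variables (f g : C -> C -> C) (R0 Lf : R).
Hypothesis HR0 : 0 < R0 <= 1.
Hypothesis HLf : 1 <= Lf.
Hypothesis Hf : hol2 (pd2 R0 R0) f. Hypothesis Hg : hol2 (pd2 R0 R0) g.
Hypothesis Hfl : lip_on R0 Lf f. Hypothesis Hgl : lip_on R0 Lf g.
Hypothesis Hf0 : f 0 0 = 0. Hypothesis Hg0 : g 0 0 = 0.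
Hypothesis Hf1 : cD (f 0) 0 = 1. Hypothesis Hg1 : cD (g 0) 0 = 1.
Hypothesis Hfn : ~ (forall y, Cmod y < R0 -> f 0 y = y). Hypothesis Hgn : ~ (forall y, Cmod y < R0 -> g 0 y = y).
Variables (xs : nat -> C) (ks : nat -> C -> C) (s eps : R).
Hypothesis Hs : 0 < s <= R0. Hypothesis Heps : 0 < eps <= R0.
Hypothesis Hxs : forall e, 0 < e -> exists N, forall n, (N <= n)%nat -> Cmod (xs n) <= e.
Hypothesis Hk : forall n, holball 0 s (ks n).
Hypothesis Hki : forall n y z, Cmod y < s -> Cmod z < s -> ks n y = ks n z -> y = z.
Hypothesis Hkc : forall n y, Cmod y < eps -> Cmod (f (xs n) y) < s -> Cmod y < s -> Cmod (ks n y) < eps -> ks n (f (xs n) y) = g (xs n) (ks n y).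
Hypothesis Hkf : forall n y, Cmod y < s -> Cmod y < eps -> f (xs n) y = y -> ks n y = y.

Lemma gen_le h x y : lip_on R0 Lf h -> h 0 0 = 0 -> Cmod x < R0 -> Cmod y < R0 -> Cmod (h x y) <= Lf * (Cmod x + Cmod y).
Proof. intros H h0 hx hy. have q := H x y 0 0 hx hy _lra _lra. rewrite h0, !C0r in q. auto. Qed.
Lemma gen_bound h x y : lip_on R0 Lf h -> h 0 0 = 0 -> pd2 R0 R0 x y -> Cmod (h x y - y) <= 3 * Lf.
Proof. intros H h0 [hx hy]. via Cmod_minus_le. have q := gen_le h x y H h0 hx hy.
  assert (Lf * (Cmod x + Cmod y) <= Lf * 2) by mono. lra.
Qed.
Lemma gen_hol h : hol2 (pd2 R0 R0) h -> hol2 (pd2 R0 R0) (fun x y => h x y - y)%C.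
Proof. intros H g1 g2 t0 r hr hh. apply hol_minus; [apply (H g1 g2 t0 r hr hh)|]. apply (hh t0). lra. Qed.
(** Tangency to the identity enters here: near the origin, neighbouring points are displaced by
    nearly the same amount. *)
Lemma gen_slip h mu : hol2 (pd2 R0 R0) h -> lip_on R0 Lf h -> h 0 0 = 0 -> cD (h 0) 0 = 1 -> 0 < mu ->
  exists del, 0 < del <= R0 / 4 /\ forall x y y', Cmod x < del -> Cmod y < del -> Cmod y' < del -> Cmod ((h x y - y) - (h x y' - y')) <= mu * Cmod (y - y').
Proof.
  intros H Hl h0 h1 hmu. apply (small_lip (fun x y => h x y - y)%C R0 (3 * Lf) mu); auto; [lra|apply gen_hol; auto|intros; apply gen_bound; auto|].
  apply cD_eq. apply (Cd_ext (fun y => h 0 y + (- (1)) * y)%C _ _ _ 1); [lra|intros; ring|]. eapply Cd_eq; [|apply Cd_plus; [apply cD_spec, (hol2_slice R0); auto; rewrite Cmod_0; lra|apply Cd_scal, Cd_id]]. rewrite h1. ring.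
Qed.
(** The displacement at [x = 0] has an isolated zero at the origin. The bound is on an annulus
    instead of a circle, because images under [ks n] are known only up to distortion. *)
Lemma gen_lower h : hol2 (pd2 R0 R0) h -> lip_on R0 Lf h -> ~ (forall y, Cmod y < R0 -> h 0 y = y) -> exists dl, 0 < dl <= R0 /\ forall r, 0 < r < dl -> exists c e, 0 < c /\ 0 < e <= r /\ forall x y, Cmod x < e -> r / 4 <= Cmod y -> Cmod y <= r -> c <= Cmod (h x y - y).
Proof.
  intros H Hl hn. destruct (local_lower 0 R0 (fun y => h 0 y - y)%C _lra) as [k [dl [al [hdl [hal HL]]]]].
  - intros y hy. rewrite C0r in hy. apply hol_minus; [apply (hol2_slice R0); auto; rewrite Cmod_0; lra|au].
  - intros E. apply hn. intros y hy. apply (proj2 (Ceq_minus _ _)), E. lra.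
  - small dl' ((1, dl) :: (1, R0) :: nil) as [hdl' [q1 [q2 _]]]. exists dl'. split; [lra|]. intros r hr.
    set (c := al * (r / 4) ^ k). have hc : 0 < c by pos. small e ((1, r) :: (2 * Lf, c) :: nil) as [he [q3 [q4 _]]]. exists (c / 2), e. split; [lra|]. split; [lra|].
    intros x y hx hy1 hy2. have l := HL y _lra. cbv beta in l. replace (0 + y)%C with y in l by ring.
    assert (c <= al * Cmod y ^ k) by (apply Rmult_le_compat_l; au).
    have q := Hl 0 y x y _lra _lra _lra _lra. rewrite Cmod_self, Cmod_sym in q. rewrite (Cmod_sym 0 x), C0r in q.
    assert (Lf * Cmod x <= Lf * e) by mono.
    have t := Cmod_rev (h 0 y - y) (h x y - y). replace (h 0 y - y - (h x y - y))%C with (- (h x y - h 0 y))%C in t by ring. rewrite Cmod_opp in t. lra.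
Qed.

Variable s1 : R.
Hypothesis Hs1 : 0 < s1 < s.
Hypothesis HD : forall n, (forall z, Cmod z < s1 -> cD (ks n) z <> 0) /\ forall z w, Cmod z < s1 -> Cmod w < s1 -> Cmod (ks n z - ks n w - cD (ks n) w * (z - w)) <= / 2 * Cmod (cD (ks n) w) * Cmod (z - w).

Lemma dist_two n z w : Cmod z < s1 -> Cmod w < s1 -> / 2 * Cmod (cD (ks n) w) * Cmod (z - w) <= Cmod (ks n z - ks n w) <= 3 / 2 * Cmod (cD (ks n) w) * Cmod (z - w).
Proof.
  intros hz hw. destruct (HD n) as [_ h]. specialize (h z w hz hw). have q := Cmod_rev (ks n z - ks n w) (cD (ks n) w * (z - w)).
  have q2 := Cmod_rev (cD (ks n) w * (z - w)) (ks n z - ks n w). rewrite (Cmod_sym (cD (ks n) w * (z - w))) in q2. rewrite Cmod_mult in q, q2. lra.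
Qed.
Lemma dist_deriv n z w : Cmod z < s1 -> Cmod w < s1 -> z <> w -> Cmod (cD (ks n) z) <= 3 * Cmod (cD (ks n) w).
Proof.
  intros hz hw hzw. destruct (dist_two n z w hz hw) as [_ a]. destruct (dist_two n w z hw hz) as [b _]. rewrite (Cmod_sym w z), (Cmod_sym (ks n w)) in b.
  have p : 0 < Cmod (z - w) by (apply Cmod_pos; intros E; apply hzw; apply (proj2 (Ceq_minus _ _)); auto).
  apply Rmult_le_reg_r with (Cmod (z - w)); auto. lra.
Qed.

(** If [la], the derivative at the fixed point [p], is large, then a point at the tiny distance
    [z = r / la] from [p] is sent into the annulus where [g] displaces by at least [c]. But this
    displacement is transported by [ks n] from that of [f], at most [mu * z], hence it is at most a
    multiple of [la * mu * z = mu * r], which is too small. *)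
Lemma deriv_upper : exists La del N, 0 < La /\ 0 < del /\ forall n p, (N <= n)%nat -> Cmod p < del -> f (xs n) p = p -> Cmod (cD (ks n) p) <= La.
Proof.
  destruct (gen_lower g Hg Hgl Hgn) as [dl [hdl HL]]. small r2 ((2, dl) :: (2, eps) :: nil) as [hr2 [a1 [a2 _]]].
  (* With [3/5], the image, at distance between [r / 2] and [3 r / 2] from [p], stays between the
     radii [r2 / 4] and [r2]. *)
  destruct (HL r2 _lra) as [c [e [hc [he HB]]]]. set (r := 3 / 5 * r2). 
  have hr : 0 < r by mono. small mu ((1, 1) :: (9 * r, c) :: nil) as [hmu [m1 [mur _]]].
  destruct (gen_slip f mu Hf Hfl Hf0 Hf1 hmu) as [d1 [hd1 HS]].
  small dd ((1, d1) :: (1, s1 / 4) :: (1, eps / 4) :: (1, r / 16) :: nil) as [hdd [b1 [b2 [b3 [b4 _]]]]].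
  small ex ((2, e) :: (2, dd) :: nil) as [hex [x1 [x2 _]]]. destruct (Hxs ex hex) as [N HN].
  exists (4 * r / dd), (dd / 2), N. split; [pos|]. split; [lra|]. intros n p hn hp hfp.
  specialize (HN n hn). set (x := xs n) in *.
  destruct (Rle_dec (Cmod (cD (ks n) p)) (4 * r / dd)) as [|hb]; auto. exfalso. apply Rnot_le_lt in hb. set (la := Cmod (cD (ks n) p)) in *.
  have hla : 0 < la by (assert (0 < 4 * r / dd) by pos; lra).
  set (z := r / la). have hz : 0 < z by pos. have zla : la * z = r by (unfold z; field; lra).
  have zd : z < dd / 4. { apply Rmult_lt_reg_l with la; auto. rewrite zla. apply Rle_lt_trans with (4 * r / dd * (dd / 4)); [apply Req_le; field; lra|]. au. }
  set (y := (p + z)%C). have yp : (y - p)%C = z by (unfold y; ring). have myp : Cmod (y - p) = z by (rewrite yp, Cmod_R, Rabs_pos_eq; lra).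
  have hy : Cmod y < dd by (have q := Cmod_rev y p; lra).
  have kp : ks n p = p by au.
  have hU : Cmod (f x y - y) <= mu * z.
  { have q := HS x y p _lra _lra _lra. fold x in hfp. rewrite hfp, myp in q. replace (f x y - y - (p - p))%C with (f x y - y)%C in q by ring. auto. }
  have muz : mu * z <= 1 * z by mono.
  have hfy : Cmod (f x y) < s1 by (have q := Cmod_rev (f x y) y; lra).
  have dk := proj2 (HD n) y p _lra _lra. fold la in dk. rewrite kp, yp in dk. rewrite Cmod_R, Rabs_pos_eq in dk by lra.
  have mdk : Cmod (cD (ks n) p * z) = r by (rewrite Cmod_mult, Cmod_R, Rabs_pos_eq by lra; exact zla).
  have q1 := Cmod_rev (ks n y - p) (cD (ks n) p * z). have q2 := Cmod_rev (cD (ks n) p * z) (ks n y - p). rewrite (Cmod_sym (cD (ks n) p * z)) in q2. rewrite mdk in q1, q2.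
  have q3 := Cmod_rev (ks n y) p. have q4 := Cmod_minus_le (ks n y) p.
  have lo : r2 / 4 <= Cmod (ks n y) by (unfold r in *; lra). have up : Cmod (ks n y) <= r2 by (unfold r in *; lra).
  have B := HB x (ks n y) _lra lo up.
  have kc := Hkc n y _lra ltac:(fold x; lra) _lra _lra. fold x in kc. rewrite <- kc in B.
  destruct (dist_two n (f x y) y hfy _lra) as [_ d2].
  have yne : y <> p by (intros E; rewrite E, Cmod_self in myp; lra).
  have d3 := dist_deriv n y p _lra _lra yne. fold la in d3.
  assert (Cmod (cD (ks n) y) * Cmod (f x y - y) <= 3 * la * (mu * z)) by mono.
  assert (3 * la * (mu * z) = 3 * (mu * r)) by (rewrite <- zla; ring). lra.
Qed.

(** The mirror image: if the derivative [la] is small, a point at distance [r] from [p] is displaced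
    by [f] by at least [c], while its image is so close to [p] that [g] displaces it by at most [mu]
    times its distance to [p]. *)
Lemma deriv_lower : exists la0 del N, 0 < la0 /\ 0 < del /\ forall n p, (N <= n)%nat -> Cmod p < del -> f (xs n) p = p -> la0 <= Cmod (cD (ks n) p).
Proof.
  destruct (gen_lower f Hf Hfl Hfn) as [dl [hdl HL]]. small r2 ((2, dl) :: (2, eps) :: (4 * Lf, s1) :: (4, s1) :: nil) as [hr2 [a1 [a2 [a4 [a5 _]]]]].
  destruct (HL r2 _lra) as [c [e [hc [he HB]]]]. set (r := r2 / 2). have hr : 0 < r by mono.
  set (mu := c / (18 * r)). have hmu : 0 < mu by pos. have mur : 18 * (mu * r) = c by (unfold mu; field; lra).
  destruct (gen_slip g mu Hg Hgl Hg0 Hg1 hmu) as [d1 [hd1 HS]].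
  small dd ((1, d1) :: (1, s1 / 4) :: (1, eps / 4) :: (1, r / 4) :: nil) as [hdd [b1 [b2 [b3 [b4 _]]]]].
  small ex ((2, e) :: (2, dd) :: nil) as [hex [x1 [x2 _]]]. destruct (Hxs ex hex) as [N HN].
  exists (dd / (4 * r)), (dd / 2), N. split; [pos|]. split; [lra|]. intros n p hn hp hfp.
  specialize (HN n hn). set (x := xs n) in *.
  destruct (Rle_dec (dd / (4 * r)) (Cmod (cD (ks n) p))) as [|hb]; auto. exfalso. apply Rnot_le_lt in hb.
  have hla := Cmod_pos _ (proj1 (HD n) p _lra). set (la := Cmod (cD (ks n) p)) in *.
  have lar : la * r < dd / 4. { apply Rlt_le_trans with (dd / (4 * r) * r); [mono|apply Req_le; field; lra]. }
  set (y := (p + r)%C). have yp : (y - p)%C = r by (unfold y; ring). have myp : Cmod (y - p) = r by (rewrite yp, Cmod_R, Rabs_pos_eq; lra).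
  have hy1 : Cmod y <= r2 by (have q := Cmod_rev y p; unfold r in *; lra).
  have hy2 : r2 / 4 <= Cmod y by (have q := Cmod_minus_le y p; unfold r in *; lra).
  have kp : ks n p = p by au.
  have gp : g x p = p.
  { have q := Hkc n p _lra. fold x in q, hfp. rewrite hfp, kp in q. symmetry. au. }
  have B := HB x y _lra hy2 hy1.
  have hfy : Cmod (f x y) < s1. { have q := gen_le f x y Hfl Hf0 _lra _lra. assert (Lf * (Cmod x + Cmod y) <= Lf * (r2 + r2)) by mono. lra. }
  destruct (dist_two n y p _lra _lra) as [_ d0]. fold la in d0. rewrite kp, myp in d0.
  have hky : Cmod (ks n y) < dd by (have q := Cmod_rev (ks n y) p; lra).
  have kc := Hkc n y _lra ltac:(fold x; lra) _lra _lra. fold x in kc.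
  have q := HS x (ks n y) p _lra _lra _lra. rewrite gp in q. replace (g x (ks n y) - ks n y - (p - p))%C with (g x (ks n y) - ks n y)%C in q by ring.
  rewrite <- kc in q. destruct (dist_two n (f x y) y hfy _lra) as [d2 _].
  have yne : p <> y by (intros E; rewrite E, Cmod_self in myp; lra).
  have d3 := dist_deriv n p y _lra _lra yne. fold la in d3.
  assert (la * c <= 3 * Cmod (cD (ks n) y) * Cmod (f x y - y)) by mono.
  assert (mu * Cmod (ks n y - p) <= mu * (3 / 2 * la * r)) by mono. assert (mu * (3 / 2 * la * r) = la * (c / 12)) by (rewrite <- mur; field). assert (0 < la * c) by pos.
  lra.
Qed.

(** Without a fixed point the minimum principle would give at [0] the lower bound valid on a circle,
    but [f x 0] tends to [0] with [x]. Fixed points near the origin are where the values of [ks n]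
    are pinned. *)
Lemma fixed_near r : 0 < r -> exists N, forall n, (N <= n)%nat -> exists p, Cmod p < r /\ f (xs n) p = p.
Proof.
  intros hr. destruct (gen_lower f Hf Hfl Hfn) as [dl [hdl HL]]. small r' ((1, r / 2) :: (1, dl / 2) :: nil) as [hr' [a1 [a2 _]]].
  destruct (HL r' _lra) as [c [e [hc [he HB]]]]. small ex ((2, e) :: (2 * Lf, c) :: nil) as [hex [x1 [x2 _]]].
  destruct (Hxs ex hex) as [N HN]. exists N. intros n hn. specialize (HN n hn). set (x := xs n) in *.
  have xL : Lf * Cmod x <= Lf * ex by mono.
  destruct (classic (exists p, Cmod p < r /\ f x p = p)) as [|hno]; auto. exfalso.
  have MP : c <= Cmod (f x 0 - 0).
  { apply (min_principle 0 r' (fun y => f x y - y)%C (r' / 2) c); auto; try lra.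
    - intros y hy. rewrite C0r in hy. apply hol_minus; [apply (hol2_slice R0); auto; lra|au].
    - intros z hz E. rewrite C0r in hz. apply hno. exists z. split; [lra|]. apply (proj2 (Ceq_minus _ _)). au.
    - au. }
  rewrite C0r in MP. have q := gen_le f x 0 Hfl Hf0 _lra _lra. lra.
Qed.

(** Bounds on the derivative at one fixed point spread over the disc by distortion. The upper one
    gives the Lipschitz constant [K] and a normal family; the lower one passes to the limit as
    [|S0 z| >= la0 / 2 * |z|] and makes [S0] invertible. *)
Lemma limit_conj : exists phi S0 r K, strictly phi /\ 0 < r <= s1 /\ holball 0 r S0 /\ S0 0 = 0 /\ cD S0 0 <> 0 /\ 1 <= K /\ (forall z, Cmod z < r -> Cmod (S0 z) <= K * Cmod z) /\
  (forall e, 0 < e -> exists N, forall n z, (N <= n)%nat -> Cmod z < r -> Cmod (ks (phi n) z - S0 z) <= e) /\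
  exists r', 0 < r' <= r /\ forall y, Cmod y < r' -> Cmod (f 0 y) < r /\ Cmod (S0 y) < eps /\ S0 (f 0 y) = g 0 (S0 y).
Proof.
  destruct deriv_upper as [La [d1 [N1 [hLa [hd1 HU]]]]]. destruct deriv_lower as [la0 [d2 [N2 [hla0 [hd2 HLo]]]]].
  small dd ((1, d1) :: (1, d2) :: (1, s1 / 2) :: (1, eps / 2) :: nil) as [hdd [b1 [b2 [b3 [b4 _]]]]].
  destruct (fixed_near dd hdd) as [N3 H3]. set (N0 := (N1 + N2 + N3)%nat).
  set (K := 9 / 2 * La + 1).
  have KL : forall n z w, (N0 <= n)%nat -> Cmod z < s1 -> Cmod w < s1 -> Cmod (ks n z - ks n w) <= K * Cmod (z - w).
  { intros n z w hn hz hw. destruct (H3 n ltac:(au)) as [p [hp hfp]]. have B := HU n p ltac:(au) _lra hfp.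
    destruct (dist_two n z w hz hw) as [_ q]. have B2 : Cmod (cD (ks n) w) <= 3 * La.
    { destruct (classic (w = p)) as [->|hne]; [lra|]. have t := dist_deriv n w p hw _lra hne. lra. }
    have pz := Cmod_ge_0 (z - w). assert (Cmod (cD (ks n) w) * Cmod (z - w) <= 3 * La * Cmod (z - w)) by mono. unfold K. lra. }
  have KB : forall n z, (N0 <= n)%nat -> Cmod z < s1 -> Cmod (ks n z) <= K * (2 * s1) + s1.
  { intros n z hn hz. destruct (H3 n ltac:(au)) as [p [hp hfp]]. have kp : ks n p = p by au.
    have q := KL n z p hn hz _lra. rewrite kp in q. have t := Cmod_rev (ks n z) p. have t2 := Cmod_minus_le z p.
    assert (K * Cmod (z - p) <= K * (2 * s1)) by mono. lra. }
  destruct (montel (fun n => ks (N0 + n)%nat) s1 (s1 / 2) (K * (2 * s1) + s1) _lra) as [phi [S0 [hphi HC]]].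
  { au. }
  { au. }
  exists (fun n => N0 + phi n)%nat, S0, (s1 / 2), K.
  have hK : 1 <= K by (unfold K; lra).
  have AP : forall e, 0 < e -> exists n p, (N0 <= n)%nat /\ Cmod p < e /\ Cmod p < dd /\ ks n p = p /\ la0 <= Cmod (cD (ks n) p) /\ Cmod (xs n) <= e /\ forall z, Cmod z <= s1 / 2 -> Cmod (ks n z - S0 z) <= e.
  { intros e he. destruct (HC e he) as [M1 HM1]. destruct (Hxs e he) as [M2 HM2]. small ed ((1, e) :: (1, dd) :: nil) as [hed [p1 [p2 _]]]. destruct (fixed_near ed hed) as [M3 HM3].
    set (k := (M1 + M2 + M3)%nat). have kk := strictly_ge phi hphi k. destruct (HM3 (N0 + phi k)%nat ltac:(au)) as [p [hp hfp]].
    exists (N0 + phi k)%nat, p. split; [lia|]. au. }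
  have SL : forall z w, Cmod z <= s1 / 2 -> Cmod w <= s1 / 2 -> Cmod (S0 z - S0 w) <= K * Cmod (z - w).
  { intros z w hz hw. apply le_epsilon. intros e he. destruct (AP (e / 2) _lra) as [n [p [h1 [h2 [h3 [h4 [h5 [h6 h7]]]]]]]].
    have q := KL n z w h1 _lra _lra. have qz := h7 z hz. have qw := h7 w hw.
    have t := Cmod_tri (S0 z) (ks n z) (S0 w). have t2 := Cmod_tri (ks n z) (ks n w) (S0 w). rewrite (Cmod_sym (S0 z) (ks n z)) in t. lra. }
  have S00 : S0 0 = 0.
  { apply Cmod_small_eq. intros e he. small e' ((K + 2, e) :: nil) as [he' [hee _]].
    destruct (AP e' he') as [n [p [h1 [h2 [h3 [h4 [h5 [h6 h7]]]]]]]]. have z0 : Cmod 0 <= s1 / 2 by lra. have q := h7 0 z0.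
    have q2 := KL n 0 p h1 _lra _lra. rewrite h4 in q2. rewrite (Cmod_sym 0 p), C0r in q2.
    assert (K * Cmod p <= K * e') by mono. rewrite C0r.
    have t := Cmod_rev (S0 0) (ks n 0). have t2 := Cmod_rev (ks n 0) p. rewrite (Cmod_sym (S0 0)) in t. lra. }
  have SU : forall z, Cmod z < s1 / 2 -> Cmod (S0 z) <= K * Cmod z.
  { intros z hz. have q := SL z 0 _lra _lra. rewrite S00, !C0r in q. auto. }
  have SLo : forall z, Cmod z <= s1 / 2 -> la0 / 2 * Cmod z <= Cmod (S0 z).
  { intros z hz. apply le_epsilon. intros e he. small e' ((la0 + 2, e) :: nil) as [he' [hee _]].
    destruct (AP e' he') as [n [p [h1 [h2 [h3 [h4 [h5 [h6 h7]]]]]]]]. have q := h7 z hz.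
    destruct (dist_two n z p _lra _lra) as [q2 _]. rewrite h4 in q2. have t := Cmod_rev z p. have t2 := Cmod_minus_le (ks n z) p. have t3 := Cmod_rev (ks n z) (S0 z).
    assert (la0 * Cmod (z - p) <= Cmod (cD (ks n) p) * Cmod (z - p)) by mono.
    assert (la0 * (Cmod z - Cmod p) <= la0 * Cmod (z - p)) by mono. assert (la0 * Cmod p <= la0 * e') by mono. assert (0 < la0 * e') by pos. lra. }
  have SH : holball 0 (s1 / 2) S0.
  { intros z hz. rewrite C0r in hz. apply (lim_hol (fun n => ks (N0 + phi n)%nat) S0 z (s1 / 2 - Cmod z) _lra).
    - intros n. apply (holball_sub 0 s); [mono|]. lra.
    - intros e he. destruct (HC e he) as [M1 HM1]. exists M1. intros n w hn hw. apply HM1; auto. have q := Cmod_rev w z. lra. }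
  split; [intros n; specialize (hphi n); lia|]. split; [lra|]. split; [auto|]. split; [auto|]. split.
  { intros E. have h0 := cD_spec S0 0 (SH 0 _lra). rewrite E in h0. destruct (h0 (la0 / 4) _lra) as [d3 [hd3 h3]].
    small h ((2, d3) :: (4, s1) :: nil) as [hh [w1 [w2 _]]]. set (w := RtoC h). have mw : Cmod w = h by (unfold w; rewrite Cmod_R, Rabs_pos_eq; lra).
    specialize (h3 w _lra). rewrite S00, !C0r in h3. replace (S0 w - 0 * w)%C with (S0 w) in h3 by ring. have q := SLo w _lra. assert (0 < la0 * h) by pos. rewrite mw in *. lra. }
  split; [auto|]. split; [auto|]. split.
  { intros e he. destruct (HC e he) as [M1 HM1]. exists M1. au. }
  small r' ((4, s1) :: (4 * K, eps) :: (4 * Lf, s1) :: nil) as [hr' [c1 [c2 [c3 _]]]].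
  exists r'. split; [lra|]. intros y hy. have z0 : Cmod 0 < R0 by lra.
  have hf0 : Cmod (f 0 y) < s1 / 4. { have q := gen_le f 0 y Hfl Hf0 z0 _lra. rewrite Cmod_0 in q. assert (Lf * Cmod y < Lf * r') by (apply Rmult_lt_compat_l; lra). lra. }
  have hS : Cmod (S0 y) < eps / 4 by (have q := SU y _lra; assert (K * Cmod y < K * r') by (apply Rmult_lt_compat_l; lra); lra).
  split; [lra|]. split; [lra|]. apply Cmod_small_eq. intros e he.
  have KL0 : 0 < K * Lf by pos. small e' ((1 + K * Lf + 2 * Lf, e) :: (4, eps) :: (8 * Lf, s1) :: (2, R0) :: nil) as [he' [g1 [g2 [g3 [g4 _]]]]].
  destruct (AP e' he') as [n [p [h1 [h2 [h3 [h4 [h5 [h6 h7]]]]]]]]. set (x := xs n) in *. have px := Cmod_ge_0 x.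
  have fd := Hfl x y 0 y _lra _lra z0 _lra. rewrite Cmod_self, C0r in fd.
  have Lx : Lf * Cmod x <= Lf * e' by mono.
  have hfx : Cmod (f x y) < s1 / 2 by (have t := Cmod_rev (f x y) (f 0 y); lra).
  have hky : Cmod (ks n y) < eps by (have t := Cmod_rev (ks n y) (S0 y); specialize (h7 y _lra); lra).
  have ye : Cmod y < eps by (assert (1 * r' <= K * r') by mono; lra).
  have kc := Hkc n y ye ltac:(fold x; lra) _lra hky. fold x in kc.
  have q1 := h7 (f 0 y) _lra. have q2 := KL n (f x y) (f 0 y) h1 _lra _lra. rewrite kc in q2.
  have q3 := h7 y _lra. have q4 := Hgl x (ks n y) 0 (S0 y) _lra _lra z0 _lra. rewrite C0r in q4.
  assert (Lf * (Cmod x + Cmod (ks n y - S0 y)) <= Lf * (e' + e')) by mono.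
  assert (K * Cmod (f x y - f 0 y) <= K * (Lf * e')) by mono.
  have t1 := Cmod_tri (S0 (f 0 y)) (ks n (f 0 y)) (g 0 (S0 y)). have t2 := Cmod_tri (ks n (f 0 y)) (g x (ks n y)) (g 0 (S0 y)).
  rewrite (Cmod_sym (S0 (f 0 y)) (ks n (f 0 y))) in t1. rewrite (Cmod_sym (ks n (f 0 y)) (g x (ks n y))) in t2. lra.
Qed.
End Limit.

(** * Extraction of the leading term *)
Lemma inverse_fam (f : C -> C -> C) R M r0 : 0 < R -> 0 < r0 -> hol2 (pd2 R R) f -> (forall x y, pd2 R R x y -> Cmod (f x y) <= M) -> f 0 0 = 0 -> cD (f 0) 0 <> 0 ->
  exists d fi, 0 < d /\ hol2 (pd2 d d) fi /\ fi 0 0 = 0 /\ (forall x y, pd2 d d x y -> Cmod (fi x y) < R /\ Cmod (fi x y) < r0 /\ f x (fi x y) = y) /\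
    exists d', 0 < d' <= d /\ forall x y, pd2 d' d' x y -> Cmod (f x y) < d /\ fi x (f x y) = y.
Proof.
  intros hR hr0 Hf Bf f0 fd. have hM : 0 <= M by (eapply Rle_trans; au; split; rewrite Cmod_0; auto).
  small r1 ((1, r0) :: (1, R) :: nil) as [hr1 [q1 [q2 _]]]. destruct (ift (fun x u w => f x w - u)%C R (M + R) r1) as [d [eta [W [h1 [h2 [h3 [h4 [h5 h6]]]]]]]]; auto.
  - intros g1 g2 g3 t0 r hr h. apply hol_minus; [|apply (h t0); rewrite Cmod_self; auto].
    apply (Hf g1 g3 t0 r hr). intros t ht. destruct (h t ht) as [k1 [k2 [k3 [k4 [k5 k6]]]]]. au.
  - intros x u y [k1 [k2 k3]]. via Cmod_minus_le. have q := Bf x y (conj k1 k3). lra.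
  - rewrite f0. ring.
  - have z : Cmod 0 < R by lra. rewrite (cD_eq _ _ (cD (f 0) 0)); auto. apply (Cd_ext (fun w => f 0 w + 0)%C _ _ _ 1); [lra|intros; ring|].
    eapply Cd_eq; [|apply Cd_plus; [apply cD_spec, (hol2_slice R); auto|apply Cd_const]]. ring.
  - exists d, W. split; [lra|]. split; [auto|].
    have z : pd2 d d 0 0 by au. split.
    { destruct (h6 0 0 z) as [_ [_ u]]. symmetry. apply u; [lra|]. rewrite f0. ring. }
    split.
    { intros x y hxy. destruct (h6 x y hxy) as [a [b _]]. split; [lra|]. split; [lra|]. apply (proj2 (Ceq_minus _ _)). au. }
    destruct (lip_exists f R M hR Hf Bf) as [L [hL HL]]. small d' ((1, d) :: (1, eta) :: (2, R) :: (4 * L, d) :: nil) as [hd' [e1 [e2 [e3 [e4 _]]]]].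
    exists d'. split; [lra|]. intros x y [hx hy]. have z0 : Cmod 0 < R / 2 by lra.
    have q := HL x y 0 0 _lra _lra z0 z0. rewrite f0, !C0r in q. assert (L * (Cmod x + Cmod y) <= L * (d' + d')) by mono.
    have b : Cmod (f x y) < d by lra. split; auto. destruct (h6 x (f x y) ltac:(au)) as [_ [_ u]]. symmetry. apply u; [lra|ring].
Qed.

Lemma hol2_lip_0 f R M : 0 < R -> hol2 (pd2 R R) f -> (forall x y, pd2 R R x y -> Cmod (f x y) <= M) -> f 0 0 = 0 -> forall e, 0 < e -> exists e', 0 < e' <= R / 2 /\ e' <= e /\ forall x y, pd2 e' e' x y -> Cmod (f x y) < e.
Proof.
  intros hR Hf Bf f0 e he. destruct (lip_exists f R M hR Hf Bf) as [L [hL HL]]. small e' ((2, R) :: (4 * L, e) :: (1, e) :: nil) as [he' [e1 [e2 [e3 _]]]].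
  exists e'. split; [lra|]. split; [lra|]. intros x y [hx hy]. have z0 : Cmod 0 < R / 2 by lra.
  have q := HL x y 0 0 _lra _lra z0 z0. rewrite f0, !C0r in q. assert (L * (Cmod x + Cmod y) <= L * (e' + e')) by mono. lra.
Qed.

Lemma lip_mono R R' L L' U : R' <= R -> L <= L' -> lip_on R L U -> lip_on R' L' U.
Proof.
  intros h1 h2 H x y x' y' hx hy hx' hy'. eapply Rle_trans; [au|]. au.
Qed.
Lemma pd2_sub R R' U : R' <= R -> hol2 (pd2 R R) U -> hol2 (pd2 R' R') U.
Proof. intros h H. apply (hol2_sub (pd2 R R)); auto. au. Qed.

(** [d] is the order of vanishing of [f0 - id]; the conditions on [f0] and its derivative at [0]
    exclude the orders 0 and 1. *)
Lemma leading_term f0 R : 0 < R -> holball 0 R f0 -> f0 0 = 0 -> cD f0 0 = 1 -> ~ (forall y, Cmod y < R -> f0 y = y) ->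
  exists a d, a <> RtoC 0 /\ (2 <= d)%nat /\ bo (S d) (fun y => f0 y - y - a * y ^ d)%C.
Proof.
  intros hR Hf f00 fd hn. destruct (local_form 0 R (fun y => f0 y - y)%C hR) as [k [u [Hu [u0 [E [Ec1 Ec2]]]]]].
  - au.
  - intros h. apply hn. intros y hy. apply (proj2 (Ceq_minus _ _)), h. lra.
  - have E' : forall w, Cmod w < R / 2 -> (f0 w - w)%C = (w ^ k * u w)%C by (intros w hw; have q := E w hw; replace (0 + w)%C with w in q by ring; auto).
    exists (u 0), k. split; [auto|]. split.
    + have Hq : holball 0 R (fun y => f0 y - y)%C by au.
      have z0 : Cmod (0 - 0) < R by lra.
      destruct k as [|[|k]]; [| |lia].
      * exfalso. apply u0. rewrite <- (Ec1 (R / 2)) by lra. rewrite (coef_0 0 R) by mono. rewrite f00. ring.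
      * exfalso. apply u0. rewrite <- (Ec1 (R / 2)) by lra. rewrite (coef_1 0 R) by mono. apply cD_eq. apply (Cd_ext (fun y => f0 y + (- (1)) * y)%C _ _ _ 1); [lra|intros; ring|].
        eapply Cd_eq; [|apply Cd_plus; [apply cD_spec, Hf; auto|apply Cd_scal, Cd_id]]. rewrite fd. ring.
    + apply (bo_ext_loc _ (fun y => y ^ k * (u y - u 0))%C _ (R / 2)); [lra| |].
      * intros y hy. rewrite E' by auto. ring.
      * replace (S k) with (k + 1)%nat by lia. apply bo_mult; [apply bo_pow|].
        destruct (Hu 0 _lra) as [l hl]. destruct (Cd_lip u 0 l hl) as [e [he h]]. small m ((1, e) :: (1, 1) :: nil) as [hm [m1 [m2 _]]]. exists (Cmod l + 1), m.
        have q := Cmod_ge_0 l. split; [lra|]. split; [lra|]. intros y hy. specialize (h y _lra). lra.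
Qed.

Lemma core_exists f h R M : 0 < R -> hol2 (pd2 R R) f -> hol2 (pd2 R R) h -> (forall x y, pd2 R R x y -> Cmod (f x y) <= M) -> (forall x y, pd2 R R x y -> Cmod (h x y) <= M) ->
  f 0 0 = 0 -> cD (f 0) 0 = 1 -> (forall y, Cmod y < R -> f 0 y = h 0 y) -> ~ (forall y, Cmod y < R -> f 0 y = y) ->
  exists fi hi R1 L a d, R1 <= R /\ core f h fi hi R1 L a d.
Proof.
  intros hR Hf Hh Bf Bh f0 fd fh fn. have z0 : Cmod 0 < R by lra.
  have h0 : h 0 0 = 0 by (rewrite <- fh; auto).
  have n1 : cD (f 0) 0 <> 0. { rewrite fd. au. }
  have hd : cD (h 0) 0 = 1.
  { rewrite <- fd. apply cD_eq. apply (Cd_ext (f 0) _ _ _ R hR); [au|]. apply cD_spec, (hol2_slice R); auto. }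
  destruct (inverse_fam f R M 1 hR _lra Hf Bf f0 n1) as [d1 [fi [i1 [i2 [i3 [i4 [d1' [i5 i6]]]]]]]].
  destruct (inverse_fam h R M 1 hR _lra Hh Bh h0 ltac:(rewrite hd, <- fd; auto)) as [d2 [hi [j1 [j2 [j3 [j4 [d2' [j5 j6]]]]]]]].
  destruct (lip_exists f R M hR Hf Bf) as [L1 [l1 HL1]]. destruct (lip_exists h R M hR Hh Bh) as [L2 [l2 HL2]].
  destruct (lip_exists fi d1 1 i1 i2) as [L3 [l3 HL3]]; [intros x y hxy; destruct (i4 x y hxy) as [_ [q _]]; lra|].
  destruct (lip_exists hi d2 1 j1 j2) as [L4 [l4 HL4]]; [intros x y hxy; destruct (j4 x y hxy) as [_ [q _]]; lra|].
  destruct (dy_lip h R M hR Hh Bh) as [L5 [l5 HL5]].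
  destruct (leading_term (f 0) R hR) as [a [d [ha [hd2 he]]]]; auto.
  { intros z hz. rewrite C0r in hz. apply (hol2_slice R); auto. }
  small R1 ((2, d1) :: (1, d1') :: (2, d2) :: (1, d2') :: (4, R) :: (1, 1) :: nil) as [hR1 [a1 [a2 [a3 [a4 [a5 [a6 _]]]]]]].
  set (L := L1 + L2 + L3 + L4 + L5).
  exists fi, hi, R1, L, a, d. split; [lra|]. constructor; auto; try (unfold L; lra).
  - apply (pd2_sub R); auto; lra.
  - apply (pd2_sub R); auto; lra.
  - apply (pd2_sub d1); auto; lra.
  - apply (pd2_sub d2); auto; lra.
  - apply (lip_mono (R / 2) R1 L1); auto; unfold L; lra.
  - apply (lip_mono (R / 2) R1 L2); auto; unfold L; lra.
  - apply (lip_mono (d1 / 2) R1 L3); auto; unfold L; lra.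
  - apply (lip_mono (d2 / 2) R1 L4); auto; unfold L; lra.
  - intros x y hx hy. apply i6. au.
  - intros x y hx hy. apply i4. au.
  - intros x y hx hy. apply j6. au.
  - au.
  - intros x y y' hx hy hy'. have E : cD (f 0) y' = cD (h 0) y'.
    { apply cD_eq. apply (Cd_ext (h 0) _ _ _ (R - Cmod y')); [lra| |apply cD_spec, (hol2_slice R); auto; lra]. intros w hw. have q := Cmod_rev w y'. symmetry. au. }
    rewrite E. have q := HL5 x y 0 y' _lra _lra _lra _lra. rewrite C0r in q. eapply Rle_trans; [exact q|].
    apply Rmult_le_compat_r; [|unfold L; lra]. au.
Qed.

(** Each point contributes the value there of its own local quotient. Near [p] the divisor vanishes
    at most at [p], so these values agree with the local quotient of [p]. *)
Lemma removable (U N : C -> C) r : (forall p, Cmod p < r -> exists dl h, 0 < dl /\ hol h p /\ forall w, Cmod (w - p) < dl -> N w = (U w * h w)%C /\ (w <> p -> U w <> 0)) ->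
  exists q, holball 0 r q /\ forall w, Cmod w < r -> N w = (U w * q w)%C.
Proof.
  intros H.
  set (P := fun p (h : C -> C) => Cmod p < r -> exists dl, 0 < dl /\ hol h p /\ forall w, Cmod (w - p) < dl -> N w = (U w * h w)%C /\ (w <> p -> U w <> 0)).
  have Ex : forall p, exists h, P p h.
  { intros p. destruct (Rlt_dec (Cmod p) r) as [hp|hp]; [|exists (fun _ => RtoC 0); intros h; contradiction]. destruct (H p hp) as [dl [h hh]]. exists h. intros _. exists dl. au. }
  set (h := fun p => proj1_sig (constructive_indefinite_description _ (Ex p))). have Hh : forall p, P p (h p) by (intros p; unfold h; destruct constructive_indefinite_description; auto).
  exists (fun w => h w w). split.
  - intros p hp. rewrite C0r in hp. destruct (Hh p hp) as [dl [hdl [hol_h hw]]].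
    small m ((1, dl) :: (1, r - Cmod p) :: nil) as [hm [m1 [m2 _]]]. apply (hol_ext (h p) _ p m); auto. intros w hwp. have q3 := Cmod_rev w p.
    destruct (classic (w = p)) as [->|hne]; auto. destruct (hw w _lra) as [e1 e2]. specialize (e2 hne).
    destruct (Hh w _lra) as [dl' [hdl' [_ hw']]]. destruct (hw' w _lra) as [e3 _].
    rewrite e1 in e3. apply (f_equal (fun z => z / U w)%C) in e3. field_simplify in e3; auto.
  - intros w hw. destruct (Hh w hw) as [dl [hdl [_ h1]]]. apply h1. lra.
Qed.

(** * Behaviour on the fixed points *)
(* [D^d] is divisible by [U] on the lines [x = xs n], hence [D^d = U Q] with [Q] the Cauchy integral of [D^d / U]; this identity then
   extends to all small [x]. *)
Lemma fix_identity (U D : C -> C -> C) R (a : C) d L M (xs : nat -> C) : 0 < R <= 1 -> hol2 (pd2 R R) U -> 1 <= L -> lip_on R L U ->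
  bo (S d) (fun y => U 0 y - a * y ^ d)%C -> a <> 0 -> (2 <= d)%nat -> hol2 (pd2 R R) D -> (forall x y, pd2 R R x y -> Cmod (D x y) <= M) ->
  (forall n, xs n <> 0) -> (forall e, 0 < e -> exists N, forall n, (N <= n)%nat -> Cmod (xs n) <= e) ->
  (exists N, forall n, (N <= n)%nat -> forall p, Cmod p < R -> U (xs n) p = 0 -> D (xs n) p = 0) ->
  exists e, 0 < e /\ forall x p, Cmod x < e -> Cmod p < e -> U x p = 0 -> D x p = 0.
Proof.
  intros hR HU hL HL HB ha hd HD BD xs0 Hxs [N0 HN0]. have z0 : Cmod 0 < R by lra. have pa := Cmod_pos _ ha.
  have UB : forall x, Cmod x < R -> holball 0 R (U x) by (intros x hx z hz; rewrite C0r in hz; apply (hol2_slice R); auto).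
  have DB : forall x, Cmod x < R -> holball 0 R (D x) by (intros x hx z hz; rewrite C0r in hz; apply (hol2_slice R); auto).
  set (r1 := R / 4). have hr1 : 0 < r1 ^ d by mono.
  have Ca : coef 0 r1 d (U 0) = a.
  { have q := coef_bo R (fun y => U 0 y - a * y ^ d)%C r1 (S d). have HP : holball 0 R (fun y => a * y ^ d)%C by au.
    have q' := q ltac:(au) ltac:(unfold r1; lra) HB d ltac:(lia).
    rewrite (coef_minus 0 R) in q' by (auto; unfold r1; lra). rewrite (coef_mono R d hd r1 d a) in q' by (unfold r1; lra). apply (proj2 (Ceq_minus _ _)). au. }
  have pr : 0 < Cmod a * r1 ^ d by pos. small tau ((4, R) :: (4 * L, Cmod a * r1 ^ d) :: nil) as [htau [t1 [t2 _]]].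
  (* The [d]-th coefficient of [U x] at [p] stays close to [a], so [U x] vanishes at [p] to order at
     most [d], whereas [D^d] vanishes to order at least [d] wherever [D] does. *)
  have CN : forall x p, Cmod x <= tau -> Cmod p <= tau -> coef p r1 d (U x) <> 0.
  { intros x p hx hp E. 
    have B : Cmod (coef p r1 d (U x) - coef 0 r1 d (U 0)) <= L * (tau + tau) / r1 ^ d.
    { have Hp : holball p (R / 2) (U x) by (apply (holball_sub 0 R); au).
      unfold coef at 1 2. rewrite <- mean_minus.
      - rewrite (mean_ext _ (fun t => (U x (p + cir r1 t)%C - U 0 (0 + cir r1 t)%C) / cir r1 t ^ d)%C) by (intros; unfold Cdiv; ring).
        apply (coef_bound (fun t => U x (p + cir r1 t)%C - U 0 (0 + cir r1 t)%C)%C r1 d); [mono| |].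
        + intros t _. apply ccont_minus; [apply (ccont_circ p (R / 2)); auto; unfold r1; lra|apply (ccont_circ 0 R); auto; unfold r1; lra].
        + intros t. have mc : Cmod (cir r1 t) = r1 by (apply Cmod_cir; unfold r1; lra). have q := Cmod_triangle p (cir r1 t).
          eapply Rle_trans; [apply HL; auto; try (rewrite in0; unfold r1; lra); try lra; unfold r1 in *; lra|]. rewrite C0r. replace (p + cir r1 t - (0 + cir r1 t))%C with p by ring. au.
      - intros t _. apply ccont_coef; [mono|]. apply (ccont_circ p (R / 2)); auto; unfold r1; lra.
      - intros t _. apply ccont_coef; [mono|]. apply (ccont_circ 0 R); auto; unfold r1; lra. }
    rewrite E, Ca in B. replace (0 - a)%C with (- a)%C in B by ring. rewrite Cmod_opp in B. 
    assert (Cmod a * r1 ^ d <= L * (tau + tau)) by (apply Rle_trans with (L * (tau + tau) / r1 ^ d * r1 ^ d); [mono|apply Req_le; field; lra]). lra. }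
  destruct HB as [K [e0 [hK [he0 HK]]]].
  small rho ((4, tau) :: (2, e0) :: (2 * (K + 1), Cmod a) :: nil) as [hrho [r2 [r3 [r4 _]]]]. have r4' : K * rho <= Cmod a / 2 by lra.
  set (c := Cmod a * rho ^ d / 2). have hrd : 0 < rho ^ d by pos. have hc : 0 < c by pos.
  have LB : forall z, Cmod z = rho -> c <= Cmod (U 0 z).
  { intros z hz. specialize (HK z _lra). rewrite hz in HK. have q := Cmod_rev (a * z ^ d) (U 0 z). rewrite (Cmod_sym (a * z ^ d)), Cmod_mult, Cmod_pow, hz in q.
    simpl in HK. assert (K * (rho * rho ^ d) <= Cmod a / 2 * rho ^ d) by (rewrite <- Rmult_assoc; mono). unfold c. lra. }
  small e1 ((1, tau) :: (2 * L, c) :: nil) as [he1 [e11 [e12 _]]].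
  have LB2 : forall x z, Cmod x <= e1 -> Cmod z = rho -> c / 2 <= Cmod (U x z).
  { intros x z hx hz. have l := LB z hz. have q := HL x z 0 z _lra _lra z0 _lra. rewrite Cmod_self, C0r in q. have t := Cmod_rev (U 0 z) (U x z). rewrite (Cmod_sym (U 0 z)) in t.
    assert (L * Cmod x <= L * e1) by mono. lra. }
  have nz : forall x z, Cmod x <= e1 -> Cmod z = rho -> U x z <> 0 by (intros x z hx hz; apply Cmod_neq0; have q := LB2 x z hx hz; lra).
  have DIV : forall n, (N0 <= n)%nat -> Cmod (xs n) <= e1 -> exists q, holball 0 (2 * rho) q /\ forall w, Cmod w < 2 * rho -> (D (xs n) w ^ d)%C = (U (xs n) w * q w)%C.
  { intros n hn hx. set (x := xs n) in *. apply removable. intros p hp.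
    destruct (classic (U x p = 0)) as [Up|Up].
    - have Dp : D x p = 0 by (apply HN0; auto; lra).
      have HUp : holball p (R / 2) (U x) by (apply (holball_sub 0 R); au).
      have HDp : holball p (R / 2) (D x) by (apply (holball_sub 0 R); au).
      destruct (local_form p (R / 2) (U x) _lra HUp) as [k [u [Hu [u0 [E [E1 E2]]]]]].
      { intros Z. apply (CN x p); try lra. unfold coef. rewrite (mean_ext _ (fun _ => RtoC 0)); [apply mean_const|]. intros t _. rewrite Z; [unfold Cdiv; ring|].
        replace (p + cir r1 t - p)%C with (cir r1 t) by ring. rewrite Cmod_cir; unfold r1; lra. }
      have kd : (k <= d)%nat. { destruct (Nat.le_gt_cases k d) as [|h]; auto. exfalso. apply (CN x p); try lra. apply E2; auto. unfold r1. lra. }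
      set (v := rem p r1 1 (D x)).
      have Ev : forall w, Cmod w < r1 -> D x (p + w)%C = (w * v w)%C.
      { intros w hw. rewrite (taylor0 p (R / 2) (D x) r1 1 w HDp ltac:(unfold r1; lra) hw).
        - fold v. simpl. ring.
        - intros j hj. replace j with 0%nat by lia. rewrite (coef_0 p (R / 2)) by (auto; unfold r1; lra). au. }
      have hv : hol v 0 by (apply (hol_rem p (R / 2)); auto; [unfold r1; lra|rewrite Cmod_0; unfold r1; lra]).
      have hu : hol u 0 by au.
      destruct (hol_cont u 0 hu (Cmod (u 0)) (Cmod_pos _ u0)) as [d1 [hd1 hud]].
      small dm ((1, d1) :: (4, R) :: nil) as [hdm [dm1 [dm2 _]]]. exists dm, (fun z => (z - p) ^ (d - k) * v (z - p)%C ^ d / u (z - p)%C)%C. split; [auto|]. split.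
      + have hs : hol (fun z => z - p)%C p by au. have pp : (p - p)%C = 0 by ring.
        apply hol_div; [apply hol_mult; [au|apply hol_pow, (hol_comp (fun z => z - p)%C v); auto; rewrite pp; auto]|apply (hol_comp (fun z => z - p)%C u); auto; rewrite pp; auto|rewrite pp; auto].
      + intros z hz. set (w := (z - p)%C) in *. have zw : z = (p + w)%C by (unfold w; ring).
        have uw : u w <> 0. { intros h. specialize (hud w _lra). rewrite h in hud. replace (0 - u 0)%C with (- u 0)%C in hud by ring. rewrite Cmod_opp in hud. lra. }
        rewrite zw, Ev, E by (unfold r1; lra). split.
        * rewrite Cpow_mult_l. replace (w ^ d)%C with (w ^ k * w ^ (d - k))%C by (rewrite <- Cpow_add_r; f_equal; lia). field. au.
        * intros hne. apply Cmult_neq_0; auto. apply Cpow_nz. intros h. apply hne. rewrite h. ring.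
    - have hUx : hol (U x) p by au. destruct (hol_cont (U x) p hUx (Cmod (U x p)) (Cmod_pos _ Up)) as [d1 [hd1 hud]].
      have un : forall w, Cmod (w - p) < d1 -> U x w <> 0. { intros w hw h. specialize (hud w hw). rewrite h in hud. replace (0 - U x p)%C with (- U x p)%C in hud by ring. rewrite Cmod_opp in hud. lra. }
      exists d1, (fun w => D x w ^ d / U x w)%C. split; [auto|]. split; [au|].
      intros w hw. split; [field; auto|auto]. }
  (* Unlike the local quotients, this integral only involves the circle [rho], on which [U x] has no
     zero for small [x]; it is therefore holomorphic in [x]. *)
  set (Q := fun x y => mean (fun t => D x (cir rho t) ^ d / U x (cir rho t) * (cir rho t / (cir rho t - y)))%C).
  have mc : forall t, Cmod (cir rho t) = rho by (intros; apply Cmod_cir; lra).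
  have QE : forall n y, (N0 <= n)%nat -> Cmod (xs n) <= e1 -> Cmod y < rho -> (D (xs n) y ^ d - U (xs n) y * Q (xs n) y)%C = 0.
  { intros n y hn hx hy. destruct (DIV n hn hx) as [q [hq Eq]]. have cf := cauchy_formula 0 (2 * rho) q rho y hq hy _lra. replace (0 + y)%C with y in cf by ring.
    have EQ : Q (xs n) y = q y.
    { rewrite <- cf. unfold Q. apply mean_ext. intros t _. replace (0 + cir rho t)%C with (cir rho t) by ring. rewrite Eq by lra. f_equal. field. au. }
    rewrite EQ, Eq by lra. ring. }
  have hM : 0 <= M by (eapply Rle_trans; au; split; auto).
  have QH : forall y, Cmod y <= rho / 2 -> holball 0 e1 (fun x => Q x y).
  { intros y hy x hx. rewrite C0r in hx. have hi : forall t, Cmod (t - x) < e1 - Cmod x -> Cmod t < e1 by (intros t ht; have q := Cmod_rev t x; lra).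
    apply (param_int (fun x t => D x (cir rho t) ^ d / U x (cir rho t) * (cir rho t / (cir rho t - y)))%C x (e1 - Cmod x) (M ^ d * (2 / c) * 2)); [lra| | |].
    - intros th t ht. specialize (hi t ht). apply hol_mult; [|au]. apply hol_div; [apply hol_pow| |au].
      + apply (hol2_x (pd2 R R) D (cir rho th) 0 R HD); au.
      + apply (hol2_x (pd2 R R) U (cir rho th) 0 R HU); au.
    - intros t th ht. specialize (hi t ht). rewrite Cmod_mult, Cmod_div, Cmod_pow by au.
      have b1 := BD t (cir rho th) ltac:(au). have b2 := LB2 t (cir rho th) _lra (mc th). have b3 := Cmod_kernel rho y th _lra.
      have b4 : / Cmod (U t (cir rho th)) <= 2 / c. { replace (2 / c) with (/ (c / 2)) by (field; lra). apply Rinv_le_contravar; lra. }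
      assert (0 < / Cmod (U t (cir rho th))) by pos.
      apply Rmult_le_compat; try apply Cmod_ge_0.
      + au.
      + apply Rmult_le_compat; au.
      + eapply Rle_trans; [exact b3|]. apply Rmult_le_reg_r with (rho - Cmod y); [lra|]. unfold Rdiv. rewrite Rmult_assoc, Rinv_l by lra. lra.
    - intros t th ht. specialize (hi t ht). apply ccont_mult; [|apply ccont_kernel; lra]. apply ccont_div; [apply ccont_pow| |au].
      + apply (ccont_hol (D t) (cir rho)); [au|]. au.
      + apply (ccont_hol (U t) (cir rho)); [au|]. au. }
  small e2 ((1, e1) :: (2, rho) :: nil) as [he2 [f1 [f2 _]]]. exists e2. split; [auto|].
  intros x p hx hp hU.
  have I : (D x p ^ d - U x p * Q x p)%C = 0.
  { apply (identity_thm 0 e1 (fun x => D x p ^ d - U x p * Q x p)%C he1).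
    - intros w hw. have hw' := hw. rewrite C0r in hw. apply hol_minus; [apply hol_pow|apply hol_mult; [|au]].
      + apply (hol2_x (pd2 R R) D p 0 R HD); au.
      + apply (hol2_x (pd2 R R) U p 0 R HU); au.
    - intros dd hdd. small dm ((2, dd) :: (1, e1) :: nil) as [hdm [g1 [g2 _]]]. destruct (Hxs dm hdm) as [N1 HN1]. specialize (HN1 (N0 + N1)%nat ltac:(lia)). exists (xs (N0 + N1)%nat).
      rewrite C0r. au.
    - lra. }
  rewrite hU in I. replace (D x p ^ d - 0 * Q x p)%C with (D x p ^ d)%C in I by ring.
  destruct (classic (D x p = 0)) as [|hn]; auto. exfalso. revert I. apply Cpow_nz. au.
Qed.

(** * Conjugacy of germs *)
Lemma conj_germ (f g : C -> C -> C) (R0 Lf : R) (xs : nat -> C) (ks : nat -> C -> C) (s eps : R) :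
  0 < R0 <= 1 -> 1 <= Lf -> hol2 (pd2 R0 R0) f -> hol2 (pd2 R0 R0) g -> lip_on R0 Lf f -> lip_on R0 Lf g -> f 0 0 = 0 -> g 0 0 = 0 ->
  cD (f 0) 0 = 1 -> cD (g 0) 0 = 1 -> (forall r, 0 < r -> ~ (forall y, Cmod y < r -> f 0 y = y)) -> (forall r, 0 < r -> ~ (forall y, Cmod y < r -> g 0 y = y)) ->
  0 < s <= R0 -> 0 < eps <= R0 -> (forall n, xs n <> 0) -> (forall e, 0 < e -> exists N, forall n, (N <= n)%nat -> Cmod (xs n) <= e) -> (forall n, Cmod (xs n) < R0) ->
  (forall n, holball 0 s (ks n)) -> (forall n y z, Cmod y < s -> Cmod z < s -> ks n y = ks n z -> y = z) ->
  (forall n y, Cmod y < eps -> Cmod (f (xs n) y) < s -> Cmod y < s -> Cmod (ks n y) < eps -> ks n (f (xs n) y) = g (xs n) (ks n y)) ->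
  (forall n y, Cmod y < s -> Cmod y < eps -> f (xs n) y = y -> ks n y = y) ->
  exists e T M, 0 < e /\ hol2 (pd2 e e) T /\ (forall x y, pd2 e e x y -> Cmod (T x y) <= M) /\ T 0 0 = 0 /\ cD (T 0) 0 <> 0 /\
    exists e', 0 < e' <= e /\ forall x y, pd2 e' e' x y -> Cmod (T x y) < R0 /\ T x (f x y) = g x (T x y) /\ (f x y = y -> T x y = y).
Proof.
  intros hR0 hLf Hf Hg Hfl Hgl f0 g0 f1 g1 fn gn hs heps hx0 hx hxR Hk Hki Hkc Hkf. have z0 : Cmod 0 < R0 by lra.
  destruct (univalent_distortion s _lra) as [s1 [hs1 HD]].
  destruct (limit_conj f g R0 Lf hR0 hLf Hf Hg Hfl Hgl f0 g0 f1 g1 (fn R0 _lra) (gn R0 _lra) xs ks s eps hs heps hx Hk Hkc Hkf s1 hs1 (fun n => HD (ks n) (Hk n) (Hki n)))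
    as [phi [S0 [r [K [hphi [hr [SH [S00 [Sd [hK [SU [Sc [r' [hr' SC]]]]]]]]]]]]]].
  destruct (inverse_fam (fun _ y => S0 y) r (K * r) 1 _lra _lra) as [d [Si [hd [SiH [Si0 [SiS [d' [hd' SSi]]]]]]]]; auto.
  { intros h1 h2 t0 rr hrr h. apply (hol_comp h2 S0); [apply h; rewrite Cmod_self; auto|apply SH; rewrite C0r; apply h; rewrite Cmod_self; auto]. }
  { intros x y [_ hy]. eapply Rle_trans; [mono|]. au. }
  set (T0 := fun w => Si 0 w).
  have zd : Cmod 0 < d by lra. have zd' : Cmod 0 < d' by lra.
  have TH : holball 0 d T0 by (intros z hz; rewrite C0r in hz; apply (hol2_slice d); auto).
  have TS : forall w, Cmod w < d -> Cmod (T0 w) < r /\ Cmod (T0 w) < 1 /\ S0 (T0 w) = w by (intros w hw; apply (SiS 0 w); split; auto).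
  have ST : forall y, Cmod y < d' -> Cmod (S0 y) < d /\ T0 (S0 y) = y by (intros y hy; apply (SSi 0 y); split; auto).
  have LK : 1 * K <= Lf * K by mono.
  small R2 ((1, r') :: (1, d') :: (1, R0) :: (2 * K, R0) :: (4 * Lf * K, d) :: (2 * Lf, d') :: nil) as [hR2 [m1 [m2 [m3 [m4 [m5 [m6 _]]]]]]].
  have KR2 : 1 * R2 <= K * R2 by mono.
  have GB : forall x y, Cmod x < R2 -> Cmod y < R2 -> Cmod (S0 y) < R0 /\ Cmod (g x (S0 y)) < d.
  { intros x y hx' hy'. have q1 := SU y _lra. assert (K * Cmod y <= K * R2) by mono. split; [lra|].
    have q := gen_le R0 Lf hR0 g x (S0 y) Hgl g0 _lra _lra. assert (Lf * (Cmod x + Cmod (S0 y)) <= Lf * (K * R2 + K * R2)) by mono. lra. }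
  have FB : forall x y, Cmod x < R2 -> Cmod y < R2 -> Cmod (f x y) < d'.
  { intros x y hx' hy'. have q := gen_le R0 Lf hR0 f x y Hfl f0 _lra _lra. assert (Lf * (Cmod x + Cmod y) < Lf * (R2 + R2)) by (apply Rmult_lt_compat_l; lra). lra. }
  (* [T0] inverts [S0], so [h] is [g] in the coordinate given by [S0], and it coincides with [f] on
     [x = 0] as [core] demands. *)
  set (h := fun x y => T0 (g x (S0 y))).
  have hh : hol2 (pd2 R2 R2) h.
  { intros h1 h2 t0 rr hrr H. have Ht0 : Cmod (t0 - t0) < rr by lra.
    apply (hol_comp (fun t => g (h1 t) (S0 (h2 t))) T0).
    - apply (Hg h1 (fun t => S0 (h2 t)) t0 rr hrr). intros t ht. destruct (H t ht) as [k1 [k2 [k3 k4]]]. split; [auto|]. split; [|split; [lra|apply (GB (h1 t) (h2 t)); auto]].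
      apply (hol_comp h2 S0); auto. au.
    - apply TH. rewrite C0r. destruct (H t0 Ht0) as [k1 [k2 [k3 k4]]]. apply GB; auto. }
  have fh : forall y, Cmod y < R2 -> f 0 y = h 0 y.
  { intros y hy. unfold h. destruct (SC y _lra) as [_ [_ q]]. rewrite <- q. symmetry. apply ST. au. }
  destruct (core_exists f h R2 (d' + 1) hR2) as [fi [hi [R1 [L [a [dg [hR1 HC]]]]]]]; auto.
  { apply (pd2_sub R0); auto. }
  { intros x y [k1 k2]. have q := FB x y k1 k2. lra. }
  { intros x y [k1 k2]. unfold h. have q : Cmod (T0 (g x (S0 y))) < 1 by (apply TS, GB; auto). lra. }
  destruct (adapted_family f h fi hi R1 L a dg HC) as [sm [hsm [hsm2 HAF]]]. have cR := c_R1 _ _ _ _ _ _ _ _ HC. have cL := c_L _ _ _ _ _ _ _ _ HC.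
  small s0 ((1, R1) :: (1, d') :: (1, r) :: (1, s) :: (1, eps) :: (4 * K, eps) :: (4 * K, d) :: (1, sm) :: nil) as [hs0 [n1 [n2 [n3 [n4 [n5 [n6 [n7 [n8 _]]]]]]]]].
  have Ls : L * s0 <= L * sm by mono. small e2 ((8, d) :: (4, eps) :: nil) as [he2 [e21 [e22 _]]].
  destruct (Sc e2 he2) as [N2 HN2]. destruct (hx (R2 / 2) _lra) as [N3 HN3].
  (* The subsequence starts late enough for [ks (mm n)] to be close to [S0] and [xs (mm n)] to be
     small for all [n]. *)
  set (mm := fun n => phi (N2 + N3 + n)%nat).
  have mmge : forall n, (N2 + N3 + n <= mm n)%nat by (intros n; apply (strictly_ge phi hphi)).
  have KN : forall n y, Cmod y < s0 -> Cmod (ks (mm n) y - S0 y) <= e2 by (intros n y hy; apply HN2; [lia|lra]).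
  have SB : forall y, Cmod y < s0 -> Cmod (S0 y) <= d / 4 /\ Cmod (S0 y) <= eps / 4.
  { intros y hy. have q := SU y _lra. assert (K * Cmod y <= K * s0) by mono. lra. }
  have KB : forall n y, Cmod y < s0 -> Cmod (ks (mm n) y) <= d * 3 / 8 /\ Cmod (ks (mm n) y) < eps.
  { intros n y hy. have q := KN n y hy. destruct (SB y hy). have t := Cmod_rev (ks (mm n) y) (S0 y). lra. }
  have xR2 : forall n, Cmod (xs (mm n)) < R2 by (intros n; have q := HN3 (mm n) ltac:(have w := mmge n; lia); lra).
  set (W := fun n y => (T0 (ks (mm n) y) - y)%C).
  have CJ : exists S, conjugacy f h R1 (fun n => xs (mm n)) W S.
  { apply (conjugacy_exists f h fi hi R1 L a dg HC s0) with (s0 := s0); auto; [lra| | | | |lra|au].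
    - split; [auto|]. intros e he. destruct (hx e he) as [N HN]. exists N. intros n hn. apply HN. have w := mmge n. lia.
    - intros n z hz. rewrite C0r in hz. apply hol_minus; [|au]. apply (hol_comp (ks (mm n)) T0); [au|]. apply TH. rewrite C0r. destruct (KB n z hz). lra.
    - intros e he. set (Li := 2 * 1 / (d - d / 2)). have hLi : 0 < Li by pos. destruct (Sc (e / Li)) as [N HN]; [pos|].
      exists N. intros n y hn hy. unfold W. destruct (ST y _lra) as [_ q]. rewrite <- q at 2. destruct (KB n y hy) as [k1 _]. destruct (SB y hy) as [k2 _].
      eapply Rle_trans; [apply (lip_ball 0 d (d / 2) T0 1); try rewrite C0r; auto; try lra; intros w hw; rewrite C0r in hw; apply Rlt_le, TS; auto|]. fold Li.
      have q2 := HN (N2 + N3 + n)%nat y ltac:(lia) _lra. fold (mm n) in q2. apply Rle_trans with (Li * (e / Li)); [mono|apply Req_le; field; lra].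
    - intros n y hy hfy. unfold Fd, W, h. destruct (KB n y hy) as [k1 k2]. 
      replace (y + (T0 (ks (mm n) y) - y))%C with (T0 (ks (mm n) y)) by ring. destruct (TS (ks (mm n) y) _lra) as [_ [_ q]]. rewrite q.
      rewrite (Hkc (mm n) y) by lra. ring. }
  destruct CJ as [S [r3 [r3' [h3 [CH [C0' [CB [CE [N4 CF]]]]]]]]].
  have S000 : S 0 0 = 0 by au.
  small e0 ((1, r) :: (1, R2) :: nil) as [he0 [q31 [q32 _]]]. destruct (hol2_lip_0 S r3 (R1 / 2) _lra CH CB S000 e0 he0) as [e3 [he3 [he3' HS3]]].
  set (T := fun x y => S0 (S x y)).
  have TH2 : hol2 (pd2 e3 e3) T.
  { intros h1 h2 t0 rr hrr H. have Ht0 : Cmod (t0 - t0) < rr by lra. destruct (H t0 Ht0) as [_ [_ [k3 k4]]].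
    apply (hol_comp (fun t => S (h1 t) (h2 t)) S0).
    - apply (pd2_sub r3 e3 S _lra CH h1 h2 t0 rr hrr). au.
    - apply SH. rewrite C0r. have q := HS3 _ _ (conj k3 k4). lra. }
  have TB : forall x y, pd2 e3 e3 x y -> Cmod (T x y) <= K * r.
  { intros x y hxy. have q := HS3 x y hxy. eapply Rle_trans; [apply SU; lra|]. au. }
  have T00 : T 0 0 = 0 by (unfold T; rewrite S000; auto).
  have z3 : Cmod 0 < e3 by lra.
  destruct (hol2_lip_0 T e3 (K * r) _lra TH2 TB T00 R0 _lra) as [e4 [he4 [he4' HT4]]].
  small e5 ((1, e4) :: (1, r3') :: (1, R2) :: (1, s0) :: nil) as [he5 [e51 [e52 [e53 [e54 _]]]]].
  destruct (fix_identity (fun x y => f x y - y)%C (fun x y => T x y - y)%C e5 a dg (Lf + 1) (K * r + 1) (fun n => xs (mm n))) as [e6 [he6 HF]]; auto; try lra.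
  - apply (pd2_sub R0); [lra|]. apply gen_hol; auto.
  - intros x y x' y' k1 k2 k3 k4. replace (f x y - y - (f x' y' - y'))%C with ((f x y - f x' y') - (y - y'))%C by ring.
    via Cmod_minus_le. have q := Hfl x y x' y' _lra _lra _lra _lra. have px := Cmod_ge_0 (x - x'). lra.
  - exact (c_exp _ _ _ _ _ _ _ _ HC).
  - exact (c_a _ _ _ _ _ _ _ _ HC).
  - exact (c_d _ _ _ _ _ _ _ _ HC).
  - apply (pd2_sub e3); [lra|]. intros h1 h2 t0 rr hrr H. apply hol_minus; [apply (TH2 h1 h2 t0 rr hrr H)|apply (H t0); rewrite Cmod_self; auto].
  - intros x y [k1 k2]. via Cmod_minus_le. have q := TB x y ltac:(au). lra.
  - intros e he. destruct (hx e he) as [N HN]. exists N. intros n hn. apply HN. have w := mmge n. lia.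
  (* Here [ks (mm n)] fixes [p], so [S] sends [p] to [T0 p], and [T], which is [S0] after [S], sends
     it back to [p]. *)
  - exists N4. intros n hn p hp hU. apply (proj2 (Ceq_minus _ _)) in hU. 
    have q := CF n hn p _lra hU. have kp := Hkf (mm n) p _lra _lra hU. unfold W in q. rewrite kp in q. replace (p + (T0 p - p))%C with (T0 p) in q by ring.
    unfold T. rewrite q. destruct (TS p _lra) as [_ [_ q2]]. rewrite q2. ring.
  - exists e3, T, (K * r). split; [lra|]. split; [auto|]. split; [auto|]. split; [auto|]. split.
    { intros E. apply Sd. transitivity (cD (T 0) 0); [|mono]. symmetry. apply cD_eq. apply (Cd_ext S0 _ _ _ r3); [lra| |].
      - intros w hw. rewrite C0r in hw. unfold T. rewrite C0'; auto.
      - apply cD_spec, SH. lra. }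
    small e7 ((1, e5) :: (1, e6) :: nil) as [he7 [v1 [v2 _]]]. exists e7. split; [lra|].
    intros x y [k1 k2]. have T4 := HT4 x y ltac:(au). have S3 := HS3 x y ltac:(au). split; [lra|]. split.
    + unfold T. destruct (CE x y ltac:(au)) as [_ q]. rewrite q. unfold h. destruct (TS (g x (S0 (S x y)))) as [_ [_ q2]]; auto. apply GB; lra.
    + intros hfxy. apply (proj2 (Ceq_minus _ _)). apply HF; try lra. rewrite hfxy. ring.
Qed.

(** * The theorem *)
Definition fib (phi : C2 -> C2) (x y : C) : C := snd (phi (x, y)).

(** One radius on which the representative is fibred, holomorphic along curves and bounded; the
    bound comes from continuity at the origin, where [phi] vanishes. *)
Lemma germ_extract phi : Diff_p1 phi -> exists R, 0 < R <= 1 /\ hol2 (pd2 R R) (fib phi) /\ (forall x y, pd2 R R x y -> Cmod (fib phi x y) <= 1) /\ fib phi 0 0 = 0 /\ cD (fib phi 0) 0 = 1 /\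
  (forall r, 0 < r -> ~ (forall y, Cmod y < r -> fib phi 0 y = y)) /\ forall x y, pd2 R R x y -> phi (x, y) = (x, fib phi x y).
Proof.
  intros [[[[r [hr Hh]] [h0 _]] Hn] [Hd Hi]]. apply near0_iff in Hn. destruct Hn as [r1 [hr1 Hn]].
  have O2d : polydisc r r O2 by (split; unfold Cdisc; simpl; rewrite Cmod_0; auto).
  have Cn := filterdiff_continuous phi O2 (Hh O2 O2d).
  have Bn : near0 (fun p => Cmod (snd (phi p)) < 1).
  { refine (Cn (fun q : C2 => Cmod (snd q) < 1) _). rewrite h0. apply near0_iff. exists 1. au. }
  apply near0_iff in Bn. destruct Bn as [r2 [hr2 Bn]].
  small R ((1, r) :: (1, r1) :: (1, r2) :: (1, 1) :: nil) as [hR [a1 [a2 [a3 [a4 _]]]]].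
  exists R. split; [lra|]. split; [|split; [|split; [|split; [|split]]]].
  - apply (hol2_sub (fun x y => polydisc r r (x, y))); [|apply (hol2_of_holomorphic2 (polydisc r r)); auto].
    intros x y [k1 k2]. split; unfold Cdisc; simpl; lra.
  - intros x y [k1 k2]. apply Rlt_le, Bn; lra.
  - unfold fib. change (RtoC 0, RtoC 0) with O2. rewrite h0. au.
  - apply cD_eq, is_derive_Cd. au.
  - intros e he H. apply Hi. apply locally_C1. exists e. au.
  - intros x y [k1 k2]. have q := Hn x y _lra _lra. simpl in q. unfold fib. rewrite <- q at 2. apply surjective_pairing.
Qed.

Theorem theorem1p1 (delta epsilon : R) (phi eta : C2 -> C2) :
  (0 < delta)%R -> (0 < epsilon)%R ->
  Diff_p1 phi -> Diff_p1 eta ->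
  holomorphic2 (polydisc delta epsilon) phi ->
  holomorphic2 (polydisc delta epsilon) eta ->
  germ_set_eq (Fixset phi) (Fixset eta) ->
  (exists (s : R) (x : nat -> C),
      (0 < s)%R /\
      filterlim x eventually (locally (T := C_UniformSpace) (RtoC 0)) /\
      forall n : nat,
        Cdisc delta (x n) /\ x n <> RtoC 0 /\
        exists kappa : C -> C,
          holomorphic1 (Cdisc s) kappa /\
          injective_on (Cdisc s) kappa /\
          conjugates_on s epsilon kappa (line_restr phi (x n)) (line_restr eta (x n)) /\
          (forall y : C, Cdisc s y -> Cdisc epsilon y -> Fixset phi (x n, y) -> kappa y = y)) ->
  equiv_rel_Fix phi eta.
Proof.
  intros _ heps Hphi Heta _ _ _ [s [x [hs [hx Hn]]]].
  destruct (germ_extract phi Hphi) as [Ra [hRa [Ha [Ba [a0 [a1 [an Pa]]]]]]]. destruct (germ_extract eta Heta) as [Rb [hRb [Hb [Bb [b0 [b1 [bn Pb]]]]]]].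
  set (f := fib phi) in *. set (g := fib eta) in *.
  destruct (lip_exists f Ra 1 _lra Ha Ba) as [La [hLa HLa]]. destruct (lip_exists g Rb 1 _lra Hb Bb) as [Lb [hLb HLb]].
  small R0 ((2, Ra) :: (2, Rb) :: nil) as [hR0 [R01 [R02 _]]].
  have hx' : forall e, 0 < e -> exists N, forall n, (N <= n)%nat -> Cmod (x n) <= e.
  { intros e he. have q : locally (T := C_UniformSpace) (RtoC 0) (fun z => Cmod z <= e).
    { apply locally_C1. exists e. au. }
    destruct (hx _ q) as [N HN]. exists N. au. }
  destruct (hx' (R0 / 2) _lra) as [N1 HN1].
  (* Dropping the first terms places every line in the common polydisc. *)
  set (xs := fun n => x (N1 + n)%nat).
  have Ek : forall n, exists kappa : C -> C, holomorphic1 (Cdisc s) kappa /\ injective_on (Cdisc s) kappa /\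
     conjugates_on s epsilon kappa (line_restr phi (xs n)) (line_restr eta (xs n)) /\ (forall y : C, Cdisc s y -> Cdisc epsilon y -> Fixset phi (xs n, y) -> kappa y = y) by (intros n; apply (Hn (N1 + n)%nat)).
  set (ks := fun n => proj1_sig (constructive_indefinite_description _ (Ek n))).
  have Hk : forall n, holomorphic1 (Cdisc s) (ks n) /\ injective_on (Cdisc s) (ks n) /\
     conjugates_on s epsilon (ks n) (line_restr phi (xs n)) (line_restr eta (xs n)) /\ (forall y : C, Cdisc s y -> Cdisc epsilon y -> Fixset phi (xs n, y) -> ks n y = y) by (intros n; unfold ks; destruct constructive_indefinite_description; auto).
  have xR : forall n, Cmod (xs n) < R0 by (intros n; have q := HN1 (N1 + n)%nat ltac:(lia); unfold xs; lra).
  small s' ((1, s) :: (1, R0) :: nil) as [hs' [s1 [s2 _]]]. small ep ((1, epsilon) :: (1, R0) :: nil) as [hep [e1 [e2 _]]].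
  destruct (conj_germ f g R0 (La + Lb) xs ks s' ep) as [e [T [M [he [HT [BT [T0 [Td [e' [he' HE]]]]]]]]]]; auto; try lra.
  - apply (pd2_sub Ra); auto; lra.
  - apply (pd2_sub Rb); auto; lra.
  - apply (lip_mono (Ra / 2) _ La); auto; lra.
  - apply (lip_mono (Rb / 2) _ Lb); auto; lra.
  - intros n. apply (Hn (N1 + n)%nat).
  - intros u hu. destruct (hx' u hu) as [N HN]. exists N. intros n hn. apply HN. lia.
  - intros n z hz. rewrite C0r in hz. apply ex_derive_hol. apply (Hk n). unfold Cdisc. lra.
  - intros n y z hy hz. apply (Hk n); unfold Cdisc; lra.
  - intros n y k1 k2 k3 k4. destruct (Hk n) as [_ [_ [h _]]]. apply h; unfold Cdisc; [lra| |lra|lra]. change (Cmod (f (xs n) y) < s). lra.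
  - intros n y k1 k2 k3. apply (Hk n); unfold Cdisc; try lra. unfold Fixset. rewrite Pa by (split; [assert (q := xR n)|]; lra). fold f. rewrite k3. au.
  (* The inverse germ is obtained on each line with [x] as a parameter; both germs preserve [x]. *)
  - destruct (inverse_fam T e M 1 he _lra HT BT T0 Td) as [d [Ti [hd [HTi [Ti0 [i1 [d' [hd' i2]]]]]]]].
    exists (fun p => (fst p, T (fst p) (snd p))). split; [|split].
    + split; [|split].
      * exists (e / 2). split; [lra|]. apply (holomorphic2_graph T (e / 2) M); [lra| |]; replace (2 * (e / 2)) with e by field; auto.
      * unfold O2. simpl. rewrite T0. au.
      * exists (fun p => (fst p, Ti (fst p) (snd p))). split; [|split; [|split]].
        -- exists (d / 2). split; [lra|]. apply (holomorphic2_graph Ti (d / 2) e); [lra| |]; replace (2 * (d / 2)) with d by field; auto.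
           intros u v huv. apply Rlt_le, (i1 u v huv).
        -- unfold O2. simpl. rewrite Ti0. au.
        -- apply near0_iff. exists d'. split; [lra|]. intros u v hu hv. simpl. f_equal. apply i2. au.
        -- apply near0_iff. exists d. split; [lra|]. intros u v hu hv. simpl. f_equal. apply i1. au.
    + apply near0_iff. small r ((1, e') :: (1, R0) :: nil) as [hr [r1 [r2 _]]]. exists r. split; [auto|].
      intros u v hu hv. destruct (HE u v ltac:(au)) as [t1 [t2 _]]. rewrite Pa by au. simpl. fold f. rewrite Pb by au. fold g. rewrite t2. au.
    + apply near0_iff. small r ((1, e') :: (1, R0) :: nil) as [hr [r1 [r2 _]]]. exists r. split; [auto|].
      intros u v hu hv hF. destruct (HE u v ltac:(au)) as [_ [_ t3]]. simpl. f_equal. apply t3. unfold Fixset in hF. unfold f, fib. rewrite hF. au.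
Qed.
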